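(* Let $T>0$. For each $N\ge 2$ let the particle system start from a deterministic configuration $x(0)\in\mathbf Z^N$, and assume there is $\psi\in H(\mathbf R)$ such that for every $f\in S(\mathbf R)$ $$\lim_{N\to\infty}\frac1N\sum_{k\in\mathbf Z}\xi_{N,k}(0)f(k/N)=\int_{\mathbf R}\psi(x)f(x)\,dx .$$ (i) If $\alpha-\beta=\lambda\neq0$ and $\mu_N=\mu/N$ with $\mu>0$, then the laws $Q^{(T)}_{N,\lambda}$ of the processes $\{\zeta_N(tN),\,t\in[0,T]\}$, viewed as probability measures on $D([0,T],S'(\mathbf R))$, converge weakly as $N\to\infty$ to the Dirac measure concentrated on the trajectory $t\mapsto u(t,\cdot)$, where $u$ is the unique weak solution on $[0,T]\times\mathbf R$ of $$u_t=-\lambda u_x+\mu(u^2-u),\qquad u(0,x)=\psi(x);$$ moreover $u(t,\cdot)\in H(\mathbf R)$ for every $t\ge0$. (ii) If $\alpha=\beta=\gamma>0$ and $\mu_N=\mu/N^2$ with $\mu>0$, then the laws $Q^{(T)}_{N,\gamma}$ of $\{\zeta_N(tN^2),\,t\in[0,T]\}$ converge weakly as $N\to\infty$ to the Dirac measure concentrated on the trajectory $t\mapsto u(t,\cdot)$, where $u$ is the unique weak solution on $[0,T]\times\mathbf R$ of $$u_t=\gamma u_{xx}+\mu(u^2-u),\qquad u(0,x)=\psi(x);$$ moreover $u(t,\cdot)\in H(\mathbf R)$ for every $t\ge 0$.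
   Context: Particle system: fix $N\ge2$, constants $\alpha,\beta\ge0$, $\mu_N>0$. $x(t)=(x_1(t),\dots,x_N(t))$ is the continuous-time Markov chain on $\mathbf Z^N$ with generator $G_Ng(x)=\sum_{i=1}^N[\alpha(g(x+e_i)-g(x))+\beta(g(x-e_i)-g(x))]+\sum_{i=1}^N\sum_{j\ne i}(g(x-(x_i-x_j)e_i)-g(x))\mathbf 1\{x_i>x_j\}\frac{\mu_N}{N}$, $e_i$ the $i$-th unit vector: each particle jumps $+1$ at rate $\alpha$, $-1$ at rate $\beta$, and for each ordered pair $(i,j)$, $j\neq i$, at rate $\mu_N/N$ particle $i$ is moved to $x_j$ if $x_i>x_j$. Define $\xi_{N,k}(t)=\frac1N\sum_{i=1}^N\mathbf 1\{x_i(t)\ge k\}$, $k\in\mathbf Z$, and $\zeta_N(t)$ the function $x\mapsto\xi_{N,[Nx]}(t)$, $x\in\mathbf R$. $H(\mathbf R)$ is the set of nonincreasing, right-continuous functions $h:\mathbf R\to[0,1]$ with $h(-\infty)=1$, $h(+\infty)=0$. Each bounded measurable $h$ is identified with the tempered distribution $f\mapsto(h,f)=\int h f\,dx$ on the Schwartz space $S(\mathbf R)$; $S'(\mathbf R)$ carries the strong topology generated by the seminorms $\rho_A(M)=\sup_{\phi\in A}|(M,\phi)|$, $A\subset S(\mathbf R)$ bounded. $D([0,T],S'(\mathbf R))$ is the space of right-continuous paths with left limits in $S'(\mathbf R)$, with the topology given as the projective limit of the pseudometrics $d_A(y,z)=\inf_{\lambda\in\Lambda}\{\sup_t\rho_A(y_t-z_{\lambda(t)})+\sup_{t\ne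 s}|\log\frac{\lambda(t)-\lambda(s)}{t-s}|\}$, $\Lambda$ the strictly increasing continuous maps of $[0,T]$ onto itself, with its Borel $\sigma$-algebra. Weak solution: a bounded measurable $u$ on $[0,T]\times\mathbf R$ is a weak solution of $u_t=-\lambda u_x+\mu(u^2-u)$, $u(0,\cdot)=\psi$, if for every $f\in C^\infty_{0,T}$ (smooth, compactly supported in $[0,T]\times\mathbf R$, vanishing at $t=T$): $\int_0^T\!\!\int_{\mathbf R}[u(f_t+\lambda f_x)+\mu(u^2-u)f]\,dx\,dt+\int_{\mathbf R}\psi(x)f(0,x)\,dx=0$; and of $u_t=\gamma u_{xx}+\mu(u^2-u)$, $u(0,\cdot)=\psi$, if $\int_0^T\!\!\int_{\mathbf R}[u(f_t+\gamma f_{xx})+\mu(u^2-u)f]\,dx\,dt+\int_{\mathbf R}\psi(x)f(0,x)\,dx=0$ for all such $f$. *)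

(* Defs.v *)
From HB Require Import structures.
From mathcomp Require Import all_boot all_order all_algebra.
From mathcomp Require Import all_classical all_reals all_analysis.
Set Implicit Arguments. Unset Strict Implicit. Unset Printing Implicit Defensive.
Import Order.TTheory GRing.Theory Num.Theory.
Import numFieldNormedType.Exports.
Local Open Scope classical_set_scope.
Local Open Scope ring_scope.

Section Defs.
Variable R : realType.
Local Notation leb := (@lebesgue_measure R).

Definition config (N : nat) := 'I_N -> int.

Definition upd N (x : config N) (i : 'I_N) (v : int) : config N :=
  fun k => if k == i then v else x k.

Definition gen N (alpha beta muN : R) (g : config N -> R) (x : config N) : R :=
  \sum_(i < N) (alpha * (g (upd x i (x i + 1)%R) - g x)
               + beta * (g (upd x i (x i - 1)%R) - g x))
  + \sum_(i < N) \sum_(j < N | j != i)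
      (if (x j < x i)%R then (g (upd x i (x j)) - g x) * (muN / N%:R) else 0).

(* transition probabilities p_t(x,y) = (exp(t G_N) 1_{y})(x) *)
Definition trans N alpha beta muN (t : R) (x y : config N) : R :=
  limn (fun M : nat => \sum_(0 <= n < M) (t ^+ n / (n`!)%:R
                     * iter n (gen alpha beta muN) (fun z => if z == y then 1 else 0) x)).

(* probability that the chain started at x at time s visits the given
   (time, state) list; times are assumed nondecreasing *)
Fixpoint fdd N alpha beta muN (x : config N) (s : R) (l : seq (R * config N)) : R :=
  match l with
  | [::] => 1
  | (t, y) :: l' => trans alpha beta muN (t - s) x y * fdd alpha beta muN y t l'
  end.

Definition sorted_times N (l : seq (R * config N)) : Prop :=
  forall i, (i.+1 < size l)%N ->
    (nth 0 (map fst l) i <= nth 0 (map fst l) i.+1).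

Definition is_chain (d : measure_display) (Omega : measurableType d)
    (P : probability Omega R) N alpha beta muN (x0 : config N)
    (X : Omega -> R -> config N) : Prop :=
  (forall t y, measurable [set w | X w t = y]) /\
  (* cadlag paths (in the discrete topology of Z^N) *)
  (forall w t, 0 <= t -> exists2 e : R, 0 < e &
     forall s, t <= s < t + e -> X w s = X w t) /\
  (forall w t, 0 < t -> exists y, exists2 e : R, 0 < e &
     forall s, t - e < s < t -> X w s = y) /\
  (forall l : seq (R * config N), sorted_times l ->
     all (fun p => 0 <= p.1) l ->
     P [set w | forall p, p \in l -> X w p.1 = p.2] =
       (fdd alpha beta muN x0 0 l)%:E).

Definition xi N (k : int) (x : config N) : R :=
  (#|[pred i : 'I_N | (k <= x i)%R]|)%:R / N%:R.

Definition zsum (a : int -> R) : R :=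
  lim ((fun M : nat => \sum_(i < (2 * M).+1) a (i%:Z - M%:Z)%R) @ \oo).

Definition inH (h : R -> R) : Prop :=
  (forall x y, x <= y -> h y <= h x) /\
  (forall x, h y @[y --> x^'+] --> h x) /\
  (forall x, 0 <= h x <= 1) /\
  (h x @[x --> -oo] --> (1 : R)) /\ (h x @[x --> +oo] --> (0 : R)).

Definition schwartz (f : R -> R) : Prop :=
  (forall n x, derivable (derive1n n f) x 1) /\
  (forall k m, exists C : R, forall x, `|x ^+ k * derive1n m f x| <= C).

Definition sbounded (A : set (R -> R)) : Prop :=
  A `<=` schwartz /\
  (forall k m, exists C : R, forall phi x, A phi -> `|x ^+ k * derive1n m phi x| <= C).

(* tempered distributions: linear functionals on S(R) (defined on all
   functions; only the values on S(R) matter), continuous for the Frechet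
   topology of S(R) *)
Definition tempered (M : (R -> R) -> R) : Prop :=
  (forall a b phi psi, schwartz phi -> schwartz psi ->
     M (fun x => a * phi x + b * psi x) = a * M phi + b * M psi) /\
  (exists C : R, exists k m : nat, forall phi B, schwartz phi ->
     (forall k' m' x, (k' <= k)%N -> (m' <= m)%N ->
        `|x ^+ k' * derive1n m' phi x| <= B) ->
     `|M phi| <= C * B).

Definition dsub (M M' : (R -> R) -> R) : (R -> R) -> R := fun phi => M phi - M' phi.

Definition rho (A : set (R -> R)) (M : (R -> R) -> R) : \bar R :=
  ereal_sup [set (`|M phi|)%:E | phi in A].

Definition distr_of (h : R -> R) : (R -> R) -> R :=
  fun f => fine (\int[leb]_x (h x * f x)%:E).

Definition path_sp := R -> (R -> R) -> R.

Definition Dsp (T : R) : set path_sp := fun y =>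
  (forall t, 0 <= t <= T -> tempered (y t)) /\
  (forall t, 0 <= t < T -> forall A, sbounded A -> forall e : R, 0 < e ->
     exists2 del : R, 0 < del & forall s, t <= s < t + del -> s <= T ->
       (rho A (dsub (y s) (y t)) < e%:E)%E) /\
  (forall t, 0 < t <= T -> exists2 L, tempered L &
     forall A, sbounded A -> forall e : R, 0 < e ->
     exists2 del : R, 0 < del & forall s, t - del < s < t -> 0 <= s ->
       (rho A (dsub (y s) L) < e%:E)%E).

Definition Lambda (T : R) : set (R -> R) := fun la =>
  la 0 = 0 /\ la T = T /\
  (forall s t, 0 <= s -> s < t -> t <= T -> la s < la t) /\
  {within `[0, T], continuous la}.

Definition dA (T : R) (A : set (R -> R)) (y z : path_sp) : \bar R :=
  ereal_inf [set (ereal_sup [set rho A (dsub (y t) (z (la t))) | t in [set t : R | (0 <= t <= T)%R]]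
                 + ereal_sup [set (`|ln ((la p.1 - la p.2) / (p.1 - p.2))|)%:E
                              | p in [set p : R * R | ((0 <= p.1 <= T) && (0 <= p.2 <= T)
                                                      && (p.1 != p.2))%R]])%E
                | la in Lambda T].

(* open sets of D for the projective limit topology of the pseudometrics d_A *)
Definition openD (T : R) (U : set path_sp) : Prop :=
  U `<=` Dsp T /\
  forall y, U y -> exists s : seq (set (R -> R) * R),
    (forall p, p \in s -> sbounded p.1 /\ 0 < p.2) /\
    [set z | Dsp T z /\ forall p, p \in s -> (dA T p.1 y z < p.2%:E)%E] `<=` U.

Definition bcontD (T : R) (F : path_sp -> R) : Prop :=
  (exists C : R, forall y, Dsp T y -> `|F y| <= C) /\
  (forall y, Dsp T y -> forall e : R, 0 < e -> exists U, openD T U /\ U y /\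
     forall z, U z -> `|F z - F y| < e).

Definition law_cvg_dirac (T : R) (d : nat -> measure_display)
    (Omega : forall N, measurableType (d N)) (P : forall N, probability (Omega N) R)
    (Z : forall N, Omega N -> path_sp) (u0 : path_sp) : Prop :=
  (forall N, (2 <= N)%N -> forall w, Dsp T (Z N w)) /\
  (forall N, (2 <= N)%N -> forall B, <<s Dsp T, openD T >> B ->
      measurable (Z N @^-1` B)) /\
  (forall F, bcontD T F ->
     ((fun N => \int[P N]_w (F (Z N w))%:E) @ \oo --> (F u0)%:E)%E).

Definition I0T (T : R) : set R := `[0, T].

Definition pdt (f : R -> R -> R) : R -> R -> R := fun t x => derive1 (fun s => f s x) t.
Definition pdx (f : R -> R -> R) : R -> R -> R := fun t x => derive1 (f t) x.

Definition smooth2 (f : R -> R -> R) : Prop :=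
  forall w : seq bool,
    let g := foldr (fun b h => if b then pdt h else pdx h) f w in
    continuous (fun p : R * R => g p.1 p.2) /\
    (forall t x, derivable (fun s => g s x) t 1) /\
    (forall t x, derivable (g t) x 1).

(* C^infty_{0,T}: restrictions to [0,T] x R of smooth compactly supported
   functions on R^2 which vanish at t = T *)
Definition testfun (T : R) (f : R -> R -> R) : Prop :=
  smooth2 f /\ (exists K : R, forall t x, K < `|t| \/ K < `|x| -> f t x = 0) /\
  (forall x, f T x = 0).

Definition bdd_meas (T : R) (u : R -> R -> R) : Prop :=
  measurable_fun (I0T T `*` setT) (fun p : R * R => u p.1 p.2) /\
  exists C : R, forall t x, 0 <= t <= T -> `|u t x| <= C.

Definition weak_sol_transport (T lambda mu : R) (psi : R -> R) (u : R -> R -> R) : Prop :=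
  forall f, testfun T f ->
   (\int[leb]_(t in I0T T) \int[leb]_x
        (u t x * (pdt f t x + lambda * pdx f t x) + mu * (u t x ^+ 2 - u t x) * f t x)%:E
    + \int[leb]_x (psi x * f 0 x)%:E = 0)%E.

Definition weak_sol_heat (T gamma mu : R) (psi : R -> R) (u : R -> R -> R) : Prop :=
  forall f, testfun T f ->
   (\int[leb]_(t in I0T T) \int[leb]_x
        (u t x * (pdt f t x + gamma * pdx (pdx f) t x) + mu * (u t x ^+ 2 - u t x) * f t x)%:E
    + \int[leb]_x (psi x * f 0 x)%:E = 0)%E.

Definition unique_sol (T : R) (sol : (R -> R -> R) -> Prop) (u : R -> R -> R) : Prop :=
  bdd_meas T u /\ sol u /\ (forall t, 0 <= t <= T -> inH (u t)) /\
  (forall v, bdd_meas T v -> sol v ->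
     (leb \x leb)%E.-negligible [set p : R * R | 0 <= p.1 <= T /\ u p.1 p.2 != v p.1 p.2]).

Definition traj (u : R -> R -> R) : path_sp := fun t => distr_of (u t).

Definition zeta_path N (Omega : Type) (X : Omega -> R -> config N) (c : R)
    (w : Omega) : path_sp :=
  fun t => distr_of (fun x => xi (Num.floor (N%:R * x)) (X w (t * c))).

End Defs.

(* Main.v *)
(* The profile of the particle system satisfies c_N G zeta = B_N(zeta) exactly, where
   B_N(v) = L_N v + mu (v^2 - v) and L_N is the accelerated generator of a walk on the grid of step 1/N.
   It is therefore compared with the solution v_N of the deterministic lattice equation v' = B_N(v), v(0) = psi.
   The tool is one energy inequality: for profiles v, w with the same right-hand side, the weighted L^2 norm of
   the mollified difference k_eps * (v - w) grows at most exponentially, up to an error coming from the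
   commutator of the mollifier with the square, and this error is O(eps) because monotone profiles have small
   oscillation in L^1. It yields
   - that (v_N) is Cauchy in weighted L^1, uniformly on [0, T]; the limit u is a weak solution;
   - that weak solutions are unique, the lattice operators being consistent with the differential operator;
   - that the energy of zeta - v_N, corrected by an exponential factor and by the noise O(1/N), is a
     supermartingale, so that a maximal inequality bounds it uniformly in time, in probability.
   Uniform closeness to u outside of a small event gives the weak convergence of the laws; the measurability of
   the path-valued variable follows by sampling, since its paths are step functions. *)
Require Import Defs.
From HB Require Import structures.
From mathcomp Require Import all_boot all_order all_algebra.
From mathcomp Require Import all_classical all_reals all_analysis.
From mathcomp Require Import measurable_realfun ring lra zify.
Set Implicit Arguments. Unset Strict Implicit. Unset Printing Implicit Defensive.
Import Order.TTheory GRing.Theory Num.Theory.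
Import numFieldNormedType.Exports.
Local Open Scope classical_set_scope.
Local Open Scope ring_scope.

(** * Weighted integrals on the line *)

Section Toolkit.
Variable R : realType.
Local Notation leb := (@lebesgue_measure R).

(** The obstacle is the square: the initial hypothesis gives weak convergence only, and [v^2] is not
    weakly continuous. Mollification turns weak convergence into pointwise convergence of
    [S k zeta], and the energy inequality leads back to the profiles themselves. Mollification also
    tames the noise of the diffusive scaling: a unit jump changes the profile by 1/N on one cell of
    length 1/N, so without smoothing the noise in the squared norm has order c_N / N^2 = 1;
    smoothing gains a factor 1/N. A weight is needed because differences of profiles with arbitrary
    tails may fail to be integrable. Competing weak solutions are only bounded and measurable; for
    them the oscillation tends to 0 without a rate, by Lebesgue's differentiation theorem.
    Evolutions are never differentiated in time: each enters through its increments over a step d,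
    up to O(d^2), and a discrete Gronwall lemma sums these. The constants in O(d^2) may depend on N
    and eps, because d tends to 0 while N and eps are fixed. *)

Definition mf (f : R -> R) := measurable_fun setT f.

Lemma mf_cst c : mf (fun=> c). Proof. exact: measurable_cst. Qed.

Lemma mfD f g : mf f -> mf g -> mf (fun x => f x + g x).
Proof. exact: measurable_realfun.measurable_funD. Qed.

Lemma mfM f g : mf f -> mf g -> mf (fun x => f x * g x).
Proof. exact: measurable_realfun.measurable_funM. Qed.

Lemma mfB f g : mf f -> mf g -> mf (fun x => f x - g x).
Proof. exact: measurable_realfun.measurable_funB. Qed.

Lemma mf_continuous f : continuous f -> mf f.
Proof. exact: continuous_measurable_fun. Qed.

Lemma mf_comp f g : mf f -> mf g -> mf (fun x => f (g x)).
Proof. by move=> mf_f mf_g; exact: (measurableT_comp mf_f mf_g). Qed.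

Lemma mf_abs f : mf f -> mf (fun x => `|f x|).
Proof. by move=> mf_f; apply: (@mf_comp (fun x => `|x|) f) => //; exact: mf_continuous (@norm_continuous _ _). Qed.

Lemma mf_id : mf (fun x => x). Proof. exact: measurable_id. Qed.

Lemma mf_shift f a : mf f -> mf (fun x => f (x + a)).
Proof. by move=> mf_f; apply: (mf_comp mf_f); apply: mfD (mf_cst a); exact: mf_id. Qed.

Lemma mf_sqr f : mf f -> mf (fun x => f x ^+ 2).
Proof.
by move=> mf_f; rewrite (_ : (fun x => _) = (fun x => f x * f x)); [exact: mfM|apply/funext => x; rewrite expr2].
Qed.

Lemma mf_nonincreasing (h : R -> R) : (forall x y, x <= y -> h y <= h x) -> mf h.
Proof.
move=> hdec mT; apply: (measurability _ (RGenOInfty.measurableE R)) => //.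
move=> _ [_ [a ->] <-]; rewrite setTI; apply: is_interval_measurable.
move=> x y /=; rewrite !in_itv/= !andbT => hx hy z /andP[xz zy].
by rewrite in_itv/= andbT (lt_le_trans hy)// hdec.
Qed.

(* The weighted distance [itg (wt * |g - h|)] metrizes local convergence of profiles, dominates Schwartz
   functions, and [wt] is almost a supersolution of the adjoint lattice operators ([sc_wt]). *)
Definition wt (x : R) : R := (1 + x ^+ 2)^-1.

Lemma wt_den_ge1 x : 1 <= 1 + x ^+ 2 :> R.
Proof. by rewrite lerDl sqr_ge0. Qed.

Lemma wt_den_gt0 x : 0 < 1 + x ^+ 2 :> R.
Proof. exact: lt_le_trans ltr01 (wt_den_ge1 x). Qed.

Lemma wt_gt0 x : 0 < wt x.
Proof. by rewrite invr_gt0 wt_den_gt0. Qed.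

Lemma wt_ge0 x : 0 <= wt x. Proof. exact: ltW (wt_gt0 x). Qed.

Lemma wt_le1 x : wt x <= 1.
Proof. by rewrite invf_le1 ?wt_den_gt0 ?wt_den_ge1. Qed.

Lemma wtE x : wt x * (1 + x ^+ 2) = 1.
Proof. by rewrite mulVf// gt_eqF// wt_den_gt0. Qed.

Lemma continuous_wt : continuous wt.
Proof. exact: continuous_oneDsqrV. Qed.

Lemma mf_wt : mf wt. Proof. exact: mf_continuous continuous_wt. Qed.

(** Peetre's inequality: [(2 + 2 a^2) (1 + (x + a)^2) - (1 + x^2)] equals
    [1 + (x + 2 a)^2 + 2 a^2 (x + a)^2]. It makes [dom] stable under translations. *)
Lemma wt_shift x a : wt (x + a) <= (2 + 2 * a ^+ 2) * wt x.
Proof.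
rewrite /wt -[leLHS]mul1r ler_pdivrMr ?wt_den_gt0// mulrAC ler_pdivlMr ?wt_den_gt0//.
have := sqr_ge0 (x + 2 * a); have := sqr_ge0 (a * (x + a)); nra.
Qed.

Lemma wt_integrable : leb.-integrable setT (EFin \o wt).
Proof.
apply/integrableP; split; first by apply/measurable_EFinP; exact: mf_wt.
under eq_integral do rewrite /= ger0_norm ?wt_ge0//.
rewrite (ge0_symfun_integralT wt_ge0 continuous_wt); last first.
  by move=> x; rewrite /wt /= sqrrN.
rewrite (_ : [set x | _] = `[0, +oo[%classic); last first.
  by apply/seteqP; split=> x /=; rewrite in_itv/= andbT.
have := @integral0y_oneDsqr R; rewrite /oneDsqr => ->.
by rewrite lte_mul_pinfty// ?lee_fin// ltry.
Qed.

(* [itg f] is a junk value unless [f] is integrable, which the lemmas obtain from [dom f]. *)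
Definition itg (f : R -> R) : R := fine (\int[leb]_x (f x)%:E).

(** Domination by the weight implies integrability and survives sums, bounded factors and
    translations, which are the operations performed on integrands below. *)
Definition dom (f : R -> R) := mf f /\ exists C, forall x, `|f x| <= C * wt x.

Lemma dom_integrable f : dom f -> leb.-integrable setT (EFin \o f).
Proof.
move=> [mf_f [C fC]]; apply: (@le_integrable _ _ R leb setT measurableT _ (EFin \o (fun x => C * wt x))) => //.
- exact/measurable_EFinP.
- by move=> x _; rewrite /= lee_fin (le_trans (fC x))// ler_norm.
- rewrite (_ : _ \o _ = (fun x => C%:E * (EFin \o wt) x)%E)//.
  by apply: integrableZl => //; exact: wt_integrable.
Qed.

Lemma domD f g : dom f -> dom g -> dom (fun x => f x + g x).
Proof.
move=> [mf_f [C fC]] [mf_g [C' gC]]; split; first exact: mfD.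
exists (C + C') => x; by rewrite mulrDl (le_trans (ler_normD _ _))// lerD.
Qed.

Lemma domM h f B : mf h -> (forall x, `|h x| <= B) -> dom f -> dom (fun x => h x * f x).
Proof.
move=> mf_h hB [mf_f [C fC]]; split; first exact: mfM.
exists (B * C) => x; by rewrite normrM -mulrA ler_pM.
Qed.

Lemma domMr h f B : mf h -> (forall x, `|h x| <= B) -> dom f -> dom (fun x => f x * h x).
Proof.
move=> mf_h hB df; rewrite (_ : (fun x => _) = fun x => h x * f x); first exact: domM hB df.
by apply/funext => x; rewrite mulrC.
Qed.

Lemma domZ c f : dom f -> dom (fun x => c * f x).
Proof. by apply: (@domM (fun=> c)); [exact: mf_cst|move=> x; exact: lexx]. Qed.

Lemma domB f g : dom f -> dom g -> dom (fun x => f x - g x).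
Proof.
move=> df /(domZ (-1)) dg; rewrite (_ : (fun x => _) = fun x => f x + (-1) * g x); first exact: domD.
by apply/funext => x; rewrite mulN1r.
Qed.

Lemma dom_wt : dom wt.
Proof. by split; [exact: mf_wt|exists 1 => x; rewrite mul1r ger0_norm// wt_ge0]. Qed.

Lemma dom0 : dom (fun=> 0).
Proof. by split; [exact: mf_cst|exists 0 => x; rewrite normr0 mul0r]. Qed.

Lemma dom_abs f : dom f -> dom (fun x => `|f x|).
Proof.
by move=> [mf_f [C fC]]; split; [exact: mf_abs|exists C => x; rewrite normr_id; exact: fC].
Qed.

Lemma dom_le g f : mf f -> dom g -> (forall x, `|f x| <= g x) -> dom f.
Proof.
move=> mf_f [_ [C gC]] fg; split=> //; exists C => x.
by rewrite (le_trans (fg x))// (le_trans (ler_norm _))//; exact: gC.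
Qed.

Lemma dom_shift f a : dom f -> dom (fun x => f (x + a)).
Proof.
move=> [mf_f [C fC]]; split; first exact: mf_shift.
exists (C * (2 + 2 * a ^+ 2)) => x; rewrite (le_trans (fC _))// -mulrA ler_wpM2l ?wt_shift//.
have := fC 0; have := wt_gt0 0 => w0 fC0.
by have := le_trans (normr_ge0 _) fC0; rewrite pmulr_lge0.
Qed.

Lemma dom_sum (J : Type) (r : seq J) (P : pred J) (F : J -> R -> R) :
  (forall j, dom (F j)) -> dom (fun x => \sum_(j <- r | P j) F j x).
Proof.
move=> dF; elim: r => [|j r IH].
  by rewrite (_ : (fun x => _) = fun=> 0) ?(rwP dom0)//; [exact: dom0|apply/funext => x; rewrite big_nil].
rewrite (_ : (fun x => _) = fun x => (if P j then F j x else 0) + \sum_(j <- r | P j) F j x); last first.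
  by apply/funext => x; rewrite big_cons; case: (P j); rewrite ?add0r.
by apply: domD => //; case: (P j) => //; exact: dom0.
Qed.

Lemma itgD f g : dom f -> dom g -> itg (fun x => f x + g x) = itg f + itg g.
Proof. by move=> /dom_integrable df /dom_integrable dg; exact: RintegralD. Qed.

Lemma itgB f g : dom f -> dom g -> itg (fun x => f x - g x) = itg f - itg g.
Proof. by move=> /dom_integrable df /dom_integrable dg; exact: RintegralB. Qed.

Lemma itgZ c f : dom f -> itg (fun x => c * f x) = c * itg f.
Proof. by move=> /dom_integrable df; exact: RintegralZl. Qed.

Lemma itg_sum (J : Type) (r : seq J) (P : pred J) (F : J -> R -> R) :
  (forall j, dom (F j)) ->
  itg (fun x => \sum_(j <- r | P j) F j x) = \sum_(j <- r | P j) itg (F j).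
Proof.
move=> dF; elim: r => [|j r IH].
  rewrite big_nil /itg (_ : (fun x => _) = cst 0%E); last by apply/funext => x; rewrite big_nil.
  by rewrite integral_cst// mul0e.
rewrite big_cons -IH; case: ifPn => Pj.
  rewrite -itgD//; last exact: dom_sum.
  by congr itg; apply/funext => x; rewrite big_cons Pj.
by congr itg; apply/funext => x; rewrite big_cons (negbTE Pj).
Qed.

Lemma le_itg f g : dom f -> dom g -> (forall x, f x <= g x) -> itg f <= itg g.
Proof. by move=> /dom_integrable df /dom_integrable dg fg; apply: le_Rintegral. Qed.

Lemma itg_ge0 f : (forall x, 0 <= f x) -> 0 <= itg f.
Proof. by move=> f0; apply: fine_ge0; apply: integral_ge0 => x _; rewrite lee_fin. Qed.

Lemma normr_itg f : dom f -> `|itg f| <= itg (fun x => `|f x|).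
Proof. by move=> /dom_integrable df; exact: le_normr_Rintegral. Qed.

Lemma normr_itg_le f g : dom f -> dom g -> (forall x, `|f x| <= g x) -> `|itg f| <= itg g.
Proof.
by move=> df dg fg; rewrite (le_trans (normr_itg df))// le_itg//; exact: dom_abs.
Qed.

Definition wtot : R := itg wt.

Lemma wtot_ge0 : 0 <= wtot. Proof. exact: itg_ge0 wt_ge0. Qed.

Lemma normr_itg_wt f C : mf f -> (forall x, `|f x| <= C * wt x) -> `|itg f| <= C * wtot.
Proof.
move=> mf_f fC; rewrite -itgZ; last exact: dom_wt.
by apply: normr_itg_le => //; [split=> //; exists C|exact: domZ dom_wt].
Qed.

(** The image measure under the translation has the right value on half-open intervals, and Lebesgue
    measure is the only such measure. *)
Lemma lebesgue_shift (a : R) (A : set R) : measurable A ->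
  leb ((fun x => x + a) @^-1` A) = leb A.
Proof.
move=> mA; have mshift : measurable_fun setT (fun x : R => x + a).
  by apply: mfD (mf_cst a); exact: mf_id.
have -> : leb ((fun x => x + a) @^-1` A) = pushforward leb (fun x : R => x + a) A by [].
apply/esym.
pose mu : {measure set (measurableTypeR R) -> \bar R} :=
  @measure_function_pushforward__canonical__measure_function_Measure _ _
    (measurableTypeR R) (measurableTypeR R) R leb _ mshift.
apply: (@lebesgue_measure_unique R mu) => //.
move=> X /ocitvP[->|[[c d] /= cd ->]]; first by rewrite !measure0.
rewrite /pushforward (_ : _ @^-1` _ = `]c - a, d - a]%classic); last first.
  by apply/seteqP; split=> x /=; rewrite !in_itv/= ltrBlDr lerBrDr.
rewrite !lebesgue_measure_itv/= !lte_fin ltrD2r -!EFinB; case: ifP => // _.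
by congr EFin; lra.
Qed.

Lemma itg_shift f a : dom f -> itg (fun x => f (x + a)) = itg f.
Proof.
move=> df; have dfa := dom_shift a df.
rewrite /itg; congr fine.
have mshift : measurable_fun setT (fun x : R => x + a) by apply: mfD (mf_cst a); exact: mf_id.
pose mu : {measure set (measurableTypeR R) -> \bar R} :=
  @measure_function_pushforward__canonical__measure_function_Measure _ _
    (measurableTypeR R) (measurableTypeR R) R leb _ mshift.
transitivity (\int[mu]_x (EFin \o f) x)%E; last first.
  by apply: eq_measure_integral => A mA _; exact: (lebesgue_shift a mA).
apply/esym; apply: (@integral_pushforward _ _ (measurableTypeR R) (measurableTypeR R) R
  (fun x : R => x + a) mshift leb setT (EFin \o f)) => //.
- by apply/measurable_EFinP; case: df.
- exact: (dom_integrable dfa).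
Qed.

End Toolkit.

(** * A concrete bump function *)

Section Bump.
Variable R : realType.

(** This is [y / k <= e^(y / k)] raised to the power [k]. *)
Lemma pow_expRN_le (k : nat) (y : R) : 0 <= y -> y ^+ k * expR (- y) <= k%:R ^+ k.
Proof.
move=> y0; case: k => [|k]; first by rewrite !expr0 mul1r -expR0 ler_expR oppr_le0.
rewrite expRN ler_pdivrMr ?expR_gt0//.
have -> : expR y = expR (y / k.+1%:R) ^+ k.+1.
  by rewrite -expRM_natl mulrC divfK// pnatr_eq0.
rewrite -exprMn lerXn2r ?nnegrE//.
rewrite -[leLHS](@divfK _ k.+1%:R) ?pnatr_eq0// mulrC ler_wpM2l//.
by apply: le_trans (expR_ge1Dx _); rewrite lerDr.
Qed.

(** Carrying a polynomial in [1/x] along with the classical flat function makes the family closed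
    under differentiation, so that differentiability at 0, proved once for all [p], gives
    smoothness. *)
Definition flat (p : {poly R}) (x : R) : R :=
  if 0 < x then p.[x^-1] * expR (- x^-1) else 0.

Lemma flat_bounded p : exists C : R, 0 <= C /\ forall x, `|flat p x| <= C.
Proof.
exists (\sum_(i < size p) `|p`_i| * i%:R ^+ i); split.
  by apply: sumr_ge0 => i _; rewrite mulr_ge0// exprn_ge0.
move=> x; rewrite /flat; case: ifPn => [x0|_]; last first.
  by rewrite normr0; apply: sumr_ge0 => i _; rewrite mulr_ge0// exprn_ge0.
rewrite horner_coef mulr_suml (le_trans (ler_norm_sum _ _ _))//; apply: ler_sum => i _.
have xV : 0 <= x^-1 by rewrite invr_ge0 ltW.
rewrite -mulrA normrM ler_wpM2l// ger0_norm ?mulr_ge0 ?exprn_ge0 ?expR_ge0//.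
exact: pow_expRN_le.
Qed.

(** A factor [x^2] is traded for a factor [X^2] of the polynomial. What remains is bounded, hence
    [flat p] vanishes quadratically at 0, the only point where differentiability is in question. *)
Lemma flat_sqr p x : flat p x = x ^+ 2 * flat ('X ^+ 2 * p) x.
Proof.
rewrite /flat; case: ifPn => [x0|_]; last by rewrite mulr0.
have -> : ('X ^+ 2 * p).[x^-1] = x^-1 ^+ 2 * p.[x^-1] by rewrite hornerM hornerXn.
by field; rewrite gt_eqF.
Qed.

Lemma is_derive0_of_sqr_bound (f : R -> R) (C : R) :
  (forall x, `|f x| <= C * x ^+ 2) -> is_derive (0:R) 1 f 0.
Proof.
move=> fC; have f0 : f 0 = 0.
  by apply/eqP; rewrite -normr_le0 (le_trans (fC 0))// expr0n/= mulr0.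
have C0 : 0 <= C by have := fC 1; rewrite expr1n mulr1; apply: le_trans.
have h0 : (fun h : R => h^-1 *: (f (h *: (1:R) + 0) - f 0)) @ 0^' --> (0 : R).
  apply/cvgrPdist_le => /= e e0; near=> h.
  have hn0 : h != 0 by near: h; exact: nbhs_dnbhs_neq.
  rewrite sub0r normrN addr0 f0 subr0 /GRing.scale/= mulr1 normrM normfV.
  rewrite ler_pdivrMl ?normr_gt0// (le_trans (fC h))//.
  rewrite -real_normK ?num_real// expr2 mulrA [leRHS]mulrC ler_wpM2r//.
  have : `|h| < e / (C + 1).
    near: h; apply/dnbhs0_lt; rewrite divr_gt0// ltr_wpDl//.
  move=> /ltW/(ler_wpM2l C0)/le_trans; apply.
  by rewrite mulrCA ger_pMr// ler_pdivrMr ?ltr_wpDl// mul1r lerDl.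
apply: DeriveDef; first by apply/cvg_ex; exists 0.
exact: cvg_lim h0.
Unshelve. all: by end_near. Qed.

(** Chain rule with [y = 1/x]: d/dx is [- y^2] d/dy, and d/dy of [p(y) e^(-y)] is
    [(p' - p)(y) e^(-y)]. *)
Definition Dflat (p : {poly R}) : {poly R} := 'X ^+ 2 * (p - p^`()).

Lemma is_derive_near (f g : R -> R) (x d : R) :
  (\forall y \near x, g y = f y) -> is_derive x 1 f d -> is_derive x 1 g d.
Proof.
move=> fg [dx <-]; apply: DeriveDef.
  by apply: near_eq_derivable dx; rewrite ?oner_eq0//; near do apply/esym.
by apply: near_eq_derive; rewrite ?oner_eq0.
Unshelve. all: by end_near. Qed.

Lemma is_derive_flat p (x : R) : is_derive x (1:R) (flat p) (flat (Dflat p) x).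
Proof.
have [x0|x0|->] := ltgtP x 0.
- rewrite {2}/flat ltNge (ltW x0)/=; apply: (@is_derive_near (cst 0)).
  by near=> y; rewrite /flat ltNge ltW//=; near: y; exact: lt_nbhsl.
- rewrite {2}/flat x0.
  apply: (@is_derive_near (fun y => p.[y^-1] * expR (- y^-1))).
    by near=> y; rewrite /flat ifT//; near: y; exact: lt_nbhsr.
  have xn0 : x != 0 by rewrite gt_eqF.
  have dV : is_derive x 1 (fun y : R => y^-1) (- x ^- 2).
    have h := @is_deriveV _ id x (1:R) (1:R) xn0 (is_derive_id x (1:R)).
    by apply: is_derive_eq; rewrite /GRing.scale/= mulr1.
  have dp : is_derive x 1 (fun y : R => p.[y^-1]) (- x ^- 2 * p^`().[x^-1]).
    by have := @is_derive1_comp _ _ _ x _ _ (is_derive_poly p (x^-1)) dV; rewrite mulrC.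
  have dN : is_derive x 1 (fun y : R => - y^-1) (x ^- 2).
    by have := is_deriveN dV; rewrite opprK.
  have dE : is_derive x 1 (fun y : R => expR (- y^-1)) (x ^- 2 * expR (- x^-1)).
    by have := @is_derive1_comp _ _ _ x _ _ (is_derive_expR (- x^-1)) dN; rewrite mulrC.
  have := is_deriveM dp dE; rewrite /GRing.scale/= => h.
  apply: is_derive_eq; rewrite /Dflat hornerM hornerXn hornerD hornerN exprVn; ring.
- rewrite {2}/flat ltxx; have [C [C0 HC]] := flat_bounded ('X ^+ 2 * p).
  apply: (@is_derive0_of_sqr_bound _ C) => y.
  by rewrite flat_sqr normrM [`|y ^+ 2|]ger0_norm ?sqr_ge0// mulrC ler_wpM2r ?sqr_ge0.
Unshelve. all: by end_near. Qed.

(* Sums of [p(1/(1-x)) e^(-1/(1-x)) q(1/(1+x)) e^(-1/(1+x))], extended by 0 outside of (-1, 1). *)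
Definition bsum (s : seq ({poly R} * {poly R})) (x : R) : R :=
  \sum_(pq <- s) flat pq.1 (1 - x) * flat pq.2 (1 + x).

Definition Dbsum (s : seq ({poly R} * {poly R})) :=
  flatten [seq [:: (- Dflat pq.1, pq.2); (pq.1, Dflat pq.2)] | pq <- s].

Lemma flatN p x : flat (- p) x = - flat p x.
Proof. by rewrite /flat; case: ifP; rewrite ?oppr0// hornerN mulNr. Qed.

Lemma is_derive_bsum s (x : R) : is_derive x (1:R) (bsum s) (bsum (Dbsum s) x).
Proof.
elim: s => [|[p q] s IH].
  rewrite /Dbsum /bsum/= big_nil (_ : (fun _ => _) = fun=> 0); first exact: is_derive_cst.
  by apply/funext => y; rewrite big_nil.
have -> : bsum ((p, q) :: s) = (fun y => flat p (1 - y) * flat q (1 + y)) \+ bsum s.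
  by apply/funext => y; rewrite /bsum big_cons.
have -> : bsum (Dbsum ((p, q) :: s)) x =
  (- flat (Dflat p) (1 - x) * flat q (1 + x) + flat p (1 - x) * flat (Dflat q) (1 + x))
  + bsum (Dbsum s) x.
  by rewrite /bsum /Dbsum /= !big_cons/= flatN addrA.
apply: is_deriveD.
have d1 : is_derive x 1 (fun y : R => flat p (1 - y)) (- flat (Dflat p) (1 - x)).
  have dl : is_derive x 1 (fun y : R => 1 - y) (- 1).
    by have := is_deriveB (is_derive_cst (1:R) x 1) (is_derive_id x (1:R)); rewrite sub0r.
  by have := @is_derive1_comp _ _ _ x _ _ (is_derive_flat p (1 - x)) dl; rewrite /GRing.scale/= mulrN1.
have d2 : is_derive x 1 (fun y : R => flat q (1 + y)) (flat (Dflat q) (1 + x)).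
  have dl : is_derive x 1 (fun y : R => 1 + y) 1.
    by have := is_deriveD (is_derive_cst (1:R) x 1) (is_derive_id x (1:R)); rewrite add0r.
  by have := @is_derive1_comp _ _ _ x _ _ (is_derive_flat q (1 + x)) dl; rewrite /GRing.scale/= mulr1.
have := is_deriveM d1 d2; rewrite /GRing.scale/= => h; apply: is_derive_eq; ring.
Qed.

Lemma bsum_bounded s : exists C : R, 0 <= C /\ forall x, `|bsum s x| <= C.
Proof.
elim: s => [|[p q] s [C [C0 HC]]]; first by exists 0; split=> // x; rewrite /bsum big_nil normr0.
have [C1 [C10 H1]] := flat_bounded p; have [C2 [C20 H2]] := flat_bounded q.
exists (C1 * C2 + C); split; first by rewrite addr_ge0// mulr_ge0.
move=> x; rewrite /bsum big_cons (le_trans (ler_normD _ _))// lerD//=.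
  by rewrite normrM ler_pM ?H1 ?H2.
exact: HC.
Qed.

Lemma bsum_supp s x : 1 <= `|x| -> bsum s x = 0.
Proof.
move=> x1; rewrite /bsum big1// => -[p q] _ /=.
move: x1; rewrite ler_normr => /orP[x1|x1].
  by rewrite {1}/flat subr_gt0 ltNge x1 mul0r.
by rewrite mulrC {1}/flat -[x]opprK subr_gt0 ltNge x1 mul0r.
Qed.

(* [mkt c a b s] is the affine image [c * bsum s (a z + b)]: a family of compactly supported
   functions closed under differentiation. *)
Definition mkt (c a b : R) s (z : R) : R := c * bsum s (a * z + b).

Lemma is_derive_mkt c a b s (z : R) : is_derive z (1:R) (mkt c a b s) (mkt (c * a) a b (Dbsum s) z).
Proof.
have dl : is_derive z 1 (fun y : R => a * y + b) a.
  have := is_deriveD (is_deriveZ a (is_derive_id z (1:R))) (is_derive_cst b z (1:R)).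
  by rewrite addr0 /GRing.scale/= mulr1.
have h : is_derive z 1 (mkt c a b s) _ := is_deriveZ c (@is_derive1_comp _ _ _ z _ _ (is_derive_bsum s (a * z + b)) dl).
by apply: is_derive_eq; rewrite /mkt /GRing.scale/=; ring.
Qed.

Lemma derive1_mkt c a b s : derive1 (mkt c a b s) = mkt (c * a) a b (Dbsum s).
Proof. by apply/funext => z; rewrite derive1E; have := is_derive_mkt c a b s z => -[_ ->]. Qed.

Lemma derivable_mkt c a b s z : derivable (mkt c a b s) z 1.
Proof. by have := is_derive_mkt c a b s z => -[]. Qed.

Lemma continuous_mkt c a b s : continuous (mkt c a b s).
Proof. by move=> z; apply/differentiable_continuous/derivable1_diffP/derivable_mkt. Qed.

Lemma derive1n_mkt n c a b s : derive1n n (mkt c a b s) = mkt (c * a ^+ n) a b (iter n Dbsum s).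
Proof.
elim: n c s => [|n IH] c s; first by rewrite expr0 mulr1.
by rewrite derive1Sn derive1_mkt IH exprS mulrA -iterSr.
Qed.

Lemma mkt_bounded c a b s : exists C : R, 0 <= C /\ forall x, `|mkt c a b s x| <= C.
Proof.
have [C [C0 HC]] := bsum_bounded s; exists (`|c| * C); split; first exact: mulr_ge0.
by move=> x; rewrite normrM ler_wpM2l.
Qed.

Lemma mkt_supp c a b s x : 1 <= `|a * x + b| -> mkt c a b s x = 0.
Proof. by move=> h; rewrite /mkt bsum_supp// mulr0. Qed.

Lemma schwartz_mkt c a b s : a != 0 -> schwartz (mkt c a b s).
Proof.
move=> a0; split=> [n x|k m]; first by rewrite derive1n_mkt; exact: derivable_mkt.
rewrite derive1n_mkt; have [C [C0 HC]] := mkt_bounded (c * a ^+ m) a b (iter m Dbsum s).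
(* On the support [|a x + b| < 1], hence [|x| <= (1 + |b|) / |a|]. *)
exists (((1 + `|b|) / `|a|) ^+ k * C) => x.
have [h|h] := lerP 1 `|a * x + b|.
  by rewrite mkt_supp// mulr0 normr0 mulr_ge0// exprn_ge0// divr_ge0// addr_ge0.
rewrite normrM ler_pM// normrX lerXn2r ?nnegrE ?divr_ge0 ?addr_ge0//.
rewrite ler_pdivlMr ?normr_gt0// -normrM mulrC -[a * x](addrK b) (le_trans (ler_normB _ _))//.
by rewrite lerD2r ltW.
Qed.

End Bump.

(** * Smoothing and the weighted energy inequality *)

Section Smoothing.
Variable R : realType.
Local Notation leb := (@lebesgue_measure R).
Implicit Types f g k : R -> R.

Definition bm f := mf f /\ exists B, forall x, `|f x| <= B.

Lemma bm_mf f : bm f -> mf f. Proof. by case. Qed.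

Lemma bm_cst (c : R) : bm (fun=> c).
Proof. by split; [exact: mf_cst|exists `|c|]. Qed.

Lemma bmD f g : bm f -> bm g -> bm (fun x => f x + g x).
Proof.
move=> [mf_f [B fB]] [mf_g [C gC]]; split; first exact: mfD.
by exists (B + C) => x; rewrite (le_trans (ler_normD _ _))// lerD.
Qed.

Lemma bmM f g : bm f -> bm g -> bm (fun x => f x * g x).
Proof.
move=> [mf_f [B fB]] [mf_g [C gC]]; split; first exact: mfM.
by exists (B * C) => x; rewrite normrM ler_pM.
Qed.

Lemma bmZ c f : bm f -> bm (fun x => c * f x).
Proof. by move=> bf; apply: bmM => //; exact: bm_cst. Qed.

Lemma bmB f g : bm f -> bm g -> bm (fun x => f x - g x).
Proof.
move=> [mf_f [B fB]] [mf_g [C gC]]; split; first exact: mfB.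
by exists (B + C) => x; rewrite (le_trans (ler_normB _ _))// lerD.
Qed.

Lemma bm_abs f : bm f -> bm (fun x => `|f x|).
Proof.
by move=> [mf_f [B fB]]; split; [exact: mf_abs|exists B => x; rewrite normr_id].
Qed.

Lemma bm_sqr f : bm f -> bm (fun x => f x ^+ 2).
Proof.
by move=> bf; rewrite (_ : (fun x => _) = fun x => f x * f x); [exact: bmM|apply/funext => x; rewrite expr2].
Qed.

Lemma bm_shift f a : bm f -> bm (fun x => f (x + a)).
Proof. by move=> [mf_f [B fB]]; split; [exact: mf_shift|exists B => x]. Qed.

Lemma bm_wt : bm (@wt R).
Proof. by split; [exact: mf_wt|exists 1 => x; rewrite ger0_norm ?wt_ge0 ?wt_le1]. Qed.

Lemma dom_wtM f : bm f -> dom (fun x => wt x * f x).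
Proof. by move=> [mf_f [B fB]]; apply: domMr fB (dom_wt R). Qed.

Lemma dom_bm f : dom f -> bm f.
Proof.
move=> [mf_f [C fC]]; split=> //; exists `|C| => x; rewrite (le_trans (fC x))//.
rewrite (le_trans (ler_norm _))// normrM [`|wt x|]ger0_norm ?wt_ge0//.
by rewrite ler_piMr// wt_le1.
Qed.

Lemma le_itg_wtM f g : bm f -> bm g -> (forall x, f x <= g x) ->
  itg (fun x => wt x * f x) <= itg (fun x => wt x * g x).
Proof.
by move=> bf bg fg; apply: le_itg => [||x]; rewrite ?ler_wpM2l ?wt_ge0//; exact: dom_wtM.
Qed.

Lemma itg_wtM_le f C : bm f -> (forall x, f x <= C) -> itg (fun x => wt x * f x) <= C * wtot R.
Proof.
move=> bf fC; rewrite -(itgZ _ (dom_wt R)); apply: le_itg => [||x].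
- exact: dom_wtM.
- exact: domZ (dom_wt R).
- by rewrite mulrC ler_wpM2r ?wt_ge0.
Qed.

Lemma itg_wtM_ge0 f : (forall x, 0 <= f x) -> 0 <= itg (fun x => wt x * f x).
Proof. by move=> f0; apply: itg_ge0 => x; rewrite mulr_ge0 ?wt_ge0. Qed.

Lemma itg_wtMD f g : bm f -> bm g ->
  itg (fun x => wt x * (f x + g x)) = itg (fun x => wt x * f x) + itg (fun x => wt x * g x).
Proof.
move=> bf bg; rewrite -itgD; [|exact: dom_wtM|exact: dom_wtM].
by congr itg; apply/funext => x; rewrite mulrDr.
Qed.

Lemma itg_wtMZ c f : bm f ->
  itg (fun x => wt x * (c * f x)) = c * itg (fun x => wt x * f x).
Proof.
move=> bf; rewrite -itgZ; last exact: dom_wtM.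
by congr itg; apply/funext => x; rewrite mulrCA.
Qed.

(** Tonelli is applied to the positive and negative parts separately, so that the claim holds
    without integrability, for the default value of [itg] as well. *)
Lemma measurable_itg d (T : measurableType d) (F : T -> R -> R) :
  measurable_fun setT (fun p : T * R => F p.1 p.2) ->
  measurable_fun setT (fun x => itg (F x)).
Proof.
move=> mF; have mF' : measurable_fun setT (fun p : T * measurableTypeR R => (F p.1 p.2)%:E).
  exact/measurable_EFinP.
apply: (measurableT_comp (f := fine)) => //.
have -> : (fun x => (\int[leb]_y (F x y)%:E)%E) = (fun x =>
    (\int[leb]_y ((fun p : T * measurableTypeR R => (F p.1 p.2)%:E)^\+ (x, y)) -
     \int[leb]_y ((fun p : T * measurableTypeR R => (F p.1 p.2)%:E)^\- (x, y)))%E).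
  apply/funext => x; rewrite [LHS]integralE.
  by congr (_ - _)%E; apply: eq_integral => y _; rewrite ?funeposE ?funenegE.
apply: emeasurable_funB.
- apply: (@measurable_fun_fubini_tonelli_F _ _ T (measurableTypeR R) R leb
    ((fun p : T * measurableTypeR R => (F p.1 p.2)%:E)^\+)%E) => //.
  exact: measurable_funepos.
- apply: (@measurable_fun_fubini_tonelli_F _ _ T (measurableTypeR R) R leb
    ((fun p : T * measurableTypeR R => (F p.1 p.2)%:E)^\-)%E) => //.
  exact: measurable_funeneg.
Qed.

(** [M] is to be independent of [eps]. The bound [M / eps] serves twice: it compares [S] with
    averages over balls, and it controls the effect of a single jump. As [S] uses [k (z - y)], it is
    a correlation and [k] need not be even. *)
Definition mollifier (M eps : R) k :=
  [/\ continuous k, forall z, 0 <= k z, forall z, eps <= `|z| -> k z = 0,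
      itg k = 1 & forall z, k z <= M / eps].

Definition S k (h : R -> R) (y : R) : R := itg (fun z => h z * k (z - y)).

Section FixedMollifier.
Variables (M eps : R) (k : R -> R).
Hypotheses (eps0 : 0 < eps) (km : mollifier M eps k).

Let k_ge0 z : 0 <= k z. Proof. by case: km => _ + _ _ _; apply. Qed.
Let k_supp z : eps <= `|z| -> k z = 0. Proof. by case: km => _ _ + _ _; apply. Qed.
Let k_mf : mf k. Proof. by case: km => + _ _ _ _; exact: mf_continuous. Qed.

Lemma moll_bound_ge0 : 0 <= M / eps.
Proof. by case: km => _ k0 _ _ kM; exact: le_trans (k0 0) (kM 0). Qed.

Lemma dom_moll y : dom (fun z => k (z - y)).
Proof.
split; first exact: mf_shift.
exists (M / eps * (1 + (`|y| + eps) ^+ 2)) => z; rewrite ger0_norm ?k_ge0//.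
have [zy|zy] := lerP eps `|z - y|.
  by rewrite k_supp// mulr_ge0 ?wt_ge0// mulr_ge0 ?moll_bound_ge0 ?addr_ge0 ?sqr_ge0.
have kz : k (z - y) <= M / eps by case: km.
rewrite (le_trans kz)// -mulrA ler_peMr ?moll_bound_ge0//.
rewrite -[leLHS](wtE z) mulrC ler_wpM2r ?wt_ge0// lerD2l -[leLHS]real_normK ?num_real//.
rewrite lerXn2r ?nnegrE ?addr_ge0 ?(ltW eps0)//.
by rewrite -[z](subrK y) addrC (le_trans (ler_normD _ _))// lerD2l ltW.
Qed.

Lemma itg_moll y : itg (fun z => k (z - y)) = 1.
Proof.
have dk : dom k.
  by have := dom_moll 0; under eq_fun do rewrite subr0.
by rewrite (itg_shift (- y) dk); case: km.
Qed.

Lemma dom_Sint h y : bm h -> dom (fun z => h z * k (z - y)).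
Proof. by move=> [mf_h [B hB]]; apply: domM hB _ => //; exact: dom_moll. Qed.

Lemma SD h1 h2 y : bm h1 -> bm h2 -> S k (fun z => h1 z + h2 z) y = S k h1 y + S k h2 y.
Proof.
move=> b1 b2; rewrite /S -itgD; [|exact: dom_Sint|exact: dom_Sint].
by congr itg; apply/funext => z; rewrite mulrDl.
Qed.

Lemma SB h1 h2 y : bm h1 -> bm h2 -> S k (fun z => h1 z - h2 z) y = S k h1 y - S k h2 y.
Proof.
move=> b1 b2; rewrite /S -itgB; [|exact: dom_Sint|exact: dom_Sint].
by congr itg; apply/funext => z; rewrite mulrBl.
Qed.

Lemma SZ c h y : bm h -> S k (fun z => c * h z) y = c * S k h y.
Proof.
move=> b1; rewrite /S -itgZ; last exact: dom_Sint.
by congr itg; apply/funext => z; rewrite mulrA.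
Qed.

Lemma Scst c y : S k (fun=> c) y = c.
Proof. by rewrite /S itgZ ?itg_moll ?mulr1//; exact: dom_moll. Qed.

Lemma le_S h1 h2 y : bm h1 -> bm h2 -> (forall z, `|z - y| < eps -> h1 z <= h2 z) ->
  S k h1 y <= S k h2 y.
Proof.
move=> b1 b2 h12; apply: le_itg => [||z]; [exact: dom_Sint|exact: dom_Sint|].
have [zy|zy] := lerP eps `|z - y|; first by rewrite k_supp// !mulr0.
by rewrite ler_wpM2r ?k_ge0 ?h12.
Qed.

Lemma normr_S h y : bm h -> `|S k h y| <= S k (fun z => `|h z|) y.
Proof.
move=> bh; apply: normr_itg_le => [||z].
- exact: dom_Sint.
- by apply: dom_Sint; exact: bm_abs.
- by rewrite normrM [`|k _|]ger0_norm ?k_ge0.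
Qed.

Lemma normr_S_le h y B : bm h -> (forall z, `|z - y| < eps -> `|h z| <= B) -> `|S k h y| <= B.
Proof.
move=> bh hB; rewrite (le_trans (normr_S y bh))// -[leRHS](Scst B y).
by apply: le_S => //; [exact: bm_abs|exact: bm_cst].
Qed.

Lemma S_shift h a y : bm h -> S k (fun z => h (z + a)) y = S k h (y + a).
Proof.
move=> bh; rewrite /S -(itg_shift a (dom_Sint (y + a) bh)); congr itg; apply/funext => z.
by congr (_ * k _); lra.
Qed.

Lemma mf_S h : bm h -> mf (S k h).
Proof.
move=> [mf_h _]; apply: measurable_itg.
apply: measurable_realfun.measurable_funM; first exact: (measurableT_comp mf_h).
by apply: (measurableT_comp k_mf); exact: measurable_realfun.measurable_funB.
Qed.

Lemma bm_S h : bm h -> bm (S k h).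
Proof.
move=> bh; split; first exact: mf_S.
by case: (bh) => _ [B hB]; exists B => y; apply: normr_S_le.
Qed.

(* The energy method controls only smoothed differences; [oscS] measures what smoothing loses, and for
   monotone profiles it is O(eps) whatever the profile. *)
Definition oscS (h : R -> R) y := S k (fun z => `|h z - h y|) y.

Lemma bm_oscS h : bm h -> bm (oscS h).
Proof.
move=> [mf_h [B hB]]; split.
  apply: measurable_itg; apply: measurable_realfun.measurable_funM.
    apply: measurableT_comp => //; apply: measurable_realfun.measurable_funB.
      exact: (measurableT_comp mf_h).
    exact: (measurableT_comp mf_h).
  by apply: (measurableT_comp k_mf); exact: measurable_realfun.measurable_funB.
exists (B + B) => y; apply: normr_S_le => [|z _].
  by apply: bm_abs; apply: bmB; [split=> //; exists B|exact: bm_cst].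
by rewrite normr_id (le_trans (ler_normB _ _))// lerD.
Qed.

Lemma normr_subS h y : bm h -> `|h y - S k h y| <= oscS h y.
Proof.
move=> bh; rewrite -{1}(Scst (h y) y) -SB//; last exact: bm_cst.
apply: (le_trans (normr_S _ _)); first by apply: bmB => //; exact: bm_cst.
apply: le_S; [| |by move=> z _; rewrite distrC]; apply: bm_abs; apply: bmB => //; exact: bm_cst.
Qed.

(** The reverse of [|S h| <= S |h|], up to an oscillation: [S |h|] and [|S h|] are each within
    [oscS h y] of [|h y|], whence the factor 2. *)
Lemma Sabs_sub h y : bm h -> S k (fun z => `|h z|) y - `|S k h y| <= 2 * oscS h y.
Proof.
move=> bh; have := normr_subS y bh; have bh' := bm_abs bh; have := normr_subS y bh'.
have : oscS (fun z => `|h z|) y <= oscS h y.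
  apply: le_S => [||z _].
  - by apply: bm_abs; apply: bmB => //; exact: bm_cst.
  - by apply: bm_abs; apply: bmB => //; exact: bm_cst.
  - exact: ler_dist_dist.
rewrite -[S k (fun z => `|h z|) y]/(S k (fun z => `|h z|) y) => h1 h2 h3.
have := ler_dist_dist (h y) (S k h y).
move: h2; rewrite !ler_norml => /andP[h2 _] /andP[_ h4]; lra.
Qed.

(** A translation moves the difference onto the weight, and [wt (y + eps) - wt (y - eps)] is at most
    [eps] times the sum of the two values: over the common denominator the gap is
    [2 eps ((y + 1)^2 + eps^2)]. For a nonincreasing [g] the integrand on the left is the full
    variation on the window, so a signed integral suffices. *)
Lemma itg_wt_shift_diff g : (forall x y, x <= y -> g y <= g x) -> (forall x, 0 <= g x <= 1) ->
  itg (fun y => wt y * (g (y - eps) - g (y + eps))) <= 2 * eps * wtot R.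
Proof.
move=> gdec g01; have bg : bm g.
  split; first exact: mf_nonincreasing.
  by exists 1 => x; case/andP: (g01 x) => g0 g1; rewrite ger0_norm.
have wtd y : wt (y + eps) - wt (y - eps) <= eps * (wt (y + eps) + wt (y - eps)).
  rewrite /wt; have h1 := wt_den_gt0 (y + eps); have h2 := wt_den_gt0 (y - eps).
  rewrite -subr_ge0 (_ : _ - _ = (eps * ((1 + (y + eps) ^+ 2) + (1 + (y - eps) ^+ 2)) + 4 * y * eps)
    / ((1 + (y + eps) ^+ 2) * (1 + (y - eps) ^+ 2))); last first.
    by field; rewrite !gt_eqF.
  rewrite divr_ge0//; last by rewrite mulr_ge0// ltW.
  have : 0 <= eps * ((y + 1) ^+ 2 + eps ^+ 2).
    by rewrite mulr_ge0 ?(ltW eps0)// addr_ge0 ?sqr_ge0.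
  nra.
have bwp := bm_shift eps bm_wt; have bwm := bm_shift (- eps) bm_wt.
have gp := bm_shift eps bg; have gm := bm_shift (- eps) bg.
have dwp := dom_shift eps (dom_wt R); have dwm := dom_shift (- eps) (dom_wt R).
have [_ [B gB]] := bg.
have -> : itg (fun y => wt y * (g (y - eps) - g (y + eps))) =
          itg (fun y => (wt (y + eps) - wt (y - eps)) * g y).
  have e1 := itg_shift eps (dom_wtM gm); have e2 := itg_shift (- eps) (dom_wtM gp).
  have -> : itg (fun y => wt y * (g (y - eps) - g (y + eps))) =
    itg (fun y => wt y * g (y - eps)) - itg (fun y => wt y * g (y + eps)).
    rewrite -itgB; [|exact: dom_wtM|exact: dom_wtM].
    by congr itg; apply/funext => y; rewrite mulrBr.
  rewrite -e1 -e2 -itgB; last 2 first.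
    by apply: (@domMr _ _ _ B) dwp; [apply: (@mf_shift _ (fun x => g (x - eps))); exact: bm_mf|move=> x; exact: gB].
    by apply: (@domMr _ _ _ B) dwm; [apply: (@mf_shift _ (fun x => g (x + eps))); exact: bm_mf|move=> x; exact: gB].
  by congr itg; apply/funext => y; rewrite mulrBl addrK subrK.
rewrite (_ : 2 * eps * wtot R = itg (fun y => eps * (wt (y + eps) + wt (y - eps)))); last first.
  rewrite itgZ; last exact: domD.
  by rewrite itgD// !(itg_shift _ (dom_wt R)) /wtot; ring.
apply: le_itg => [||y].
- by apply: domMr (domB dwp dwm) => //; case: bg.
- by apply: domZ; exact: domD.
- case/andP: (g01 y) => g0 g1; have := wtd y.
  have : 0 <= eps * (wt (y + eps) + wt (y - eps)).
    by rewrite mulr_ge0 ?(ltW eps0)// addr_ge0 ?wt_ge0.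
  nra.
Qed.

Definition unitdec g := (forall x y, x <= y -> g y <= g x) /\ (forall x, 0 <= g x <= 1).

Lemma unitdec_bm g : unitdec g -> bm g.
Proof.
move=> [gdec g01]; split; first exact: mf_nonincreasing.
by exists 1 => x; case/andP: (g01 x) => g0 g1; rewrite ger0_norm.
Qed.

(** On the window [|z - y| < eps] a monotone profile varies by at most its total drop across the
    window. Two profiles give 2 + 2 = 4. *)
Lemma itg_wt_osc g1 g2 : unitdec g1 -> unitdec g2 ->
  itg (fun y => wt y * oscS (fun z => g1 z - g2 z) y) <= 4 * eps * wtot R.
Proof.
move=> u1 u2; have b1 := unitdec_bm u1; have b2 := unitdec_bm u2.
have b12 := bmB b1 b2.
have h1 := itg_wt_shift_diff u1.1 u1.2; have h2 := itg_wt_shift_diff u2.1 u2.2.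
have c1 := bmB (bm_shift (- eps) b1) (bm_shift eps b1).
have c2 := bmB (bm_shift (- eps) b2) (bm_shift eps b2).
apply: (@le_trans _ _ (itg (fun y => wt y * ((g1 (y - eps) - g1 (y + eps)) + (g2 (y - eps) - g2 (y + eps)))))).
  apply: le_itg_wtM => [||y]; [exact: bm_oscS|exact: bmD|].
  apply: (le_trans (ler_norm _)); apply: normr_S_le => [|z].
    by apply: bm_abs; apply: bmB => //; exact: bm_cst.
  rewrite normr_id ltr_norml => /andP[z1 z2].
  have /andP[] : (y - eps <= z) && (z <= y + eps) by apply/andP; split; lra.
  move=> z3 z4; have y3 : y - eps <= y by lra. have y4 : y <= y + eps by lra.
  have := u1.1 _ _ z3; have := u1.1 _ _ z4; have := u1.1 _ _ y3; have := u1.1 _ _ y4.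
  have := u2.1 _ _ z3; have := u2.1 _ _ z4; have := u2.1 _ _ y3; have := u2.1 _ _ y4.
  by rewrite ler_norml => *; apply/andP; split; lra.
rewrite itg_wtMD//; lra.
Qed.

(** The way back from the mollified L^2 energy to L^1: [|D| <= |S D| + oscS D], and
    [a <= eta + a^2 / eta]. *)
Lemma itg_wt_abs_le_sqr D (eta : R) : bm D -> 0 < eta ->
  itg (fun y => wt y * `|D y|) <=
  eta * wtot R + itg (fun y => wt y * S k D y ^+ 2) / eta + itg (fun y => wt y * oscS D y).
Proof.
move=> bD eta0; have bS := bm_S bD; have bo := bm_oscS bD.
rewrite (_ : eta * _ = itg (fun y => wt y * eta)); last first.
  by rewrite -itgZ; [congr itg; apply/funext => y; rewrite mulrC|exact: dom_wt].
rewrite [X in _ + X + _]mulrC -itg_wtMZ; last exact: bm_sqr.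
have bc := bm_cst eta; have bz := bmZ eta^-1 (bm_sqr bS).
rewrite -itg_wtMD// -itg_wtMD//; last exact: bmD.
apply: le_itg_wtM => [||y]; [exact: bm_abs|by apply: bmD => //; exact: bmD|].
have : `|D y| <= `|S k D y| + oscS D y.
  have := normr_subS y bD; have := ler_normD (D y - S k D y) (S k D y).
  by rewrite subrK => *; lra.
suff : `|S k D y| <= eta + eta^-1 * S k D y ^+ 2 by lra.
rewrite -[S k D y ^+ 2]real_normK ?num_real//; set a := `|_|.
have a0 : 0 <= a by exact: normr_ge0.
rewrite -(ler_pM2l eta0) mulrDr mulrA divff ?gt_eqF// mul1r.
have := sqr_ge0 (a - eta); have := mulr_ge0 a0 (ltW eta0); rewrite !expr2; nra.
Qed.

(** The action of the walk on tail profiles: a jump to the right translates the profile to the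
    right, so the rate [al] goes with [x - h]. Exchanging [al] and [be] gives the adjoint. *)
Definition Lop (c al be h : R) (u : R -> R) x :=
  c * (al * (u (x - h) - u x) + be * (u (x + h) - u x)).

Lemma bm_Lop c al be h u : bm u -> bm (Lop c al be h u).
Proof.
move=> bu; apply: bmZ; apply: bmD; apply: bmZ; apply: bmB => //; exact: bm_shift.
Qed.

Lemma S_Lop c al be h u y : bm u -> S k (Lop c al be h u) y = Lop c al be h (S k u) y.
Proof.
move=> bu; have b1 := bm_shift (- h) bu; have b2 := bm_shift h bu.
rewrite /Lop SZ; last by apply: bmD; apply: bmZ; exact: bmB.
by rewrite SD ?SZ ?SB ?S_shift//; do ?[apply: bmZ|exact: bmB].
Qed.

Lemma itg_comb c al be f0 f1 f2 : dom f0 -> dom f1 -> dom f2 ->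
  itg (fun y => c * (al * (f1 y - f0 y) + be * (f2 y - f0 y))) =
  c * (al * (itg f1 - itg f0) + be * (itg f2 - itg f0)).
Proof.
move=> d0 d1 d2; have d10 := domB d1 d0; have d20 := domB d2 d0.
by rewrite itgZ ?itgD ?itgZ ?itgB//; [apply: domZ|apply: domZ|apply: domD; apply: domZ].
Qed.

Lemma itg_Lop_dual c al be h f u : dom f -> bm u ->
  itg (fun y => f y * Lop c al be h u y) = itg (fun y => Lop c be al h f y * u y).
Proof.
move=> df bu; have b1 := bm_shift (- h) bu; have b2 := bm_shift h bu; have [mf_u [B uB]] := bu.
have dT a : dom (fun y => f y * u (y + a)).
  by have [ms [Bs sB]] := bm_shift a bu; apply: domMr sB df.
pose T a := itg (fun y => f y * u (y + a)).
have Ta a : T a = itg (fun y => f (y - a) * u y).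
  rewrite /T -(itg_shift (- a) (dT a)).
  by congr itg; apply/funext => y; rewrite subrK.
have dw a : dom (fun y => f (y + a) * u y) by apply: domMr uB _ => //; exact: dom_shift.
have d0 : dom (fun y => f y * u y) by apply: domMr uB _.
have T0 : T 0 = itg (fun y => f y * u y) by congr itg; apply/funext => y; rewrite addr0.
have e1 : itg (fun y => f y * Lop c al be h u y) = c * (al * (T (- h) - T 0) + be * (T h - T 0)).
  rewrite /T -itg_comb//; congr itg; apply/funext => y; rewrite /Lop addr0; ring.
have -> : itg (fun y => f y * Lop c al be h u y) =
    c * (al * (itg (fun y => f (y + h) * u y) - itg (fun y => f y * u y)) +
         be * (itg (fun y => f (y - h) * u y) - itg (fun y => f y * u y))).
  rewrite e1 T0 -(Ta h); congr (c * (al * (_ - _) + _)).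
  by rewrite Ta; congr itg; apply/funext => y; rewrite opprK.
rewrite -itg_comb//.
by congr itg; apply/funext => y; rewrite /Lop; ring.
Qed.

(* Contraction up to the oscillation term: convexity of the square makes the jump operator dissipative, so only
   the weight and the reaction term contribute to the growth rate. *)
Lemma energy (c al be h K0 mu kap B : R) (D R0 : R -> R) :
  0 <= c -> 0 <= al -> 0 <= be -> 0 <= mu -> 0 <= kap -> 0 <= B ->
  (forall x, Lop c be al h (@wt R) x <= K0 * wt x) ->
  bm D -> (forall x, `|D x| <= B) -> bm R0 -> (forall x, `|R0 x| <= kap) ->
  itg (fun y => wt y * (2 * S k D y *
     (Lop c al be h (S k D) y + mu * S k (fun z => D z * R0 z) y))) <=
  (K0 + 2 * mu * kap) * itg (fun y => wt y * S k D y ^+ 2)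
  + 4 * mu * kap * B * itg (fun y => wt y * oscS D y).
Proof.
move=> c0 al0 be0 mu0 kap0 B0 HK bD DB bR RB.
have be_ := bm_S bD; have bsq := bm_sqr be_; have bo := bm_oscS bD.
apply: (@le_trans _ _ (itg (fun y => wt y * (Lop c al be h (fun z => S k D z ^+ 2) y +
   (2 * mu * kap * S k D y ^+ 2 + 4 * mu * kap * B * oscS D y))))).
  apply: le_itg_wtM => [||y].
  - apply: bmM; first exact: bmZ.
    by apply: bmD; [exact: bm_Lop|apply: bmZ; apply: bm_S; exact: bmM].
  - by apply: bmD; [exact: bm_Lop|apply: bmD; exact: bmZ].
  rewrite mulrDr lerD//.
    rewrite /Lop -subr_ge0.
    (* The difference between [Lop] of the square and twice the product is the carre du champ of the
       walk, a sum of squares. *)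
    rewrite [X in 0 <= X](_ : _ = c * (al * (S k D (y - h) - S k D y) ^+ 2 + be * (S k D (y + h) - S k D y) ^+ 2)); last by ring.
    by rewrite mulr_ge0// addr_ge0// mulr_ge0// sqr_ge0.
  (* The factor [R0] cannot be pulled out of [S]. It is bounded inside, which leaves [S |D|], and
     passing from there to [|S D|] costs the oscillation. *)
  have h1 : `|S k (fun z => D z * R0 z) y| <= kap * S k (fun z => `|D z|) y.
    rewrite -SZ; last exact: bm_abs.
    apply: (le_trans (normr_S _ (bmM bD bR))); apply: le_S => [||z _].
    - by apply: bm_abs; exact: bmM.
    - by apply: bmZ; exact: bm_abs.
    - by rewrite normrM mulrC ler_wpM2r.
  have h2 := Sabs_sub y bD.
  have h3 : `|S k D y| <= B by apply: normr_S_le.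
  apply: (le_trans (ler_norm _)); rewrite !normrM ger0_norm// [`|mu|]ger0_norm//.
  rewrite -[S k D y ^+ 2]real_normK ?num_real//.
  set a := `|S k D y| in h2 h3 *; have a0 : 0 <= a by exact: normr_ge0.
  set b := `|S k _ y| in h1 *.
  have ho : 0 <= oscS D y.
    apply: (@le_trans _ _ `|D y - S k D y|) => //; exact: normr_subS.
  have hb : b <= kap * (a + 2 * oscS D y).
    by apply: (le_trans h1); rewrite ler_wpM2l//; lra.
  have hm : 0 <= 2 * mu by lra.
  apply: (@le_trans _ _ (2 * mu * (a * (kap * (a + 2 * oscS D y))))).
    rewrite (_ : 2 * a * (mu * b) = 2 * mu * (a * b)); last by ring.
    by rewrite ler_wpM2l// ler_wpM2l.
  rewrite -subr_ge0 (_ : _ - _ = 4 * (mu * kap * oscS D y * (B - a))); last by ring.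
  by rewrite mulr_ge0// mulr_ge0 ?subr_ge0// mulr_ge0// mulr_ge0.
rewrite itg_wtMD; [|exact: bm_Lop|by apply: bmD; exact: bmZ].
rewrite itg_wtMD; [|exact: bmZ|exact: bmZ].
rewrite (itg_wtMZ (2 * mu * kap) bsq) (itg_wtMZ (4 * mu * kap * B) bo).
suff : itg (fun x => wt x * Lop c al be h (fun z => S k D z ^+ 2) x) <=
    K0 * itg (fun y => wt y * S k D y ^+ 2) by lra.
(* By duality the operator acts on the weight, where the hypothesis on [wt] applies. *)
rewrite (itg_Lop_dual _ _ _ _ (dom_wt R) bsq) -itgZ; last exact: dom_wtM.
have [mf_s [Bs sB]] := bsq.
apply: le_itg => [||y].
- apply: domMr sB _ => //; apply: domZ; apply: domD; apply: domZ; apply: domB;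
   do ?[exact: dom_wt|exact: (dom_shift _ (dom_wt R))].
- by apply: domZ; exact: dom_wtM.
- by rewrite mulrA ler_wpM2r ?sqr_ge0.
Qed.

End FixedMollifier.

End Smoothing.

(** * An explicit smooth mollifier *)

Section Mollifiers.
Variable R : realType.
Local Notation leb := (@lebesgue_measure R).

Definition bump0 : seq ({poly R} * {poly R}) := [:: (1, 1)].

Lemma bump0E x : bsum bump0 x = flat 1 (1 - x) * flat 1 (1 + x).
Proof. by rewrite /bsum big_cons big_nil addr0. Qed.

Lemma flat1E (x : R) : 0 < x -> flat 1 x = expR (- x^-1).
Proof. by move=> x0; rewrite /flat x0 hornerC mul1r. Qed.

Lemma flat1_ge0 (x : R) : 0 <= flat 1 x.
Proof. by rewrite /flat; case: ifP => // _; rewrite hornerC mul1r expR_ge0. Qed.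

Lemma flat1_half (x : R) : 2^-1 <= x -> expR (- 2) <= flat 1 x.
Proof.
move=> x2; have x0 : 0 < x by apply: lt_le_trans x2; rewrite invr_gt0.
by rewrite flat1E// ler_expR lerN2 -[leRHS]invrK lef_pV2// posrE invr_gt0.
Qed.

Definition bump_mass (eps : R) : R := itg (mkt 1 eps^-1 0 bump0).

Lemma mkt_mf c a b s : mf (@mkt R c a b s).
Proof. exact: mf_continuous (@continuous_mkt R c a b s). Qed.

Lemma dom_mkt c a b s : a != 0 -> dom (@mkt R c a b s).
Proof.
move=> a0; split; first exact: mkt_mf.
have [_ H] := schwartz_mkt c b s a0.
have [C0 H0] := H 0%N 0%N; have [C2 H2] := H 2%N 0%N.
exists (C0 + C2) => x; rewrite -(ler_pM2r (wt_den_gt0 x)) -mulrA wtE mulr1 mulrDr mulr1.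
apply: lerD; first by have := H0 x; rewrite expr0 mul1r.
by have := H2 x; rewrite normrM [`|x ^+ 2|]ger0_norm ?sqr_ge0// mulrC.
Qed.

(** For [|x| <= eps / 2] both [1 - x / eps] and [1 + x / eps] are at least 1/2, so each factor is at
    least [e^(-2)]. Every [eps] has its own normalization, and this lower bound of order [eps] is
    what makes the constant [M] of the mollifiers uniform. *)
Lemma bump_mass_ge (eps : R) : 0 < eps -> expR (- 4) * eps <= bump_mass eps.
Proof.
move=> e0; have en0 : eps^-1 != 0 by rewrite invr_neq0// gt_eqF.
pose J : set R := `[- (eps / 2), eps / 2]%classic.
have J1 x : J x -> `|x| <= eps / 2 by rewrite /J /= in_itv/= ler_norml.
have dJ : dom (\1_J : R -> R).
  split; first exact: measurable_indic (measurable_itv _).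
  exists (1 + (eps / 2) ^+ 2) => x; rewrite indicE; have [/set_mem xJ|xJ] := boolP (x \in J).
    rewrite normr1 -(ler_pM2r (wt_den_gt0 x)) -mulrA wtE mulr1 mul1r lerD2l -[leLHS]real_normK ?num_real//.
    by rewrite lerXn2r ?nnegrE ?(divr_ge0 (ltW e0))//; exact: J1.
  by rewrite normr0 mulr_ge0 ?wt_ge0// addr_ge0 ?sqr_ge0.
have eJ : itg (\1_J : R -> R) = eps.
  rewrite /itg integral_indic ?setIT//=; last exact: measurable_itv.
  by rewrite /J lebesgue_measure_itv/= lte_fin ifT; [rewrite -EFinB/=; lra|lra].
rewrite -{1}eJ -itgZ//; apply: le_itg => [||x]; [exact: domZ|exact: dom_mkt|].
rewrite /mkt mul1r addr0 bump0E indicE.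
have [/set_mem xJ|xJ] := boolP (x \in J); last first.
  by rewrite mulr0 mulr_ge0 ?flat1_ge0.
rewrite mulr1 (_ : - 4 = - 2 + - 2); last by ring.
have := J1 _ xJ; rewrite ler_norml => /andP[x1 x2].
have h1 : - 2^-1 <= eps^-1 * x by rewrite -(ler_pM2l e0) mulrA divff ?gt_eqF// mul1r; lra.
have h2 : eps^-1 * x <= 2^-1 by rewrite -(ler_pM2l e0) mulrA divff ?gt_eqF// mul1r; lra.
by rewrite expRD ler_pM ?expR_ge0// flat1_half//; lra.
Qed.

Definition moll (eps : R) : R -> R := mkt (bump_mass eps)^-1 eps^-1 0 bump0.

Lemma moll_translate eps y :
  (fun z => moll eps (z - y)) = mkt (bump_mass eps)^-1 eps^-1 (- (eps^-1 * y)) bump0.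
Proof. by apply/funext => z; rewrite /moll /mkt addr0 mulrBr. Qed.

Lemma moll_mollifier : exists2 M : R, 0 <= M & forall eps, 0 < eps -> mollifier M eps (moll eps).
Proof.
have [C [C0 HC]] := bsum_bounded bump0.
exists (C / expR (- 4)); first by rewrite divr_ge0// expR_ge0.
move=> eps e0; have mge := bump_mass_ge e0.
have m0 : 0 < bump_mass eps by apply: lt_le_trans mge; rewrite mulr_gt0// expR_gt0.
split.
- exact: continuous_mkt.
- move=> z; rewrite /moll /mkt mulr_ge0 ?invr_ge0 ?(ltW m0)//.
  by rewrite bump0E mulr_ge0 ?flat1_ge0.
- move=> z ez; apply: mkt_supp; rewrite addr0 normrM normfV [`|eps|]gtr0_norm//.
  by rewrite ler_pdivlMl// mulr1.
- rewrite (_ : moll eps = fun z => (bump_mass eps)^-1 * mkt 1 eps^-1 0 bump0 z); last first.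
    by apply/funext => z; rewrite /moll /mkt mul1r.
  by rewrite itgZ ?mulVf ?gt_eqF//; apply: dom_mkt; rewrite invr_neq0// gt_eqF.
- move=> z; rewrite /moll /mkt mulrC ler_pdivrMr//.
  apply: (le_trans (ler_norm _)); apply: (le_trans (HC _)).
  rewrite -!mulrA ler_peMr// mulrA -invfM ler_pdivlMl ?mulr1//.
  by rewrite mulr_gt0// expR_gt0.
Qed.

End Mollifiers.

(** * Limits along an ultrafilter *)

Section UltraLimit.
Variable R : realType.

(** With one ultrafilter, bounded approximations converge at all points (t, x) at once, with neither
    a Cauchy estimate nor a diagonal subsequence. *)
Lemma ultra_bounded_cvg (F : set_system nat) (a : nat -> R) (B : R) :
  UltraFilter F -> F [set n | `|a n| <= B] -> exists l : R, a @ F --> l.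
Proof.
move=> FU aB.
have FP : ProperFilter F := @ultra_proper _ F FU.
have cK : compact `[- B, B]%classic by exact: segment_compact.
have FU' : UltraFilter (a @ F).
  constructor=> [|G GP FG]; first exact: fmap_proper_filter.
  apply/seteqP; split=> // A GA.
  have [//|FA] := in_ultra_setVsetC (a @^-1` A) FU.
  have GnA : G (~` A) by apply: FG.
  by have : G (A `&` ~` A) by [exact: filterI]; rewrite setICr => /filter_ex[].
have FK : (a @ F) `[- B, B]%classic.
  rewrite /fmap/= /nbhs/=; have FF : Filter F := @filter_filter _ _ FP.
  apply: (@filterS _ F FF _ _ _ aB) => n /= nB; rewrite in_itv/=; move: nB.
  by rewrite ler_norml.
move: cK; rewrite compact_ultra => /(_ (a @ F) FU' FK) [l [_ al]].
by exists l.
Qed.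

End UltraLimit.

(** * The lattice equation *)

Section LatticeODE.
Variable R : realType.
Variables (c al be h mu : R).
Hypotheses (c0 : 0 <= c) (al0 : 0 <= al) (be0 : 0 <= be) (mu0 : 0 < mu).

Definition Bop (u : R -> R) (x : R) : R := Lop c al be h u x + mu * (u x ^+ 2 - u x).

Definition Estep (tau : R) (u : R -> R) (x : R) : R := u x + tau * Bop u x.

(** On profiles with values in [0, 1], both a bound for [Bop] and a Lipschitz constant of it for the
    supremum norm. *)
Definition Blip : R := 2 * c * (al + be) + mu.

Lemma Blip_gt0 : 0 < Blip.
Proof. by rewrite /Blip ltr_wpDl// !mulr_ge0// addr_ge0. Qed.

(** Under the Courant-Friedrichs-Lewy condition on [tau] the Euler step is nondecreasing in each of
    the three values it reads. Two profiles and two points are allowed, so that the same statement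
    yields comparison with constants and monotonicity in space. *)
Lemma Estep_mono tau (u v : R -> R) x y : 0 <= tau -> tau * (c * (al + be) + mu) <= 1 ->
  (forall z, 0 <= u z <= 1) -> (forall z, 0 <= v z <= 1) ->
  u x <= v y -> u (x - h) <= v (y - h) -> u (x + h) <= v (y + h) ->
  Estep tau u x <= Estep tau v y.
Proof.
move=> t0 tq u01 v01 h0 h1 h2; rewrite -subr_ge0.
rewrite (_ : _ - _ = tau * (c * (al * (v (y - h) - u (x - h)))) +
   tau * (c * (be * (v (y + h) - u (x + h)))) +
  ((1 - tau * (c * (al + be) + mu)) + tau * mu * (u x + v y)) * (v y - u x)); last first.
  by rewrite /Estep /Bop /Lop; ring.
have /andP[u0 _] := u01 x; have /andP[v0 _] := v01 y.
rewrite addr_ge0//.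
  by rewrite addr_ge0// mulr_ge0// mulr_ge0// mulr_ge0 ?subr_ge0.
rewrite mulr_ge0 ?subr_ge0// addr_ge0 ?subr_ge0//.
by rewrite mulr_ge0 ?addr_ge0// mulr_ge0// ltW.
Qed.

Lemma Estep_unitdec tau u : 0 <= tau -> tau * (c * (al + be) + mu) <= 1 ->
  unitdec u -> unitdec (Estep tau u).
Proof.
move=> t0 tq [udec u01]; split=> [x y xy|x].
  by apply: Estep_mono => //; apply: udec; rewrite ?lerD2r.
(* 0 and 1 are equilibria; comparison with them keeps the values in [0, 1]. *)
have e0 : Estep tau (fun=> 0) x = 0 by rewrite /Estep /Bop /Lop; ring.
have e1 : Estep tau (fun=> 1) x = 1 by rewrite /Estep /Bop /Lop; ring.
have z01 (z : R) : (0 : R) <= 0 <= (1:R) by rewrite lexx ler01.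
have o01 (z : R) : (0 : R) <= 1 <= (1:R) by rewrite lexx ler01.
have h0 z : 0 <= u z by case/andP: (u01 z).
have h1 z : u z <= 1 by case/andP: (u01 z).
by apply/andP; split; [rewrite -{1}e0|rewrite -[leRHS]e1]; apply: Estep_mono.
Qed.

Lemma Bop_bound u x : (forall z, 0 <= u z <= 1) -> `|Bop u x| <= Blip.
Proof.
move=> u01; have /andP[a1 a2] := u01 x; have /andP[b1 b2] := u01 (x - h).
have /andP[d1 d2] := u01 (x + h).
have cal : 0 <= c * al by rewrite mulr_ge0. have cbe : 0 <= c * be by rewrite mulr_ge0.
have H (p q r : R) : 0 <= p -> -1 <= q <= 1 -> - p <= p * q <= p.
  by move=> p0 /andP[q1 q2]; apply/andP; split; nra.
have /andP[] := H (c * al) (u (x - h) - u x) 1 cal ltac:(apply/andP; split; lra).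
have /andP[] := H (c * be) (u (x + h) - u x) 1 cbe ltac:(apply/andP; split; lra).
have /andP[] := H mu (u x ^+ 2 - u x) 1 (ltW mu0) ltac:(apply/andP; split; nra).
move=> *; rewrite /Bop /Lop /Blip ler_norml; apply/andP; split; lra.
Qed.

Lemma Bop_lip u v x d : (forall z, 0 <= u z <= 1) -> (forall z, 0 <= v z <= 1) ->
  (forall z, `|u z - v z| <= d) -> `|Bop u x - Bop v x| <= Blip * d.
Proof.
move=> u01 v01 uvd; have d0 : 0 <= d := le_trans (normr_ge0 _) (uvd x).
have cal : 0 <= c * al by rewrite mulr_ge0. have cbe : 0 <= c * be by rewrite mulr_ge0.
rewrite (_ : _ - _ = c * al * (u (x - h) - v (x - h)) + c * be * (u (x + h) - v (x + h)) -
   (c * al + c * be) * (u x - v x) + mu * ((u x - v x) * (u x + v x - 1))); last first.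
  by rewrite /Bop /Lop; ring.
have h1 : `|c * al * (u (x - h) - v (x - h))| <= c * al * d by rewrite normrM ger0_norm// ler_wpM2l.
have h2 : `|c * be * (u (x + h) - v (x + h))| <= c * be * d by rewrite normrM ger0_norm// ler_wpM2l.
have h3 : `|(c * al + c * be) * (u x - v x)| <= (c * al + c * be) * d.
  by rewrite normrM ger0_norm ?addr_ge0// ler_wpM2l ?addr_ge0.
have h4 : `|mu * ((u x - v x) * (u x + v x - 1))| <= mu * (d * 1).
  rewrite normrM gtr0_norm// ler_wpM2l ?(ltW mu0)// normrM ler_pM// ler_norml.
  by have /andP[? ?] := u01 x; have /andP[? ?] := v01 x; apply/andP; split; lra.
move: h1 h2 h3 h4; rewrite !ler_norml => /andP[? ?] /andP[? ?] /andP[? ?] /andP[? ?].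
rewrite /Blip; apply/andP; split; lra.
Qed.

Section Iterates.
Variables (psi : R -> R) (tau : R).
Hypotheses (psi_u : unitdec psi) (t0 : 0 <= tau) (tq : tau * (c * (al + be) + mu) <= 1).

Let U k := iter k (Estep tau) psi.

Lemma Euler_unitdec k : unitdec (U k).
Proof. by elim: k => // k IH; rewrite /U iterS; apply: Estep_unitdec. Qed.

Lemma Euler_lip k m x : `|U (k + m) x - U k x| <= m%:R * tau * Blip.
Proof.
elim: m => [|m IH]; first by rewrite addn0 subrr normr0 !mul0r.
rewrite addnS /U iterS -/(U _) /Estep addrAC (le_trans (ler_normD _ _))//.
rewrite -natr1 !mulrDl mul1r lerD// normrM ger0_norm// ler_wpM2l// Bop_bound//.
exact: (Euler_unitdec _).2.
Qed.

(** The bound involves only the elapsed time [m tau], not the step, so it survives the limit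
    [tau -> 0]. The induction closes because [m^2 + m <= (m + 1)^2]. *)
Lemma Euler_EP k m x :
  `|U (k + m) x - U k x - m%:R * tau * Bop (U k) x| <= (Blip * (m%:R * tau)) ^+ 2.
Proof.
elim: m => [|m IH]; first by rewrite addn0 !mul0r subrr subr0 normr0 sqr_ge0.
rewrite addnS /U iterS -/(U _) /Estep -natr1.
rewrite (_ : _ - _ - _ = (U (k + m) x - U k x - m%:R * tau * Bop (U k) x) +
   tau * (Bop (U (k + m)) x - Bop (U k) x)); last by rewrite -/(U k); ring.
have h1 : `|tau * (Bop (U (k + m)) x - Bop (U k) x)| <= tau * (Blip * (m%:R * tau * Blip)).
  rewrite normrM ger0_norm// ler_wpM2l//; apply: Bop_lip.
    - exact: (Euler_unitdec _).2.
    - exact: (Euler_unitdec _).2.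
    - by move=> z; exact: Euler_lip.
apply: (le_trans (ler_normD _ _)); apply: (le_trans (lerD IH h1)).
have m0 : 0 <= m%:R :> R by rewrite ler0n.
have : 0 <= (Blip * tau) ^+ 2 * (m%:R + 1) by rewrite mulr_ge0 ?sqr_ge0 ?addr_ge0.
by rewrite -subr_ge0 => hh; rewrite -subr_ge0; move: hh; rewrite !expr2 => hh; nra.
Qed.

(** [eta + A e^(-x)] is a barrier: the reaction only lowers the profile and the walk annihilates
    constants, so only the exponential grows. The constant [eta] accommodates profiles that decay at
    no given rate. *)
Lemma Euler_tail_right C eta A k : 0 <= C -> 0 <= eta -> 0 <= A ->
  (forall x, Lop c al be h (fun x => expR (- x)) x <= C * expR (- x)) ->
  (forall x, psi x <= eta + A * expR (- x)) ->
  forall x, U k x <= eta + expR (C * (k%:R * tau)) * (A * expR (- x)).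
Proof.
move=> C0 e0 A0 HC Hpsi.
have H x : U k x <= eta + (1 + C * tau) ^+ k * (A * expR (- x)).
  elim: k x => [|k IH] x; first by rewrite expr0 mul1r.
  rewrite /U iterS -/(U _) /Estep /Bop; set A' := (1 + C * tau) ^+ k * A.
  have A'0 : 0 <= A' by rewrite mulr_ge0// exprn_ge0// addr_ge0// mulr_ge0.
  have {}IH z : U k z <= eta + A' * expR (- z) by rewrite -mulrA.
  have := (Euler_unitdec k).2 x => /andP[u0 u1].
  have hmu : mu * (U k x ^+ 2 - U k x) <= 0.
    by rewrite mulr_ge0_le0 ?(ltW mu0)// subr_le0 expr2 ler_piMr.
  have hL : U k x + tau * Lop c al be h (U k) x <= eta + A' * expR (- x) +
     tau * (A' * Lop c al be h (fun x => expR (- x)) x).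
    rewrite -subr_ge0 (_ : _ - _ = (1 - tau * (c * (al + be))) * (eta + A' * expR (- x) - U k x) +
      tau * (c * (al * (eta + A' * expR (- (x - h)) - U k (x - h)) +
              be * (eta + A' * expR (- (x + h)) - U k (x + h))))); last by rewrite /Lop; ring.
    rewrite addr_ge0//; rewrite mulr_ge0 ?subr_ge0 ?IH//.
      by apply: le_trans tq; rewrite ler_wpM2l// lerDl ltW.
    by rewrite mulr_ge0// addr_ge0// mulr_ge0 ?subr_ge0 ?IH.
  have hh : tau * (A' * Lop c al be h (fun x => expR (- x)) x) <= tau * (A' * (C * expR (- x))).
    by rewrite ler_wpM2l// ler_wpM2l.
  have hm : tau * (mu * (U k x ^+ 2 - U k x)) <= 0 by rewrite mulr_ge0_le0.
  rewrite (exprS (1 + C * tau)) [leRHS](_ : _ = eta + A' * expR (- x) + tau * (A' * (C * expR (- x)))); last by rewrite /A'; ring.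
  rewrite mulrDr; lra.
move=> x; apply: (le_trans (H x)); rewrite lerD2l ler_wpM2r ?mulr_ge0 ?expR_ge0//.
rewrite mulrCA expRM_natl lerXn2r ?nnegrE ?expR_ge0 ?addr_ge0 ?mulr_ge0//.
exact: expR_ge1Dx.
Qed.

(** The reaction feeds [1 - u] at rate at most [mu]; hence [C + mu] in the exponent, and the growth
    of [eta] as well. *)
Lemma Euler_tail_left C eta A k : 0 <= C -> 0 <= eta -> 0 <= A ->
  (forall x, Lop c al be h (@expR R) x <= C * expR x) ->
  (forall x, 1 - psi x <= eta + A * expR x) ->
  forall x, 1 - U k x <= expR ((C + mu) * (k%:R * tau)) * (eta + A * expR x).
Proof.
move=> C0 e0 A0 HC Hpsi.
have cm0 : 0 <= C + mu by rewrite addr_ge0// ltW.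
have H x : 1 - U k x <= (1 + (C + mu) * tau) ^+ k * (eta + A * expR x).
  elim: k x => [|k IH] x; first by rewrite expr0 mul1r.
  rewrite /U iterS -/(U _) /Estep /Bop; set q := (1 + (C + mu) * tau) ^+ k.
  have q0 : 0 <= q by rewrite exprn_ge0// addr_ge0// mulr_ge0.
  have := (Euler_unitdec k).2 x => /andP[u0 u1].
  have hmu : mu * (U k x - U k x ^+ 2) <= mu * (1 - U k x).
    rewrite ler_wpM2l ?(ltW mu0)//; have := sqr_ge0 (1 - U k x); rewrite !expr2; nra.
  have hL : (1 - U k x) - tau * Lop c al be h (U k) x <= q * (eta + A * expR x) +
     tau * (q * A * Lop c al be h (@expR R) x).
    rewrite -subr_ge0 (_ : _ - _ = (1 - tau * (c * (al + be))) * (q * (eta + A * expR x) - (1 - U k x)) +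
      tau * (c * (al * (q * (eta + A * expR (x - h)) - (1 - U k (x - h))) +
              be * (q * (eta + A * expR (x + h)) - (1 - U k (x + h)))))); last by rewrite /Lop; ring.
    rewrite addr_ge0//; rewrite mulr_ge0 ?subr_ge0 ?IH//.
      by apply: le_trans tq; rewrite ler_wpM2l// lerDl ltW.
    by rewrite mulr_ge0// addr_ge0// mulr_ge0 ?subr_ge0 ?IH.
  have hh : tau * (q * A * Lop c al be h (@expR R) x) <= tau * (q * A * (C * expR x)).
    by rewrite ler_wpM2l// ler_wpM2l// mulr_ge0.
  have hm : tau * (mu * (U k x - U k x ^+ 2)) <= tau * (mu * (q * (eta + A * expR x))).
    rewrite ler_wpM2l//; apply: (le_trans hmu); rewrite ler_wpM2l ?(ltW mu0)//; exact: IH.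
  have hx : 0 <= tau * (C * (q * eta)) by rewrite !mulr_ge0.
  rewrite (exprS (1 + (C + mu) * tau)) -/q; lra.
move=> x; apply: (le_trans (H x)); rewrite ler_wpM2r ?addr_ge0 ?mulr_ge0 ?expR_ge0//.
rewrite mulrCA expRM_natl lerXn2r ?nnegrE ?expR_ge0 ?addr_ge0 ?mulr_ge0//.
exact: expR_ge1Dx.
Qed.

End Iterates.

(** The solution is the limit, along an ultrafilter, of explicit Euler schemes with step [1/(j+1)].
    Each property is a non-strict inequality between finitely many values of the scheme, hence
    passes to the limit. The equation itself is expressed by an expansion over a step [d] with error
    O(d^2), the form in which Gronwall's argument consumes it. *)
Theorem lattice_ode (psi : R -> R) : unitdec psi -> exists v : R -> R -> R,
  [/\ v 0 = psi,
      forall t, 0 <= t -> unitdec (v t),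
      forall t d x, 0 <= t -> 0 <= d ->
        `|v (t + d) x - v t x - d * Bop (v t) x| <= (Blip * d) ^+ 2,
      forall C eta A, 0 <= C -> 0 <= eta -> 0 <= A ->
        (forall x, Lop c al be h (fun x => expR (- x)) x <= C * expR (- x)) ->
        (forall x, psi x <= eta + A * expR (- x)) ->
        forall t x, 0 <= t -> v t x <= eta + expR (C * t) * (A * expR (- x))
    & forall C eta A, 0 <= C -> 0 <= eta -> 0 <= A ->
        (forall x, Lop c al be h (@expR R) x <= C * expR x) ->
        (forall x, 1 - psi x <= eta + A * expR x) ->
        forall t x, 0 <= t -> 1 - v t x <= expR ((C + mu) * t) * (eta + A * expR x)].
Proof.
move=> psi_u.
have [F [FU Foo]] : exists F : set_system nat, UltraFilter F /\ \oo `<=` F.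
  exact: ultraFilterLemma.
have FP : ProperFilter F := @ultra_proper _ F FU.
pose tau (j : nat) : R := j.+1%:R^-1.
(* The number of Euler steps that fit in [0, t]. *)
pose kk j (t : R) : nat := Num.truncn (t * j.+1%:R).
pose U j k : R -> R := iter k (Estep (tau j)) psi.
have tau0 j : 0 <= tau j by rewrite invr_ge0.
have tauF : tau @ F --> (0 : R).
  by apply: cvg_trans (@cvg_harmonic R); apply: cvg_app => A; exact: Foo.
have Fq : \forall j \near F, tau j * (c * (al + be) + mu) <= 1.
  have cq : (fun j => tau j * (c * (al + be) + mu)) @ F --> 0 * (c * (al + be) + mu).
    by apply: cvgMl.
  rewrite mul0r in cq; have FF : Filter F := @filter_filter _ _ FP.
  by apply: filterS (cvgr_lt _ cq _ ltr01) => j /ltW.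
have kk1 j t : 0 <= t -> (kk j t)%:R * tau j <= t < (kk j t)%:R * tau j + tau j.
  move=> t0; have : 0 <= t * j.+1%:R by rewrite mulr_ge0.
  move=> /truncn_itv; rewrite -/(kk j t) => /andP[h1 h2].
  rewrite /tau ler_pdivrMr ?ltr0Sn// h1/= -[X in _ < _ + X]mul1r -mulrDl natr1.
  by rewrite ltr_pdivlMr ?ltr0Sn.
have kkF t : 0 <= t -> (fun j => (kk j t)%:R * tau j) @ F --> t.
  move=> t0; apply: (@squeeze_cvgr _ _ _ _ (fun j => t - tau j) (fun=> t)).
  - by apply: nearW => j; have /andP[h1 h2] := kk1 j t t0; rewrite h1 andbT; lra.
  - by rewrite -[X in _ --> X]subr0; apply: cvgB => //; exact: cvg_cst.
  - exact: cvg_cst.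
have Ucv t x : exists l : R, (fun j => U j (kk j t) x) @ F --> l.
  apply: (@ultra_bounded_cvg _ _ _ 1) => //; apply: filterS Fq => j tq /=.
  have /andP[a b] := (@Euler_unitdec _ _ psi_u (tau0 j) tq (kk j t)).2 x.
  by rewrite ger0_norm.
pose v t x := projT1 (cid (Ucv t x)).
have vP t x : (fun j => U j (kk j t) x) @ F --> v t x := projT2 (cid (Ucv t x)).
exists v; split.
- apply/funext => x; have U0 j : U j (kk j 0) x = psi x by rewrite /U /kk mul0r truncn0.
  apply/eqP; rewrite eq_le; apply/andP; split.
    apply: (ler_cvg_to (vP 0 x) (@cvg_cst _ (psi x) _ F _)).
    by apply: nearW => j; rewrite U0.
  apply: (ler_cvg_to (@cvg_cst _ (psi x) _ F _) (vP 0 x)).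
  by apply: nearW => j; rewrite U0.
- move=> t t0; split=> [x y xy|x].
    apply: (ler_cvg_to (vP t y) (vP t x)); apply: filterS Fq => j tq.
    exact: (@Euler_unitdec _ _ psi_u (tau0 j) tq (kk j t)).1.
  apply/andP; split.
    apply: (ler_cvg_to (@cvg_cst _ (0:R) _ F _) (vP t x)); apply: filterS Fq => j tq.
    by have /andP[] := (@Euler_unitdec _ _ psi_u (tau0 j) tq (kk j t)).2 x.
  apply: (ler_cvg_to (vP t x) (@cvg_cst _ (1:R) _ F _)); apply: filterS Fq => j tq.
  by have /andP[] := (@Euler_unitdec _ _ psi_u (tau0 j) tq (kk j t)).2 x.
- move=> t d x t0 d0; have td0 : 0 <= t + d by rewrite addr_ge0.
  have kle j : leq (kk j t) (kk j (t + d)).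
    by rewrite /kk le_truncn// ler_wpM2r// lerDl.
  have mF : (fun j => (kk j (t + d) - kk j t)%:R * tau j) @ F --> d.
    rewrite (_ : (fun j => _) = fun j => (kk j (t + d))%:R * tau j - (kk j t)%:R * tau j); last first.
      by apply/funext => j; rewrite natrB// mulrBl.
    have -> : d = (t + d) - t by lra.
    rewrite (_ : t + (t + d - t) = t + d); last by lra.
    by apply: cvgB; exact: kkF.
  have BF : (fun j => Bop (U j (kk j t)) x) @ F --> Bop (v t) x.
    rewrite /Bop /Lop; apply: cvgD.
      apply: cvgMr; apply: cvgD; apply: cvgMr; apply: cvgB; exact: vP.
    by apply: cvgMr; apply: cvgB; [rewrite expr2; apply: cvgM; exact: vP|exact: vP].
  apply: (@ler_cvg_to _ F _ _
    (fun j => `|U j (kk j (t + d)) x - U j (kk j t) x - (kk j (t + d) - kk j t)%:R * tau j * Bop (U j (kk j t)) x|)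
    (fun j => (Blip * ((kk j (t + d) - kk j t)%:R * tau j)) ^+ 2)).
  + apply: cvg_norm; apply: cvgB; first by apply: cvgB; exact: vP.
    exact: cvgM.
  + rewrite expr2 (_ : (fun j => _) = fun j => (Blip * ((kk j (t + d) - kk j t)%:R * tau j)) * (Blip * ((kk j (t + d) - kk j t)%:R * tau j))); last first.
      by apply/funext => j; rewrite expr2.
    by apply: cvgM; apply: cvgMr.
  + apply: filterS Fq => j tq; rewrite -[X in U j X x - _](subnKC (kle j)).
    exact: Euler_EP.
- move=> C eta A C0 e0 A0 HC Hpsi t x t0.
  apply: (ler_cvg_to (vP t x) (@cvg_cst _ _ _ F _)); apply: filterS Fq => j tq.
  apply: (le_trans (@Euler_tail_right _ _ psi_u (tau0 j) tq C eta A (kk j t) C0 e0 A0 HC Hpsi x)).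
  rewrite lerD2l ler_wpM2r ?mulr_ge0 ?expR_ge0// ler_expR ler_wpM2l//.
  by have /andP[] := kk1 j t t0.
- move=> C eta A C0 e0 A0 HC Hpsi t x t0.
  have cm0 : 0 <= C + mu by rewrite addr_ge0// ltW.
  apply: (ler_cvg_to (cvgB (@cvg_cst _ (1:R) _ F _) (vP t x)) (@cvg_cst _ _ _ F _)).
  apply: filterS Fq => j tq.
  apply: (le_trans (@Euler_tail_left _ _ psi_u (tau0 j) tq C eta A (kk j t) C0 e0 A0 HC Hpsi x)).
  rewrite ler_wpM2r ?addr_ge0 ?mulr_ge0 ?expR_ge0// ler_expR ler_wpM2l//.
  by have /andP[] := kk1 j t t0.
Qed.

End LatticeODE.

(** * Scalings, and the Cauchy property of the lattice solutions *)

Section Gronwall.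
Variable R : realType.

(** The interval [0, t] is cut into [n] equal steps: the errors [C d^2] add up to [C t d], which
    vanishes as [n] grows. [V] may be discontinuous and take negative values; both occur below. *)
Lemma discrete_gronwall (V : R -> R) (K E C V0 T t : R) :
  0 <= K -> 0 <= E -> 0 <= C -> 0 <= V0 -> V 0 <= V0 ->
  (forall s d, 0 <= s -> 0 <= d <= 1 -> s + d <= T ->
     V (s + d) <= (1 + K * d) * V s + d * E + C * d ^+ 2) ->
  0 <= t <= T -> V t <= expR (K * t) * (V0 + t * E).
Proof.
move=> K0 E0 C0 V00 V0le step /andP[t0 tT]; apply/ler_addgt0Pr => e e0.
(* Makes [e^(K t) C t^2 / n] at most [e], and the step [t / n] at most 1. *)
pose n := (Num.truncn (expR (K * t) * (C * t ^+ 2) / e + t)).+1.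
pose d : R := t / n%:R.
have n0 : 0 < n%:R :> R by rewrite ltr0n.
have d0 : 0 <= d by rewrite divr_ge0// ltW.
have nd : n%:R * d = t by rewrite mulrC divfK// gt_eqF.
have A0 : 0 <= expR (K * t) * (C * t ^+ 2) by rewrite mulr_ge0 ?expR_ge0// mulr_ge0// sqr_ge0.
have nb : expR (K * t) * (C * t ^+ 2) / e + t < n%:R.
  have h0 : 0 <= expR (K * t) * (C * t ^+ 2) / e + t by rewrite addr_ge0// divr_ge0// ltW.
  by have /andP[] := truncn_itv h0.
have Ae : 0 <= expR (K * t) * (C * t ^+ 2) / e by rewrite divr_ge0// ltW.
have d1 : d <= 1 by rewrite /d ler_pdivrMr// mul1r; lra.
have H i : (i <= n)%N -> V (i%:R * d) <= (1 + K * d) ^+ i * (V0 + i%:R * (d * E + C * d ^+ 2)).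
  elim: i => [|i IH] iN; first by rewrite !mul0r addr0 expr0 mul1r.
  have iT : i%:R * d + d <= T.
    rewrite -[X in _ + X]mul1r -mulrDl natr1 (le_trans _ tT)// -nd ler_wpM2r//.
    by rewrite ler_nat.
  have i0 : 0 <= i%:R * d by rewrite mulr_ge0.
  rewrite -natr1 mulrDl mul1r; have := step _ _ i0 (introT andP (conj d0 d1)) iT.
  move=> /le_trans; apply.
  have Kd : 0 <= K * d by rewrite mulr_ge0.
  have q1 : 1 <= (1 + K * d) ^+ i.+1 by rewrite exprn_ege1// lerDl.
  have dE : 0 <= d * E + C * d ^+ 2 by rewrite addr_ge0 ?mulr_ge0// sqr_ge0.
  have h1 : (1 + K * d) * V (i%:R * d) <= (1 + K * d) ^+ i.+1 * (V0 + i%:R * (d * E + C * d ^+ 2)).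
    by rewrite exprS -mulrA ler_wpM2l ?addr_ge0// IH// ltnW.
  have h2 : d * E + C * d ^+ 2 <= (1 + K * d) ^+ i.+1 * (d * E + C * d ^+ 2) by rewrite ler_peMl.
  rewrite (_ : (i%:R + 1) * _ = i%:R * (d * E + C * d ^+ 2) + (d * E + C * d ^+ 2)); last by ring.
  rewrite addrA (mulrDr _ (V0 + _)) -addrA; lra.
have := H n (leqnn _); rewrite nd => /le_trans; apply.
have e1 : (1 + K * d) ^+ n <= expR (K * t).
  have -> : K * t = n%:R * (K * d) by rewrite -nd; ring.
  rewrite expRM_natl lerXn2r ?nnegrE ?expR_ge0 ?addr_ge0 ?mulr_ge0//.
  exact: expR_ge1Dx.
have X0 : 0 <= V0 + n%:R * (d * E + C * d ^+ 2).
  by rewrite addr_ge0// mulr_ge0 ?ler0n// addr_ge0 ?mulr_ge0 ?sqr_ge0.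
apply: (le_trans (ler_wpM2r X0 e1)).
rewrite (_ : V0 + _ = (V0 + t * E) + C * t * d); last by rewrite -nd; ring.
rewrite mulrDr lerD2l /d mulrA mulrA ler_pdivrMr//.
rewrite (_ : C * t * t = C * t ^+ 2); last by rewrite expr2 mulrA.
by rewrite [leRHS]mulrC -ler_pdivrMr//; lra.
Qed.

End Gronwall.

Section Scaling.
Variable R : realType.
Local Notation leb := (@lebesgue_measure R).

(* [sc_c N] is the speed-up of time and [sc_a1 d/dx + sc_a2 d^2/dx^2] the limit of the adjoint of the
   accelerated lattice generator on the grid of step 1/N; the fields hold all that the proof uses of the two regimes. *)
Record scaling := Scaling {
  sc_c : nat -> R; sc_al : R; sc_be : R; sc_mu : R; sc_a1 : R; sc_a2 : R;
  sc_K : R; sc_Cc : R; sc_CE : R;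
  sc_c0 : forall N, 0 <= sc_c N;
  sc_al0 : 0 <= sc_al; sc_be0 : 0 <= sc_be; sc_mu0 : 0 < sc_mu;
  sc_K0 : 0 <= sc_K; sc_Cc0 : 0 <= sc_Cc; sc_CE0 : 0 <= sc_CE;
  sc_wt : forall N, (0 < N)%N -> forall x,
    Lop (sc_c N) sc_be sc_al N%:R^-1 (@wt R) x <= sc_K * wt x;
  sc_expN : forall N, (0 < N)%N -> forall x,
    Lop (sc_c N) sc_al sc_be N%:R^-1 (fun x => expR (- x)) x <= sc_CE * expR (- x);
  sc_exp : forall N, (0 < N)%N -> forall x,
    Lop (sc_c N) sc_al sc_be N%:R^-1 (@expR R) x <= sc_CE * expR x;
  sc_cons : forall (f f1 f2 f3 : R -> R) B,
    (forall x : R, is_derive x (1:R) f (f1 x)) -> (forall x : R, is_derive x (1:R) f1 (f2 x)) ->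
    (forall x : R, is_derive x (1:R) f2 (f3 x)) ->
    (forall x, [/\ `|f1 x| <= B, `|f2 x| <= B & `|f3 x| <= B]) ->
    forall N, (0 < N)%N -> forall x,
      `|Lop (sc_c N) sc_be sc_al N%:R^-1 f x - (sc_a1 * f1 x + sc_a2 * f2 x)| <= sc_Cc * B / N%:R;
  sc_noise : forall N, (0 < N)%N -> sc_c N <= N%:R ^+ 2 }.

Variable sc : scaling.
Local Notation c := (sc_c sc).
Local Notation al := (sc_al sc).
Local Notation be := (sc_be sc).
Local Notation mu := (sc_mu sc).
Local Notation a1 := (sc_a1 sc).
Local Notation a2 := (sc_a2 sc).

Definition LN N := Lop (c N) al be N%:R^-1.
Definition LNt N := Lop (c N) be al N%:R^-1.

Lemma Lop_S_dual (k u : R -> R) cc b1 b2 (hh y : R) eps M : 0 < eps -> mollifier M eps k -> bm u ->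
  Lop cc b1 b2 hh (S k u) y = itg (fun z => u z * Lop cc b2 b1 hh (fun z => k (z - y)) z).
Proof.
move=> e0 km bu; have d a := dom_Sint e0 km a bu.
rewrite /Lop /S -itg_comb//; congr itg; apply/funext => z.
have -> : z - (y - hh) = z + hh - y by lra.
have -> : z - (y + hh) = z - hh - y by lra.
by ring.
Qed.

Lemma dom_Lop cc b1 b2 hh f : dom f -> dom (@Lop R cc b1 b2 hh f).
Proof. by move=> df; apply: domZ; apply: domD; apply: domZ; apply: domB => //; exact: dom_shift. Qed.

Definition Lmoll (eps : R) (z : R) : R :=
  a1 * (moll eps)^`()%classic z + a2 * (moll eps)^`()^`()%classic z.

(** The limit operator applied to [S (moll eps) u], with the derivatives placed on the kernel
    because [u] is merely measurable. *)
Definition LSm (eps : R) (u : R -> R) (y : R) : R := itg (fun z => u z * Lmoll eps (z - y)).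

Lemma Lmoll_dom eps : 0 < eps -> dom (Lmoll eps).
Proof.
move=> e0; have en0 : eps^-1 != 0 by rewrite invr_neq0// gt_eqF.
by apply: domD; apply: domZ; rewrite /moll !derive1_mkt; exact: dom_mkt.
Qed.

Lemma Lop_LSm eps : 0 < eps <= 1 -> exists2 C, 0 <= C & forall N, (0 < N)%N ->
  forall u B y, mf u -> (forall x, `|u x| <= B) ->
  `|LN N (S (moll eps) u) y - LSm eps u y| <= B * (C / N%:R).
Proof.
move=> /andP[e0 e1]; have en0 : eps^-1 != 0 by rewrite invr_neq0// gt_eqF.
have [M M0 HM] := moll_mollifier R; have km := HM _ e0.
set b := bump_mass eps; set D := @Dbsum R; set b0 := bump0 R.
have [B1 [B10 HB1]] := mkt_bounded (b^-1 * eps^-1) eps^-1 0 (D b0).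
have [B2 [B20 HB2]] := mkt_bounded (b^-1 * eps^-1 * eps^-1) eps^-1 0 (D (D b0)).
have [B3 [B30 HB3]] := mkt_bounded (b^-1 * eps^-1 * eps^-1 * eps^-1) eps^-1 0 (D (D (D b0))).
pose BB := B1 + B2 + B3.
have BB0 : 0 <= BB by rewrite /BB !addr_ge0.
exists (sc_Cc sc * BB * 5 * wtot R).
  by rewrite !mulr_ge0 ?wtot_ge0// sc_Cc0.
move=> N N0 u B y mf_u uB; have bu : bm u by split=> //; exists B.
have B0 : 0 <= B := le_trans (normr_ge0 _) (uB 0).
have N1 : N%:R^-1 <= 1 :> R by rewrite invf_le1 ?ler1n ?ltr0n.
have NV0 : 0 <= N%:R^-1 :> R by rewrite invr_ge0.
pose F z := LNt N (moll eps) z - Lmoll eps z.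
have Fsmall z : `|F z| <= sc_Cc sc * BB / N%:R.
  rewrite /F /Lmoll /moll !derive1_mkt.
  refine (@sc_cons sc _ _ _ _ BB (fun x => is_derive_mkt b^-1 eps^-1 0 b0 x)
    (fun x => is_derive_mkt _ _ _ _ x) (fun x => is_derive_mkt _ _ _ _ x) _ N N0 z).
  move=> x; split; [apply: (le_trans (HB1 x))|apply: (le_trans (HB2 x))|apply: (le_trans (HB3 x))]; rewrite /BB; lra.
have Fsupp z : 2 <= `|z| -> F z = 0.
  move=> z2; have ne t : eps <= `|t| -> 1 <= `|eps^-1 * t + 0|.
    by move=> et; rewrite addr0 normrM normfV [`|eps|]gtr0_norm// ler_pdivlMl// mulr1.
  have z0 : eps <= `|z| by lra.
  have zm : eps <= `|z - N%:R^-1|.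
    by have := ler_normD (z - N%:R^-1) N%:R^-1; rewrite subrK (ger0_norm NV0); lra.
  have zp : eps <= `|z + N%:R^-1|.
    by have := ler_normB (z + N%:R^-1) N%:R^-1; rewrite addrK (ger0_norm NV0); lra.
  by rewrite /F /LNt /Lop /Lmoll /moll !derive1_mkt !mkt_supp ?ne//; ring.
(* Since [eps] and [1/N] are at most 1, [F] lives on [|z| < 2], where [1 <= 5 wt z]. *)
have Fwt z : `|F z| <= sc_Cc sc * BB * 5 / N%:R * wt z.
  have A0 : 0 <= sc_Cc sc * BB / N%:R by rewrite divr_ge0// mulr_ge0// sc_Cc0.
  have [z2|z2] := lerP 2 `|z|.
    by rewrite Fsupp// normr0 mulr_ge0 ?wt_ge0// divr_ge0// !mulr_ge0// sc_Cc0.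
  apply: (le_trans (Fsmall z)).
  rewrite (_ : _ * 5 / _ * _ = sc_Cc sc * BB / N%:R * (5 * wt z)); last by ring.
  rewrite ler_peMr// -(ler_pM2r (wt_den_gt0 z)) mul1r -mulrA wtE mulr1.
  have : `|z| ^+ 2 <= 2 ^+ 2 by rewrite lerXn2r ?nnegrE// ltW.
  by rewrite real_normK ?num_real//; lra.
have dk := dom_moll e0 km 0.
have dmoll : dom (moll eps) by apply: dom_mkt.
have dF : dom F.
  apply: domB; last exact: Lmoll_dom.
  exact: dom_Lop.
have dFy := dom_shift (- y) dF.
have -> : LN N (S (moll eps) u) y - LSm eps u y = itg (fun z => u z * F (z - y)).
  rewrite /LN (Lop_S_dual _ _ _ _ _ e0 km bu) /LSm -itgB.
  - congr itg; apply/funext => z; rewrite /F /LNt /Lop -mulrBr.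
    have -> : z - N%:R^-1 - y = z - y - N%:R^-1 by lra.
    by have -> : z + N%:R^-1 - y = z - y + N%:R^-1 by lra.
  - by apply: domM uB _ => //; apply: dom_Lop; exact: dom_moll e0 km y.
  - by apply: domM uB _ => //; exact: dom_shift (Lmoll_dom e0).
apply: (@le_trans _ _ (itg (fun z => B * `|F (z - y)|))).
  apply: normr_itg_le => [||z].
  - exact: domM uB _.
  - by apply: domZ; exact: dom_abs.
  - by rewrite normrM ler_wpM2r.
rewrite itgZ; last exact: dom_abs.
rewrite ler_wpM2l// (itg_shift (- y) (dom_abs dF)).
have := normr_itg_wt (mf_abs dF.1) (C := sc_Cc sc * BB * 5 / N%:R).
rewrite ger0_norm; last exact: itg_ge0.
move=> h; apply: (le_trans (h _)).
  by move=> z; rewrite normr_id.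
by rewrite mulrAC.
Qed.

Variable psi : R -> R.
Hypothesis psi_u : unitdec psi.

Definition vN (N : nat) : R -> R -> R :=
  projT1 (cid (lattice_ode N%:R^-1 (sc_c0 sc N) (sc_al0 sc) (sc_be0 sc) (sc_mu0 sc) psi_u)).

Definition Lam N : R := Blip (c N) al be mu.
Definition BN N := Bop (c N) al be N%:R^-1 mu.

Lemma vN0 N : vN N 0 = psi. Proof. by rewrite /vN; case: cid => v /= []. Qed.

Lemma vN_unitdec N t : 0 <= t -> unitdec (vN N t).
Proof. by rewrite /vN; case: cid => v /= [_ + _ _ _]; apply. Qed.

Lemma vN_EP N t d x : 0 <= t -> 0 <= d ->
  `|vN N (t + d) x - vN N t x - d * BN N (vN N t) x| <= (Lam N * d) ^+ 2.
Proof. by rewrite /vN; case: cid => v /= [_ _ + _ _]; apply. Qed.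

Lemma vN_tail_right N (eta A : R) : (0 < N)%N -> 0 <= eta -> 0 <= A ->
  (forall x, psi x <= eta + A * expR (- x)) -> forall x t, 0 <= t ->
  vN N t x <= eta + expR (sc_CE sc * t) * (A * expR (- x)).
Proof.
move=> N0 e0 A0 H x t t0; rewrite /vN; case: cid => v /= [_ _ _ + _].
by move=> /(_ _ _ _ (sc_CE0 sc) e0 A0 (@sc_expN sc N N0) H); apply.
Qed.

Lemma vN_tail_left N (eta A : R) : (0 < N)%N -> 0 <= eta -> 0 <= A ->
  (forall x, 1 - psi x <= eta + A * expR x) -> forall x t, 0 <= t ->
  1 - vN N t x <= expR ((sc_CE sc + mu) * t) * (eta + A * expR x).
Proof.
move=> N0 e0 A0 H x t t0; rewrite /vN; case: cid => v /= [_ _ _ _].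
by move=> /(_ _ _ _ (sc_CE0 sc) e0 A0 (@sc_exp sc N N0) H); apply.
Qed.

Lemma Lam_gt0 N : 0 < Lam N.
Proof. exact: (Blip_gt0 (sc_c0 sc N) (sc_al0 sc) (sc_be0 sc) (sc_mu0 sc)). Qed.

Lemma BN_bound N u x : unitdec u -> `|BN N u x| <= Lam N.
Proof.
by move=> [_ u01]; apply: (Bop_bound _ (sc_c0 sc N) (sc_al0 sc) (sc_be0 sc) (sc_mu0 sc)).
Qed.

Lemma bm_BN N u : bm u -> bm (BN N u).
Proof.
move=> bu; apply: bmD; first exact: bm_Lop.
by apply: bmZ; apply: bmB => //; exact: bm_sqr.
Qed.

Lemma S_BN N k M eps u y : 0 < eps -> mollifier M eps k -> bm u ->
  S k (BN N u) y = LN N (S k u) y + mu * S k (fun z => u z ^+ 2 - u z) y.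
Proof.
move=> e0 km bu; rewrite /BN /Bop (SD e0 km); last 2 first.
- exact: bm_Lop.
- by apply: bmZ; apply: bmB => //; exact: bm_sqr.
rewrite (S_Lop e0 km)// (SZ e0 km)//; apply: bmB => //; exact: bm_sqr.
Qed.

Lemma LN_SB N k M eps u v y : 0 < eps -> mollifier M eps k -> bm u -> bm v ->
  LN N (S k (fun z => u z - v z)) y = LN N (S k u) y - LN N (S k v) y.
Proof. by move=> e0 km bu bv; rewrite /LN /Lop !(SB e0 km _ bu bv); ring. Qed.

(** The reaction terms differ by [(u - v) (u + v - 1)], which is the form required by [energy]. The
    last bracket is the consistency error between two meshes; it vanishes for [N = M], the case of
    the particle system. *)
Lemma S_BN_diff N M k Mm eps u v y : 0 < eps -> mollifier Mm eps k -> bm u -> bm v ->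
  S k (BN N u) y - S k (BN M v) y =
  (LN N (S k (fun z => u z - v z)) y + mu * S k (fun z => (u z - v z) * (u z + v z - 1)) y) +
  (LN N (S k v) y - LN M (S k v) y).
Proof.
move=> e0 km bu bv; have bu2 := bmB (bm_sqr bu) bu; have bv2 := bmB (bm_sqr bv) bv.
rewrite !(S_BN _ _ e0 km)// (LN_SB N y e0 km bu bv).
have -> : S k (fun z => (u z - v z) * (u z + v z - 1)) y =
    S k (fun z => u z ^+ 2 - u z) y - S k (fun z => v z ^+ 2 - v z) y.
  by rewrite -(SB e0 km y bu2 bv2); congr S; apply/funext => z; ring.
by ring.
Qed.

Lemma vN_lip N t d x : 0 <= t -> 0 <= d -> d <= 1 ->
  `|vN N (t + d) x - vN N t x| <= (Lam N + Lam N ^+ 2) * d.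
Proof.
move=> t0 d0 d1; have h1 := vN_EP N x t0 d0; have h2 := BN_bound N x (vN_unitdec N t0).
have := ler_normD (vN N (t + d) x - vN N t x - d * BN N (vN N t) x) (d * BN N (vN N t) x).
rewrite subrK normrM [`|d|]ger0_norm// => h3.
have h4 : d * `|BN N (vN N t) x| <= d * Lam N by rewrite ler_wpM2l.
have h5 : (Lam N * d) ^+ 2 <= Lam N ^+ 2 * d.
  by rewrite exprMn ler_wpM2l ?sqr_ge0// expr2 ler_piMl.
lra.
Qed.

(** Gronwall for the energy of [vN N - vN M]. The factor 16 is 4 from [energy] (with both bounds
    equal to 1) times 4 from the oscillation of two monotone profiles; [Ce] carries the consistency
    error between the meshes. *)
Lemma cauchy_step eps : 0 < eps <= 1 -> exists2 Ce, 0 <= Ce & forall N M, (0 < N)%N -> (0 < M)%N ->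
  forall t, 0 <= t ->
  itg (fun y => wt y * S (moll eps) (fun z => vN N t z - vN M t z) y ^+ 2) <=
  expR ((sc_K sc + 2 * mu) * t) * (t * (16 * mu * eps * wtot R + Ce * (N%:R^-1 + M%:R^-1))).
Proof.
move=> e01; have [C C0 HC] := Lop_LSm e01; have /andP[e0 e1] := e01.
have [Mm M0 HM] := moll_mollifier R; move: (HM _ e0) HC; move: (moll eps) => k km HC.
have W0 := wtot_ge0 R.
exists (2 * C * wtot R); first by rewrite mulr_ge0// mulr_ge0.
move=> N M N0 M0' t t0.
pose V s := itg (fun y => wt y * S k (fun z => vN N s z - vN M s z) y ^+ 2).
have NV : 0 <= N%:R^-1 :> R by rewrite invr_ge0. have MV : 0 <= M%:R^-1 :> R by rewrite invr_ge0.
pose G := Lam N + Lam M; pose rho := Lam N ^+ 2 + Lam M ^+ 2.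
have G0 : 0 <= G by rewrite addr_ge0// ltW// Lam_gt0.
have rho0 : 0 <= rho by rewrite addr_ge0// sqr_ge0.
have mu0 := sc_mu0 sc.
have := @discrete_gronwall R V (sc_K sc + 2 * mu) (16 * mu * eps * wtot R + 2 * C * wtot R * (N%:R^-1 + M%:R^-1))
   ((2 * rho + 2 * (G ^+ 2 + rho ^+ 2)) * wtot R) 0 t t.
rewrite add0r; apply => //.
- by rewrite addr_ge0 ?sc_K0// mulr_ge0// ltW.
- by rewrite addr_ge0// !mulr_ge0 ?addr_ge0// ltW.
- by rewrite mulr_ge0// addr_ge0 ?mulr_ge0 ?addr_ge0 ?sqr_ge0.
- rewrite /V !vN0 (_ : (fun y => _) = fun y => 0 * wt y); first by rewrite itgZ ?mul0r//; exact: dom_wt.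
  apply/funext => y; rewrite (_ : (fun z => _) = fun=> 0); first by rewrite (Scst e0 km) expr0n/= mulr0 mul0r.
  by apply/funext => z; rewrite subrr.
- move=> s d s0 /andP[d0 d1] _.
  have uN := vN_unitdec N s0; have uM := vN_unitdec M s0.
  have sd0 : 0 <= s + d by rewrite addr_ge0.
  have bN := unitdec_bm uN; have bM := unitdec_bm uM.
  have bN' := unitdec_bm (vN_unitdec N sd0); have bM' := unitdec_bm (vN_unitdec M sd0).
  pose D z := vN N s z - vN M s z; pose R0 z := vN N s z + vN M s z - 1.
  have bD : bm D by exact: bmB.
  have bD' : bm (fun z => vN N (s + d) z - vN M (s + d) z) by exact: bmB.
  have bR : bm R0 by apply: bmB; [exact: bmD|exact: bm_cst].
  have D1 x : `|D x| <= 1.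
    by have /andP[? ?] := uN.2 x; have /andP[? ?] := uM.2 x; rewrite ler_norml; apply/andP; split; rewrite /D; lra.
  have R1 x : `|R0 x| <= 1.
    by have /andP[? ?] := uN.2 x; have /andP[? ?] := uM.2 x; rewrite ler_norml; apply/andP; split; rewrite /R0; lra.
  (* [g] is the time derivative of the mollified difference and [r] the remainder of its expansion
     over the step; they are bounded by [G] and [rho d^2]. *)
  pose g y := S k (BN N (vN N s)) y - S k (BN M (vN M s)) y.
  pose r y := S k (fun z => vN N (s + d) z - vN M (s + d) z) y - S k D y - d * g y.
  have bBN := bm_BN N bN; have bBM := bm_BN M bM.
  have bBB := bmB bBN bBM.
  have rE y : r y = S k (fun z => (vN N (s + d) z - vN M (s + d) z - D z) - d * (BN N (vN N s) z - BN M (vN M s) z)) y.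
    rewrite (SB e0 km); [|exact: bmB|exact: bmZ].
    by rewrite (SB e0 km y bD' bD) (SZ e0 km d y bBB) (SB e0 km y bBN bBM).
  have rb y : `|r y| <= rho * d ^+ 2.
    rewrite rE; apply: (normr_S_le e0 km) => [|z _]; first by apply: bmB; [exact: bmB|exact: bmZ].
    have h1 := vN_EP N z s0 d0; have h2 := vN_EP M z s0 d0.
    rewrite (_ : _ - _ = (vN N (s + d) z - vN N s z - d * BN N (vN N s) z) -
       (vN M (s + d) z - vN M s z - d * BN M (vN M s) z)); last by rewrite /D; ring.
    by rewrite (le_trans (ler_normB _ _))// /rho mulrDl -!exprMn lerD.
  have gb y : `|g y| <= G.
    rewrite /g -(SB e0 km)//; apply: (normr_S_le e0 km) => // z _.
    by rewrite (le_trans (ler_normB _ _))// lerD//; exact: BN_bound.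
  have eb y : `|S k D y| <= 1 by exact: (normr_S_le e0 km).
  have be_ := bm_S e0 km bD; have bsq := bm_sqr be_.
  have bg : bm g by apply: bmB; exact: (bm_S e0 km).
  have bsq' := bm_sqr (bm_S e0 km bD').
  have bLs : bm (fun y => LN N (S k D) y + mu * S k (fun z => D z * R0 z) y).
    by apply: bmD; [exact: bm_Lop|apply: bmZ; apply: (bm_S e0 km); exact: bmM].
  have bmain : bm (fun y => 2 * S k D y * (LN N (S k D) y + mu * S k (fun z => D z * R0 z) y)).
    by apply: bmM => //; exact: bmZ.
  pose Q := 2 * (C * (N%:R^-1 + M%:R^-1)).
  apply: (@le_trans _ _ (itg (fun y => wt y * (S k D y ^+ 2 +
     (d * (2 * S k D y * (LN N (S k D) y + mu * S k (fun z => D z * R0 z) y)) +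
      (d * Q + (2 * rho + 2 * (G ^+ 2 + rho ^+ 2)) * d ^+ 2)))))).
    apply: le_itg_wtM => [//||y].
      by apply: bmD => //; apply: bmD; [exact: bmZ|exact: bm_cst].
    have hg : g y = (LN N (S k D) y + mu * S k (fun z => D z * R0 z) y) +
        (LN N (S k (vN M s)) y - LN M (S k (vN M s)) y).
      exact: (S_BN_diff N M y e0 km bN bM).
    have hc : `|LN N (S k (vN M s)) y - LN M (S k (vN M s)) y| <= C * (N%:R^-1 + M%:R^-1).
      have v1 x : `|vN M s x| <= 1 by have /andP[? ?] := uM.2 x; rewrite ger0_norm.
      have h1 := HC N N0 _ _ y (bm_mf bM) v1; have h2 := HC M M0' _ _ y (bm_mf bM) v1.
      have := ler_normB (LN N (S k (vN M s)) y - LSm eps (vN M s) y) (LN M (S k (vN M s)) y - LSm eps (vN M s) y).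
      rewrite (_ : _ - _ - (_ - _) = LN N (S k (vN M s)) y - LN M (S k (vN M s)) y); last by ring.
      rewrite !mul1r in h1 h2; lra.
    have he : S k (fun z => vN N (s + d) z - vN M (s + d) z) y = S k D y + (d * g y + r y).
      by rewrite /r; ring.
    rewrite he; have hr := rb y; have hgb := gb y; have heb := eb y.
    move: hg hc; set L := LN N (S k D) y + _; set X := LN N (S k (vN M s)) y - _ => hg hc.
    set a := S k D y in heb *; set gg := g y in hg hgb *; set rr := r y in hr *.
    have p1 : 2 * a * (d * X) <= d * Q.
      rewrite (_ : 2 * a * (d * X) = d * (2 * (a * X))); last by ring.
      rewrite ler_wpM2l// /Q ler_wpM2l// (le_trans (ler_norm _))// normrM.
      by rewrite -[leRHS]mul1r ler_pM.
    have p2 : 2 * a * rr <= 2 * rho * d ^+ 2.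
      rewrite -!mulrA ler_wpM2l// (le_trans (ler_norm _))// normrM.
      by rewrite -[leRHS]mul1r ler_pM.
    have dd : d ^+ 2 <= 1 by rewrite expr2 mulr_ile1.
    have d20 : 0 <= d ^+ 2 by exact: sqr_ge0.
    have p3 : (d * gg) ^+ 2 <= G ^+ 2 * d ^+ 2.
      rewrite exprMn mulrC ler_wpM2r// -[leLHS]real_normK ?num_real//.
      by rewrite lerXn2r ?nnegrE.
    have p4 : rr ^+ 2 <= rho ^+ 2 * d ^+ 2.
      rewrite -[leLHS]real_normK ?num_real//.
      apply: (@le_trans _ _ ((rho * d ^+ 2) ^+ 2)).
        by rewrite lerXn2r ?nnegrE// mulr_ge0.
      rewrite exprMn ler_wpM2l ?sqr_ge0// [X in X <= _]expr2 ler_piMl//.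
    have p5 : (d * gg + rr) ^+ 2 <= 2 * ((d * gg) ^+ 2 + rr ^+ 2).
      by rewrite -subr_ge0 (_ : _ - _ = (d * gg - rr) ^+ 2) ?sqr_ge0//; ring.
    rewrite (_ : (a + _) ^+ 2 = a ^+ 2 + (2 * a * (d * gg) + 2 * a * rr + (d * gg + rr) ^+ 2)); last by ring.
    have p6 : 2 * a * (d * gg) = d * (2 * a * L) + 2 * a * (d * X) by rewrite hg; ring.
    rewrite lerD2l; lra.
  rewrite itg_wtMD//; last by apply: bmD; [exact: bmZ|exact: bm_cst].
  rewrite itg_wtMD; [|exact: bmZ|exact: bm_cst].
  rewrite itg_wtMZ//.
  have := @energy R Mm eps k e0 km (c N) al be N%:R^-1 (sc_K sc) mu 1 1 D R0
     (sc_c0 sc N) (sc_al0 sc) (sc_be0 sc) (ltW mu0) ler01 ler01 (@sc_wt sc N N0) bD D1 bR R1.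
  have osc := itg_wt_osc e0 km uN uM.
  rewrite -/(LN N) => en.
  rewrite (_ : itg (fun x => wt x * (d * Q + _)) = (d * Q + (2 * rho + 2 * (G ^+ 2 + rho ^+ 2)) * d ^+ 2) * wtot R); last first.
    rewrite -itgZ; last exact: dom_wt.
    by congr itg; apply/funext => y; rewrite mulrC.
  rewrite -/(V s).
  have en2 : itg (fun y => wt y * (2 * S k D y * (LN N (S k D) y + mu * S k (fun z => D z * R0 z) y))) <=
     (sc_K sc + 2 * mu) * V s + 16 * mu * eps * wtot R.
    apply: (le_trans en); rewrite !mulr1; rewrite -/(V s) lerD2l.
    have := ler_wpM2l (ltW mu0) osc; rewrite -/D; lra.
  have en3 := ler_wpM2l d0 en2.
  rewrite /Q; lra.
- by rewrite t0 lexx.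
Qed.

(** The order of choices matters: [eta] for the passage from L^2 to L^1, then [eps] against the
    oscillation, whose contribution is divided by [eta], and finally [N0], as the consistency
    constant depends on [eps]. *)
Lemma cauchy_L1 T e : 0 < T -> 0 < e -> exists N0 : nat, forall N M, (N0 <= N)%N -> (N0 <= M)%N ->
  (0 < N)%N /\ forall t, 0 <= t <= T -> itg (fun y => wt y * `|vN N t y - vN M t y|) <= e.
Proof.
move=> T0 e0; have W0 := wtot_ge0 R; have mu0 := sc_mu0 sc.
pose W := wtot R + 1; have W1 : 0 < W by rewrite /W ltr_wpDl.
pose eta := e / (4 * W); have eta0 : 0 < eta by rewrite divr_gt0// mulr_gt0.
pose EE := expR ((sc_K sc + 2 * mu) * T) * T.
have EE0 : 0 < EE by rewrite mulr_gt0// expR_gt0.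
pose A := EE * (16 * mu * W) / eta + 4 * W + e.
have A1 : 0 < EE * (16 * mu * W) / eta by apply: divr_gt0 => //; do 3! (apply: mulr_gt0 => //).
have A0 : 0 < A by rewrite /A !addr_gt0// mulr_gt0.
pose eps := e / (4 * (A + e)).
have Ae0 : 0 < 4 * (A + e) by apply: mulr_gt0 => //; exact: addr_gt0.
have eps0 : 0 < eps by exact: divr_gt0.
have eps1 : eps <= 1 by rewrite ler_pdivrMr// mul1r; lra.
have epsA : eps * A <= e / 4.
  rewrite /eps mulrAC ler_pdivrMr//.
  rewrite (_ : e / 4 * (4 * (A + e)) = e * A + e * e); last by field.
  by rewrite lerDl mulr_ge0// ltW.
have [Ce Ce0 HC] := cauchy_step (introT andP (conj eps0 eps1)).
pose N0 := (Num.truncn (EE * Ce * 2 / eta / (e / 4))).+1.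
exists N0 => N M N0N N0M; have Np : (0 < N)%N by apply: leq_trans N0N.
have Mp : (0 < M)%N by apply: leq_trans N0M.
split=> // t /andP[t0 tT].
have [Mm M0 HM] := moll_mollifier R; have km := HM _ eps0.
have uN := vN_unitdec N t0; have uM := vN_unitdec M t0.
have bD := bmB (unitdec_bm uN) (unitdec_bm uM).
apply: (le_trans (itg_wt_abs_le_sqr eps0 km bD eta0)).
have h1 := itg_wt_osc eps0 km uN uM.
have h2 := HC N M Np Mp t t0.
have NN : N%:R^-1 + M%:R^-1 <= 2 / N0%:R :> R.
  have NV : N%:R^-1 <= N0%:R^-1 :> R by rewrite lef_pV2 ?posrE ?ltr0n// ler_nat.
  have MV : M%:R^-1 <= N0%:R^-1 :> R by rewrite lef_pV2 ?posrE ?ltr0n// ler_nat.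
  by rewrite mulrDl mul1r lerD.
have h3 : itg (fun y => wt y * S (moll eps) (fun z => vN N t z - vN M t z) y ^+ 2) <=
   EE * (16 * mu * eps * W + Ce * (2 / N0%:R)).
  apply: (le_trans h2); rewrite mulrA.
  have hX : 0 <= 16 * mu * eps * wtot R + Ce * (N%:R^-1 + M%:R^-1).
    by rewrite addr_ge0 ?mulr_ge0 ?addr_ge0 ?invr_ge0// ltW.
  apply: ler_pM => //.
  - by rewrite mulr_ge0// expR_ge0.
  - by rewrite /EE ler_pM ?expR_ge0// ler_expR ler_wpM2l// addr_ge0 ?sc_K0// mulr_ge0// ltW.
  - apply: lerD; last by rewrite ler_wpM2l.
    by rewrite ler_wpM2l /W ?lerDl// mulr_ge0 ?(ltW eps0)// mulr_ge0 ?(ltW mu0).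
have h4 : EE * Ce * (2 / N0%:R) / eta <= e / 4.
  have e4 : 0 < e / 4 by rewrite divr_gt0.
  have n0 : 0 <= EE * Ce * 2 / eta / (e / 4).
    by apply: divr_ge0 (ltW e4); apply: divr_ge0 (ltW eta0); rewrite mulr_ge0// mulr_ge0// ltW.
  have /andP[_] := truncn_itv n0; rewrite -/N0 ltr_pdivrMr// => hn.
  rewrite (_ : _ / eta = EE * Ce * 2 / eta / N0%:R); last by ring.
  by rewrite ler_pdivrMr ?ltr0n// [leRHS]mulrC ltW.
have h5 : eta * wtot R <= e / 4.
  by rewrite /eta mulrAC ler_pdivrMr ?mulr_gt0// (_ : e / 4 * (4 * W) = e * W); [rewrite ler_wpM2l ?ltW// /W; lra|field].
have h6 : itg (fun y => wt y * S (moll eps) (fun z => vN N t z - vN M t z) y ^+ 2) / eta <=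
   eps * (EE * (16 * mu * W) / eta) + e / 4.
  apply: (le_trans (ler_wpM2r _ h3)); first by rewrite invr_ge0 ltW.
  rewrite (_ : _ / eta = eps * (EE * (16 * mu * W) / eta) + EE * Ce * (2 / N0%:R) / eta); last by ring.
  by rewrite lerD2l.
have h7 : eps * (EE * (16 * mu * W) / eta) + 4 * eps * W <= e / 4.
  apply: le_trans epsA; rewrite /A.
  rewrite (_ : eps * (_ + _ + e) = eps * (EE * (16 * mu * W) / eta) + 4 * eps * W + eps * e); last by ring.
  by rewrite lerDl mulr_ge0// ltW.
have h8 : 4 * eps * wtot R <= 4 * eps * W by rewrite ler_wpM2l /W ?lerDl// mulr_ge0// ltW.
lra.
Qed.

End Scaling.
Global Opaque vN.

(** * The limit profile *)

Section LimitTools.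
Variable R : realType.
Local Notation leb := (@lebesgue_measure R).

Lemma ler_dist4 (a b c d f : R) : `|a - f| <= (`|a - b| + `|b - c|) + (`|d - c| + `|d - f|).
Proof.
rewrite (_ : a - f = (a - b) + (b - c) - (d - c) + (d - f)); last by ring.
rewrite [leRHS]addrA (le_trans (ler_normD _ _))// lerD2r (le_trans (ler_normB _ _))// lerD2r.
exact: ler_normD.
Qed.

Lemma bounded01 (w : R^nat) : (forall m, 0 <= w m <= 1) -> bounded_fun (w : (R^o)^nat).
Proof.
move=> w01; exists 1; split; first exact: num_real.
move=> M M1 m _ /=; have /andP[a b] := w01 m; rewrite ger0_norm//; exact: (le_trans b (ltW M1)).
Qed.

Lemma limn_sup_ge (w : R^nat) k (a : R) : (forall m, 0 <= w m <= 1) ->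
  (forall m, (k <= m)%N -> a <= w m) -> a <= limn_sup (w : (R^o)^nat).
Proof.
move=> w01 aw; rewrite (limn_supE (bounded01 w01)); apply: lb_le_inf.
  by exists (sups (w : (R^o)^nat) 0%N); exists 0%N.
move=> _ [n _ <-]; apply: (@le_trans _ _ (w (maxn n k))); first by apply: aw; exact: leq_maxr.
rewrite /sups; apply: ub_le_sup.
  by exists 1 => _ [m _ <-]; have /andP[] := w01 m.
by exists (maxn n k) => //=; exact: leq_maxl.
Qed.

Lemma limn_sup_le (w : R^nat) k (b : R) : (forall m, 0 <= w m <= 1) ->
  (forall m, (k <= m)%N -> w m <= b) -> limn_sup (w : (R^o)^nat) <= b.
Proof.
move=> w01 wb; rewrite (limn_supE (bounded01 w01)).
apply: (@le_trans _ _ (sups (w : (R^o)^nat) k)).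
  apply: ge_inf; last by exists k.
  exists 0 => _ [n _ <-]; apply: (@le_trans _ _ (w n)); first by have /andP[] := w01 n.
  apply: ub_le_sup; last by exists n => //=.
  by exists 1 => _ [m _ <-]; have /andP[] := w01 m.
apply: ge_sup; first by exists (w k); exists k => //=.
by move=> _ [m /= km <-]; exact: wb.
Qed.

Lemma le_limn_sup01 (w w' : R^nat) : (forall m, 0 <= w m <= 1) -> (forall m, 0 <= w' m <= 1) ->
  (forall m, w m <= w' m) -> limn_sup (w : (R^o)^nat) <= limn_sup (w' : (R^o)^nat).
Proof.
move=> w01 w01' ww'; rewrite (limn_supE (bounded01 w01')); apply: lb_le_inf.
  by exists (sups (w' : (R^o)^nat) 0%N); exists 0%N.
move=> _ [n _ <-]; apply: (@limn_sup_le _ n) => // m nm; apply: (le_trans (ww' m)).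
apply: ub_le_sup; last by exists m.
by exists 1 => _ [i _ <-]; have /andP[] := w01' i.
Qed.

Lemma dist_limn_sup_le (w : R^nat) k (a s : R) : (forall m, 0 <= w m <= 1) ->
  (forall m, (k <= m)%N -> `|w m - a| <= s) -> `|limn_sup (w : (R^o)^nat) - a| <= s.
Proof.
move=> w01 H; rewrite ler_norml; apply/andP; split.
  rewrite lerBrDr; apply: (limn_sup_ge (k := k) w01) => m km.
  by have := H m km; rewrite ler_norml => /andP[? _]; lra.
rewrite lerBlDr; apply: (limn_sup_le (k := k) w01) => m km.
by have := H m km; rewrite ler_norml => /andP[_ ?]; lra.
Qed.

Lemma itgE_le (f : R -> R) (C : R) : dom f -> (forall x, 0 <= f x) ->
  (\int[leb]_x (f x)%:E <= C%:E)%E -> itg f <= C.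
Proof.
move=> df f0 h; rewrite -lee_fin /itg fineK//.
by apply: integrable_fin_num => //; exact: dom_integrable df.
Qed.

Lemma EFin_itg (f : R -> R) : dom f -> (\int[leb]_x (f x)%:E = (itg f)%:E)%E.
Proof.
move=> df; rewrite /itg fineK//.
by apply: integrable_fin_num => //; exact: dom_integrable df.
Qed.

(** The Riesz-Fischer argument with the upper limit as candidate. An upper limit has a value
    everywhere, preserves order and is measurable, so no exceptional null set has to be carried
    along. *)
Lemma fast_L1_limit (w : nat -> R -> R) (e : R^nat) (E : R) k :
  (forall m, mf (w m)) -> (forall m x, 0 <= w m x <= 1) ->
  (forall m, itg (fun x => wt x * `|w m.+1 x - w m x|) <= e m) ->
  (forall n, \sum_(0 <= j < n) e (k + j)%N <= E) ->
  itg (fun x => wt x * `|limn_sup ((fun m => w m x) : (R^o)^nat) - w k x|) <= E.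
Proof.
move=> mw w01 we eE.
have bw m : bm (w m) by split=> //; exists 1 => x; have /andP[a b] := w01 m x; rewrite ger0_norm.
pose ls x := limn_sup ((fun m => w m x) : (R^o)^nat).
have ls01 x : 0 <= ls x <= 1.
  apply/andP; split; first by apply: (@limn_sup_ge _ 0%N) => // m _; have /andP[] := w01 m x.
  by apply: (@limn_sup_le _ 0%N) => // m _; have /andP[] := w01 m x.
have bls : bm ls.
  split; last by exists 1 => x; have /andP[a b] := ls01 x; rewrite ger0_norm.
  apply: measurable_fun_limn_sup => [x _|x _|m]; last exact: mw.
  - by exists 1 => _ [m _ <-]; have /andP[] := w01 m x.
  - by exists 0 => _ [m _ <-]; have /andP[] := w01 m x.
have bd m : bm (fun x => `|w (k + m).+1 x - w (k + m)%N x|) by apply: bm_abs; exact: bmB.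
apply: itgE_le.
- by apply: dom_wtM; apply: bm_abs; exact: bmB.
- by move=> x; rewrite mulr_ge0 ?wt_ge0.
pose F m x := (wt x * `|w (k + m).+1 x - w (k + m)%N x|)%:E.
have F0 m x : (0 <= F m x)%E by rewrite lee_fin mulr_ge0 ?wt_ge0.
have mF m : measurable_fun setT (F m).
  by apply/measurable_EFinP; have [] := dom_wtM (bd m).
apply: (@le_trans _ _ (\int[leb]_x (\sum_(0 <= m <oo) F m x))%E).
  apply: ge0_le_integral => //.
  - by move=> x _; rewrite lee_fin mulr_ge0 ?wt_ge0.
  - by apply/measurable_EFinP; have [] := dom_wtM (bm_abs (bmB bls (bw k))).
  - apply: (emeasurable_fun_cvg (fun n x => (\sum_(0 <= m < n) F m x)%E)) => [n|x _].
      by apply: emeasurable_sum => m; exact: mF.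
    by apply: is_cvg_nneseries => m _ _; exact: F0.
  (* Where the series diverges there is nothing to prove; elsewhere its sum bounds
     [wt x * |w m x - w k x|] for all later [m]. *)
  move=> x _; case E1 : (\sum_(0 <= m <oo) F m x)%E => [s||]; [|by rewrite leey|]; last first.
    have : (0%R <= \sum_(0 <= m <oo) F m x)%E by apply: nneseries_ge0 => m _ _; exact: F0.
    by rewrite E1.
  rewrite lee_fin mulrC -ler_pdivlMr ?wt_gt0//.
  apply: (@dist_limn_sup_le _ k) => // m km; rewrite -(subnKC km); move: (m - k)%N => {km}m.
  rewrite ler_pdivlMr ?wt_gt0// mulrC -lee_fin -E1.
  apply: (le_trans _ (nneseries_lim_ge m (fun j _ _ => F0 j x))).
  elim: m => [|m IH]; first by rewrite addn0 subrr normr0 mulr0 big_nil.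
  rewrite big_nat_recr//= addnS (le_trans _ (leeD2r _ IH))// -EFinD lee_fin -mulrDr.
  rewrite ler_wpM2l ?wt_ge0// [leRHS]addrC.
  by rewrite (_ : w (k + m).+1 x - w k x = (w (k + m).+1 x - w (k + m)%N x) + (w (k + m)%N x - w k x)) ?ler_normD//; lra.
rewrite integral_nneseries//.
apply: lime_le; first by apply: is_cvg_nneseries => m _ _; apply: integral_ge0.
apply: nearW => n; apply: (@le_trans _ _ (\sum_(0 <= j < n) (e (k + j)%N)%:E)%E); last first.
  by rewrite sumEFin lee_fin.
apply: lee_sum => j _; rewrite /F EFin_itg; last exact: dom_wtM.
by rewrite lee_fin.
Qed.

(** Measurability in space and a Lipschitz bound in time give joint measurability: with time frozen
    at the preceding grid point, preimages are countable unions of rectangles. Time is clamped to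
    [0, T] because the estimates concern nonnegative times. *)
Lemma measurable_caratheodory (f : R -> R -> R) (C T : R) : 0 <= C ->
  (forall t, mf (f t)) ->
  (forall t d x, 0 <= t -> 0 <= d -> d <= 1 -> `|f (t + d) x - f t x| <= C * d) ->
  measurable_fun setT (fun p : R * R => f (Num.max 0 (Num.min p.1 T)) p.2).
Proof.
move=> C0 mft lipf; pose cl (t : R) := Num.max 0 (Num.min t T).
have cl0 t : 0 <= cl t by rewrite le_max lexx.
have mcl : mf cl.
  apply: measurable_maxr; first exact: mf_cst.
  rewrite (_ : (fun t => _) = fun t => t + T - Num.max t T).
    by apply: mfB; [apply: mfD; [exact: mf_id|exact: mf_cst]|apply: measurable_maxr; [exact: mf_id|exact: mf_cst]].
  by apply/funext => t; rewrite -(addr_max_min t T) addrC addKr.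
pose idx j (t : R) := Num.truncn (cl t * j.+1%:R).
pose g j (p : R * R) := f ((idx j p.1)%:R / j.+1%:R) p.2.
apply: (@measurable_fun_cvg _ _ _ _ g) => [j|p _].
  move=> _ Y mY; rewrite setTI.
  have -> : g j @^-1` Y = \bigcup_n ([set t | idx j t = n] `*` (f (n%:R / j.+1%:R) @^-1` Y)).
    apply/seteqP; split=> [[t x] gY|[t x] [n _ [/= tn fY]]]; first by exists (idx j t).
    by rewrite /preimage /g/= tn.
  apply: bigcupT_measurable => n; apply: measurableX; last first.
    by rewrite -[X in measurable X]setTI; exact: mft.
  have -> : [set t | idx j t = n] = (fun t => cl t * j.+1%:R) @^-1` `[n%:R, n.+1%:R[%classic.
    apply/seteqP; split=> t /=; rewrite in_itv/=.
      by move=> <-; apply: truncn_itv; rewrite mulr_ge0.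
    exact: truncn_def.
  rewrite -[X in measurable X]setTI.
  have mm : mf (fun t => cl t * j.+1%:R) by apply: mfM => //; exact: mf_cst.
  exact: mm.
rewrite -/(cl p.1); apply/cvgrPdist_le => /= e e0.
near=> j; rewrite /g.
have j0 : 0 < j.+1%:R :> R by rewrite ltr0n.
have h0 : 0 <= cl p.1 * j.+1%:R by rewrite mulr_ge0.
have := truncn_itv h0; rewrite -/(idx j p.1) => /andP[h1 h2].
set a := (idx j p.1)%:R / j.+1%:R.
have a0 : 0 <= a by rewrite divr_ge0.
have a1 : a <= cl p.1 by rewrite /a ler_pdivrMr.
have a2 : cl p.1 - a <= j.+1%:R^-1.
  rewrite lerBlDr /a -[X in _ <= X + _]mul1r -mulrDl ler_pdivlMr// addrC natr1; exact: ltW.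
have j1 : j.+1%:R^-1 <= 1 :> R by rewrite invf_le1// ler1n.
have := lipf a (cl p.1 - a) p.2 a0; rewrite (_ : a + (cl p.1 - a) = cl p.1); last by lra.
have d0 : 0 <= cl p.1 - a by rewrite subr_ge0.
move=> /(_ d0 (le_trans a2 j1))/le_trans; apply.
apply: (@le_trans _ _ (C * j.+1%:R^-1)); first by rewrite ler_wpM2l.
near: j; have : (fun j => C * harmonic j) @ \oo --> C * 0 by apply: cvgMr; exact: cvg_harmonic.
rewrite mulr0 => /cvgrPdist_le /(_ e e0); apply: filterS => j /=.
by rewrite sub0r normrN; apply: le_trans; exact: ler_norm.
Unshelve. all: by end_near. Qed.

End LimitTools.
Section LimitProfile.
Variable R : realType.
Variables (sc : scaling R) (psi : R -> R) (T : R).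
Hypotheses (psi_u : unitdec psi) (T0 : 0 < T).
Local Notation vN N := (vN sc psi_u N).
Local Notation mu := (sc_mu sc).

Lemma tail_expN (eta : R) : inH psi -> 0 < eta ->
  exists2 A, 0 <= A & forall x, psi x <= eta + A * expR (- x).
Proof.
move=> [pdec [_ [p01 [_ pinf]]]] eta0.
have [M [Mr HM]] : \forall x \near +oo, psi x < eta by exact: (cvgr_lt _ pinf _ eta0).
exists (expR (M + 1)); first exact: expR_ge0.
move=> x; have [Mx|xM] := ltrP M x.
  by rewrite (le_trans (ltW (HM _ Mx)))// lerDl mulr_ge0 ?expR_ge0.
have /andP[_ p1] := p01 x; apply: (le_trans p1).
rewrite -expRD (@le_trans _ _ (expR (M + 1 - x)))//; last by rewrite lerDr ltW.
by rewrite -[leLHS]expR0 ler_expR; lra.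
Qed.

Lemma tail_exp (eta : R) : inH psi -> 0 < eta ->
  exists2 A, 0 <= A & forall x, 1 - psi x <= eta + A * expR x.
Proof.
move=> [pdec [_ [p01 [pinf _]]]] eta0.
have [M [Mr HM]] : \forall x \near -oo, 1 - eta < psi x.
  by apply: (cvgr_gt _ pinf); rewrite ltrBlDr ltrDl.
exists (expR (1 - M)); first exact: expR_ge0.
move=> x; have [Mx|xM] := ltrP x M.
  have := HM _ Mx; have := mulr_ge0 (expR_ge0 (1 - M)) (expR_ge0 x); lra.
have /andP[p0 _] := p01 x; rewrite -expRD.
have : 1 <= expR (1 - M + x) by rewrite -[leLHS]expR0 ler_expR; lra.
lra.
Qed.

Let cl (t : R) := Num.max 0 (Num.min t T).

Lemma cl_id t : 0 <= t <= T -> cl t = t.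
Proof. by move=> /andP[t0 tT]; rewrite /cl min_l// max_r. Qed.

Lemma cl_itv t : 0 <= cl t <= T.
Proof. by rewrite /cl le_max lexx/= ge_max (ltW T0)/= ge_min lexx orbT. Qed.

(** The profile is built pointwise for every [t], not as a class modulo null sets, because
    membership in H is required at every time: a fast subsequence, its upper limit, then the
    right-continuous version, which has weighted L^1 distance 0 from the latter. *)
Lemma limit_profile : exists u : R -> R -> R,
  [/\ measurable_fun setT (fun p : R * R => u p.1 p.2),
      forall t, unitdec (u t),
      forall t x, u t y @[y --> x^'+] --> u t x,
      forall e, 0 < e -> exists N0 : nat, forall N, (N0 <= N)%N -> (0 < N)%N /\
        forall t, 0 <= t <= T -> itg (fun y => wt y * `|vN N t y - u t y|) <= e
    & inH psi -> forall t, inH (u t)].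
Proof.
have CP k := cauchy_L1 sc psi_u T0 (exprn_gt0 k (ltac:(lra) : 0 < 2^-1 :> R)).
pose N0 k := projT1 (cid (CP k)).
have N0P k : forall N M, (N0 k <= N)%N -> (N0 k <= M)%N ->
  (0 < N)%N /\ forall t, 0 <= t <= T -> itg (fun y => wt y * `|vN N t y - vN M t y|) <= 2^-1 ^+ k.
  exact: projT2 (cid (CP k)).
(* A maximum over all earlier ranks, so that the subsequence is nondecreasing and [nk k.+1] still
   satisfies the bound of rank [k]. *)
pose nk k := (\max_(i < k.+1) N0 i)%N.
have nkN k : (N0 k <= nk k)%N by exact: (@leq_bigmax_cond _ xpredT (fun i : 'I_k.+1 => N0 i) ord_max).
have nkS k : (nk k <= nk k.+1)%N by rewrite /nk [X in (_ <= X)%N]big_ord_recr/= leq_maxl.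
have cl0 t : 0 <= cl t by have /andP[] := cl_itv t.
pose w t k x := vN (nk k) (cl t) x.
have uw t k : unitdec (w t k) by exact: vN_unitdec.
have bw t k := unitdec_bm (uw t k).
have w01 t m x : 0 <= w t m x <= 1 by exact: (uw t m).2.
pose u0 t x := limn_sup ((fun m => w t m x) : (R^o)^nat).
have u01 t x : 0 <= u0 t x <= 1.
  apply/andP; split.
    by apply: (@limn_sup_ge _ _ 0%N) => // m _; have /andP[] := w01 t m x.
  by apply: (@limn_sup_le _ _ 0%N) => // m _; have /andP[] := w01 t m x.
have u0dec t x y : x <= y -> u0 t y <= u0 t x.
  by move=> xy; apply: le_limn_sup01 => // m; exact: (uw t m).1.
have uu0 t : unitdec (u0 t) by split; [exact: u0dec|exact: u01].
have wlim t k : itg (fun x => wt x * `|u0 t x - w t k x|) <= 2 * 2^-1 ^+ k.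
  apply: (@fast_L1_limit R (w t) (fun k => 2^-1 ^+ k)) => //.
  - by move=> m; exact: bm_mf.
  - move=> m; have [_] := N0P m (nk m.+1) (nk m) (leq_trans (nkN m) (nkS m)) (nkN m).
    by apply; exact: cl_itv.
  - move=> n; under eq_bigr do rewrite exprD.
    rewrite -mulr_sumr mulrC ler_wpM2r ?exprn_ge0//.
    suff -> : \sum_(0 <= j < n) (2^-1 : R) ^+ j = 2 - 2 * 2^-1 ^+ n.
      by rewrite lerBlDr lerDl mulr_ge0// exprn_ge0.
    elim: n => [|n IH]; first by rewrite big_nil expr0; lra.
    by rewrite big_nat_recr//= IH exprS; lra.
(* As [u0 t] is nonincreasing, its values at [x + 1/(m+1)] increase with [m]; the upper limit taken
   next is their supremum, the right-continuous version. *)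
pose us t m x := u0 t (x + m.+1%:R^-1).
have us_mono t x m n : (m <= n)%N -> us t m x <= us t n x.
  move=> mn; apply: u0dec; rewrite lerD2l lef_pV2 ?posrE ?ltr0n//.
  by rewrite ler_nat.
have us01 t m x : 0 <= us t m x <= 1 by exact: u01.
pose u t x := limn_sup ((fun m => us t m x) : (R^o)^nat).
have us_le t m x : us t m x <= u t x.
  by apply: (@limn_sup_ge _ _ m) => // n mn; exact: us_mono.
have u_le t x : u t x <= u0 t x.
  by apply: (@limn_sup_le _ _ 0%N) => // n _; apply: u0dec; rewrite lerDl.
have ul01 t x : 0 <= u t x <= 1.
  apply/andP; split; first by have /andP[h _] := us01 t 0%N x; exact: le_trans h (us_le t 0%N x).
  by have /andP[_ h] := u01 t x; exact: le_trans (u_le t x) h.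
have udec t x y : x <= y -> u t y <= u t x.
  by move=> xy; apply: le_limn_sup01 => // m; apply: u0dec; rewrite lerD2r.
have uu t : unitdec (u t) by split; [exact: udec|exact: ul01].
(* [u0 - u] is squeezed between 0 and a difference of two translates of [u0], whose weighted
   integral is proportional to the translation. *)
have uu0_0 t : itg (fun x => wt x * `|u0 t x - u t x|) = 0.
  apply/eqP; rewrite eq_le itg_wtM_ge0 ?andbT; last by move=> x.
  apply/ler_addgt0Pr => e e0; rewrite add0r.
  pose m := Num.truncn (2 * wtot R / e).
  have W0 := wtot_ge0 R.
  have h0 : 0 <= 2 * wtot R / e by rewrite divr_ge0 ?mulr_ge0// ltW.
  have /andP[_ mb] := truncn_itv h0.
  have d0 : 0 < m.+1%:R^-1 :> R by rewrite invr_gt0 ltr0n.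
  apply: (@le_trans _ _ (2 * m.+1%:R^-1 * wtot R)); last first.
    rewrite ltr_pdivrMr// in mb.
    rewrite (_ : 2 * m.+1%:R^-1 * wtot R = 2 * wtot R / m.+1%:R); last by ring.
    by rewrite ler_pdivrMr ?ltr0n// [leRHS]mulrC ltW.
  apply: le_trans (itg_wt_shift_diff d0 (uu0 t).1 (uu0 t).2).
  have bu0 := unitdec_bm (uu0 t); have bu := unitdec_bm (uu t).
  apply: le_itg_wtM => [||x].
  - by apply: bm_abs; exact: bmB.
  - by apply: bmB; exact: bm_shift.
  - rewrite ger0_norm ?subr_ge0//.
    have h1 := us_le t m x; rewrite /us in h1.
    have h2 : u0 t x <= u0 t (x - m.+1%:R^-1) by apply: u0dec; rewrite gerBl ltW.
    lra.
have rcont t x : u t y @[y --> x^'+] --> u t x.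
  apply/cvgrPdist_le => /= e e0.
  have [m hm] : exists m, u t x - e <= us t m x.
    apply: contrapT => /forallNP H.
    have : u t x <= u t x - e.
      apply: (@limn_sup_le _ _ 0%N) => // m _; have := H m.
      by move=> /negP; rewrite -ltNge => /ltW.
    by rewrite lerBrDl gerDr leNgt e0.
  near=> y.
  have xy : x < y by near: y; exact: nbhs_right_gt.
  have h1 : u t y <= u t x by apply: udec; exact: ltW.
  rewrite ger0_norm ?subr_ge0// lerBlDr -lerBlDl; apply: (le_trans hm).
  have ym : y < x + m.+1%:R^-1.
    near: y; apply: nbhs_right_lt; by rewrite ltrDl invr_gt0 ltr0n.
  pose d := x + m.+1%:R^-1 - y; have d0 : 0 < d by rewrite subr_gt0.
  pose n := Num.truncn d^-1.
  have hn : n.+1%:R^-1 < d.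
    rewrite -[ltRHS]invrK ltf_pV2 ?posrE ?ltr0n ?invr_gt0//.
    have dV0 : 0 <= d^-1 by rewrite invr_ge0 ltW.
    by have /andP[] := truncn_itv dV0.
  apply: le_trans (us_le t n y); apply: u0dec; rewrite -lerBrDl; exact: ltW hn.
exists u; split.
- apply: measurable_fun_limn_sup => [p _|p _|m].
  + by exists 1 => _ [m _ <-]; have /andP[] := us01 p.1 m p.2.
  + by exists 0 => _ [m _ <-]; have /andP[] := us01 p.1 m p.2.
  rewrite /us; have mu0 : measurable_fun setT (fun p : R * R => u0 p.1 p.2).
    apply: measurable_fun_limn_sup => [p _|p _|k].
    + by exists 1 => _ [k _ <-]; have /andP[] := w01 p.1 k p.2.
    + by exists 0 => _ [k _ <-]; have /andP[] := w01 p.1 k p.2.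
    pose f t x := vN (nk k) (Num.max 0 t) x.
    have -> : (fun p : R * R => w p.1 k p.2) = (fun p => f (Num.max 0 (Num.min p.1 T)) p.2).
      by apply/funext => p; rewrite /w /f maxA maxxx.
    apply: (@measurable_caratheodory _ f (Lam sc (nk k) + Lam sc (nk k) ^+ 2)).
    + by rewrite addr_ge0 ?sqr_ge0// ltW// Lam_gt0.
    + by move=> t; apply: bm_mf; apply: unitdec_bm; apply: vN_unitdec; rewrite le_max lexx.
    + move=> t d x t0 d0 d1; rewrite /f !max_r//; last exact: addr_ge0.
      exact: vN_lip.
  pose sh (p : R * R) : R * R := (p.1, p.2 + m.+1%:R^-1).
  have msh : measurable_fun setT sh.
    apply: measurable_fun_pair; first exact: measurable_fst.
    by apply: measurable_realfun.measurable_funD; [exact: measurable_snd|exact: measurable_cst].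
  exact: (measurableT_comp mu0 msh).
- exact: uu.
- exact: rcont.
- move=> e e0; have e2 : 0 < e by [].
  have [N1 HN1] := cauchy_L1 sc psi_u T0 e0.
  exists (maxn N1 1) => N; rewrite geq_max => /andP[N1N N0N]; split=> // t tT.
  apply/ler_addgt0Pr => e' e'0.
  have [k hk] : exists k, 3 * 2^-1 ^+ k <= e'.
    have c3 : (fun k => 3 * (2^-1 : R) ^+ k) @ \oo --> (3 * 0 : R).
      by apply: cvgMr; apply: cvg_expr; rewrite ger0_norm//; lra.
    rewrite mulr0 in c3; have [k _ Hk] := cvgr_le _ c3 _ e'0.
    by exists k; apply: Hk => /=.
  pose M := maxn N1 (nk k).
  have [_ HM1] := HN1 N M N1N (leq_maxl _ _).
  have [_ HM2] := N0P k M (nk k) (leq_trans (nkN k) (leq_maxr _ _)) (nkN k).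
  have h1 := HM1 t tT; have h2 := HM2 t tT; have h3 := wlim t k; have h4 := uu0_0 t.
  have /andP[t0 _] := tT; rewrite /w (cl_id tT) in h3.
  have bN := unitdec_bm (vN_unitdec sc psi_u N t0); have bM := unitdec_bm (vN_unitdec sc psi_u M t0).
  have bk := unitdec_bm (vN_unitdec sc psi_u (nk k) t0).
  have b0 := unitdec_bm (uu0 t); have bu := unitdec_bm (uu t).
  have d1 := bm_abs (bmB bN bM); have d2 := bm_abs (bmB bM bk); have d3 := bm_abs (bmB b0 bk).
  have d4 := bm_abs (bmB b0 bu).
  apply: (@le_trans _ _ (itg (fun y => wt y * ((`|vN N t y - vN M t y| + `|vN M t y - vN (nk k) t y|)
     + (`|u0 t y - vN (nk k) t y| + `|u0 t y - u t y|))))).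
    apply: le_itg_wtM => [||y]; [by apply: bm_abs; exact: bmB|by apply: bmD; exact: bmD|].
    exact: ler_dist4.
  rewrite itg_wtMD; [|exact: bmD|exact: bmD].
  rewrite (itg_wtMD d1 d2) (itg_wtMD d3 d4) h4.
  apply: (le_trans (lerD (lerD h1 h2) (lerD h3 (lexx 0)))).
  by rewrite addr0 -addrA lerD2l -[X in X + _]mul1r -mulrDl (_ : 1 + 2 = 3 :> R)//; ring.
- move=> Hpsi t; have CE0 := sc_CE0 sc; have mu0 := sc_mu0 sc.
  have nk0 k : (0 < nk k)%N by have [] := N0P k (nk k) (nk k) (nkN k) (nkN k).
  split; first exact: udec.
  split; first exact: rcont.
  split; first exact: ul01.
  have clT : cl t <= T by have /andP[] := cl_itv t.
  split.
  + apply/cvgrPdist_le => /= e e0; pose K := expR ((sc_CE sc + mu) * T).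
    have K0 : 0 < K by exact: expR_gt0.
    have eta0 : 0 < e / (2 * K) by rewrite divr_gt0// mulr_gt0.
    have [A A0 HA] := tail_exp Hpsi eta0.
    exists (- (K * A / (e / 2))); split; first exact: num_real.
    move=> x xM; rewrite ger0_norm; last by have /andP[] := ul01 t x; rewrite subr_ge0.
    (* The term of rank 0 bounds [u] below by [u0] at [x + 1]; hence the shifted exponent. *)
    have h1 : 1 - u t x <= K * (e / (2 * K) + A * expR (x + 1)).
      have := us_le t 0%N x; rewrite /us invr1 => h.
      suff : 1 - u0 t (x + 1) <= K * (e / (2 * K) + A * expR (x + 1)) by lra.
      rewrite lerBlDr -lerBlDl; apply: (@limn_sup_ge _ _ 0%N) => // m _.
      rewrite lerBlDl -lerBlDr.
      apply: (le_trans (vN_tail_left sc psi_u (nk0 m) (ltW eta0) A0 HA (x + 1) (cl0 t))).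
      have h5 : 0 <= e / (2 * K) + A * expR (x + 1).
        by rewrite addr_ge0 ?(ltW eta0)// mulr_ge0 ?expR_ge0.
      rewrite ler_wpM2r// /K ler_expR.
      by rewrite ler_wpM2l ?addr_ge0// ltW.
    have e20 : 0 < e / 2 by rewrite divr_gt0.
    have h2 : K * A * expR (x + 1) <= e / 2.
      have h3 : - x <= expR (- (x + 1)) by apply: le_trans (expR_ge1Dx _); lra.
      rewrite -[x + 1]opprK expRN ler_pdivrMr ?expR_gt0//.
      have h4 : K * A / (e / 2) <= - x by lra.
      by rewrite ler_pdivrMr// in h4; rewrite (le_trans h4)// mulrC ler_wpM2l// ltW.
    have h3 : K * (e / (2 * K)) = e / 2 by field; rewrite gt_eqF.
    rewrite mulrDr h3 mulrA in h1; lra.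
  + apply/cvgrPdist_le => /= e e0; pose K := expR (sc_CE sc * T).
    have K0 : 0 < K by exact: expR_gt0.
    have e20 : 0 < e / 2 by rewrite divr_gt0.
    have [A A0 HA] := tail_expN Hpsi e20.
    exists (K * A / (e / 2)); split; first exact: num_real.
    move=> x xM; rewrite sub0r normrN ger0_norm; last by have /andP[] := ul01 t x.
    have h1 : u t x <= e / 2 + K * (A * expR (- x)).
      apply: (le_trans (u_le t x)); apply: (@limn_sup_le _ _ 0%N) => // m _.
      apply: (le_trans (vN_tail_right sc psi_u (nk0 m) (ltW e20) A0 HA x (cl0 t))).
      rewrite lerD2l ler_wpM2r ?mulr_ge0 ?expR_ge0// /K ler_expR ler_wpM2l//.
    have h2 : K * A * expR (- x) <= e / 2.
      have h3 : x <= expR x by apply: le_trans (expR_ge1Dx _); lra.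
      rewrite expRN ler_pdivrMr ?expR_gt0//.
      have h4 : K * A / (e / 2) <= x by exact: ltW.
      rewrite ler_pdivrMr// in h4; rewrite (le_trans h4)//.
      by rewrite mulrC ler_wpM2l// ltW.
    rewrite mulrA in h1; lra.
Unshelve. all: by end_near. Qed.

End LimitProfile.

(** * The limit profile is a weak solution *)

Section IntegralTools.
Variable R : realType.
Local Notation leb := (@lebesgue_measure R).
Local Notation RR := (measurableTypeR R).

Definition mf2 (F : R -> R -> R) := measurable_fun setT (fun p : R * R => F p.1 p.2).

Lemma mf2_l F t : mf2 F -> mf (F t).
Proof.
move=> mF; have h : measurable_fun setT (fun x : R => (t, x)) by apply: measurable_fun_pair.
exact: (measurableT_comp mF h).
Qed.

Lemma mf2_r F x : mf2 F -> mf (fun t => F t x).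
Proof.
move=> mF; have h : measurable_fun setT (fun t : R => (t, x)) by apply: measurable_fun_pair.
exact: (measurableT_comp mF h).
Qed.

Lemma mf2_swap F : mf2 F -> mf2 (fun x t => F t x).
Proof.
move=> mF; have h : measurable_fun setT (fun p : R * R => (p.2, p.1)) by apply: measurable_fun_pair.
exact: (measurableT_comp mF h).
Qed.

Lemma mf2_fst f : mf f -> mf2 (fun t x => f t).
Proof. by move=> mff; apply: (measurableT_comp mff); exact: measurable_fst. Qed.

Lemma mf2_snd f : mf f -> mf2 (fun t x => f x).
Proof. by move=> mff; apply: (measurableT_comp mff); exact: measurable_snd. Qed.

Lemma mf2M F G : mf2 F -> mf2 G -> mf2 (fun t x => F t x * G t x).
Proof. exact: measurable_realfun.measurable_funM. Qed.

Lemma mf2D F G : mf2 F -> mf2 G -> mf2 (fun t x => F t x + G t x).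
Proof. exact: measurable_realfun.measurable_funD. Qed.

Lemma mf2B F G : mf2 F -> mf2 G -> mf2 (fun t x => F t x - G t x).
Proof. exact: measurable_realfun.measurable_funB. Qed.

Lemma mf2Z c F : mf2 F -> mf2 (fun t x => c * F t x).
Proof. by move=> mF; apply: mf2M => //; apply: mf2_fst; exact: mf_cst. Qed.

Lemma mf2_abs F : mf2 F -> mf2 (fun t x => `|F t x|).
Proof. by move=> mF; apply: (measurableT_comp (mf_continuous (@norm_continuous _ _)) mF). Qed.

Lemma itg2_mf F : mf2 F -> mf (fun t => itg (F t)).
Proof. exact: measurable_itg. Qed.

Lemma mf2_itg3 (G : R -> R -> R -> R) :
  measurable_fun setT (fun p : (R * R) * R => G p.1.1 p.1.2 p.2) ->
  mf2 (fun t y => itg (G t y)).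
Proof.
move=> mG; exact: (@measurable_itg R _ _ (fun p : R * R => G p.1 p.2)).
Qed.

Definition dom2 F := mf2 F /\ exists C, forall t x, `|F t x| <= C * (wt t * wt x).

Lemma dom2_l F t : dom2 F -> dom (F t).
Proof.
move=> [mF [C FC]]; split; first exact: mf2_l.
by exists (C * wt t) => x; rewrite -mulrA.
Qed.

Lemma dom2_itg F : dom2 F -> dom (fun t => itg (F t)).
Proof.
move=> [mF [C FC]]; split; first exact: itg2_mf.
exists (C * wtot R) => t; rewrite mulrAC; apply: normr_itg_wt; first exact: mf2_l.
by move=> x; rewrite -mulrA.
Qed.

Lemma dom2_swap F : dom2 F -> dom2 (fun x t => F t x).
Proof.
move=> [mF [C FC]]; split; first exact: mf2_swap.
by exists C => x t; rewrite [wt x * _]mulrC.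
Qed.

Lemma mf2E F : mf2 F -> measurable_fun setT (fun p : RR * RR => (F p.1 p.2)%:E).
Proof. by move=> mF; exact/measurable_EFinP. Qed.

Lemma dom2_integrable F : dom2 F ->
  (leb \x leb)%E.-integrable setT (fun p : RR * RR => (F p.1 p.2)%:E).
Proof.
move=> dF; have [mF [C FC]] := dF; apply/integrable12ltyP; first exact: mf2E.
have dA : dom2 (fun t x => `|F t x|).
  by split; [exact: mf2_abs|exists C => t x; rewrite normr_id].
under eq_integral => t _ do rewrite /= (EFin_itg (dom2_l t dA)).
by rewrite (EFin_itg (dom2_itg dA)) ltry.
Qed.

Lemma itg_fubini F : dom2 F -> itg (fun t => itg (F t)) = itg (fun x => itg (fun t => F t x)).
Proof.
move=> dF; have dFs := dom2_swap dF.
apply: EFin_inj; rewrite -(EFin_itg (dom2_itg dF)) -(EFin_itg (dom2_itg dFs)).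
have := Fubini (dom2_integrable dF).
under eq_integral => t _ do rewrite /= (EFin_itg (dom2_l t dF)).
by under [in RHS]eq_integral => x _ do rewrite /= (EFin_itg (dom2_l x dFs)).
Qed.

Lemma ae0_itg f : mf f -> {ae leb, forall x, f x = 0} -> itg f = 0.
Proof.
move=> mff f0; rewrite /itg (ae_eq_integral (cst 0%E))//.
- by rewrite integral_cst// mul0e.
- by apply/measurable_EFinP.
- by apply: (@filterS _ _ (ae_filter_ringOfSetsType leb) _ _ _ f0) => x fx _; rewrite /= fx.
Qed.

Lemma itg2_negligible F : dom2 F -> itg (fun t => itg (fun x => `|F t x|)) = 0 ->
  (leb \x leb)%E.-negligible [set p : R * R | F p.1 p.2 != 0].
Proof.
move=> dF h; have [mF [C FC]] := dF.
have dA : dom2 (fun t x => `|F t x|).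
  by split; [exact: mf2_abs|exists C => t x; rewrite normr_id].
have me := mf2E mF.
have /(ae_eq_integral_abs (leb \x leb)%E measurableT me) :
    (\int[(leb \x leb)]_(p in setT) `|(F p.1 p.2)%:E| = 0)%E.
  rewrite fubini_tonelli1//; last exact: measurableT_comp.
  under eq_integral => t _ do rewrite /fubini_F /= (EFin_itg (dom2_l t dA)).
  by rewrite (EFin_itg (dom2_itg dA)) h.
apply: negligibleS => p /= Fp H; move/eqP: Fp; apply.
by have [] := H I.
Qed.

Lemma itg_dominated (f : nat -> R -> R) (C : R) : (forall n, mf (f n)) ->
  (forall n x, `|f n x| <= C * wt x) ->
  {ae leb, forall x, f n x @[n --> \oo] --> (0 : R)} ->
  itg (f n) @[n --> \oo] --> (0 : R).
Proof.
move=> mfn fC f0.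
have dfn n : dom (f n) by split=> //; exists C.
have [] := @dominated_convergence _ _ R leb setT measurableT (fun n => EFin \o f n) (cst 0%E)
  (EFin \o (fun x => C * wt x)).
- by move=> n; apply/measurable_EFinP; exact: mfn.
- exact: measurable_cst.
- apply: (@filterS _ _ (ae_filter_ringOfSetsType leb) _ _ _ f0) => x fx _; apply: cvg_EFin => //=; exact: nearW.
- by apply: dom_integrable; apply: domZ; exact: dom_wt.
- by apply: aeW => x n _; rewrite /= lee_fin.
move=> _ _ H.
have {}H : (\int[leb]_x (f n x)%:E)%E @[n --> \oo] --> (0 : R)%:E.
  by move: H; rewrite integral_cst// mul0e.
by move: H => /fine_cvgP[].
Qed.

Definition ind (a b : R) : R -> R := \1_(`[a, b]%classic).

Lemma mf_ind a b : mf (ind a b).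
Proof. by apply: measurable_indic; exact: measurable_itv. Qed.

Lemma indE (a b t : R) : ind a b t = (a <= t <= b)%R%:R.
Proof. by rewrite /ind indicE mem_setE in_itv. Qed.

Lemma ind_ge0 a b t : 0 <= ind a b t. Proof. by rewrite indE ler0n. Qed.

Lemma ind_le_wt a b t : ind a b t <= (1 + (`|a| + `|b|) ^+ 2) * wt t.
Proof.
rewrite indE; case: (boolP (a <= t <= b)) => [/andP[at_ tb]|_]; last first.
  by rewrite mulr_ge0 ?wt_ge0// addr_ge0 ?sqr_ge0.
rewrite -(ler_pM2r (wt_den_gt0 t)) mul1r -mulrA wtE mulr1 lerD2l -[leLHS]real_normK ?num_real//.
rewrite lerXn2r ?nnegrE ?addr_ge0// ler_norml; apply/andP; split.
  by have := ler_norm (- a); rewrite normrN; have := normr_ge0 b; lra.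
by have := ler_norm b; have := normr_ge0 a; lra.
Qed.

Lemma dom_ind a b : dom (ind a b).
Proof.
split; first exact: mf_ind.
by exists (1 + (`|a| + `|b|) ^+ 2) => t; rewrite ger0_norm ?ind_ge0 ?ind_le_wt.
Qed.

Lemma itg_ind a b : a <= b -> itg (ind a b) = b - a.
Proof.
move=> ab; rewrite /itg /ind integral_indic ?setIT//=.
rewrite lebesgue_measure_itv/= lte_fin; case: ltP => // ba.
have -> : a = b by apply/eqP; rewrite eq_le ab ba.
by rewrite subrr.
Qed.

Lemma dom_indM a b f : bm f -> dom (fun t => ind a b t * f t).
Proof. by move=> [mff [B fB]]; apply: domMr fB (dom_ind a b). Qed.

Lemma itg_itv a b f : (\int[leb]_(t in `[a, b]) (f t)%:E = \int[leb]_t (ind a b t * f t)%:E)%E.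
Proof.
rewrite integral_mkcond; apply: eq_integral => t _.
rewrite restrict_EFin /ind indicE /= patchE; case: ifP => // _.
  by rewrite mul1r.
by rewrite mul0r.
Qed.

Lemma dom2_ind a b F B : mf2 F -> (forall t x, a <= t <= b -> `|F t x| <= B) ->
  dom2 (fun t x => ind a b t * (wt x * F t x)).
Proof.
move=> mF FB; split.
  by apply: mf2M; [apply: mf2_fst; exact: mf_ind|apply: mf2M => //; apply: mf2_snd; exact: mf_wt].
pose A := (1 + (`|a| + `|b|) ^+ 2).
exists (A * `|B|) => t x; have [tab|tab] := boolP (a <= t <= b); last first.
  rewrite indE (negbTE tab) mul0r normr0 mulr_ge0// ?mulr_ge0 ?wt_ge0//.
  by rewrite /A addr_ge0 ?sqr_ge0.
rewrite normrM normrM (ger0_norm (ind_ge0 _ _ _)) (ger0_norm (wt_ge0 _)).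
have h1 := ind_le_wt a b t; have h2 := FB t x tab.
have -> : A * `|B| * (wt t * wt x) = (A * wt t) * (wt x * `|B|) by ring.
apply: ler_pM => //; rewrite ?ind_ge0 ?mulr_ge0 ?wt_ge0//.
by rewrite ler_wpM2l ?wt_ge0// (le_trans h2)// ler_norm.
Qed.

(** The kernel is at most [M / eps] on a ball of length [2 eps], which gives the factor [2 M] in
    front of the average. *)
Lemma oscS_davg (k : R -> R) (M eps : R) (h : R -> R) (y : R) : 0 < eps -> mollifier M eps k -> bm h ->
  ((oscS k h y)%:E <= (2 * M)%:E * davg h y eps)%E.
Proof.
move=> e0 km bh; have [ck k0 ksupp _ kM] := km.
have dI := dom_Sint e0 km y (bm_abs (bmB bh (bm_cst (h y)))).
rewrite /oscS /S -(EFin_itg dI) /davg /iavg.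
have Me := moll_bound_ge0 km.
have mg : measurable_fun (ball y eps) (fun z => `|(center (h y) (h z))%:E|%E).
  apply: measurableT_comp => //; apply/measurable_EFinP.
  by apply: measurable_funTS; apply: mfB => //; [exact: bm_mf bh|exact: mf_cst].
have -> : ((2 * M)%:E * ((leb (ball y eps))^-1 *
     \int[leb]_(z in ball y eps) `|(center (h y) (h z))%:E|) =
     (M / eps)%:E * \int[leb]_(z in ball y eps) `|(center (h y) (h z))%:E|)%E.
  rewrite lebesgue_measure_ball ?ltW// inver ifF; last first.
    by apply/negbTE; rewrite gt_eqF// mulr2n addr_gt0.
  rewrite muleA -EFinM; congr (_%:E * _)%E; rewrite mulr2n.
  by field; rewrite gt_eqF.
rewrite -ge0_integralZl//; last exact: measurable_ball.
rewrite [leRHS]integral_mkcond; apply: ge0_le_integral => //.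
- by move=> z _; rewrite lee_fin mulr_ge0.
- by apply/measurable_EFinP; case: dI.
- apply/(measurable_restrictT _ (measurable_ball _ _)).
  apply: measurable_funeM => //.
move=> z _; rewrite patchE; case: ifPn => [/set_mem|/negP zb].
  rewrite /ball/= => zb; rewrite -EFinM lee_fin mulrC ler_wpM2r//.
rewrite ksupp ?mulr0//; rewrite leNgt; apply/negP => zy; apply: zb; apply: mem_set.
by rewrite /ball/= distrC.
Qed.

(** Almost every point is a Lebesgue point. This replaces the O(eps) bound of monotone profiles for
    solutions that are only bounded and measurable. *)
Lemma oscS_cvg0 (h : R -> R) : bm h -> {ae leb, forall y, oscS (@moll R n.+1%:R^-1) h y @[n --> \oo] --> (0 : R)}.
Proof.
move=> bh; have [mh [B hB]] := bh.
have li : locally_integrable setT h.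
  split=> //; first exact: openT.
  move=> K _ cK; have mK : measurable K by exact: compact_measurable.
  apply: (@le_lt_trans _ _ (\int[leb]_(x in K) (cst B%:E) x)%E).
    apply: ge0_le_integral => //.
    - by apply/measurable_EFinP; apply: measurable_funTS; exact: mf_abs.
    - by move=> x _; rewrite lee_fin.
  by rewrite integral_cst// lte_mul_pinfty// ?lee_fin ?(le_trans (normr_ge0 _) (hB 0))// compact_finite_measure.
have [M M0 HM] := moll_mollifier R.
apply: (@filterS _ _ (ae_filter_ringOfSetsType leb) _ _ _ (lebesgue_differentiation li)) => y ly.
have en n : 0 < n.+1%:R^-1 :> R by rewrite invr_gt0 ltr0n.
have hb n := oscS_davg y (en n) (HM _ (en n)) bh.
have c0 : ((2 * M)%:E * davg h y n.+1%:R^-1)%E @[n --> \oo] --> ((2 * M)%:E * 0)%E.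
  apply: cvgeZl => //; have hr : (n.+1%:R^-1 : R) @[n --> \oo] --> (0 : R)^'+.
    by move=> A nA; have := @cvg_harmonic R _ nA; rewrite /nbhs/= /within/= => H; apply: filterS H => n H; exact: (H (en n)).
  exact: (cvg_comp _ _ hr ly).
rewrite mule0 in c0.
have : (oscS (moll n.+1%:R^-1) h y)%:E @[n --> \oo] --> 0%E.
  apply: (squeeze_cvge _ (cvg_cst 0%E) c0); apply: nearW => n; rewrite hb andbT lee_fin.
  apply: itg_ge0 => z; rewrite mulr_ge0//; have [_ k0 _ _ _] := HM _ (en n); exact: k0.
by move=> /fine_cvgP[].
Qed.

End IntegralTools.

(** * Partial derivatives of test functions *)

Section TestFunctions.
Variable R : realType.
Implicit Types f g : R -> R -> R.

Definition word f (w : seq bool) := foldr (fun b h => if b then pdt h else pdx h) f w.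

Definition box_supp (K : R) f := forall t x, K < `|t| \/ K < `|x| -> f t x = 0.

Lemma near_norm_gt (K t : R) : K < `|t| -> \forall s \near t, K < `|s|.
Proof. by move=> Kt; have /cvgr_gt := @norm_continuous R R t; apply. Qed.

Lemma derive1_near0 (f : R -> R) (x : R) : (\forall y \near x, f y = 0) -> derive1 f x = 0.
Proof.
move=> f0; rewrite derive1E.
have H : is_derive x (1:R) f 0 by apply: is_derive_near f0 _; exact: is_derive_cst.
exact: derive_val.
Qed.

Lemma box_supp_pdt K f : box_supp K f -> box_supp K (pdt f).
Proof.
move=> fK t x h; apply: derive1_near0; case: h => [tK|xK].
  by apply: filterS (near_norm_gt tK) => s sK; apply: fK; left.
by near=> s; apply: fK; right.
Unshelve. all: by end_near. Qed.

Lemma box_supp_pdx K f : box_supp K f -> box_supp K (pdx f).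
Proof.
move=> fK t x h; apply: derive1_near0; case: h => [tK|xK].
  by near=> s; apply: fK; left.
by apply: filterS (near_norm_gt xK) => s sK; apply: fK; right.
Unshelve. all: by end_near. Qed.

Lemma box_supp_word K f w : box_supp K f -> box_supp K (word f w).
Proof.
move=> fK; elim: w => [//|b w IH] /=; case: b; [exact: box_supp_pdt|exact: box_supp_pdx].
Qed.

Lemma box_bound f K : continuous (fun p : R * R => f p.1 p.2) ->
  exists2 C, 0 <= C & forall t x, `|t| <= K -> `|x| <= K -> `|f t x| <= C.
Proof.
move=> cf; have cK : compact (`[- K, K]%classic : set R) by exact: segment_compact.
have cc := compact_setX cK cK.
have /compact_bounded [M [_ HM]] : compact ((fun p : R * R => f p.1 p.2) @` (`[- K, K] `*` `[- K, K])).
  by apply: continuous_compact => //; apply: continuous_subspaceT.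
exists (`|M| + 1); first by rewrite addr_ge0.
move=> t x tK xK; apply: (HM (`|M| + 1)); first by have := ler_norm M; lra.
by exists (t, x) => //=; split; rewrite /= in_itv/= -ler_norml.
Qed.

Lemma box_supp_wt f K C : 0 <= C -> box_supp K f -> (forall t x, `|t| <= K -> `|x| <= K -> `|f t x| <= C) ->
  forall t x, `|f t x| <= C * (1 + K ^+ 2) * wt x.
Proof.
move=> C0 fK fC t x.
have [tK|tK] := ltP K `|t|; first by rewrite fK ?normr0 ?mulr_ge0 ?wt_ge0 ?(ltW (wt_den_gt0 _))//; left.
have [xK|xK] := ltP K `|x|; first by rewrite fK ?normr0 ?mulr_ge0 ?wt_ge0 ?(ltW (wt_den_gt0 _))//; right.
apply: le_trans (fC _ _ tK xK) _; rewrite -mulrA ler_peMr//.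
rewrite mulrC; apply: (@le_trans _ _ (wt x * (1 + x ^+ 2))); first by rewrite wtE.
rewrite ler_wpM2l ?wt_ge0// lerD2l -[leLHS]real_normK ?num_real//.
by rewrite lerXn2r// ?nnegrE// (le_trans _ xK).
Qed.

Lemma testfun_word T f w : testfun T f ->
  exists2 C, 0 <= C & forall t x, `|word f w t x| <= C * wt x.
Proof.
move=> [sf [[K fK] _]]; have [cw _] := sf w.
have [C C0 HC] := box_bound (f := word f w) K cw.
exists (C * (1 + K ^+ 2)); first by rewrite mulr_ge0// (ltW (wt_den_gt0 _)).
exact: box_supp_wt C0 (box_supp_word w fK) HC.
Qed.

Lemma mvt_bound (g : R -> R) (B a b : R) : a <= b -> (forall t, derivable g t 1) ->
  (forall t, `|derive1 g t| <= B) -> `|g b - g a| <= B * (b - a).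
Proof.
move=> ab dg gB; have cg : {within `[a, b], continuous g}.
  by apply: derivable_within_continuous.
have [|c _ ->] := @MVT_segment R g (derive1 g) a b ab _ cg.
  by move=> x _; rewrite derive1E; apply: DeriveDef.
by rewrite normrM (ger0_norm (x := b - a)) ?subr_ge0// ler_wpM2r ?subr_ge0.
Qed.

Lemma taylor2_bound (g : R -> R) (B a b : R) : a <= b -> (forall t, derivable g t 1) ->
  (forall t, derivable (derive1 g) t 1) -> (forall t, `|derive1 (derive1 g) t| <= B) ->
  `|g b - g a - (b - a) * derive1 g a| <= B * (b - a) ^+ 2.
Proof.
move=> ab dg dg1 gB; have cg : {within `[a, b], continuous g}.
  by apply: derivable_within_continuous.
have [|c + ->] := @MVT_segment R g (derive1 g) a b ab _ cg.
  by move=> x _; rewrite derive1E; apply: DeriveDef.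
rewrite in_itv/= => /andP[ac cb].
rewrite mulrC -mulrBr normrM (ger0_norm (x := b - a)) ?subr_ge0// expr2 [leRHS]mulrA mulrC.
rewrite ler_wpM2r ?subr_ge0//; apply: le_trans (mvt_bound ac dg1 gB) _.
by rewrite ler_wpM2l ?(le_trans _ (gB a))// lerD2r.
Qed.

Section Words.
Variables (T : R) (f : R -> R -> R).
Hypothesis tf : testfun T f.

Lemma word_lip w : exists2 C, 0 <= C & forall t d x, 0 <= d ->
  `|word f w (t + d) x - word f w t x| <= C * wt x * d.
Proof.
have [C C0 HC] := testfun_word (true :: w) tf; exists C => // t d x d0.
have [sf _] := tf; have [_ [dt _]] := sf w.
have := @mvt_bound (fun s => word f w s x) (C * wt x) t (t + d).
rewrite lerDl d0 => /(_ isT (fun s => dt s x) (fun s => HC s x)).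
by rewrite addrAC subrr add0r.
Qed.

Lemma word_taylor w : exists2 C, 0 <= C & forall t d x, 0 <= d ->
  `|word f w (t + d) x - word f w t x - d * word f (true :: w) t x| <= C * wt x * d ^+ 2.
Proof.
have [C C0 HC] := testfun_word [:: true, true & w] tf; exists C => // t d x d0.
have [sf _] := tf; have [_ [dt _]] := sf w; have [_ [dt1 _]] := sf (true :: w).
have := @taylor2_bound (fun s => word f w s x) (C * wt x) t (t + d).
rewrite lerDl d0 => /(_ isT (fun s => dt s x) (fun s => dt1 s x) (fun s => HC s x)).
by rewrite [t + d - t]addrAC subrr add0r.
Qed.

Lemma word_mf w t : mf (word f w t).
Proof.
have [sf _] := tf; have [_ [_ dx]] := sf w.
by apply: mf_continuous => x; apply: differentiable_continuous; apply/derivable1_diffP.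
Qed.

Lemma word_dom w t : dom (word f w t).
Proof.
split; first exact: word_mf.
by have [C C0 HC] := testfun_word w tf; exists C => x.
Qed.

Lemma word_mf2 w : mf2 (fun t x => word f w (Num.max 0 (Num.min t T)) x).
Proof.
have [C C0 HC] := word_lip w.
apply: (@measurable_caratheodory R (word f w) C T) => //; first exact: word_mf.
move=> t d x t0 d0 d1; apply: le_trans (HC t d x d0) _.
by rewrite ler_wpM2r// ler_piMr// wt_le1.
Qed.

End Words.
End TestFunctions.

Section StepIntegral.
Variable R : realType.

Lemma itg0 : itg (fun _ : R => 0) = 0.
Proof. by rewrite /itg integral0. Qed.

Lemma itg_ind00 (g : R -> R) a : bm g -> itg (fun s => ind a a s * g s) = 0.
Proof.
move=> bg; have [mg [B gB]] := bg; have dI := dom_ind a a.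
apply/eqP; rewrite -normr_le0; have := normr_itg_le (dom_indM a a bg) (domZ B dI).
rewrite itgZ// itg_ind// subrr mulr0; apply => s.
by rewrite normrM (ger0_norm (ind_ge0 _ _ _)) mulrC ler_wpM2r// ind_ge0.
Qed.

(** The fundamental theorem of calculus in incremental form: the two indicators differ by that of
    the interval from [t] (excluded) to [t + d]. Integrals in time enter the discrete Gronwall lemma
    through it. *)
Lemma itg_ind_step (g : R -> R) (t d D b : R) : bm g -> 0 <= t -> 0 <= d ->
  (forall s, t <= s <= t + d -> `|g s - D| <= b) ->
  `|itg (fun s => ind 0 (t + d) s * g s) - itg (fun s => ind 0 t s * g s) - d * D| <= d * b.
Proof.
move=> bg t0 d0 gb; have td0 : 0 <= t + d by rewrite addr_ge0.
have ebd : itg (fun s => ind 0 (t + d) s - ind 0 t s) = d.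
  by rewrite itgB ?itg_ind//; [ring|exact: dom_ind|exact: dom_ind].
have dI := domB (dom_ind 0 (t + d)) (dom_ind 0 t).
have d1 := dom_indM 0 (t + d) bg; have d2 := dom_indM 0 t bg.
rewrite -{2 3}ebd [itg _ * D]mulrC [itg _ * b]mulrC -!itgZ// -itgB// -itgB//; last 2 first.
- exact: domB.
- exact: domZ.
apply: normr_itg_le; [exact: domB (domB d1 d2) (domZ _ dI)|exact: domZ|].
move=> s; have -> : ind 0 (t + d) s * g s - ind 0 t s * g s - D * (ind 0 (t + d) s - ind 0 t s) =
   (ind 0 (t + d) s - ind 0 t s) * (g s - D) by ring.
rewrite mulrC normrM !indE.
have [s1|s1] := boolP (0 <= s <= t); have [s2|s2] := boolP (0 <= s <= t + d).
- by rewrite subrr normr0 !mulr0.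
- by case/andP: s1 => s3 s4; move: s2; rewrite s3 (le_trans s4)// lerDl.
- rewrite subr0 normr1 !mulr1; apply: gb; case/andP: s2 => s3 ->; rewrite andbT.
  by move: s1; rewrite s3/= -ltNge => /ltW.
- by rewrite subrr normr0 !mulr0.
Qed.

End StepIntegral.

Section WeakAlgebra.
Variable R : comRingType.
Implicit Types a b c p q r v w m d : R.

Lemma comb3_sub a b p q r p' q' r' :
  p' + (a * q' + b * r') - (p + (a * q + b * r)) = (p' - p) + (a * (q' - q) + b * (r' - r)).
Proof. by ring. Qed.

Lemma logistic_sub m v w p q :
  v * p + m * (v ^+ 2 - v) * q - (w * p + m * (w ^+ 2 - w) * q) =
  (v - w) * (p + m * ((v + w - 1) * q)).
Proof. by ring. Qed.

Lemma logistic_subr m v p q p' q' :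
  v * p' + m * (v ^+ 2 - v) * q' - (v * p + m * (v ^+ 2 - v) * q) =
  v * (p' - p) + m * ((v ^+ 2 - v) * (q' - q)).
Proof. by ring. Qed.

Lemma product_increment v v' p p' q b d :
  v' * p' - v * p - d * (p * b + v * q) =
  (v' - v) * (d * q) + v' * (p' - p - d * q) + (v' - v - d * b) * p.
Proof. by ring. Qed.

End WeakAlgebra.

(** * Passage to the limit in the weak formulation *)

Section WeakSolution.
Variable R : realType.
Local Notation leb := (@lebesgue_measure R).
Variables (sc : scaling R) (psi : R -> R) (T : R) (f : R -> R -> R).
Hypotheses (psi_u : unitdec psi) (T0 : 0 < T) (tf : testfun T f).
Local Notation vN N := (vN sc psi_u N).
Local Notation mu := (sc_mu sc).
Local Notation a1 := (sc_a1 sc).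
Local Notation a2 := (sc_a2 sc).

Definition adj (t x : R) : R :=
  pdt f t x + (a1 * pdx f t x + a2 * pdx (pdx f) t x).

Definition flux (v : R -> R) (t : R) : R :=
  itg (fun x => v x * adj t x + mu * (v x ^+ 2 - v x) * f t x).

Lemma dom_adj t : dom (adj t).
Proof.
apply: domD; first exact: (word_dom tf [:: true]).
by apply: domD; apply: domZ; [exact: (word_dom tf [:: false])|exact: (word_dom tf [:: false; false])].
Qed.

Lemma adj_bound : exists2 C, 0 <= C & forall t x, `|adj t x| <= C * wt x.
Proof.
have [C1 C10 H1] := testfun_word [:: true] tf; have [C2 C20 H2] := testfun_word [:: false] tf.
have [C3 C30 H3] := testfun_word [:: false; false] tf.
exists (C1 + (`|a1| * C2 + `|a2| * C3)) => [|t x].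
  by apply: addr_ge0 => //; apply: addr_ge0; apply: mulr_ge0.
have h1 := H1 t x; have h2 := H2 t x; have h3 := H3 t x.
rewrite /adj (le_trans (ler_normD _ _))// mulrDl lerD// (le_trans (ler_normD _ _))// !normrM mulrDl.
by rewrite -!mulrA lerD// ler_wpM2l.
Qed.

Lemma adj_lip : exists2 C, 0 <= C & forall t d x, 0 <= d -> `|adj (t + d) x - adj t x| <= C * wt x * d.
Proof.
have [C1 C10 H1] := word_lip tf [:: true]; have [C2 C20 H2] := word_lip tf [:: false].
have [C3 C30 H3] := word_lip tf [:: false; false].
exists (C1 + (`|a1| * C2 + `|a2| * C3)) => [|t d x d0].
  by apply: addr_ge0 => //; apply: addr_ge0; apply: mulr_ge0.
have h1 := H1 t d x d0; have h2 := H2 t d x d0; have h3 := H3 t d x d0.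
have -> : adj (t + d) x - adj t x = (pdt f (t + d) x - pdt f t x) +
  (a1 * (pdx f (t + d) x - pdx f t x) + a2 * (pdx (pdx f) (t + d) x - pdx (pdx f) t x)).
  exact: comb3_sub.
rewrite (le_trans (ler_normD _ _))// 2!mulrDl lerD// (le_trans (ler_normD _ _))// !normrM 2!mulrDl.
by rewrite -!mulrA !(mulrA C2) !(mulrA C3) lerD// ler_wpM2l.
Qed.

Lemma f_bound : exists2 C, 0 <= C & forall t x, `|f t x| <= C * wt x.
Proof. exact: (testfun_word [::] tf). Qed.

Lemma f_dom t : dom (f t).
Proof. exact: (word_dom tf [::]). Qed.

Lemma unit_logistic (a : R) : 0 <= a <= 1 -> `|a ^+ 2 - a| <= 1.
Proof. by move=> /andP[? ?]; rewrite ler_norml; apply/andP; split; nra. Qed.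

Lemma dom_flux v t : unitdec v -> dom (fun x => v x * adj t x + mu * (v x ^+ 2 - v x) * f t x).
Proof.
move=> uv; have bv := unitdec_bm uv.
have [m1 [B1 h1]] := bv; have [m2 [B2 h2]] := bmZ mu (bmB (bm_sqr bv) bv).
by apply: domD; [exact: (domM m1 h1 (dom_adj t))|exact: (domM m2 h2 (f_dom t))].
Qed.

(** The reaction difference factors as [(v - w) (v + w - 1)] with a second factor bounded by 1, so
    weighted L^1 convergence of the profiles suffices despite the square. *)
Lemma flux_diff : exists2 C, 0 <= C & forall t v w, unitdec v -> unitdec w ->
  `|flux v t - flux w t| <= C * itg (fun x => wt x * `|v x - w x|).
Proof.
have [C1 C10 H1] := adj_bound; have [C2 C20 H2] := f_bound.
have mu0 := sc_mu0 sc.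
exists (C1 + mu * C2) => [|t v w uv uw]; first by rewrite addr_ge0// mulr_ge0// ltW.
have bv := unitdec_bm uv; have bw := unitdec_bm uw.
have dd := dom_wtM (bm_abs (bmB bv bw)).
rewrite /flux -itgB; [|exact: dom_flux|exact: dom_flux].
rewrite -itgZ//; apply: normr_itg_le; [exact: domB (dom_flux _ uv) (dom_flux _ uw)|exact: domZ|move=> x].
rewrite logistic_sub.
have vw1 : `|v x + w x - 1| <= 1.
  have [_ /(_ x)/andP[? ?]] := uv; have [_ /(_ x)/andP[? ?]] := uw.
  by rewrite ler_norml; apply/andP; split; lra.
rewrite normrM mulrC (mulrA _ (wt x)) ler_wpM2r// [leRHS]mulrDl.
apply: le_trans (ler_normD _ _) _; apply: lerD => //.
rewrite !normrM (gtr0_norm mu0) -mulrA ler_wpM2l ?(ltW mu0)//.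
by apply: le_trans (H2 t x); rewrite ler_piMl.
Qed.

Lemma flux_time : exists2 C, 0 <= C & forall t d v, 0 <= d -> unitdec v ->
  `|flux v (t + d) - flux v t| <= C * d.
Proof.
have [C1 C10 H1] := adj_lip; have [C2 C20 H2] := word_lip tf [::].
have mu0 := sc_mu0 sc.
exists ((C1 + mu * C2) * wtot R) => [|t d v d0 uv].
  by rewrite mulr_ge0 ?wtot_ge0// addr_ge0// mulr_ge0// ltW.
rewrite /flux -itgB; [|exact: dom_flux|exact: dom_flux].
rewrite mulrAC; apply: normr_itg_wt; first by case: (domB (dom_flux (t + d) uv) (dom_flux t uv)).
move=> x; rewrite logistic_subr.
have [_ /(_ x) v01] := uv; have v1 := unit_logistic v01; have /andP[v0 v1'] := v01.
have -> : (C1 + mu * C2) * d * wt x = C1 * wt x * d + mu * (C2 * wt x * d) by ring.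
apply: le_trans (ler_normD _ _) _; apply: lerD.
  by rewrite normrM; apply: le_trans (H1 t d x d0); rewrite ler_piMl// ger0_norm.
rewrite !normrM (gtr0_norm mu0) ler_wpM2l ?(ltW mu0)//.
by apply: le_trans (H2 t d x d0); rewrite ler_piMl.
Qed.

Lemma LNt_cons : exists2 C, 0 <= C & forall N, (0 < N)%N -> forall t x,
  `|LNt sc N (f t) x - (a1 * pdx f t x + a2 * pdx (pdx f) t x)| <= C / N%:R * wt x.
Proof.
have [sf [[K fK] _]] := tf.
have [C1 C10 H1] := testfun_word [:: false] tf; have [C2 C20 H2] := testfun_word [:: false; false] tf.
have [C3 C30 H3] := testfun_word [:: false; false; false] tf.
pose B := C1 + C2 + C3; have B0 : 0 <= B by rewrite /B !addr_ge0.
have Hle C x : 0 <= C -> C <= B -> C * wt x <= B.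
  by move=> ? CB; apply: le_trans CB; rewrite ler_piMr ?wt_le1.
exists (sc_Cc sc * B * (1 + (`|K| + 1) ^+ 2)) => [|N N0 t x].
  by rewrite !mulr_ge0 ?sc_Cc0// (ltW (wt_den_gt0 _)).
have N1 : N%:R^-1 <= 1 :> R by rewrite invf_le1 ?ler1n ?ltr0n.
have NV0 : 0 <= N%:R^-1 :> R by rewrite invr_ge0.
pose F t x := LNt sc N (f t) x - (a1 * pdx f t x + a2 * pdx (pdx f) t x).
have Fc s y : `|F s y| <= sc_Cc sc * B / N%:R.
  apply: (@sc_cons _ sc (f s) (pdx f s) (pdx (pdx f) s) (pdx (pdx (pdx f)) s) B _ _ _ _ N N0 y) => z.
  - by have [_ [_ dx]] := sf [::]; rewrite /pdx derive1E; apply: DeriveDef; [exact: (dx s z)|].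
  - by have [_ [_ dx]] := sf [:: false]; rewrite [pdx (pdx f) s z]derive1E; apply: DeriveDef; [exact: (dx s z)|].
  - by have [_ [_ dx]] := sf [:: false; false]; rewrite [pdx (pdx (pdx f)) s z]derive1E; apply: DeriveDef; [exact: (dx s z)|].
  split; [apply: le_trans (H1 s z) (Hle _ _ _ _)|apply: le_trans (H2 s z) (Hle _ _ _ _)|
          apply: le_trans (H3 s z) (Hle _ _ _ _)] => //; rewrite /B; lra.
(* The difference operator enlarges the support by [1/N <= 1]. *)
have FK : box_supp (`|K| + 1) F.
  move=> s y h; have KK := ler_norm K.
  have f0 a : `|a| <= 1 -> f s (y + a) = 0.
    move=> ha; apply: fK; case: h => [h|h]; [left; lra|right].
    by have := ler_normB (y + a) a; rewrite addrK => ?; lra.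
  have k0 w : word f w s y = 0 by apply: (box_supp_word w fK); case: h => h; [left|right]; lra.
  have f00 : f s y = 0 := k0 [::].
  have f1 : f s (y - N%:R^-1) = 0 by apply: f0; rewrite normrN ger0_norm.
  have f2 : f s (y + N%:R^-1) = 0 by apply: f0; rewrite ger0_norm.
  by rewrite /F /LNt /Lop f00 f1 f2 (k0 [:: false] : pdx f s y = 0) (k0 [:: false; false] : pdx (pdx f) s y = 0); ring.
apply: le_trans (box_supp_wt _ FK (fun s y _ _ => Fc s y) t x) _.
  by rewrite !mulr_ge0 ?sc_Cc0.
by rewrite le_eqVlt; apply/orP; left; apply/eqP; ring.
Qed.

Lemma BN_dual N v t : unitdec v -> itg (fun x => f t x * BN sc N v x) =
  itg (fun x => v x * LNt sc N (f t) x + mu * (v x ^+ 2 - v x) * f t x).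
Proof.
move=> uv; have bv := unitdec_bm uv; have df := f_dom t.
have [m1 [B1 h1]] := bm_Lop (sc_c sc N) (sc_al sc) (sc_be sc) N%:R^-1 bv.
have [m0 [B0 h0]] := bv; have [m2 [B2 h2]] := bmZ mu (bmB (bm_sqr bv) bv).
have d2 := domM m2 h2 df.
have dl := domM m0 h0 (dom_Lop (sc_c sc N) (sc_be sc) (sc_al sc) N%:R^-1 df).
rewrite (itgD dl d2).
have -> : itg (fun x => v x * LNt sc N (f t) x) = itg (fun x => f t x * Lop (sc_c sc N) (sc_al sc) (sc_be sc) N%:R^-1 v x).
  by rewrite itg_Lop_dual//; congr itg; apply/funext => x; rewrite mulrC.
rewrite -itgD//; last exact: domMr h1 df.
by congr itg; apply/funext => x; rewrite /BN /Bop; ring.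
Qed.

(** [C1] is uniform in [N], whereas [C2] involves the Lipschitz constants of [vN N] in time, which
    grow with [N]. This order of quantifiers is enough: [N] is fixed before the time step tends to
    0. *)
Lemma flux_step : exists2 C1, 0 <= C1 & forall N, (0 < N)%N -> exists2 C2, 0 <= C2 &
  forall t d, 0 <= t -> 0 <= d -> d <= 1 ->
  `|itg (fun x => vN N (t + d) x * f (t + d) x) - itg (fun x => vN N t x * f t x) - d * flux (vN N t) t|
    <= d * (C1 / N%:R) + C2 * d ^+ 2.
Proof.
have [Cc Cc0 Hc] := LNt_cons; have [Cf Cf0 Hf] := f_bound.
have [Cl Cl0 Hl] := testfun_word [:: true] tf.
have [Ct Ct0 Ht] := word_taylor tf [::].
exists (Cc * wtot R) => [|N N0]; first by rewrite mulr_ge0// wtot_ge0.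
have L0 := Lam_gt0 sc N; set L := Lam sc N in L0.
pose A := (L + L ^+ 2) * Cl + Ct + L ^+ 2 * Cf.
have A0 : 0 <= A.
  have LL : 0 <= L + L ^+ 2 by rewrite addr_ge0 ?sqr_ge0// ltW.
  by rewrite /A !addr_ge0// mulr_ge0// sqr_ge0.
exists (A * wtot R) => [|t d t0 d0 d1]; first by rewrite mulr_ge0// wtot_ge0.
have td0 : 0 <= t + d by rewrite addr_ge0.
have uv := vN_unitdec sc psi_u N t0; have uv' := vN_unitdec sc psi_u N td0.
have ep x := vN_EP sc psi_u N x t0 d0; have lip x := vN_lip sc psi_u N x t0 d0 d1.
move: ep lip; rewrite -/L; set v := vN N t in uv *; set v' := vN N (t + d) in uv' * => ep lip.
have bv := unitdec_bm uv; have bv' := unitdec_bm uv'.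
have [m1 [B1 h1]] := bv; have [m2 [B2 h2]] := bv'; have [m3 [B3 h3]] := bm_BN sc N bv.
have dv := domM m1 h1 (f_dom t); have dv' := domM m2 h2 (f_dom (t + d)).
have dB := domMr m3 h3 (f_dom t).
have dvt := domM m1 h1 (word_dom tf [:: true] t).
have dL := domM m1 h1 (dom_Lop (sc_c sc N) (sc_be sc) (sc_al sc) N%:R^-1 (f_dom t)).
have dA := domM m1 h1 (domD (domZ a1 (word_dom tf [:: false] t)) (domZ a2 (word_dom tf [:: false; false] t))).
have [m4 [B4 h4]] := bmZ mu (bmB (bm_sqr bv) bv).
have dq := domM m4 h4 (f_dom t).
pose e1 x := v' x * f (t + d) x - v x * f t x - d * (f t x * BN sc N v x + v x * pdt f t x).
pose e2 x := v x * LNt sc N (f t) x - v x * (a1 * pdx f t x + a2 * pdx (pdx f) t x).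
have -> : itg (fun x => v' x * f (t + d) x) - itg (fun x => v x * f t x) - d * flux v t =
    itg e1 + d * itg e2.
  rewrite /e1 itgB; [|exact: domB|by apply: domZ; exact: domD].
  rewrite itgB// itgZ; last exact: domD.
  rewrite itgD// BN_dual// itgD// /e2 itgB// /flux.
  have -> : itg (fun x => v x * adj t x + mu * (v x ^+ 2 - v x) * f t x) =
    itg (fun x => (v x * pdt f t x + v x * (a1 * pdx f t x + a2 * pdx (pdx f) t x)) + mu * (v x ^+ 2 - v x) * f t x).
    by congr itg; apply/funext => x; rewrite /adj; ring.
  rewrite itgD//; last exact: domD.
  by rewrite itgD//; ring.
rewrite addrC (le_trans (ler_normD _ _))// lerD//.
  rewrite normrM (ger0_norm d0) ler_wpM2l// mulrAC; apply: normr_itg_wt => [|x].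
    by case: (domB dL dA).
  rewrite /e2 -mulrBr normrM; apply: le_trans (Hc N N0 t x); rewrite ler_piMl//.
  by have [_ /(_ x)/andP[? ?]] := uv; rewrite ger0_norm.
rewrite mulrAC; apply: normr_itg_wt => [|x].
  by case: (domB (domB dv' dv) (domZ d (domD dB dvt))).
have -> : e1 x = (v' x - v x) * (d * pdt f t x) + v' x * (f (t + d) x - f t x - d * pdt f t x) +
   (v' x - v x - d * BN sc N v x) * f t x by rewrite /e1 product_increment.
have [_ /(_ x)/andP[v0 v1]] := uv'.
have -> : A * d ^+ 2 * wt x = ((L + L ^+ 2) * Cl * wt x * d ^+ 2 + Ct * wt x * d ^+ 2) + L ^+ 2 * Cf * wt x * d ^+ 2 by rewrite /A; ring.
apply: le_trans (ler_normD _ _) _.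
apply: lerD; last first.
  rewrite normrM; have := ep x; have := Hf t x => hf he.
  have -> : L ^+ 2 * Cf * wt x * d ^+ 2 = (L * d) ^+ 2 * (Cf * wt x) by ring.
  exact: ler_pM.
apply: le_trans (ler_normD _ _) _; apply: lerD.
  rewrite !normrM (ger0_norm d0); have hl := Hl t x; have hp := lip x.
  have -> : (L + L ^+ 2) * Cl * wt x * d ^+ 2 = ((L + L ^+ 2) * d) * (d * (Cl * wt x)) by ring.
  by apply: ler_pM => //; [rewrite mulr_ge0|rewrite ler_wpM2l].
rewrite normrM ger0_norm//; apply: le_trans (Ht t d x d0).
by rewrite ler_piMl.
Qed.

Section Limit.
Variable u : R -> R -> R.
Hypothesis mu2 : mf2 u.
Hypothesis uu : forall t, unitdec (u t).
Hypothesis ul : forall e, 0 < e -> exists N0 : nat, forall N, (N0 <= N)%N -> (0 < N)%N /\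
  forall t, 0 <= t <= T -> itg (fun y => wt y * `|vN N t y - u t y|) <= e.

Let cl (t : R) := Num.max 0 (Num.min t T).

Let mcl : mf cl.
Proof. by apply: measurable_maxr => //; apply: measurable_minr. Qed.

Let fl (t : R) := flux (u (cl t)) (cl t).

Let cl_itv_id t : 0 <= t <= T -> cl t = t.
Proof. by move=> /andP[? ?]; rewrite /cl min_l// max_r. Qed.

Let mucl : mf2 (fun t => u (cl t)).
Proof.
have h : measurable_fun setT (fun p : R * R => (cl p.1, p.2)).
  by apply: measurable_fun_pair => //; exact: (measurableT_comp mcl measurable_fst).
exact: (measurableT_comp mu2 h).
Qed.

Let mfl : mf fl.
Proof.
apply: itg2_mf; apply: mf2D.
  apply: mf2M => //; apply: mf2D; first exact: (word_mf2 tf [:: true]).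
  by apply: mf2D; apply: mf2Z; [exact: (word_mf2 tf [:: false])|exact: (word_mf2 tf [:: false; false])].
apply: mf2M; last exact: (word_mf2 tf [::]).
by apply: mf2Z; apply: mf2B => //; apply: mf2M.
Qed.

Let bfl : bm fl.
Proof.
split; first exact: mfl.
have [C1 C10 H1] := adj_bound; have [C2 C20 H2] := f_bound; have mu0 := sc_mu0 sc.
exists ((C1 + mu * C2) * wtot R) => t; apply: normr_itg_wt => [|x].
  by case: (dom_flux (cl t) (uu (cl t))).
have [_ /(_ x) v01] := uu (cl t); have v1 := unit_logistic v01; have /andP[v0 v1'] := v01.
rewrite (le_trans (ler_normD _ _))// mulrDl lerD//.
  by rewrite normrM; apply: le_trans (H1 (cl t) x); rewrite ler_piMl// ger0_norm.
rewrite !normrM (gtr0_norm mu0) -mulrA -mulrA ler_wpM2l ?(ltW mu0)//.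
by apply: le_trans (H2 (cl t) x); rewrite ler_piMl.
Qed.

(** Over a step [d] the quantity [F] moves by at most [d e + O(d^2)]: one half of [e] covers the
    consistency of the lattice, the other the L^1 distance from [vN N] to [u]. Gronwall with rate 0
    gives [|F T| <= T e], and [Phi T = 0] because the test function vanishes at [T]. *)
Lemma weak_identity : itg (fun t => ind 0 T t * fl t) + itg (fun x => psi x * f 0 x) = 0.
Proof.
have [C1 C10 H1] := flux_step; have [Cd Cd0 Hd] := flux_diff; have [Ct Ct0 Ht] := flux_time.
suff H e : 0 < e -> `|itg (fun t => ind 0 T t * fl t) + itg (fun x => psi x * f 0 x)| <= T * e.
  apply/eqP; rewrite -normr_le0; apply/ler_addgt0Pr => e e0; rewrite add0r.
  by have := H _ (divr_gt0 e0 T0); rewrite mulrC divfK ?gt_eqF.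
move=> e0; pose e' := e / (2 * (Cd + 1)).
have Cd1 : 0 < Cd + 1 by rewrite ltr_wpDl.
have e'0 : 0 < e' by rewrite divr_gt0// mulr_gt0.
have Ce : Cd * e' <= e / 2.
  have -> : e / 2 = (Cd + 1) * e' by rewrite /e'; field; rewrite gt_eqF.
  by rewrite ler_wpM2r ?(ltW e'0)// lerDl.
have [N1 HN1] := ul e'0.
pose N := maxn N1 (Num.truncn (2 * C1 / e)).+1.
have [N0 HN] := HN1 N (leq_maxl _ _).
have CN : C1 / N%:R <= e / 2.
  have nb : 2 * C1 / e <= N%:R.
    apply: ltW; apply: (lt_le_trans (truncnS_gt _)); rewrite ler_nat; exact: leq_maxr.
  have Ngt : 0 < N%:R :> R by rewrite ltr0n.
  rewrite ler_pdivrMr//; move: nb; rewrite ler_pdivrMr// => nb; lra.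
have [C2 C20 HS] := H1 N N0.
have L0 := Lam_gt0 sc N; set L := Lam sc N in L0.
pose K := Ct + Cd * ((L + L ^+ 2) * wtot R).
have K0 : 0 <= K.
  have LL : 0 <= L + L ^+ 2 by rewrite addr_ge0 ?sqr_ge0// ltW.
  by rewrite /K addr_ge0// mulr_ge0// mulr_ge0// wtot_ge0.
pose Phi t := itg (fun x => vN N t x * f t x).
pose F t := Phi t - Phi 0 - itg (fun s => ind 0 t s * fl s).
have Fstep s d : 0 <= s -> 0 <= d <= 1 -> s + d <= T -> `|F (s + d) - F s| <= d * e + (C2 + K) * d ^+ 2.
  move=> s0 /andP[d0 d1] sdT.
  have g : forall r, s <= r <= s + d -> `|fl r - flux (vN N s) s| <= e / 2 + K * d.
    move=> r /andP[sr rsd]; have r0 : 0 <= r := le_trans s0 sr.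
    have rT : 0 <= r <= T by rewrite r0 (le_trans rsd).
    rewrite /fl cl_itv_id//.
    have rs0 : 0 <= r - s by rewrite subr_ge0.
    have rsd' : r - s <= d by lra.
    have er : s + (r - s) = r by ring.
    have h1 := Hd r _ _ (uu r) (vN_unitdec sc psi_u N r0).
    have h2 := Ht s _ _ rs0 (vN_unitdec sc psi_u N s0); rewrite er in h2.
    have h3 := Hd r _ _ (vN_unitdec sc psi_u N r0) (vN_unitdec sc psi_u N s0).
    have h4 : itg (fun y => wt y * `|u r y - vN N r y|) <= e'.
      by under eq_fun do rewrite distrC; exact: HN.
    have h5 : itg (fun y => wt y * `|vN N r y - vN N s y|) <= (L + L ^+ 2) * (r - s) * wtot R.
      apply: itg_wtM_le => [|x].
        by apply: bm_abs; apply: bmB; apply: unitdec_bm; exact: vN_unitdec.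
      by have := vN_lip sc psi_u N x s0 rs0 (le_trans rsd' d1); rewrite er.
    move: h1 h2 h3 h4 h5; set i1 := itg _; set i2 := itg _; set f1 := flux _ _; set f2 := flux _ _; set f3 := flux _ _; set f4 := flux _ _.
    move=> h1 h2 h3 h4 h5.
    have h6 : Cd * i1 <= e / 2 by apply: le_trans Ce; rewrite ler_wpM2l.
    have LL : 0 <= (L + L ^+ 2) * wtot R.
      by rewrite mulr_ge0 ?wtot_ge0// addr_ge0 ?sqr_ge0// ltW.
    have h7 : Cd * i2 <= Cd * ((L + L ^+ 2) * wtot R) * d.
      rewrite -mulrA ler_wpM2l//; apply: (le_trans h5); rewrite mulrAC ler_wpM2l//.
    have h8 : Ct * (r - s) <= Ct * d by rewrite ler_wpM2l.
    have -> : f1 - f4 = (f1 - f2) + (f2 - f3) + (f3 - f4) by ring.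
    apply: le_trans (ler_normD _ _) _; have := ler_normD (f1 - f2) (f2 - f3).
    rewrite /K [_ * d]mulrDl; lra.
  have h1 := itg_ind_step bfl s0 d0 g; have h2 := HS s d s0 d0 d1.
  move: h1 h2; rewrite /F -/(Phi (s + d)) -/(Phi s).
  set i1 := itg _; set i2 := itg _; set p1 := Phi (s + d); set p2 := Phi s; set D := flux _ _; set p0 := Phi 0.
  move=> h1 h2.
  have h3 : d * (C1 / N%:R) <= d * (e / 2) by rewrite ler_wpM2l.
  have -> : p1 - p0 - i1 - (p2 - p0 - i2) = (p1 - p2 - d * D) - (i1 - i2 - d * D) by ring.
  apply: le_trans (ler_normB _ _) _.
  have -> : d * e + (C2 + K) * d ^+ 2 = d * (e / 2) + C2 * d ^+ 2 + d * (e / 2 + K * d) by field.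
  lra.
have C2K : 0 <= C2 + K by rewrite addr_ge0.
have F0 : F 0 = 0.
  rewrite /F subrr sub0r; by rewrite (itg_ind00 0 bfl) oppr0.
have TT : 0 <= T <= T by rewrite (ltW T0) lexx.
have F1 := @discrete_gronwall R F 0 e (C2 + K) 0 T T (lexx 0) (ltW e0) C2K (lexx 0).
have F2 := @discrete_gronwall R (fun t => - F t) 0 e (C2 + K) 0 T T (lexx 0) (ltW e0) C2K (lexx 0).
have g1 : F T <= T * e.
  have := F1 _ _ TT; rewrite !mul0r expR0 mul1r add0r; apply; first by rewrite F0.
  move=> s d s0 d1 sdT; have := Fstep s d s0 d1 sdT; rewrite mul0r addr0 mul1r => /ler_normlW; lra.
have g2 : - F T <= T * e.
  have := F2 _ _ TT; rewrite !mul0r expR0 mul1r add0r; apply; first by rewrite F0 oppr0.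
  move=> s d s0 d1 sdT; have := Fstep s d s0 d1 sdT; rewrite mul0r addr0 mul1r distrC => /ler_normlW; lra.
have PT : Phi T = 0.
  have [_ [_ fT]] := tf; rewrite /Phi -[RHS](itg0 R); congr itg.
  by apply/funext => x; rewrite fT mulr0.
have P0 : Phi 0 = itg (fun x => psi x * f 0 x) by rewrite /Phi vN0.
move: g1 g2; rewrite /F PT P0 sub0r => g1 g2.
by rewrite ler_norml; apply/andP; split; lra.
Qed.

Lemma weak_limit :
  (\int[leb]_(t in I0T T) \int[leb]_x
        (u t x * adj t x + mu * (u t x ^+ 2 - u t x) * f t x)%:E
    + \int[leb]_x (psi x * f 0 x)%:E = 0)%E.
Proof.
have [m0 [B0 h0]] := unitdec_bm psi_u.
rewrite (EFin_itg (domM m0 h0 (f_dom 0))).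
have -> : (\int[leb]_(t in I0T T) \int[leb]_x
        (u t x * adj t x + mu * (u t x ^+ 2 - u t x) * f t x)%:E =
   \int[leb]_(t in I0T T) (fl t)%:E)%E.
  apply: eq_integral => t /set_mem; rewrite /I0T /= in_itv/= => tT.
  by rewrite (EFin_itg (dom_flux t (uu t))) /fl cl_itv_id.
rewrite /I0T itg_itv (EFin_itg (dom_indM 0 T bfl)) -EFinD.
by have := weak_identity; rewrite /fl => ->.
Qed.

End Limit.
End WeakSolution.

(** * Uniqueness of weak solutions *)

Section SmoothProducts.
Variable R : realType.
Local Notation leb := (@lebesgue_measure R).
Implicit Types g h : R -> R.

Definition smooth1 g := forall n x, derivable (derive1n n g) x 1.

Lemma smooth1_derive g : smooth1 g -> smooth1 (derive1 g).
Proof. by move=> sg n x; rewrite -derive1Sn; exact: sg. Qed.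

Lemma smooth1_anti g h : (forall x, derivable g x 1) -> derive1 g = h -> smooth1 h -> smooth1 g.
Proof. by move=> dg gh sh [|n] x; [exact: dg|rewrite derive1Sn gh; exact: sh]. Qed.

Lemma smooth1_mkt c a b s : smooth1 (@mkt R c a b s).
Proof. by move=> n x; rewrite derive1n_mkt; exact: derivable_mkt. Qed.

Lemma smooth1B g h : smooth1 g -> smooth1 h -> smooth1 (fun x => g x - h x).
Proof.
move=> sg sh n x.
have H m : derive1n m (fun x => g x - h x) = (fun x => derive1n m g x - derive1n m h x).
  elim: m => [//|m IH]; apply/funext => y; rewrite !derive1nS IH !derive1E.
  exact: (deriveB (sg m y) (sh m y)).
by rewrite H; exact: (derivableB (sg n x) (sh n x)).
Qed.

Lemma smooth1_continuous g : smooth1 g -> continuous g.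
Proof. by move=> sg x; apply: differentiable_continuous; apply/derivable1_diffP; exact: (sg 0%N x). Qed.

Lemma word_product g h w : smooth1 g -> smooth1 h ->
  word (fun t x => g t * h x) w = (fun t x => derive1n (count id w) g t * derive1n (count negb w) h x).
Proof.
move=> sg sh; elim: w => [//|b w IH]; rewrite /= IH; apply/funext => t; apply/funext => x.
case: b => /=.
  rewrite add0n /pdt !derive1E.
  have := @deriveM R R (derive1n (count id w) g) (cst (derive1n (count negb w) h x)) t 1 (sg _ t) (derivable_cst _ _ _).
  rewrite derive_cst scaler0 add0r => H.
  by rewrite -[LHS]/('D_1 (derive1n (count id w) g * cst (derive1n (count negb w) h x)) t) H [RHS]mulrC.
rewrite add0n /pdx !derive1E.
exact: (@deriveZ R R _ (derive1n (count negb w) h) (derive1n (count id w) g t) x 1 (sh _ x)).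
Qed.

Lemma smooth2_product g h : smooth1 g -> smooth1 h -> smooth2 (fun t x => g t * h x).
Proof.
move=> sg sh w /=; rewrite -/(word _ _) word_product//.
have cg n : continuous (derive1n n g).
  by move=> x; apply: differentiable_continuous; apply/derivable1_diffP; exact: sg.
have ch n : continuous (derive1n n h).
  by move=> x; apply: differentiable_continuous; apply/derivable1_diffP; exact: sh.
split; [|split].
- move=> p; apply: cvgM.
    by apply: (cvg_comp _ _ cvg_fst); exact: cg.
  by apply: (cvg_comp _ _ cvg_snd); exact: ch.
- by move=> t x; apply: derivableM => //; exact: sg.
- by move=> t x; apply: derivableM => //; exact: sh.
Qed.

Section Antiderivative.
Variables (k : R -> R) (A : R).
Hypotheses (ck : continuous k) (dk : dom k).
Hypotheses (kl : forall r, r <= - A -> k r = 0) (kr : forall r, A <= r -> k r = 0) (k0 : itg k = 0).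

(** For a compactly supported kernel of mean 0 this primitive is compactly supported too, hence
    usable as a test function in time. *)
Definition antider (s : R) : R := (\int[leb]_(r in `]-oo, s]) k r)%R.

Lemma antiderP s : derivable antider s 1 /\ derive1 antider s = k s.
Proof.
have ss1 : s < s + 1 by rewrite ltrDl.
have ki : (@lebesgue_measure R).-integrable [set` Interval -oo%O (BRight (s + 1))] (EFin \o k).
  by apply: (integrableS measurableT) => //; exact: dom_integrable.
have := @continuous_FTC1 R k -oo%O s (s + 1) ss1 ki; apply; last exact: ck.
by rewrite /= ltNyr.
Qed.

Lemma antiderE s : antider s = itg (fun r => \1_(`]-oo, s]%classic) r * k r).
Proof.
rewrite /antider /Rintegral /itg integral_mkcond; congr fine; apply: eq_integral => t _.
rewrite restrict_EFin indicE /= patchE; case: ifP => // _; first by rewrite mul1r.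
by rewrite mul0r.
Qed.

Lemma antider_left s : s <= - A -> antider s = 0.
Proof.
move=> sA; rewrite antiderE -[RHS](itg0 R); congr itg; apply/funext => r.
rewrite indicE mem_setE in_itv/=; have [rs|rs] := leP r s; last by rewrite mul0r.
by rewrite kl ?mulr0// (le_trans rs).
Qed.

Lemma antider_right s : A <= s -> antider s = 0.
Proof.
move=> sA; rewrite antiderE -[RHS]k0; congr itg; apply/funext => r.
rewrite indicE mem_setE in_itv/=; have [rs|rs] := leP r s; first by rewrite mul1r.
by rewrite mul0r kr// (le_trans sA)// ltW.
Qed.

End Antiderivative.
End SmoothProducts.

(** * A du Bois-Reymond lemma in time *)

Section DuBoisReymond.
Variable R : realType.
Variables (T : R).
Hypothesis T0 : 0 < T.

Definition admissible (th : R -> R) :=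
  [/\ smooth1 th, th T = 0 & exists K, forall t, K < `|t| -> th t = 0].

Lemma admissible_bm th n : admissible th -> bm (derive1n n th).
Proof.
move=> [sth _ [K HK]]; have cn : continuous (derive1n n th).
  by move=> x; apply: differentiable_continuous; apply/derivable1_diffP; exact: sth.
split; first exact: mf_continuous.
have c2 : continuous (fun p : R * R => derive1n n th p.1).
  by move=> p; apply: (cvg_comp _ _ cvg_fst); exact: cn.
have [C C0 HC] := @box_bound R (fun t _ => derive1n n th t) K c2.
exists C => t; have [tK|tK] := leP `|t| K.
  by apply: (HC t 0) => //; rewrite normr0 (le_trans _ tK).
suff -> : derive1n n th t = 0 by rewrite normr0.
elim: n {cn c2 HC} t tK => [|n IH] t tK; first exact: HK.
by rewrite derive1nS; apply: derive1_near0; apply: filterS (near_norm_gt tK) => s sK; exact: IH.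
Qed.

(** Increments of order [d^2] force constancy: Gronwall with rate and source 0, applied to [F - F 0]
    and to its opposite. *)
Lemma step_le0 (F : R -> R) (C : R) : 0 <= C ->
  (forall s d, 0 <= s -> 0 <= d <= 1 -> s + d <= T -> `|F (s + d) - F s| <= C * d ^+ 2) ->
  forall t, 0 <= t <= T -> F t = F 0.
Proof.
move=> C0 H t tT; pose G t := F t - F 0.
have F1 := @discrete_gronwall R G 0 0 C 0 T t (lexx 0) (lexx 0) C0 (lexx 0).
have F2 := @discrete_gronwall R (fun t => - G t) 0 0 C 0 T t (lexx 0) (lexx 0) C0 (lexx 0).
have G0 : G 0 = 0 by rewrite /G subrr.
have g1 : G t <= 0.
  have := F1 _ _ tT; rewrite mulr0 addr0 mulr0; apply; first by rewrite G0.
  by move=> s d s0 d1 sd; have := H s d s0 d1 sd; rewrite mul0r addr0 mul1r mulr0 addr0 /G => /ler_normlW; lra.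
have g2 : - G t <= 0.
  have := F2 _ _ tT; rewrite mulr0 addr0 mulr0; apply; first by rewrite G0 oppr0.
  by move=> s d s0 d1 sd; have := H s d s0 d1 sd; rewrite mul0r addr0 mul1r mulr0 addr0 /G distrC => /ler_normlW; lra.
by move: g1 g2; rewrite /G; lra.
Qed.

Lemma prim_lip (b : R -> R) (B t d : R) : mf b -> (forall s, `|b s| <= B) -> 0 <= t -> 0 <= d ->
  `|itg (fun s => ind 0 (t + d) s * b s) - itg (fun s => ind 0 t s * b s)| <= B * d.
Proof.
move=> mb bB t0 d0; have bb : bm b by split=> //; exists B.
have := @itg_ind_step R b t d 0 B bb t0 d0; rewrite mulr0 subr0 [B * d]mulrC; apply=> s _.
by rewrite subr0.
Qed.

Lemma prim_bm (b : R -> R) : bm b -> exists2 Ec, bm Ec &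
  forall t, 0 <= t <= T -> Ec t = itg (fun s => ind 0 t s * b s).
Proof.
move=> bb; have [mb [B bB]] := bb; have BB : 0 <= B := le_trans (normr_ge0 _) (bB 0).
pose E t := itg (fun s => ind 0 t s * b s).
have Elip t d : 0 <= t -> 0 <= d -> `|E (t + d) - E t| <= B * d by exact: prim_lip.
pose cl t := Num.max 0 (Num.min t T).
exists (fun t => E (cl t)); last first.
  by move=> t /andP[? ?]; rewrite /cl min_l// max_r.
split; last first.
  exists (B * T) => t; have /andP[t0 tT] : 0 <= cl t <= T.
    by rewrite /cl le_max lexx/= ge_max (ltW T0) ge_min lexx orbT.
  have := Elip 0 _ (lexx 0) t0; rewrite add0r (_ : E 0 = 0); last exact: itg_ind00.
  by rewrite subr0 => h; apply: le_trans h _; rewrite ler_wpM2l.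
have mE2 : mf2 (fun t (_ : R) => E (cl t)).
  apply: (@measurable_caratheodory R (fun t _ => E t) B T BB) => [t|t d _ t0 d0 _]; first exact: mf_cst.
  exact: Elip.
exact: (mf2_r 0 mE2).
Qed.

Lemma by_parts (b th : R -> R) (M : R) : bm b ->
  (forall t, derivable th t 1) -> (forall t, derivable (derive1 th) t 1) ->
  (forall t, `|th t| <= M) -> (forall t, `|derive1 th t| <= M) -> (forall t, `|derive1 (derive1 th) t| <= M) ->
  th T = 0 ->
  itg (fun t => ind 0 T t * (th t * b t)) =
  - itg (fun t => ind 0 T t * (derive1 th t * itg (fun s => ind 0 t s * b s))).
Proof.
move=> bb dth dth1 M0 M1 M2 thT; have [mb [B bB]] := bb.
pose k := derive1 th; pose E t := itg (fun s => ind 0 t s * b s).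
have MM : 0 <= M := le_trans (normr_ge0 _) (M0 0).
have BB : 0 <= B := le_trans (normr_ge0 _) (bB 0).
have mth : mf th by apply: mf_continuous => x; apply: differentiable_continuous; apply/derivable1_diffP.
have mk : mf k by apply: mf_continuous => x; apply: differentiable_continuous; apply/derivable1_diffP.
have Elip t d : 0 <= t -> 0 <= d -> `|E (t + d) - E t| <= B * d by exact: prim_lip.
have E0 : E 0 = 0 by exact: itg_ind00.
have Ebnd t : 0 <= t <= T -> `|E t| <= B * T.
  move=> /andP[t0 tT]; have := Elip 0 t (lexx 0) t0; rewrite add0r E0 subr0 => h.
  by apply: le_trans h _; rewrite ler_wpM2l.
have [Ec bE cl_id] := prim_bm bb.
have b1 : bm (fun t => th t * b t) by apply: bmM => //; split=> //; exists M.
have b2 : bm (fun t => k t * Ec t) by apply: bmM => //; split=> //; exists M.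
have -> : itg (fun t => ind 0 T t * (k t * E t)) = itg (fun t => ind 0 T t * (k t * Ec t)).
  congr itg; apply/funext => t; rewrite indE; have [tT|tT] := boolP (0 <= t <= T); last by rewrite !mul0r.
  by rewrite cl_id.
(* The defect of the formula on [0, t]; [th T = 0] removes the boundary term at [T]. *)
pose Z t := itg (fun r => ind 0 t r * (th r * b r)) + itg (fun r => ind 0 t r * (k r * Ec r)) - th t * E t.
have thl t d : 0 <= d -> `|th (t + d) - th t| <= M * d.
  move=> d0; have := @mvt_bound R th M t (t + d); rewrite lerDl d0 => /(_ isT dth M1).
  by rewrite [t + d - t]addrAC subrr add0r.
have kl t d : 0 <= d -> `|k (t + d) - k t| <= M * d.
  move=> d0; have := @mvt_bound R k M t (t + d); rewrite lerDl d0 => /(_ isT dth1 M2).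
  by rewrite [t + d - t]addrAC subrr add0r.
have tht t d : 0 <= d -> `|th (t + d) - th t - d * k t| <= M * d ^+ 2.
  move=> d0; have := @taylor2_bound R th M t (t + d); rewrite lerDl d0 => /(_ isT dth dth1 M2).
  by rewrite [t + d - t]addrAC subrr add0r.
pose C := M * B + 2 * (M * (B * T) + M * B).
have C0 : 0 <= C by rewrite /C !addr_ge0// mulr_ge0// ?addr_ge0// !mulr_ge0// ltW.
have ZE : Z T = Z 0.
  apply: (step_le0 C0); last by rewrite (ltW T0) lexx.
  move=> s d s0 /andP[d0 d1] sdT.
  have sd0 : 0 <= s + d by rewrite addr_ge0.
  have sd : s <= s + d by rewrite lerDl.
  have sT : s <= T := le_trans sd sdT.
  pose g1 r := (th r - th s) * b r.
  have bg1 : bm g1 by apply: bmM => //; apply: bmB; [split=> //; exists M|exact: bm_cst].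
  have g1B r : s <= r <= s + d -> `|g1 r - 0| <= M * d * B.
    move=> /andP[sr rsd]; rewrite subr0 normrM; apply: ler_pM => //.
    have rs0 : 0 <= r - s by rewrite subr_ge0.
    have esr : s + (r - s) = r by ring.
    by have := thl s _ rs0; rewrite esr => h; apply: le_trans h _; rewrite ler_wpM2l// lerBlDl.
  have h1 := itg_ind_step bg1 s0 d0 g1B.
  have eg1 t : itg (fun r => ind 0 t r * g1 r) = itg (fun r => ind 0 t r * (th r * b r)) - th s * E t.
    rewrite /E -itgZ; last exact: dom_indM.
    rewrite -itgB; [|exact: dom_indM|by apply: domZ; exact: dom_indM].
    by congr itg; apply/funext => r; rewrite /g1; ring.
  rewrite !eg1 mulr0 subr0 in h1.
  have h2 : forall r, s <= r <= s + d -> `|k r * Ec r - k s * E s| <= M * d * (B * T) + M * (B * d).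
    move=> r /andP[sr rsd]; have rT : 0 <= r <= T by rewrite (le_trans s0 sr) (le_trans rsd sdT).
    rewrite cl_id//.
    have -> : k r * E r - k s * E s = (k r - k s) * E r + k s * (E r - E s) by ring.
    have rs0 : 0 <= r - s by rewrite subr_ge0.
    have rsd' : r - s <= d by rewrite lerBlDl.
    have esr : s + (r - s) = r by ring.
    apply: le_trans (ler_normD _ _) _; rewrite !normrM; apply: lerD; apply: ler_pM => //.
    - by have := kl s _ rs0; rewrite esr => h; apply: le_trans h _; rewrite ler_wpM2l.
    - exact: Ebnd.
    - by have := Elip s _ s0 rs0; rewrite esr => h; apply: le_trans h _; rewrite ler_wpM2l.
  have h3 := itg_ind_step b2 s0 d0 h2.
  have h4 := tht s d d0; have h5 := Elip s d s0 d0.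
  have h6 : `|E (s + d)| <= B * T by apply: Ebnd; rewrite sd0.
  have h7 := M1 s.
  move: h1 h3; rewrite /Z.
  set j1 := itg _; set j2 := itg _; set j3 := itg _; set j4 := itg _ => h1 h3.
  have -> : j1 + j3 - th (s + d) * E (s + d) - (j2 + j4 - th s * E s) =
    (j1 - th s * E (s + d) - (j2 - th s * E s)) + (j3 - j4 - d * (k s * E s))
    - ((th (s + d) - th s - d * k s) * E (s + d) + d * (k s * (E (s + d) - E s))) by ring.
  have h8 : `|(th (s + d) - th s - d * k s) * E (s + d)| <= M * d ^+ 2 * (B * T).
    by rewrite normrM; apply: ler_pM.
  have h9 : `|d * (k s * (E (s + d) - E s))| <= d * (M * (B * d)).
    by rewrite !normrM (ger0_norm d0) ler_wpM2l//; apply: ler_pM.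
  move: h1 h3 h8 h9; set q3 := (th (s + d) - th s - d * k s) * E (s + d); set q4 := d * (k s * (E (s + d) - E s)).
  set q1 := j1 - _ - _; set q2 := j3 - _ - _ => h1 h3 h8 h9.
  have := ler_normB (q1 + q2) (q3 + q4); have := ler_normD q1 q2; have := ler_normD q3 q4.
  have -> : C * d ^+ 2 = d * (M * d * B) + d * (M * d * (B * T) + M * (B * d)) + (M * d ^+ 2 * (B * T) + d * (M * (B * d))).
    by rewrite /C; ring.
  move: h1 h3 h8 h9; clear; lra.
move: ZE; rewrite /Z thT mul0r (itg_ind00 0 b1) (itg_ind00 0 b2) E0 => ZE.
by apply/eqP; rewrite -subr_eq0 opprK; apply/eqP; rewrite -[LHS]subr0 ZE mulr0 !subr0 addr0.
Qed.

End DuBoisReymond.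

Section DuBoisReymond2.
Variable R : realType.
Variable T : R.
Hypothesis T0 : 0 < T.

(** The subtracted bump makes the mean 0, so that the primitive has compact support. It sits between
    -4 and -2, at times that an integral over [0, T] does not see. *)
Let k (de tau : R) (r : R) : R := moll de (r - tau) - moll 1 (r - (-3)).

Let k_smooth de tau : smooth1 (k de tau).
Proof. by rewrite /k; apply: smooth1B; rewrite moll_translate; exact: smooth1_mkt. Qed.

Lemma moll_bounds de tau : exists2 M : R, 0 <= M &
  forall n, (n <= 2)%N -> forall r, `|derive1n n (fun r => moll de (r - tau)) r| <= M.
Proof.
rewrite moll_translate.
have [C0 [C00 H0]] := mkt_bounded (bump_mass de)^-1 de^-1 (- (de^-1 * tau)) (bump0 R).
have [C1 [C10 H1]] := mkt_bounded ((bump_mass de)^-1 * de^-1 ^+ 1) de^-1 (- (de^-1 * tau)) (Dbsum (bump0 R)).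
have [C2 [C20 H2]] := mkt_bounded ((bump_mass de)^-1 * de^-1 ^+ 2) de^-1 (- (de^-1 * tau)) (Dbsum (Dbsum (bump0 R))).
exists (C0 + C1 + C2) => [|[|[|[|//]]] _ r]; first by rewrite !addr_ge0.
- by apply: le_trans (H0 r) _; lra.
- by rewrite derive1n_mkt; apply: le_trans (H1 r) _; lra.
- by rewrite derive1n_mkt; apply: le_trans (H2 r) _; lra.
Qed.

(** Testing with the primitive of a mollifier centred at [tau] and integrating by parts, the
    mollification of [a] minus the primitive of [b] vanishes at [tau]; Lebesgue points conclude.
    Admissible functions may be nonzero at time 0, and for this reason the primitive comes without
    an additive constant. *)
Lemma du_bois_reymond (a b : R -> R) : bm a -> bm b ->
  (forall th, admissible T th ->
     itg (fun t => ind 0 T t * (derive1 th t * a t + th t * b t)) = 0) ->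
  itg (fun t => `|ind 0 T t * (a t - itg (fun s => ind 0 t s * b s))|) = 0.
Proof.
move=> ba bb H.
have [M M0 HM] := moll_mollifier R.
pose h t := ind 0 T t * (a t - itg (fun s => ind 0 t s * b s)).
have [Ec bE HE] := prim_bm T0 bb.
have hE t : h t = ind 0 T t * (a t - Ec t).
  rewrite /h indE; have [tT|tT] := boolP (0 <= t <= T); last by rewrite !mul0r.
  by rewrite HE.
have bh : bm h.
  have -> : h = (fun t => ind 0 T t * (a t - Ec t)) by apply/funext.
  by apply: bmM; [apply: dom_bm; exact: dom_ind|exact: bmB].
(* The mollifier must not cross [T], where the test function has to vanish. It may cross 0, since
   [h] is 0 at negative times. *)
have Sh n tau : 0 <= tau -> tau + n.+1%:R^-1 <= T -> S (moll n.+1%:R^-1) h tau = 0.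
  set de := n.+1%:R^-1 => tau0 tauT.
  have de0 : 0 < de by rewrite invr_gt0 ltr0n.
  have de1 : de <= 1 by rewrite invf_le1 ?ler1n ?ltr0n.
  have km := HM _ de0; have km1 := HM _ ltr01.
  have [_ _ supp _ _] := km; have [_ _ supp1 _ _] := km1.
  have dk : dom (k de tau) by apply: domB; [exact: (dom_moll de0 km)|exact: (dom_moll ltr01 km1)].
  have ck : continuous (k de tau) by apply: smooth1_continuous; exact: k_smooth.
  have kl r : r <= - (T + 5) -> k de tau r = 0.
    move=> rT; rewrite /k supp ?supp1 ?subrr//; rewrite ltr0_norm; lra.
  have kr r : T + 5 <= r -> k de tau r = 0.
    move=> rT; rewrite /k supp ?supp1 ?subrr//; rewrite gtr0_norm; lra.
  have kT r : T <= r -> k de tau r = 0.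
    move=> rT; rewrite /k supp ?supp1 ?subrr//; rewrite ger0_norm; lra.
  have k0 : itg (k de tau) = 0.
    rewrite /k itgB; [|exact: (dom_moll de0 km)|exact: (dom_moll ltr01 km1)].
    by rewrite (itg_moll de0 km) (itg_moll ltr01 km1) subrr.
  pose th := antider (k de tau).
  have thP s := antiderP ck dk s.
  have dth : derive1 th = k de tau by apply/funext => s; case: (thP s).
  have sth : smooth1 th by apply: smooth1_anti; [|exact: dth|exact: k_smooth] => s; case: (thP s).
  have thT : th T = 0.
    rewrite /th antiderE -[RHS]k0; congr itg; apply/funext => r.
    rewrite indicE mem_setE in_itv/=; have [rs|rs] := leP r T; first by rewrite mul1r.
    by rewrite mul0r kT// ltW.
  have adm : admissible T th.
    split=> //; exists (T + 5) => t tT; have [t0|t0] := leP 0 t.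
      by apply: (antider_right kr k0); move: tT; rewrite ger0_norm// => /ltW.
    by apply: (antider_left kl); move: tT; rewrite ltr0_norm//; lra.
  have [M1 M10 HM1] := moll_bounds de tau; have [M2 M20 HM2] := moll_bounds 1 (-3).
  have dk1 : derive1 (k de tau) = (fun r => derive1n 1 (fun r => moll de (r - tau)) r - derive1n 1 (fun r => moll 1 (r - (-3))) r).
    apply/funext => r; rewrite !derive1n1 !derive1E; apply: deriveB.
      by rewrite moll_translate; exact: derivable_mkt.
    by rewrite moll_translate; exact: derivable_mkt.
  pose MM := itg (fun r => `|k de tau r|) + (M1 + M2).
  have I0 : 0 <= itg (fun r => `|k de tau r|) by apply: itg_ge0.
  have t0 s : `|th s| <= MM.
    apply: (@le_trans _ _ (itg (fun r => `|k de tau r|))); last by rewrite lerDl addr_ge0.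
    rewrite /th antiderE; apply: normr_itg_le; [|exact: dom_abs|].
      apply: (domM (B := 1)) dk => [|x]; first by apply: measurable_indic; exact: measurable_itv.
      by rewrite indicE; case: (_ \in _); rewrite ?normr1 ?normr0.
    by move=> x; rewrite normrM ler_piMl// indicE; case: (_ \in _); rewrite ?normr1 ?normr0.
  have t1 s : `|derive1 th s| <= MM.
    rewrite dth /k; apply: le_trans (ler_normB _ _) (le_trans (lerD (HM1 0%N isT s) (HM2 0%N isT s)) _).
    by rewrite lerDr.
  have t2 s : `|derive1 (derive1 th) s| <= MM.
    rewrite dth dk1; apply: le_trans (ler_normB _ _) (le_trans (lerD (HM1 1%N isT s) (HM2 1%N isT s)) _).
    by rewrite lerDr.
  have bth : bm th.
    by split; [apply: mf_continuous; exact: smooth1_continuous|exists MM].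
  have bk : bm (k de tau) := dom_bm dk.
  have := by_parts T0 bb (sth 0%N) (@smooth1_derive _ _ sth 0%N) t0 t1 t2 thT.
  have := H th adm; rewrite dth.
  have -> : itg (fun t => ind 0 T t * (k de tau t * a t + th t * b t)) =
     itg (fun t => ind 0 T t * (k de tau t * a t)) + itg (fun t => ind 0 T t * (th t * b t)).
    rewrite -itgD; [|by apply: dom_indM; exact: bmM|by apply: dom_indM; exact: bmM].
    by congr itg; apply/funext => t; ring.
  move=> h1 h2; rewrite h2 in h1.
  have -> : S (moll de) h tau = itg (fun t => ind 0 T t * (k de tau t * a t)) - itg (fun t => ind 0 T t * (k de tau t * Ec t)).
    rewrite /S -itgB; [|by apply: dom_indM; exact: bmM|by apply: dom_indM; exact: bmM].
    congr itg; apply/funext => t; rewrite hE indE; have [/andP[t00 tT]|tT] := boolP (0 <= t <= T); last by rewrite !mul0r subrr.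
    by rewrite /k supp1 ?subr0; [ring|rewrite ger0_norm; lra].
  have <- : itg (fun t => ind 0 T t * (k de tau t * itg (fun s => ind 0 t s * b s))) = itg (fun t => ind 0 T t * (k de tau t * Ec t)).
    congr itg; apply/funext => t; rewrite indE; have [tT|tT] := boolP (0 <= t <= T); last by rewrite !mul0r.
    by rewrite HE.
  by [].
(* The vanishing of the mollifications covers times strictly below [T] only; the end point is a null
   set. *)
have aeT : {ae (@lebesgue_measure R), forall x, x != T}.
  exists [set T]; split=> //; first exact: lebesgue_measure_set1.
  by move=> x /= /negP; rewrite negbK => /eqP.
have aeh : {ae (@lebesgue_measure R), forall x, `|h x| = 0}.
  apply: (@filterS2 _ _ (ae_filter_ringOfSetsType _) _ _ _ _ aeT (oscS_cvg0 bh)) => t tT osc.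
  have [t01|t01] := boolP (0 <= t < T); last first.
    rewrite /h indE; suff -> : 0 <= t <= T = false by rewrite mul0r normr0.
    apply/negbTE; apply: contra t01 => /andP[-> tT']; by rewrite lt_neqAle tT.
  case/andP: t01 => t0' tT'; apply/eqP; rewrite -normr_le0 normr_id.
  apply/ler_addgt0Pr => e e0; rewrite add0r.
  have Tt0 : 0 < T - t by rewrite subr_gt0.
  have n1 : \forall n \near \oo, oscS (moll n.+1%:R^-1) h t < e by apply: (cvgr_lt _ osc).
  have n2 : \forall n \near \oo, (n.+1%:R^-1 : R) < T - t by apply: (cvgr_lt _ (@cvg_harmonic R)).
  have [n [Hn1 Hn2]] := filter_ex (filterI n1 n2).
  have en : 0 < n.+1%:R^-1 :> R by rewrite invr_gt0 ltr0n.
  have := normr_subS en (HM _ en) t bh; rewrite Sh//; last by rewrite addrC -lerBrDr ltW.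
  by rewrite subr0 => hh; apply: (le_trans hh); exact: ltW.
exact: (ae0_itg (mf_abs (bm_mf bh)) aeh).
Qed.

End DuBoisReymond2.

(** * The weak formulation tested against mollifiers *)

Section WeakIdentity.
Variable R : realType.
Local Notation leb := (@lebesgue_measure R).
Variables (sc : scaling R) (psi : R -> R) (T : R).
Hypotheses (psi_b : bm psi) (T0 : 0 < T).
Local Notation mu := (sc_mu sc).

Definition wsol (v : R -> R -> R) := forall f, testfun T f ->
  (\int[leb]_(t in I0T T) \int[leb]_x
        (v t x * adj sc f t x + mu * (v t x ^+ 2 - v t x) * f t x)%:E
    + \int[leb]_x (psi x * f 0 x)%:E = 0)%E.

Lemma mf2_conv (v : R -> R -> R) (k : R -> R) : mf2 v -> mf k ->
  mf2 (fun t y => itg (fun z => v t z * k (z - y))).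
Proof.
move=> mv mk; apply: (@mf2_itg3 R (fun t y z => v t z * k (z - y))).
apply: measurable_realfun.measurable_funM.
  have h : measurable_fun setT (fun p : R * R * R => (p.1.1, p.2)).
    by apply: measurable_fun_pair => //; exact: (measurableT_comp measurable_fst measurable_fst).
  exact: (measurableT_comp mv h).
have h : measurable_fun setT (fun p : R * R * R => p.2 - p.1.2).
  apply: measurable_realfun.measurable_funB => //.
  exact: (measurableT_comp measurable_snd measurable_fst).
exact: (measurableT_comp mk h).
Qed.

Lemma itg_conv_bound (v k : R -> R) (B : R) y : dom k -> mf v -> (forall x, `|v x| <= B) ->
  `|itg (fun z => v z * k (z - y))| <= B * itg (fun z => `|k z|).
Proof.
move=> dk mv vB; rewrite -(itg_shift (- y) (dom_abs dk)) -itgZ; last exact: (dom_shift (- y) (dom_abs dk)).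
apply: normr_itg_le; [exact: domM vB (dom_shift (- y) dk)|by apply: domZ; exact: (dom_shift (- y) (dom_abs dk))|].
by move=> x; rewrite normrM ler_wpM2r.
Qed.

Section Fixed.
Variables (eps : R) (e0 : 0 < eps).

Definition reac (v : R -> R) (y : R) : R :=
  LSm sc eps v y + mu * S (moll eps) (fun z => v z ^+ 2 - v z) y.

Lemma smooth1_moll y : smooth1 (fun x : R => moll eps (x - y)).
Proof. by rewrite moll_translate; exact: smooth1_mkt. Qed.

Lemma mkt_translate c a s (x y : R) : mkt c a (- (a * y)) s x = mkt c a 0 s (x - y).
Proof. by rewrite /mkt; congr (_ * bsum s _); ring. Qed.

Lemma adj_product (th : R -> R) y t x : smooth1 th ->
  adj sc (fun t x => th t * moll eps (x - y)) t x =
  derive1 th t * moll eps (x - y) + th t * Lmoll sc eps (x - y).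
Proof.
move=> sth; have sm := smooth1_moll (y := y).
have w1 := word_product [:: true] sth sm; have w2 := word_product [:: false] sth sm.
have w3 := word_product [:: false; false] sth sm.
have d1 : derive1 (fun x : R => moll eps (x - y)) x = derive1 (moll eps) (x - y).
  by rewrite moll_translate /moll !derive1_mkt mkt_translate.
have d2 : derive1n 2 (fun x : R => moll eps (x - y)) x = derive1 (derive1 (moll eps)) (x - y).
  by rewrite moll_translate derive1n_mkt /moll !derive1_mkt mkt_translate expr2 mulrA.
have e1 : pdt (fun t x => th t * moll eps (x - y)) t x = derive1 th t * moll eps (x - y).
  exact: (congr1 (fun F => F t x) w1).
have e2 : pdx (fun t x => th t * moll eps (x - y)) t x = th t * derive1 (fun x : R => moll eps (x - y)) x.
  exact: (congr1 (fun F => F t x) w2).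
have e3 : pdx (pdx (fun t x => th t * moll eps (x - y))) t x = th t * derive1n 2 (fun x : R => moll eps (x - y)) x.
  exact: (congr1 (fun F => F t x) w3).
by rewrite /adj e1 e2 e3 d2 d1 /Lmoll; ring.
Qed.

Lemma testfun_product (th : R -> R) y : admissible T th ->
  testfun T (fun t x => th t * moll eps (x - y)).
Proof.
move=> [sth thT [K HK]]; have [M M0 HM] := moll_mollifier R.
have [_ _ supp _ _] := HM _ e0.
split; [apply: smooth2_product => //; exact: smooth1_moll|split=> [|x]; last by rewrite thT mul0r].
exists (`|K| + `|y| + eps) => t x [h|h].
  rewrite HK ?mul0r//; apply: (le_lt_trans (ler_norm K)); apply: le_lt_trans h.
  by rewrite -addrA lerDl addr_ge0// ltW.
rewrite supp ?mulr0//; have := ler_normD (x - y) y; rewrite subrK; have := normr_ge0 K; lra.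
Qed.

Section OneSolution.
Variables (v : R -> R -> R) (B : R).
Hypotheses (mv : mf2 v) (vB : forall t x, `|v t x| <= B).

Let bv t : bm (v t). Proof. by split; [exact: mf2_l|exists B => x; exact: vB]. Qed.
Let B0 : 0 <= B := le_trans (normr_ge0 _) (vB 0 0).

Lemma mf2_S : mf2 (fun t y => S (moll eps) (v t) y).
Proof. by apply: mf2_conv => //; exact: mkt_mf. Qed.

Lemma S_abs_le t y : `|S (moll eps) (v t) y| <= B.
Proof.
have [M M0 HM] := moll_mollifier R.
by apply: (normr_S_le e0 (HM _ e0) (bv t)) => z _; exact: vB.
Qed.

Lemma mf2_reac : mf2 (fun t y => reac (v t) y).
Proof.
apply: mf2D; first by apply: mf2_conv => //; case: (Lmoll_dom sc e0).
apply: mf2Z; apply: (@mf2_conv (fun t z => v t z ^+ 2 - v t z)); last exact: mkt_mf.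
by apply: mf2B => //; apply: mf2M.
Qed.

Lemma reac_bound : exists2 C, 0 <= C & forall t y, `|reac (v t) y| <= C.
Proof.
have [M M0 HM] := moll_mollifier R; have mu0 := sc_mu0 sc.
have I0 : 0 <= itg (fun z => `|Lmoll sc eps z|) by apply: itg_ge0.
exists (B * itg (fun z => `|Lmoll sc eps z|) + mu * (B ^+ 2 + B)).
  by apply: addr_ge0; apply: mulr_ge0 => //; [exact: ltW|rewrite addr_ge0// sqr_ge0].
move=> t y; apply: le_trans (ler_normD _ _) _; apply: lerD.
  by apply: itg_conv_bound; [exact: Lmoll_dom|exact: mf2_l|exact: vB].
rewrite normrM gtr0_norm// ler_wpM2l ?(ltW mu0)//.
apply: (normr_S_le e0 (HM _ e0)); first exact: bmB (bm_sqr (bv t)) (bv t).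
move=> z _; apply: le_trans (ler_normB _ _) _; apply: lerD; last exact: vB.
by rewrite normrX lerXn2r// nnegrE.
Qed.

Lemma bm_S_time y : bm (fun t => S (moll eps) (v t) y).
Proof. by split; [exact: mf2_r mf2_S|exists B => t; exact: S_abs_le]. Qed.

Lemma bm_reac_time y : bm (fun t => reac (v t) y).
Proof. by split; [exact: mf2_r mf2_reac|have [C _ HC] := reac_bound; exists C]. Qed.

(** With the product test function [th(t) moll(x - y)], the weak equation becomes, for each fixed
    [y], a scalar equation in time: the derivative of [S (moll eps) v] at [y] is [reac v y] in the
    weak sense, with initial value [S (moll eps) psi y]. *)
Lemma wsol_mollified (th : R -> R) y : wsol v -> admissible T th ->
  itg (fun t => ind 0 T t * (derive1 th t * S (moll eps) (v t) y + th t * reac (v t) y)) =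
  - (th 0 * S (moll eps) psi y).
Proof.
move=> hv adm; have [sth thT [K HK]] := adm.
have [M M0 HM] := moll_mollifier R; have km := HM _ e0.
have := hv _ (testfun_product y adm).
have dmoll := dom_moll e0 km y.
have dL := dom_shift (- y) (Lmoll_dom sc e0).
have -> : (\int[leb]_x (psi x * (th 0 * moll eps (x - y)))%:E = (th 0 * S (moll eps) psi y)%:E)%E.
  have [mp [Bp pB]] := psi_b; have dp := domM mp pB dmoll.
  rewrite /S -itgZ// -(EFin_itg (domZ (th 0) dp)); apply: eq_integral => x _; congr EFin; ring.
have e1 t : (\int[leb]_x (v t x * adj sc (fun t x => th t * moll eps (x - y)) t x +
    mu * (v t x ^+ 2 - v t x) * (th t * moll eps (x - y)))%:E =
   (derive1 th t * S (moll eps) (v t) y + th t * reac (v t) y)%:E)%E.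
  have [m1 [B1 h1]] := bv t; have [m2 [B2 h2]] := bmB (bm_sqr (bv t)) (bv t).
  have d1 := domM m1 h1 dmoll; have d2 := domM m1 h1 dL; have d3 := domM m2 h2 dmoll.
  have -> : derive1 th t * S (moll eps) (v t) y + th t * reac (v t) y =
    itg (fun x => derive1 th t * (v t x * moll eps (x - y)) + th t * (v t x * Lmoll sc eps (x - y)
       + mu * ((v t x ^+ 2 - v t x) * moll eps (x - y)))).
    rewrite /reac /LSm /S itgD; [|exact: domZ|by apply: domZ; apply: domD => //; exact: domZ].
    rewrite !itgZ//; last by apply: domD => //; exact: domZ.
    by rewrite itgD//; [rewrite itgZ|exact: domZ].
  rewrite -EFin_itg; last by apply: domD; apply: domZ => //; apply: domD => //; exact: domZ.
  apply: eq_integral => x _; congr EFin; rewrite adj_product//; ring.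
under eq_integral => t _ do rewrite e1.
have bth : bm th := admissible_bm 0 adm.
have bth1 : bm (derive1 th) := admissible_bm 1 adm.
rewrite /I0T itg_itv EFin_itg; last first.
  apply: dom_indM; apply: bmD; apply: bmM => //; try exact: bm_S_time; try exact: bm_reac_time.
by rewrite -EFinD => -[] /eqP; rewrite addr_eq0 => /eqP.
Qed.

End OneSolution.
End Fixed.
End WeakIdentity.

(** * Energy of the difference of two weak solutions *)

Section UniqueEnergy.
Variable R : realType.
Local Notation leb := (@lebesgue_measure R).
Variables (sc : scaling R) (psi : R -> R) (T : R).
Hypotheses (psi_b : bm psi) (T0 : 0 < T).
Local Notation mu := (sc_mu sc).
Variables (v1 v2 : R -> R -> R) (B1 B2 : R).
Hypotheses (m1 : mf2 v1) (m2 : mf2 v2).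
Hypotheses (h1 : forall t x, `|v1 t x| <= B1) (h2 : forall t x, `|v2 t x| <= B2).
Hypotheses (s1 : wsol sc psi T v1) (s2 : wsol sc psi T v2).

Let D t x := v1 t x - v2 t x.
Let R0 t x := v1 t x + v2 t x - 1.
Let B := B1 + B2.
Let kap := B1 + B2 + 1.

Let B_ge0 : 0 <= B.
Proof. by have := normr_ge0 (v1 0 0); have := normr_ge0 (v2 0 0); have := h1 0 0; have := h2 0 0; rewrite /B; lra. Qed.
Let kap_ge0 : 0 <= kap. Proof. by move: B_ge0; rewrite /B /kap; lra. Qed.
Let mD : mf2 D. Proof. exact: mf2B. Qed.
Let DB t x : `|D t x| <= B.
Proof. by apply: le_trans (ler_normB _ _) _; exact: lerD. Qed.
Let mR0 : mf2 R0.
Proof. by apply: mf2B; [exact: mf2D|apply: mf2_fst; exact: mf_cst]. Qed.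
Let R0B t x : `|R0 t x| <= kap.
Proof.
apply: le_trans (ler_normB _ _) _; rewrite normr1 lerD2r.
by apply: le_trans (ler_normD _ _) _; exact: lerD.
Qed.
Let bD t : bm (D t). Proof. by split; [exact: mf2_l|exists B => x; exact: DB]. Qed.
Let bR0 t : bm (R0 t). Proof. by split; [exact: mf2_l|exists kap => x; exact: R0B]. Qed.
Let bv1 t : bm (v1 t). Proof. by split; [exact: mf2_l|exists B1 => x]. Qed.
Let bv2 t : bm (v2 t). Proof. by split; [exact: mf2_l|exists B2 => x]. Qed.

Let Kg := sc_K sc + 2 * mu * kap.
Let Cg := 4 * mu * kap * B.

Let Kg_ge0 : 0 <= Kg.
Proof. by rewrite /Kg addr_ge0 ?sc_K0// mulr_ge0// mulr_ge0// ltW// sc_mu0. Qed.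
Let Cg_ge0 : 0 <= Cg.
Proof. by rewrite /Cg !mulr_ge0// ltW// sc_mu0. Qed.

Section FixedEps.
Variable eps : R.
Hypothesis e01 : 0 < eps <= 1.
Let e0 : 0 < eps. Proof. by case/andP: e01. Qed.

Let b t y := reac sc eps (v1 t) y - reac sc eps (v2 t) y.
Let SDt t y := S (moll eps) (D t) y.
(** [SDt] is only measurable in time. [E] is its Lipschitz version, equal to it for almost every [t]
    at each [y]; the energy [V] is formed with [E] so that it has controlled increments, and [er]
    measures the discrepancy. *)
Let E t y := itg (fun s => ind 0 t s * b s y).
Let cl (t : R) := Num.max 0 (Num.min t T).
Let Ec t y := E (cl t) y.

Let cl_id t : 0 <= t <= T -> cl t = t.
Proof. by move=> /andP[? ?]; rewrite /cl min_l// max_r. Qed.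
Let cl01 t : 0 <= cl t <= T.
Proof. by rewrite /cl le_max lexx/= ge_max (ltW T0) ge_min lexx orbT. Qed.

Let mb : mf2 b. Proof. by apply: mf2B; exact: mf2_reac. Qed.
Let b_bound : exists2 C, 0 <= C & forall t y, `|b t y| <= C.
Proof.
have [C1 C10 H1] := reac_bound sc e0 m1 h1; have [C2 C20 H2] := reac_bound sc e0 m2 h2.
exists (C1 + C2) => [|t y]; first exact: addr_ge0.
by apply: le_trans (ler_normB _ _) _; exact: lerD.
Qed.

Let reac_diff t y : b t y = LSm sc eps (D t) y + mu * S (moll eps) (fun z => D t z * R0 t z) y.
Proof.
have [M M0 HM] := moll_mollifier R; have km := HM _ e0.
have dL := dom_shift (- y) (Lmoll_dom sc e0).
have bl (v : R -> R) : bm v -> bm (fun z => v z ^+ 2 - v z) by move=> bv; exact: bmB (bm_sqr bv) bv.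
have [n1 [C1 H1]] := bv1 t; have [n2 [C2 H2]] := bv2 t.
rewrite /b /reac.
have -> : LSm sc eps (D t) y = LSm sc eps (v1 t) y - LSm sc eps (v2 t) y.
  rewrite /LSm -itgB; [|exact: domM H1 dL|exact: domM H2 dL].
  by congr itg; apply/funext => z; rewrite /D; ring.
have -> : S (moll eps) (fun z => D t z * R0 t z) y =
   S (moll eps) (fun z => v1 t z ^+ 2 - v1 t z) y - S (moll eps) (fun z => v2 t z ^+ 2 - v2 t z) y.
  rewrite -(SB e0 km y (bl _ (bv1 t)) (bl _ (bv2 t))); congr (S _ _ y); apply/funext => z.
  by rewrite /D /R0; ring.
by ring.
Qed.

(** Both solutions have the same initial datum, so the initial terms cancel and the du Bois-Reymond
    lemma applies to the difference. *)
Let SDt_err y : itg (fun t => `|ind 0 T t * (SDt t y - E t y)|) = 0.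
Proof.
have [M M0 HM] := moll_mollifier R; have km := HM _ e0.
have ba1 := bm_S_time e0 m1 h1 y; have ba2 := bm_S_time e0 m2 h2 y.
have br1 := bm_reac_time sc e0 m1 h1 y; have br2 := bm_reac_time sc e0 m2 h2 y.
have eD t : SDt t y = S (moll eps) (v1 t) y - S (moll eps) (v2 t) y.
  exact: (SB e0 km y (bv1 t) (bv2 t)).
have bS : bm (fun t => SDt t y).
  by under eq_fun do rewrite eD; exact: bmB.
apply: (du_bois_reymond T0 bS); first exact: bmB br1 br2.
move=> th adm; have bth : bm th := admissible_bm 0 adm.
have bth1 : bm (derive1 th) := admissible_bm 1 adm.
have i1 := wsol_mollified psi_b e0 m1 h1 y s1 adm.
have i2 := wsol_mollified psi_b e0 m2 h2 y s2 adm.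
have -> : itg (fun t => ind 0 T t * (derive1 th t * SDt t y + th t * b t y)) =
  itg (fun t => ind 0 T t * (derive1 th t * S (moll eps) (v1 t) y + th t * reac sc eps (v1 t) y)) -
  itg (fun t => ind 0 T t * (derive1 th t * S (moll eps) (v2 t) y + th t * reac sc eps (v2 t) y)).
  rewrite -itgB; [|by apply: dom_indM; apply: bmD; exact: bmM|by apply: dom_indM; apply: bmD; exact: bmM].
  by congr itg; apply/funext => t; rewrite eD /b; ring.
by rewrite i1 i2 subrr.
Qed.

Let mEc : mf2 Ec.
Proof.
have [C C0 HC] := b_bound.
apply: (@measurable_caratheodory R E C T C0) => [t|t d y t0 d0 _].
  have h : measurable_fun setT (fun p : R * R => ind 0 t p.2 * b p.2 p.1).
    exact: (mf2M (mf2_snd (mf_ind 0 t)) (mf2_swap mb)).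
  exact: (@itg2_mf R (fun y s => ind 0 t s * b s y) h).
by apply: prim_lip => //; exact: mf2_r.
Qed.

Let rr t := itg (fun y => wt y * oscS (moll eps) (D t) y).
Let er t := itg (fun y => wt y * `|SDt t y - Ec t y|).
Let V t := itg (fun y => wt y * Ec t y ^+ 2).
Let G t := itg (fun y => wt y * (2 * Ec t y * b t y)).

Let mS : mf2 SDt. Proof. by apply: mf2_conv => //; exact: mkt_mf. Qed.

Let mosc : mf2 (fun t y => oscS (moll eps) (D t) y).
Proof.
apply: (@mf2_itg3 R (fun t y z => `|D t z - D t y| * moll eps (z - y))).
have p11 : measurable_fun setT (fun p : R * R * R => p.1.1) by exact: (measurableT_comp measurable_fst measurable_fst).
have p12 : measurable_fun setT (fun p : R * R * R => p.1.2) by exact: (measurableT_comp measurable_snd measurable_fst).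
apply: measurable_realfun.measurable_funM.
  apply: (measurableT_comp (mf_continuous (@norm_continuous _ _))).
  apply: measurable_realfun.measurable_funB.
    have h : measurable_fun setT (fun p : R * R * R => (p.1.1, p.2)) by apply: measurable_fun_pair.
    exact: (measurableT_comp mD h).
  have h : measurable_fun setT (fun p : R * R * R => (p.1.1, p.1.2)) by apply: measurable_fun_pair.
  exact: (measurableT_comp mD h).
have h : measurable_fun setT (fun p : R * R * R => p.2 - p.1.2) by exact: measurable_realfun.measurable_funB.
exact: (measurableT_comp (mkt_mf _ _ _ _) h).
Qed.

Let kmE : exists M, mollifier M eps (moll eps).
Proof. by have [M M0 HM] := moll_mollifier R; exists M; exact: HM. Qed.

Let SD_le t y : `|SDt t y| <= B.
Proof. by have [M km] := kmE; apply: (normr_S_le e0 km (bD t)) => z _; exact: DB. Qed.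

Let osc_ge0 t y : 0 <= oscS (moll eps) (D t) y.
Proof. by have [M [_ k0 _ _ _]] := kmE; apply: itg_ge0 => z; rewrite mulr_ge0. Qed.

Let osc_le t y : oscS (moll eps) (D t) y <= 2 * B.
Proof.
have [M km] := kmE; apply: le_trans (ler_norm _) _.
apply: (normr_S_le e0 km); first by apply: bm_abs; apply: bmB => //; exact: bm_cst.
by move=> z _; rewrite normr_id; apply: le_trans (ler_normB _ _) _; rewrite mulr_natl mulr2n lerD.
Qed.

Let wt_itg_bound (F : R -> R -> R) (C : R) : mf2 F -> (forall t y, `|F t y| <= C) ->
  bm (fun t => itg (fun y => wt y * F t y)).
Proof.
move=> mF FC; split.
  by apply: itg2_mf; apply: mf2M => //; apply: mf2_snd; exact: mf_wt.
exists (C * wtot R) => t; apply: normr_itg_wt => [|y].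
  by apply: mfM; [exact: mf_wt|exact: mf2_l].
by rewrite normrM mulrC (ger0_norm (wt_ge0 _)) ler_wpM2r// wt_ge0.
Qed.

Let E_lip C t d y : (forall t y, `|b t y| <= C) -> 0 <= t -> 0 <= d -> `|E (t + d) y - E t y| <= C * d.
Proof. by move=> HC t0 d0; apply: prim_lip => //; exact: mf2_r. Qed.

Let Ec_le C t y : (forall t y, `|b t y| <= C) -> `|Ec t y| <= C * T.
Proof.
move=> HC; have /andP[t0 tT] := cl01 t.
have C0 : 0 <= C := le_trans (normr_ge0 _) (HC 0 0).
have := E_lip y HC (lexx 0) t0; rewrite add0r (_ : E 0 y = 0).
  by rewrite subr0 => h; apply: le_trans h _; rewrite ler_wpM2l.
apply: itg_ind00; split; first exact: mf2_r.
by exists C.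
Qed.

Let er_bm : bm er.
Proof.
have [C C0 HC] := b_bound; apply: (@wt_itg_bound (fun t y => `|SDt t y - Ec t y|) (B + C * T)).
  by apply: mf2_abs; exact: mf2B.
by move=> t y; rewrite normr_id; apply: le_trans (ler_normB _ _) _; apply: lerD => //; exact: Ec_le.
Qed.

Let rr_bm : bm rr.
Proof.
apply: (@wt_itg_bound (fun t y => oscS (moll eps) (D t) y) (2 * B)) => // t y.
by rewrite ger0_norm.
Qed.

Let V_bm : bm V.
Proof.
have [C C0 HC] := b_bound; apply: (@wt_itg_bound (fun t y => Ec t y ^+ 2) ((C * T) ^+ 2)).
  exact: mf2M.
by move=> t y; rewrite normrX lerXn2r ?nnegrE// ?mulr_ge0 ?(ltW T0)//; exact: Ec_le.
Qed.

Let G_bm : bm G.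
Proof.
have [C C0 HC] := b_bound; apply: (@wt_itg_bound (fun t y => 2 * Ec t y * b t y) (2 * (C * T) * C)).
  by apply: mf2M => //; exact: mf2Z.
move=> t y; rewrite !normrM (ger0_norm (ler0n _ 2)); apply: ler_pM => //.
by rewrite ler_wpM2l//; exact: Ec_le.
Qed.

(** For each [y] the two versions agree at almost every time; Fubini turns this into a statement
    about almost every time, integrated over [y]. *)
Let er0 : itg (fun t => ind 0 T t * er t) = 0.
Proof.
have [C C0 HC] := b_bound.
have dF : dom2 (fun t y => ind 0 T t * (wt y * `|SDt t y - Ec t y|)).
  apply: (@dom2_ind R 0 T (fun t y => `|SDt t y - Ec t y|) (B + C * T)).
    by apply: mf2_abs; exact: mf2B.
  by move=> t y _; rewrite normr_id; apply: le_trans (ler_normB _ _) _; apply: lerD => //; exact: Ec_le.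
have eb t : bm (fun y => `|SDt t y - Ec t y|).
  apply: bm_abs; apply: bmB; split; try exact: mf2_l; [exists B => y; exact: SD_le|exists (C * T) => y; exact: Ec_le].
have -> : itg (fun t => ind 0 T t * er t) = itg (fun t => itg (fun y => ind 0 T t * (wt y * `|SDt t y - Ec t y|))).
  by congr itg; apply/funext => t; rewrite itgZ//; exact: dom_wtM.
rewrite (itg_fubini dF) -[RHS](itg0 R); congr itg; apply/funext => y.
have -> : itg (fun t => ind 0 T t * (wt y * `|SDt t y - Ec t y|)) = itg (fun t => wt y * `|ind 0 T t * (SDt t y - E t y)|).
  congr itg; apply/funext => t; rewrite normrM (ger0_norm (ind_ge0 _ _ _)) mulrCA.
  rewrite indE; have [tT|tT] := boolP (0 <= t <= T); last by rewrite !mul0r !mulr0.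
  by rewrite /Ec cl_id.
have bS : bm (fun t => SDt t y - Ec t y).
  apply: bmB; split; try exact: (mf2_r y); [exists B => t; exact: SD_le|exists (C * T) => t; exact: Ec_le].
rewrite itgZ ?SDt_err ?mulr0//.
have -> : (fun t => `|ind 0 T t * (SDt t y - E t y)|) = (fun t => `|ind 0 T t * (SDt t y - Ec t y)|).
  apply/funext => t; rewrite indE; have [tT|tT] := boolP (0 <= t <= T); last by rewrite !mul0r.
  by rewrite /Ec cl_id.
by apply: dom_abs; exact: dom_indM.
Qed.

(** The chain rule for the square of a function that is only Lipschitz in time. Over a step the
    square of the increment and the variation of the factor [Ec] are both O(d^2), so [V] minus the
    primitive of [G] is constant. *)
Let V_eq t : 0 <= t <= T -> V t = itg (fun s => ind 0 t s * G s).
Proof.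
have [C C0 HC] := b_bound.
pose P t := itg (fun s => ind 0 t s * G s).
pose Z t := V t - P t.
pose K := C ^+ 2 * wtot R + 2 * C * C * wtot R.
have K0 : 0 <= K by rewrite /K addr_ge0// mulr_ge0 ?wtot_ge0 ?sqr_ge0// !mulr_ge0.
have E00 y : E 0 y = 0 by apply: itg_ind00; split; [exact: mf2_r|exists C].
have Z0 : Z 0 = 0.
  rewrite /Z /P (itg_ind00 0 G_bm) subr0 /V -[RHS](itg0 R); congr itg; apply/funext => y.
  by rewrite /Ec cl_id ?E00 ?expr0n ?mulr0// lexx ltW.
suff HZ : forall s d, 0 <= s -> 0 <= d <= 1 -> s + d <= T -> `|Z (s + d) - Z s| <= K * d ^+ 2.
  move=> tT; have := step_le0 K0 HZ tT; rewrite Z0 /Z => /eqP; rewrite subr_eq0 => /eqP -> //.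
move=> s d s0 /andP[d0 d1] sdT.
have sd : s <= s + d by rewrite lerDl.
have sT : 0 <= s <= T by rewrite s0 (le_trans sd).
have sdT' : 0 <= s + d <= T by rewrite addr_ge0.
have bE t' : bm (Ec t') by split; [exact: mf2_l|exists (C * T) => y; exact: Ec_le].
have bbt t' : bm (b t') by split; [exact: mf2_l|exists C].
pose g r := itg (fun y => wt y * (2 * Ec s y * b r y)).
have mg2 : mf2 (fun r y => 2 * Ec s y * b r y).
  by apply: mf2M => //; apply: mf2_snd; apply: mfM; [exact: mf_cst|exact: mf2_l].
have bnd2 r y : `|2 * Ec s y * b r y| <= 2 * (C * T) * C.
  rewrite !normrM (ger0_norm (ler0n _ 2)); apply: ler_pM => //.
  by rewrite ler_wpM2l//; exact: Ec_le.
have gbm : bm g by exact: wt_itg_bound mg2 bnd2.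
(* With the factor [Ec] frozen at time [s] the expression is linear in the increment, and Fubini
   exchanges the integrals over time and space. *)
have Pg : itg (fun y => wt y * (2 * Ec s y * (Ec (s + d) y - Ec s y))) =
    itg (fun r => ind 0 (s + d) r * g r) - itg (fun r => ind 0 s r * g r).
  have sw t' : 0 <= t' <= T -> itg (fun y => wt y * (2 * Ec s y * Ec t' y)) = itg (fun r => ind 0 t' r * g r).
    move=> t'T; have dF : dom2 (fun r y => ind 0 t' r * (wt y * (2 * Ec s y * b r y))).
      by apply: dom2_ind => // r y _; exact: bnd2.
    have -> : itg (fun r => ind 0 t' r * g r) = itg (fun r => itg (fun y => ind 0 t' r * (wt y * (2 * Ec s y * b r y)))).
      congr itg; apply/funext => r; rewrite itgZ//; apply: dom_wtM.
      by split; [exact: (mf2_l r mg2)|exists (2 * (C * T) * C) => y].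
    rewrite (itg_fubini dF); congr itg; apply/funext => y.
    have -> : itg (fun r => ind 0 t' r * (wt y * (2 * Ec s y * b r y))) =
        itg (fun r => (wt y * (2 * Ec s y)) * (ind 0 t' r * b r y)).
      by congr itg; apply/funext => r; ring.
    rewrite itgZ; last by apply: dom_indM; split; [exact: (mf2_r y mb)|exists C].
    have -> : Ec t' y = E t' y by rewrite /Ec cl_id.
    by rewrite mulrA.
  rewrite -(sw _ sdT') -(sw _ sT) -itgB; [|by apply: dom_wtM; apply: bmM => //; exact: bmZ|by apply: dom_wtM; apply: bmM => //; exact: bmZ].
  by congr itg; apply/funext => y; ring.
have VV : V (s + d) - V s = itg (fun y => wt y * (Ec (s + d) y - Ec s y) ^+ 2) +
     itg (fun y => wt y * (2 * Ec s y * (Ec (s + d) y - Ec s y))).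
  rewrite /V -itgB; [|by apply: dom_wtM; exact: bm_sqr|by apply: dom_wtM; exact: bm_sqr].
  rewrite -itgD; first by congr itg; apply/funext => y; ring.
    by apply: dom_wtM; apply: bm_sqr; exact: bmB.
  by apply: dom_wtM; apply: bmM; [exact: bmZ|exact: bmB].
have a1 : `|itg (fun y => wt y * (Ec (s + d) y - Ec s y) ^+ 2)| <= (C * d) ^+ 2 * wtot R.
  apply: normr_itg_wt => [|y].
    by apply: mfM; [exact: mf_wt|apply: mf_sqr; apply: mfB; exact: mf2_l].
  rewrite normrM mulrC (ger0_norm (wt_ge0 _)) ler_wpM2r ?wt_ge0// normrX lerXn2r ?nnegrE ?mulr_ge0//.
  by rewrite /Ec !cl_id//; exact: E_lip.
have a2 : `|itg (fun r => ind 0 (s + d) r * (g r - G r)) - itg (fun r => ind 0 s r * (g r - G r)) - d * 0|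
    <= d * (2 * C * d * C * wtot R).
  apply: itg_ind_step => //; first exact: bmB.
  move=> r /andP[sr rsd]; rewrite subr0 /g /G -itgB; last 2 first.
  - by apply: dom_wtM; apply: bmM => //; exact: bmZ.
  - by apply: dom_wtM; apply: bmM => //; exact: bmZ.
  apply: normr_itg_wt => [|y].
    by apply: mfB; apply: mfM; try exact: mf_wt; apply: mfM; try exact: mf2_l; apply: mfM; try exact: mf_cst; exact: mf2_l.
  have -> : wt y * (2 * Ec s y * b r y) - wt y * (2 * Ec r y * b r y) = - (2 * (Ec r y - Ec s y) * b r y) * wt y by ring.
  rewrite normrM (ger0_norm (wt_ge0 _)) ler_wpM2r ?wt_ge0// normrN !normrM (ger0_norm (ler0n _ 2)) -!mulrA ler_wpM2l//.
  rewrite mulrA; apply: ler_pM => //.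
  have rs0 : 0 <= r - s by rewrite subr_ge0.
  have esr : s + (r - s) = r by ring.
  have rT : 0 <= r <= T by rewrite (le_trans s0 sr) (le_trans rsd).
  have := E_lip y HC s0 rs0; rewrite esr /Ec !cl_id// => h; apply: (le_trans h).
  by rewrite ler_wpM2l// lerBlDl.
have a3 t' : itg (fun r => ind 0 t' r * (g r - G r)) = itg (fun r => ind 0 t' r * g r) - P t'.
  rewrite /P -itgB; [|exact: dom_indM|exact: dom_indM].
  by congr itg; apply/funext => r; ring.
rewrite !a3 mulr0 subr0 in a2.
move: Pg VV a1 a2; rewrite /Z.
set x1 := V (s + d); set x2 := V s; set x3 := P (s + d); set x4 := P s.
set y1 := itg _; set y2 := itg _; set y3 := itg _; set y4 := itg _ => Pg VV a1 a2.
have -> : x1 - x3 - (x2 - x4) = y4 + (y2 - x3 - (y3 - x4)).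
  by have -> : x1 = x2 + (y4 + (y2 - y3)); [rewrite -Pg -VV; ring|ring].
apply: le_trans (ler_normD _ _) _; apply: le_trans (lerD a1 a2) _.
by rewrite le_eqVlt; apply/orP; left; apply/eqP; rewrite /K; ring.
Qed.

Let SD_bm t : bm (SDt t). Proof. by split; [exact: mf2_l|exists B => y; exact: SD_le]. Qed.
Let Ec_bm t : bm (Ec t).
Proof. by have [C C0 HC] := b_bound; split; [exact: mf2_l|exists (C * T) => y; exact: Ec_le]. Qed.
Let b_bm t : bm (b t). Proof. by have [C C0 HC] := b_bound; split; [exact: mf2_l|exists C]. Qed.

(* The energy inequality of the lattice operators passes to the limit [N -> oo] by consistency. *)
Let limit_energy t :
  itg (fun y => wt y * (2 * SDt t y * b t y)) <=
  Kg * itg (fun y => wt y * SDt t y ^+ 2) + Cg * rr t.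
Proof.
have [M km] := kmE; have [C C0 HC] := Lop_LSm sc e01.
have bDR : bm (fun z => D t z * R0 t z) by exact: bmM.
have bSDR := bm_S e0 km bDR.
apply/ler_addgt0Pr => e e_gt0.
pose A := 2 * B * (B * C) * wtot R.
have A0 : 0 <= A by rewrite /A !mulr_ge0 ?wtot_ge0.
pose N := (Num.truncn (A / e)).+1.
have N0 : (0 < N)%N by [].
have AN : A / N%:R <= e.
  have nb : A / e <= N%:R by apply: ltW; exact: truncnS_gt.
  by move: nb; rewrite ler_pdivrMr// ler_pdivrMr ?ltr0n// mulrC.
have := energy e0 km (sc_c0 sc N) (sc_al0 sc) (sc_be0 sc) (ltW (sc_mu0 sc)) kap_ge0 B_ge0
  (fun x => sc_wt sc N0 x) (bD t) (DB t) (bR0 t) (R0B t).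
rewrite -/(LN sc N) -/Kg -/Cg => h.
apply: le_trans (lerD h AN); rewrite -lerBlDl.
have bL : bm (LN sc N (S (moll eps) (D t))) by apply: bm_Lop; exact: (bm_S e0 km).
have b2S : bm (fun y => 2 * SDt t y) by exact: bmZ.
rewrite -itgB; last 2 first.
- by apply: dom_wtM; exact: bmM.
- by apply: dom_wtM; apply: bmM => //; apply: bmD => //; exact: bmZ.
apply: le_trans (ler_norm _) _; rewrite /A mulrAC; apply: normr_itg_wt => [|y].
  apply: mfB; apply: bm_mf; apply: bmM (bm_wt R) _; first exact: bmM.
  by apply: bmM => //; apply: bmD => //; exact: bmZ.
rewrite reac_diff.
have -> : wt y * (2 * SDt t y * (LSm sc eps (D t) y + mu * S (moll eps) (fun z => D t z * R0 t z) y)) -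
  wt y * (2 * S (moll eps) (D t) y * (LN sc N (S (moll eps) (D t)) y + mu * S (moll eps) (fun z => D t z * R0 t z) y)) =
  - (2 * SDt t y * (LN sc N (S (moll eps) (D t)) y - LSm sc eps (D t) y)) * wt y by rewrite /SDt; ring.
rewrite normrM (ger0_norm (wt_ge0 _)) ler_wpM2r ?wt_ge0// normrN !normrM (ger0_norm (ler0n _ 2)).
rewrite -!mulrA ler_wpM2l//; apply: ler_pM => //.
by have := HC N N0 (D t) B y (mf2_l t mD) (DB t); rewrite mulrA.
Qed.

Let SD_energy_le Cb t : (forall t y, `|b t y| <= Cb) ->
  itg (fun y => wt y * SDt t y ^+ 2) <= V t + (B + Cb * T) * er t.
Proof.
move=> HCb; have be : bm (fun y => `|SDt t y - Ec t y|) by apply: bm_abs; exact: bmB.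
rewrite /V /er -itgZ; last exact: dom_wtM.
have bs1 := bm_sqr (SD_bm t); have bs2 := bm_sqr (Ec_bm t).
rewrite -itgD; [|exact: dom_wtM|by apply: domZ; exact: dom_wtM].
apply: le_itg; [exact: dom_wtM|by apply: domD; [exact: dom_wtM|apply: domZ; exact: dom_wtM]|move=> y].
have -> : wt y * Ec t y ^+ 2 + (B + Cb * T) * (wt y * `|SDt t y - Ec t y|) =
  wt y * (Ec t y ^+ 2 + (B + Cb * T) * `|SDt t y - Ec t y|) by ring.
rewrite ler_wpM2l ?wt_ge0// -lerBlDl.
have -> : SDt t y ^+ 2 - Ec t y ^+ 2 = (SDt t y + Ec t y) * (SDt t y - Ec t y) by ring.
apply: le_trans (ler_norm _) _; rewrite normrM ler_wpM2r//.
by apply: le_trans (ler_normD _ _) _; apply: lerD => //; exact: Ec_le.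
Qed.

(** The replacement of [Ec] by [SDt], for which the energy inequality is known, costs a multiple of
    [er]. That multiple may depend on [eps], since [er] integrates to 0. *)
Let C2g : exists2 C, 0 <= C & forall t, 0 <= t <= T -> G t <= Kg * V t + Cg * rr t + C * er t.
Proof.
have [Cb Cb0 HCb] := b_bound.
exists (2 * Cb + Kg * (B + Cb * T)) => [|t tT].
  by rewrite addr_ge0 ?mulr_ge0// addr_ge0// mulr_ge0// ltW.
have be : bm (fun y => `|SDt t y - Ec t y|) by apply: bm_abs; exact: bmB.
have b2S : bm (fun y => 2 * SDt t y * b t y) by apply: bmM => //; exact: bmZ.
have b2E : bm (fun y => 2 * Ec t y * b t y) by apply: bmM => //; exact: bmZ.
have g1 : G t <= itg (fun y => wt y * (2 * SDt t y * b t y)) + 2 * Cb * er t.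
  rewrite /G /er -itgZ; last exact: dom_wtM.
  rewrite -itgD; [|exact: dom_wtM|by apply: domZ; exact: dom_wtM].
  apply: le_itg; [exact: dom_wtM|by apply: domD; [exact: dom_wtM|apply: domZ; exact: dom_wtM]|move=> y].
  have -> : wt y * (2 * SDt t y * b t y) + 2 * Cb * (wt y * `|SDt t y - Ec t y|) =
    wt y * (2 * SDt t y * b t y + 2 * (Cb * `|SDt t y - Ec t y|)) by ring.
  rewrite ler_wpM2l ?wt_ge0// -lerBlDl.
  have -> : 2 * Ec t y * b t y - 2 * SDt t y * b t y = 2 * (- (b t y * (SDt t y - Ec t y))) by ring.
  rewrite ler_wpM2l//; apply: le_trans (ler_norm _) _; rewrite normrN normrM.
  by rewrite ler_wpM2r.
have g2 := SD_energy_le t HCb.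
have g3 : Kg * itg (fun y => wt y * SDt t y ^+ 2) <= Kg * (V t + (B + Cb * T) * er t) by rewrite ler_wpM2l.
apply: (le_trans g1); have := limit_energy t; move: g3; set x := itg _; set z := Kg * itg _ => g3 g4.
have -> : Kg * V t + Cg * rr t + (2 * Cb + Kg * (B + Cb * T)) * er t =
  Kg * (V t + (B + Cb * T) * er t) + Cg * rr t + 2 * Cb * er t by ring.
by rewrite lerD2r (le_trans g4)// lerD2r.
Qed.

Let rho := itg (fun t => ind 0 T t * rr t).

Let rr_ge0 t : 0 <= rr t. Proof. by apply: itg_wtM_ge0. Qed.
Let er_ge0 t : 0 <= er t. Proof. by apply: itg_wtM_ge0. Qed.

Let itg_ind_mono (g : R -> R) s t : bm g -> (forall r, 0 <= g r) -> s <= t ->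
  itg (fun r => ind 0 s r * g r) <= itg (fun r => ind 0 t r * g r).
Proof.
move=> bg g0 st; apply: le_itg; [exact: dom_indM|exact: dom_indM|move=> r].
rewrite ler_wpM2r// !indE; have [/andP[-> rs]|_] := boolP (0 <= r <= s); last exact: ler0n.
by rewrite (le_trans rs st).
Qed.

(** The source [rr] is only measurable in time and small only in mean. Its primitive is therefore
    subtracted first, and Gronwall is applied to [W], whose source is a constant multiple of
    [rho]. *)
Let V_gronwall t : 0 <= t <= T -> V t <= (expR (Kg * T) * (T * (Kg * Cg)) + Cg) * rho.
Proof.
move=> tT; have [C2 C20 H2] := C2g; have [Cb Cb0 HCb] := b_bound.
pose rt s := itg (fun r => ind 0 s r * rr r).
have rho0 : 0 <= rho by apply: itg_ge0 => s; rewrite mulr_ge0// ind_ge0.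
have rtle s : s <= T -> rt s <= rho by move=> sT; exact: itg_ind_mono.
have rtge s : 0 <= rt s by apply: itg_ge0 => r; apply: mulr_ge0; [exact: ind_ge0|exact: rr_ge0].
have et s : s <= T -> itg (fun r => ind 0 s r * er r) = 0.
  move=> sT; apply/le_anti/andP; split; last by apply: itg_ge0 => r; rewrite mulr_ge0// ind_ge0.
  by apply: le_trans (itg_ind_mono er_bm er_ge0 sT) _; rewrite er0.
have [mG [BG GB]] := G_bm; have [mV [BV VB]] := V_bm.
have BG0 : 0 <= BG := le_trans (normr_ge0 _) (GB 0).
pose W s := V s - Cg * rt s.
have T00 : 0 <= (0 : R) <= T by rewrite lexx (ltW T0).
have V0 : V 0 = 0 by rewrite (V_eq T00); exact: itg_ind00 G_bm.
have rt0 : rt 0 = 0 by exact: itg_ind00.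
have W0 : W 0 <= 0 by rewrite /W V0 rt0 mulr0 subrr.
have E0' : 0 <= Kg * Cg * rho by apply: mulr_ge0 => //; exact: mulr_ge0.
have CC0 : 0 <= Kg * BG by exact: mulr_ge0.
have step s d : 0 <= s -> 0 <= d <= 1 -> s + d <= T ->
    W (s + d) <= (1 + Kg * d) * W s + d * (Kg * Cg * rho) + Kg * BG * d ^+ 2.
  move=> s0 /andP[d0 d1] sdT.
  have sd : s <= s + d by rewrite lerDl.
  have sT : 0 <= s <= T by rewrite s0 (le_trans sd).
  have sdT' : 0 <= s + d <= T by rewrite addr_ge0.
  pose q r := G r - Cg * rr r - C2 * er r.
  have bq : bm q by apply: bmB; [apply: bmB => //; exact: bmZ|exact: bmZ].
  have qle r : s <= r <= s + d -> q r <= Kg * V s + Kg * (BG * d).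
    move=> /andP[sr rsd]; have rT : 0 <= r <= T by rewrite (le_trans s0 sr) (le_trans rsd).
    have := H2 r rT; rewrite /q => h.
    have Vl : V r <= V s + BG * d.
      have rs0 : 0 <= r - s by rewrite subr_ge0.
      have esr : s + (r - s) = r by ring.
      have := prim_lip mG GB s0 rs0; rewrite esr -!V_eq// => hh.
      rewrite -lerBlDl; apply: le_trans (ler_norm _) (le_trans hh _).
      by rewrite ler_wpM2l// lerBlDl.
    have h' : Kg * V r <= Kg * (V s + BG * d) by apply: ler_wpM2l.
    by rewrite -mulrDr; apply: le_trans h'; rewrite 2!lerBlDr addrAC.
  have hI : itg (fun r => ind 0 (s + d) r * q r) - itg (fun r => ind 0 s r * q r) <= d * (Kg * V s + Kg * (BG * d)).
    set m := Kg * V s + _ in qle *.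
    have -> : d * m = itg (fun r => m * (ind 0 (s + d) r - ind 0 s r)).
      rewrite itgZ; last by apply: domB; exact: dom_ind.
      rewrite itgB ?itg_ind//; [ring|by case/andP: sdT'|exact: dom_ind|exact: dom_ind].
    rewrite -itgB; [|exact: dom_indM|exact: dom_indM].
    apply: le_itg; [by apply: domB; exact: dom_indM|by apply: domZ; apply: domB; exact: dom_ind|move=> r].
    rewrite -mulrBl mulrC !indE.
    have [r1|r1] := boolP (0 <= r <= s); have [r2|r2] := boolP (0 <= r <= s + d).
    - by rewrite subrr !mulr0.
    - by case/andP: r1 => r3 r4; move: r2; rewrite r3 (le_trans r4 sd).
    - rewrite subr0 !mulr1; apply: qle; case/andP: r2 => r3 ->; rewrite andbT.
      by move: r1; rewrite r3/= -ltNge => /ltW.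
    - by rewrite subrr !mulr0.
  have qI s' : 0 <= s' <= T -> itg (fun r => ind 0 s' r * q r) = W s'.
    move=> s'T; rewrite /W (V_eq s'T).
    have -> : itg (fun r => ind 0 s' r * q r) = itg (fun r => ind 0 s' r * G r - Cg * (ind 0 s' r * rr r) - C2 * (ind 0 s' r * er r)).
      by congr itg; apply/funext => r; rewrite /q; ring.
    rewrite itgB; [|by apply: domB; [exact: dom_indM|apply: domZ; exact: dom_indM]|by apply: domZ; exact: dom_indM].
    rewrite itgB; [|exact: dom_indM|by apply: domZ; exact: dom_indM].
    rewrite !itgZ; [|exact: dom_indM|exact: dom_indM].
    by rewrite et ?mulr0 ?subr0//; case/andP: s'T.
  rewrite !qI// in hI.
  have VW : V s = W s + Cg * rt s by rewrite /W subrK.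
  have Vle : d * (Kg * V s) <= d * (Kg * W s + Kg * Cg * rho).
    have KC : 0 <= Kg * Cg by exact: mulr_ge0.
    rewrite ler_wpM2l// VW mulrDr lerD2l mulrA ler_wpM2l//.
    by apply: rtle; case/andP: sT.
  move: hI Vle; set w1 := W _; set w2 := W _ => hI Vle.
  have -> : (1 + Kg * d) * w2 + d * (Kg * Cg * rho) + Kg * BG * d ^+ 2 =
    w2 + (d * (Kg * w2 + Kg * Cg * rho) + d * (Kg * (BG * d))) by ring.
  rewrite -lerBlDl; apply: (le_trans hI); rewrite mulrDr lerD2r//.
have := discrete_gronwall Kg_ge0 E0' CC0 (lexx 0) W0 step tT.
rewrite add0r => hW.
have -> : V t = W t + Cg * rt t by rewrite /W subrK.
rewrite mulrDl; apply: lerD; last by rewrite ler_wpM2l// rtle//; case/andP: tT.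
apply: (le_trans hW); case/andP: tT => t0 tT.
have -> : expR (Kg * T) * (T * (Kg * Cg)) * rho = expR (Kg * T) * (T * (Kg * Cg * rho)) by ring.
apply: ler_pM; [exact: expR_ge0|exact: mulr_ge0| |].
  by rewrite ler_expR ler_wpM2l.
by rewrite ler_wpM2r.
Qed.

Let unique_eps_aux (eta : R) : 0 < eta ->
  itg (fun t => ind 0 T t * itg (fun y => wt y * `|D t y|)) <=
  T * (eta * wtot R + ((expR (Kg * T) * (T * (Kg * Cg)) + Cg) * rho) / eta) + rho.
Proof.
move=> eta0; have [M km] := kmE; have [Cb Cb0 HCb] := b_bound.
set C3 := _ + Cg.
have bI : bm (fun t => itg (fun y => wt y * `|D t y|)).
  by apply: (@wt_itg_bound (fun t y => `|D t y|) B); [exact: mf2_abs|move=> t y; rewrite normr_id].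
have hp t : 0 <= t <= T -> itg (fun y => wt y * `|D t y|) <=
    (eta * wtot R + C3 * rho / eta) + (rr t + (B + Cb * T) / eta * er t).
  move=> tT; apply: le_trans (itg_wt_abs_le_sqr e0 km (bD t) eta0) _.
  have g2 := SD_energy_le t HCb.
  have := V_gronwall tT; rewrite -/C3 => hV.
  have h3 : itg (fun y => wt y * SDt t y ^+ 2) / eta <= (C3 * rho + (B + Cb * T) * er t) / eta.
    by rewrite ler_pM2r ?invr_gt0//; apply: (le_trans g2); rewrite lerD2r.
  rewrite -/(rr t); move: h3; set z := itg _ / eta => h3.
  rewrite mulrAC -/(rr t); move: h3; rewrite mulrDl => h3; lra.
have b1 : bm (fun t => rr t + (B + Cb * T) / eta * er t) by apply: bmD => //; exact: bmZ.
apply: (@le_trans _ _ (itg (fun t => ind 0 T t * ((eta * wtot R + C3 * rho / eta) + (rr t + (B + Cb * T) / eta * er t))))).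
  apply: le_itg; [exact: dom_indM|by apply: dom_indM; apply: bmD => //; exact: bm_cst|move=> t].
  by rewrite indE; have [tT|tT] := boolP (0 <= t <= T); [rewrite !mul1r; exact: hp|rewrite !mul0r].
set Q := eta * wtot R + _.
have -> : itg (fun t => ind 0 T t * (Q + (rr t + (B + Cb * T) / eta * er t))) =
   itg (fun t => Q * ind 0 T t + (ind 0 T t * rr t + (B + Cb * T) / eta * (ind 0 T t * er t))).
  by congr itg; apply/funext => t; ring.
rewrite itgD; [|by apply: domZ; exact: dom_ind|by apply: domD; [exact: dom_indM|apply: domZ; exact: dom_indM]].
rewrite itgD; [|exact: dom_indM|by apply: domZ; exact: dom_indM].
rewrite itgZ ?itg_ind//; [|exact: ltW|exact: dom_ind].
rewrite itgZ; last exact: dom_indM.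
by rewrite er0 mulr0 addr0 subr0 mulrC.
Qed.

(** The constants in front do not depend on [eps]: with [eta] fixed the oscillation integral can be
    sent to 0. *)
Lemma unique_eps (eta : R) : 0 < eta ->
  itg (fun t => ind 0 T t * itg (fun y => wt y * `|D t y|)) <=
  T * (eta * wtot R) + (T * (expR (Kg * T) * (T * (Kg * Cg)) + Cg) / eta + 1) *
     itg (fun t => ind 0 T t * itg (fun y => wt y * oscS (moll eps) (D t) y)).
Proof.
move=> eta0; apply: (le_trans (unique_eps_aux eta0)).
rewrite -/rho; set C3 := _ + Cg; rewrite le_eqVlt; apply/orP; left; apply/eqP; ring.
Qed.

Lemma osc_bm : bm (fun t => itg (fun y => wt y * oscS (moll eps) (D t) y)).
Proof. exact: rr_bm. Qed.

Lemma osc_bound t y : `|oscS (moll eps) (D t) y| <= 2 * B.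
Proof. by rewrite ger0_norm. Qed.

Lemma osc_mf t : mf (oscS (moll eps) (D t)).
Proof. exact: (mf2_l t mosc). Qed.

End FixedEps.

(** Dominated convergence in space for each fixed time, by Lebesgue points, and then in time. *)
Lemma osc_cvg0 : itg (fun t => ind 0 T t * itg (fun y => wt y * oscS (@moll R n.+1%:R^-1) (D t) y)) @[n --> \oo] --> (0 : R).
Proof.
have en n : 0 < (n.+1%:R^-1 : R) <= 1.
  by apply/andP; split; [rewrite invr_gt0 ltr0n|rewrite invf_le1 ?ler1n ?ltr0n].
have inner t : itg (fun y => wt y * oscS (@moll R n.+1%:R^-1) (D t) y) @[n --> \oo] --> (0 : R).
  apply: (@itg_dominated R (fun n y => wt y * oscS (@moll R n.+1%:R^-1) (D t) y) (2 * B)).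
  - by move=> n; apply: mfM; [exact: mf_wt|exact: osc_mf].
  - by move=> n y; rewrite normrM mulrC (ger0_norm (wt_ge0 _)) ler_wpM2r ?wt_ge0//; exact: osc_bound.
  apply: (@filterS _ _ (ae_filter_ringOfSetsType leb) _ _ _ (oscS_cvg0 (bD t))) => y oy.
  by rewrite -(mulr0 (wt y)); apply: cvgMl_tmp.
pose A := 1 + (`|0 : R| + `|T|) ^+ 2.
have A0 : 0 <= A by rewrite /A addr_ge0 ?sqr_ge0.
apply: (@itg_dominated R (fun n t => ind 0 T t * itg (fun y => wt y * oscS (@moll R n.+1%:R^-1) (D t) y)) (A * (2 * B * wtot R))).
- by move=> n; apply: mfM; [exact: mf_ind|apply: bm_mf; exact: osc_bm].
- move=> n t; rewrite normrM mulrAC; apply: ler_pM => //.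
    by rewrite ger0_norm ?ind_ge0//; exact: ind_le_wt.
  apply: normr_itg_wt => [|y]; first by apply: mfM; [exact: mf_wt|exact: osc_mf].
  by rewrite normrM mulrC (ger0_norm (wt_ge0 _)) ler_wpM2r ?wt_ge0//; exact: osc_bound.
apply: aeW => t; rewrite -[X in _ --> X](mulr0 (ind 0 T t)); apply: cvgMl_tmp; exact: inner.
Qed.

Lemma unique_L1 : itg (fun t => ind 0 T t * itg (fun y => wt y * `|D t y|)) = 0.
Proof.
have en n : 0 < (n.+1%:R^-1 : R) <= 1.
  by apply/andP; split; [rewrite invr_gt0 ltr0n|rewrite invf_le1 ?ler1n ?ltr0n].
apply/le_anti/andP; split; last first.
  by apply: itg_ge0 => t; rewrite mulr_ge0 ?ind_ge0//; apply: itg_wtM_ge0.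
set Q := itg _.
have H eta : 0 < eta -> Q <= T * (eta * wtot R).
  move=> eta0; set C4 := T * (expR (Kg * T) * (T * (Kg * Cg)) + Cg) / eta + 1.
  pose a n := T * (eta * wtot R) + C4 * itg (fun t => ind 0 T t * itg (fun y => wt y * oscS (@moll R n.+1%:R^-1) (D t) y)).
  have ca : a @ \oo --> (T * (eta * wtot R) : R).
    rewrite -[X in _ --> X]addr0 -(mulr0 C4); apply: cvgD; first exact: cvg_cst.
    by apply: cvgMl_tmp; exact: osc_cvg0.
  by apply: (cvgr_to_ge ca); apply: nearW => n; exact: (unique_eps (en n) eta0).
apply/ler_addgt0Pr => e e_gt0; rewrite add0r.
have W0 := wtot_ge0 R; have W1 : 0 < wtot R + 1 by rewrite ltr_wpDl.
have eta0 : 0 < e / (T * (wtot R + 1)) by rewrite divr_gt0// mulr_gt0.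
apply: (le_trans (H _ eta0)).
have -> : T * (e / (T * (wtot R + 1)) * wtot R) = e * (wtot R / (wtot R + 1)).
  by field; rewrite !gt_eqF.
by rewrite ler_piMr ?(ltW e_gt0)// ler_pdivrMr// mul1r lerDl.
Qed.

End UniqueEnergy.

Section Uniqueness.
Variable R : realType.
Local Notation leb := (@lebesgue_measure R).
Variables (sc : scaling R) (psi : R -> R) (T : R).
Hypotheses (psi_b : bm psi) (T0 : 0 < T).

(** A competitor is controlled on [0, T] only. Extending it by 0 makes it globally bounded and
    measurable without changing its weak formulation. *)
Lemma bdd_meas_extend (v : R -> R -> R) : bdd_meas T v ->
  mf2 (fun t x => ind 0 T t * v t x) /\ exists B, forall t x, `|ind 0 T t * v t x| <= B.
Proof.
move=> [mv [C HC]]; split; last first.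
  exists `|C| => t x; rewrite indE; have [tT|tT] := boolP (0 <= t <= T); last by rewrite mul0r normr0.
  by rewrite mul1r (le_trans (HC t x tT))// ler_norm.
have mI : measurable (I0T T `*` [set: R]) by apply: measurableX => //; exact: measurable_itv.
have := (measurable_restrictT (fun p : R * R => v p.1 p.2) mI).1 mv.
rewrite /mf2; congr (measurable_fun _ _); apply/funext => p.
rewrite patchE indE; case: ifPn => [/set_mem[]|/negP H].
  by rewrite /I0T/= in_itv/= => -> _; rewrite mul1r.
have [pT|pT] := boolP (0 <= p.1 <= T); last by rewrite mul0r.
by exfalso; apply: H; apply: mem_set; split => //; rewrite /I0T/= in_itv/= pT.
Qed.

Lemma wsol_unique (u v : R -> R -> R) (B : R) : mf2 u -> (forall t x, `|u t x| <= B) ->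
  wsol sc psi T u -> bdd_meas T v -> wsol sc psi T v ->
  (leb \x leb)%E.-negligible [set p : R * R | 0 <= p.1 <= T /\ u p.1 p.2 != v p.1 p.2].
Proof.
move=> mu2 uB su bv sv; have [mv' [C HC]] := bdd_meas_extend bv.
pose v' t x := ind 0 T t * v t x.
have sv' : wsol sc psi T v'.
  move=> f tf; apply: etrans (sv f tf); apply: (f_equal2 adde _ erefl); apply: eq_integral => t /set_mem.
  by rewrite /I0T/= in_itv/= => tT; apply: eq_integral => x _; rewrite /v' indE tT mul1r.
have L := unique_L1 psi_b T0 mu2 mv' uB HC su sv'.
have DB t x : `|u t x - v' t x| <= B + C.
  by apply: le_trans (ler_normB _ _) _; apply: lerD; [exact: uB|exact: HC].
have mD : mf2 (fun t x => u t x - v' t x) by exact: mf2B.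
have dF : dom2 (fun t x => ind 0 T t * (wt x * (u t x - v' t x))).
  by apply: dom2_ind mD _ => t x _; exact: DB.
have N := itg2_negligible dF.
apply: negligibleS (N _) => [[t x]/= [tT neq]|].
  move: neq; apply: contra; rewrite indE tT mul1r mulf_eq0 gt_eqF ?wt_gt0//= subr_eq0.
  by rewrite /v' indE tT mul1r.
rewrite -[RHS]L; congr itg; apply/funext => t.
rewrite -itgZ; last first.
  by apply: dom_wtM; apply: bm_abs; split; [exact: (mf2_l t mD)|exists (B + C) => x; exact: DB].
congr itg; apply/funext => x.
by rewrite !normrM (ger0_norm (ind_ge0 _ _ _)) (ger0_norm (wt_ge0 _)).
Qed.

End Uniqueness.

(** * A maximal inequality for the Markov chain *)

Section JumpRates.
Variable R : realType.
Variables (N : nat) (alpha beta muN : R).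
Hypotheses (al0 : 0 <= alpha) (be0 : 0 <= beta) (mu0 : 0 <= muN).
Local Notation G := (@gen R N alpha beta muN).
Implicit Types (x y : config N) (g : config N -> R).

(** All transitions as one finite type, so that the generator is a single finite sum. Transitions
    that the configuration forbids receive rate 0. *)
Definition move := (('I_N * bool) + ('I_N * 'I_N))%type.

Definition rate x (e : move) : R :=
  match e with
  | inl p => if p.2 then alpha else beta
  | inr p => if (p.2 != p.1) && (x p.2 < x p.1)%R then muN / N%:R else 0
  end.

Definition target x (e : move) : config N :=
  match e with
  | inl p => upd x p.1 (if p.2 then x p.1 + 1 else x p.1 - 1)%R
  | inr p => upd x p.1 (x p.2)
  end.

Lemma rate_ge0 x e : 0 <= rate x e.
Proof. by case: e => [[i []]|[i j]] //=; case: ifP => // _; rewrite mulr_ge0. Qed.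

Lemma genE g x : G g x = \sum_(e : move) rate x e * (g (target x e) - g x).
Proof.
rewrite (big_sumType _ predT) /gen; congr (_ + _).
  rewrite -(pair_bigA _ (fun i b => rate x (inl (i, b)) * (g (target x (inl (i, b))) - g x))) /=.
  by apply: eq_bigr => i _; rewrite big_bool.
rewrite -(pair_bigA _ (fun i j => rate x (inr (i, j)) * (g (target x (inr (i, j))) - g x))) /=.
apply: eq_bigr => i _; rewrite big_mkcond; apply: eq_bigr => j _ /=.
by case: eqP => //= _; [rewrite mul0r|case: ifP => _; rewrite ?mul0r// mulrC].
Qed.

Definition Rtot : R := #|{: move}|%:R * (alpha + beta + muN).

Lemma Rtot_ge0 : 0 <= Rtot. Proof. by rewrite mulr_ge0// !addr_ge0. Qed.

Lemma rate_sum x : \sum_(e : move) rate x e <= Rtot.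
Proof.
rewrite /Rtot mulr_natl -sumr_const; apply: ler_sum => e _.
case: e => [[i []]|[i j]] /=.
- by rewrite -addrA lerDl addr_ge0.
- by rewrite -addrA addrCA lerDl addr_ge0.
case: ifP => _; last by rewrite !addr_ge0.
have : muN / N%:R <= muN.
  case: N i j => [[//]|n i j]; rewrite ler_pdivrMr ?ltr0n// ler_peMr// ler1n//.
by move=> h; apply: (le_trans h); rewrite lerDr addr_ge0.
Qed.

Lemma gen_bound g M : (forall y, `|g y| <= M) -> forall x, `|G g x| <= 2 * Rtot * M.
Proof.
move=> gM x; have M0 : 0 <= M := le_trans (normr_ge0 _) (gM x).
rewrite genE; apply: le_trans (ler_norm_sum _ _ _) _.
apply: (@le_trans _ _ (\sum_(e : move) rate x e * (2 * M))).
  apply: ler_sum => e _; rewrite normrM ger0_norm ?rate_ge0// ler_wpM2l ?rate_ge0//.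
  by apply: le_trans (ler_normB _ _) _; rewrite mulr_natl mulr2n lerD.
rewrite -mulr_suml mulrAC mulrC ler_wpM2l ?mulr_ge0//.
by rewrite rate_sum.
Qed.

Lemma gen_affine g (a b : R) x : G (fun y => a + b * g y) x = b * G g x.
Proof.
rewrite !genE mulr_sumr; apply: eq_bigr => e _; ring.
Qed.

Definition dirac1 y : config N -> R := fun z => if z == y then 1 else 0.

Lemma iter_gen_bound y n x : `|iter n G (dirac1 y) x| <= (2 * Rtot) ^+ n.
Proof.
elim: n x => [|n IH] x; first by rewrite /= /dirac1 expr0; case: ifP; rewrite ?normr1 ?normr0.
by rewrite iterS exprS; exact: gen_bound.
Qed.

(** The generator is bounded for the supremum norm by [B = 2 Rtot], so the exponential series
    converges, and for [t <= 1] its terms of order at least 2 sum to at most [e^B t^2], uniformly in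
    both states. *)
Lemma trans_taylor : exists2 C, 0 <= C & forall x y t, 0 <= t <= 1 ->
  `|@trans R N alpha beta muN t x y - (dirac1 y x + t * G (dirac1 y) x)| <= C * t ^+ 2.
Proof.
pose B := 2 * Rtot; have B0 : 0 <= B by rewrite mulr_ge0// Rtot_ge0.
exists (expR B) => [|x y t /andP[t0 t1]]; first exact: expR_ge0.
pose a (n : nat) : R := t ^+ n / (n`!)%:R * iter n G (dirac1 y) x.
have ab n : `|a n| <= exp_coeff (B * t) n.
  rewrite /a /exp_coeff /= exprMn normrM ger0_norm; last by rewrite mulr_ge0// exprn_ge0.
  rewrite mulrAC ler_wpM2r ?invr_ge0// mulrC ler_wpM2r ?exprn_ge0//; exact: iter_gen_bound.
have ca : cvgn (series a).
  apply: normed_cvg; apply: (series_le_cvg _ _ ab) => [n|n|]; rewrite ?normr_ge0//.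
    exact: le_trans (normr_ge0 _) (ab n).
  exact: is_cvg_series_exp_coeff.
have trE : @trans R N alpha beta muN t x y = limn (series a) by [].
have part n : `|series a (n.+2) - (a 0%N + a 1%N)| <= expR B * t ^+ 2.
  rewrite /series /= big_nat_recl// big_nat_recl// addrA [X in X - _]addrC addrK.
  apply: le_trans (ler_norm_sum _ _ _) _.
  apply: (@le_trans _ _ (\sum_(0 <= i < n) exp_coeff B i.+2 * t ^+ 2)).
    apply: ler_sum => i _; apply: le_trans (ab _) _; rewrite /exp_coeff /= exprMn mulrAC ler_wpM2l//.
      by rewrite mulr_ge0 ?exprn_ge0// invr_ge0.
    by rewrite -addn2 exprD ler_piMl ?exprn_ge0// exprn_ile1.
  rewrite -mulr_suml ler_wpM2r ?exprn_ge0//.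
  have eg0 i : 0 <= exp_coeff B i by rewrite /exp_coeff /= mulr_ge0 ?exprn_ge0// invr_ge0.
  apply: (@le_trans _ _ (series (exp_coeff B) n.+2)).
    by rewrite /series /= big_nat_recl// big_nat_recl// addrA lerDr addr_ge0.
  apply: nondecreasing_cvgn_le; last exact: is_cvg_series_exp_coeff.
  by apply/nondecreasing_seqP => k; rewrite /series /= big_nat_recr//= lerDl.
have c0 : dirac1 y x + t * G (dirac1 y) x = a 0%N + a 1%N.
  by rewrite /a /= expr0 expr1 fact0 factS fact0 mul1n !divr1 mul1r.
rewrite trE c0; apply: (@cvgr_to_le _ \oo _ R (fun n => `|series a n - (a 0%N + a 1%N)|)).
  by apply: cvg_norm; apply: cvgB; [exact: ca|exact: cvg_cst].
by exists 2%N => // -[|[|n]] // _; exact: part.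
Qed.

Definition nbrs x : seq (config N) := undup (x :: [seq target x e | e <- enum {: move}]).

Lemma nbrs_size x : (size (nbrs x) <= #|{: move}|.+1)%N.
Proof. by apply: leq_trans (size_undup _) _; rewrite /= size_map -cardE. Qed.

Lemma sum_dirac1 (s : seq (config N)) z g : uniq s -> z \in s ->
  \sum_(y <- s) dirac1 y z * g y = g z.
Proof.
move=> us zs; rewrite (bigD1_seq z)//= big1 => [|y yz].
  by rewrite /dirac1 eqxx mul1r addr0.
by rewrite /dirac1 eq_sym (negbTE yz) mul0r.
Qed.

(** A state and its possible successors carry the whole first-order expansion of the semigroup; sums
    over the infinite state space can thus be cut to a finite list. *)
Lemma sum_nbrs x t g : \sum_(y <- nbrs x) (dirac1 y x + t * G (dirac1 y) x) * g y = g x + t * G g x.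
Proof.
have un : uniq (nbrs x) by exact: undup_uniq.
have xn : x \in nbrs x by rewrite mem_undup inE eqxx.
have tn e : target x e \in nbrs x.
  by rewrite mem_undup inE; apply/orP; right; apply: map_f; rewrite mem_enum.
under eq_bigr do rewrite mulrDl.
rewrite big_split /= sum_dirac1//; congr (_ + _).
under eq_bigr do rewrite -mulrA genE mulr_suml.
rewrite -mulr_sumr exchange_big /= genE; congr (_ * _); apply: eq_bigr => e _.
rewrite -(sum_dirac1 g un (tn e)) -(sum_dirac1 g un xn) -sumrB mulr_sumr.
by apply: eq_bigr => y _; ring.
Qed.

End JumpRates.

(** * Avoiding a set of states on a time grid *)

Section GridEstimate.
Variable R : realType.
Variables (N : nat) (alpha beta muN : R).
Hypotheses (al0 : 0 <= alpha) (be0 : 0 <= beta) (mu0 : 0 <= muN).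
Local Notation G := (@gen R N alpha beta muN).
Local Notation Lrt := (Rtot N alpha beta muN).
Implicit Types (x y : config N).

(* The maximum with 0 replaces a proof that the power series [trans] is nonnegative. *)
Definition transp t x y : R := Num.max 0 (@trans R N alpha beta muN t x y).

Lemma transp_ge0 t x y : 0 <= transp t x y. Proof. by rewrite le_max lexx. Qed.

(** For [t Rtot <= 1] the first-order expansion is nonnegative, and taking the maximum with 0 does
    not move a number away from a nonnegative one. *)
Lemma transp_taylor : exists2 C, 0 <= C & forall x y t, 0 <= t <= 1 -> t * Lrt <= 1 ->
  `|transp t x y - (dirac1 R y x + t * G (dirac1 R y) x)| <= C * t ^+ 2.
Proof.
have [C C0 HC] := trans_taylor N al0 be0 mu0; exists C => // x y t t01 tL.
have /andP[t0 t1] := t01.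
have b0 : 0 <= dirac1 R y x + t * G (dirac1 R y) x.
  have d0 z : 0 <= dirac1 R y z by rewrite /dirac1; case: ifP.
  have : - (dirac1 R y x * Lrt) <= G (dirac1 R y) x.
    rewrite genE; apply: (@le_trans _ _ (\sum_(e : move N) rate alpha beta muN x e * - dirac1 R y x)).
      by rewrite -mulr_suml mulrN lerN2 mulrC ler_wpM2l ?rate_sum.
    by apply: ler_sum => e _; rewrite ler_wpM2l ?rate_ge0// lerDr.
  move=> /(ler_wpM2l t0) h; have : dirac1 R y x * (1 - t * Lrt) <= dirac1 R y x + t * G (dirac1 R y) x.
    by move: h; rewrite mulrBr mulr1 mulrN mulrCA => h; rewrite lerD2l.
  by apply: le_trans; rewrite mulr_ge0// subr_ge0.
apply: le_trans (HC x y t t01); rewrite /transp.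
have [tr0|tr0] := leP 0 (trans alpha beta muN t x y); first by [].
rewrite sub0r normrN ger0_norm// ltr0_norm; last by rewrite subr_lt0 (lt_le_trans tr0).
by rewrite opprB lerBrDr -lerBrDl subrr ltW.
Qed.

Section Supersolution.
Variables (T M Ch : R) (h : R -> config N -> R) (bad : R -> config N -> Prop).
Hypothesis Ch0 : 0 <= Ch.
Hypothesis hM : forall s x, 0 <= s <= T -> 0 <= h s x <= M.
Hypothesis hstep : forall s d x, 0 <= s -> 0 <= d <= 1 -> s + d <= T ->
  h (s + d) x + d * G (h (s + d)) x <= h s x + Ch * d ^+ 2.
Hypothesis hbad : forall s x, 0 <= s <= T -> bad s x -> 1 <= h s x.

(* A lower bound for the probability of avoiding [bad] on a grid of mesh [d]: only steps to neighbours are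
   counted, and all others cost O(d^2). *)
Fixpoint good_prob (d : R) (m k : nat) x : R :=
  match m with
  | 0 => 1
  | m'.+1 => \sum_(y <- nbrs x | ~~ `[< bad (k.+1%:R * d) y >]) transp d x y * good_prob d m' k.+1 y
  end.

(** Backward induction on the number of remaining steps. One step loses [E d^2]: [Ch] is the defect
    of the supersolution inequality, and the other summand is the Taylor error of one transition
    probability, times the bound for [f], times the number of neighbours. *)
Lemma good_prob_lower : exists2 E, 0 <= E & forall d n, 0 <= d <= 1 -> d * Lrt <= 1 ->
  n%:R * d <= T -> n%:R * (E * d ^+ 2) <= 1 -> forall m k, (k + m <= n)%N -> forall x,
  1 - h (k%:R * d) x - m%:R * (E * d ^+ 2) <= good_prob d m k x.
Proof.
have [C C0 HC] := transp_taylor; pose n1 : R := (#|{: move N}|.+1)%:R.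
pose E := Ch + n1 * (C * (2 + `|M|)).
have E0 : 0 <= E by rewrite /E addr_ge0// !mulr_ge0// addr_ge0.
exists E => // d n d01 dL ndT nE; have /andP[d0 d1] := d01.
have Ed0 : 0 <= E * d ^+ 2 by rewrite mulr_ge0// exprn_ge0.
have kT k : (k <= n)%N -> 0 <= k%:R * d <= T.
  move=> kn; rewrite mulr_ge0//=; apply: le_trans ndT; by rewrite ler_wpM2r// ler_nat.
elim=> [|m IH] k kn x /=.
  rewrite mul0r subr0 lerBlDr lerDl; have := hM x (kT k _); rewrite addn0 in kn.
  by move=> /(_ kn)/andP[].
have k1n : (k.+1 <= n)%N by rewrite (leq_trans _ kn)// -addn1 leq_add2l.
have k1T := kT _ k1n.
set H := h (k.+1%:R * d); set mE := m%:R * (E * d ^+ 2).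
have mE1 : 0 <= mE <= 1.
  rewrite /mE mulr_ge0//=; apply: le_trans nE; rewrite ler_wpM2r// ler_nat.
  by rewrite (leq_trans _ kn)// addnS (leq_trans (leq_addl k m)).
pose f y := (1 - mE) + (-1) * H y.
have fM y : `|f y| <= 2 + `|M|.
  have /andP[H0 HM] : 0 <= H y <= M := hM y k1T; have nM := ler_norm M; case/andP: mE1 => m0 m1.
  by rewrite /f ler_norml; apply/andP; split; lra.
apply: (@le_trans _ _ (\sum_(y <- nbrs x) transp d x y * f y)); last first.
  rewrite [leRHS]big_mkcond /=; apply: ler_sum => y _; case: asboolP => [by_|_] /=.
    (* On bad states [h >= 1] makes [f] nonpositive, so discarding these states only increases the
       sum. *)
    have := hbad k1T by_; case/andP: mE1 => m0 m1; rewrite -/(H y) => h1.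
    by rewrite mulr_ge0_le0 ?transp_ge0// /f; lra.
  rewrite ler_wpM2l ?transp_ge0//; apply: le_trans (IH k.+1 _ y); last by rewrite addSn -addnS.
  by rewrite /f mulN1r addrAC lexx.
have tay : \sum_(y <- nbrs x) (dirac1 R y x + d * G (dirac1 R y) x) * f y - n1 * (C * d ^+ 2 * (2 + `|M|))
   <= \sum_(y <- nbrs x) transp d x y * f y.
  rewrite lerBlDl -lerBlDr -sumrB; apply: le_trans (ler_norm _) _.
  apply: le_trans (ler_norm_sum _ _ _) _.
  apply: (@le_trans _ _ (\sum_(y <- nbrs x) C * d ^+ 2 * (2 + `|M|))).
    apply: ler_sum => y _; rewrite -mulrBl normrM distrC; apply: ler_pM => //; exact: HC.
  rewrite big_const_seq count_predT iter_addr_0 -[leLHS]mulr_natl ler_wpM2r ?mulr_ge0 ?exprn_ge0 ?addr_ge0//.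
  by rewrite ler_nat; exact: nbrs_size.
apply: le_trans tay; rewrite sum_nbrs gen_affine.
have ks : k%:R * d + d = k.+1%:R * d by rewrite -natr1 mulrDl mul1r.
have k1T' : k%:R * d + d <= T by rewrite ks; case/andP: k1T.
have := hstep x (mulr_ge0 (ler0n R k) d0) d01 k1T'; rewrite ks -/H => {}hs.
have -> : m.+1%:R * (E * d ^+ 2) = mE + Ch * d ^+ 2 + n1 * (C * d ^+ 2 * (2 + `|M|)).
  by rewrite -natr1 /mE /E; ring.
rewrite /f !mulN1r mulrN; move: hs; set q := d * G H x; set a1 := H x; set a2 := h _ x; set a3 := Ch * _; set a4 := n1 * _ => hs.
lra.
Qed.

End Supersolution.

Section Chain.
Variables (dd : measure_display) (Omega : measurableType dd) (P : probability Omega R).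
Variables (x0 : config N) (X : Omega -> R -> config N).
Hypothesis ch : is_chain P alpha beta muN x0 X.

Lemma config_countable : countable [set: config N].
Proof.
apply/countable_injP; exists (fun x => pickle [ffun i => x i]) => x y _ _ /(pcan_inj pickleK) exy.
by apply/funext => i; have := congr1 (fun f : {ffun 'I_N -> int} => f i) exy; rewrite !ffunE.
Qed.

Lemma measurable_state t (A : set (config N)) : measurable [set w | A (X w t)].
Proof.
have -> : [set w | A (X w t)] = \bigcup_y [set w | A y /\ X w t = y].
  apply/seteqP; split => [w Aw|w [y _ /= [Ay e]]]; last by rewrite /= e.
  by exists (X w t).
apply: countable_bigcupT_measurable; first exact: config_countable.
move=> y; have [Ay|Ay] := pselect (A y).
  have -> : [set w | A y /\ X w t = y] = [set w | X w t = y] by apply/seteqP; split => w // [].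
  by case: ch.
by have -> : [set w | A y /\ X w t = y] = set0 by apply/seteqP; split => w // [].
Qed.

Definition cyl (l : seq (R * config N)) : set Omega := [set w | forall p, p \in l -> X w p.1 = p.2].

Lemma measurable_cyl l : measurable (cyl l).
Proof.
elim: l => [|p l IH].
  by have -> : cyl [::] = setT by apply/seteqP; split.
have -> : cyl (p :: l) = [set w | X w p.1 = p.2] `&` cyl l.
  apply/seteqP; split => w /=.
    move=> H; split; first by apply: H; rewrite inE eqxx.
    by move=> q ql; apply: H; rewrite inE ql orbT.
  by move=> [H1 H2] q; rewrite inE => /orP[/eqP->|/H2].
by apply: measurableI => //; case: ch.
Qed.

Lemma fdd_rcons x s l t y : fdd alpha beta muN x s (rcons l (t, y)) =
  fdd alpha beta muN x s l * trans alpha beta muN (t - (last (s, x) l).1) (last (s, x) l).2 y.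
Proof.
by elim: l x s => [|[t' y'] l IH] x s /=; [rewrite mulr1 mul1r|rewrite IH mulrA].
Qed.

Lemma sum_measure_state (t : R) (s : seq (config N)) (A : set Omega) : uniq s -> measurable A ->
  (\sum_(y <- s) P (A `&` [set w | X w t = y]) <= P A)%E.
Proof.
elim: s A => [|y s IH] A us mA; first by rewrite big_nil.
have my : measurable [set w | X w t = y] by case: ch.
move: us => /= /andP[ys us]; rewrite big_cons (measureDI P mA my) addeC leeD//.
apply: le_trans (IH _ us (measurableD mA my)); rewrite le_eqVlt; apply/orP; left; apply/eqP.
rewrite big_seq [RHS]big_seq; apply: eq_bigr => z zs; congr (P _).
apply/seteqP; split => w [Aw Xw]; split => //; last by case: Aw.
by split => // /= Xy; move: ys; rewrite -Xy Xw zs.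
Qed.

Section Bad.
Variables (bad : R -> config N -> Prop) (d : R).
Hypothesis d0 : 0 <= d.

Definition good_ev (k m : nat) : set Omega :=
  [set w | forall j, (k < j <= k + m)%N -> ~ bad (j%:R * d) (X w (j%:R * d))].

Lemma good_evS k m : good_ev k m.+1 =
  [set w | ~ bad (k.+1%:R * d) (X w (k.+1%:R * d))] `&` good_ev k.+1 m.
Proof.
apply/seteqP; split => w /=.
  move=> H; split=> [|j /andP[kj jm]]; apply: H; first by rewrite ltnSn addnS ltnS leq_addr.
  by rewrite (ltn_trans _ kj)//= addnS -addSn.
move=> [H1 H2] j /andP[kj jm]; have [jk|jk] := eqVneq j k.+1; first by rewrite jk.
by apply: H2; rewrite ltn_neqAle eq_sym jk kj addSn -addnS.
Qed.

Lemma measurable_good k m : measurable (good_ev k m).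
Proof.
elim: m k => [|m IH] k.
  have -> : good_ev k 0 = setT; last by [].
  by apply/seteqP; split => w // _ j; rewrite addn0; case/andP=> h1 h2; move: (leq_trans h1 h2); rewrite ltnn.
by rewrite good_evS; apply: measurableI => //; exact: (measurable_state _ (fun y => ~ bad _ y)).
Qed.

(** Extending the prescribed history by one grid time splits the event into disjoint pieces, one for
    each good neighbour; the finite-dimensional distributions give the probability of each
    history. *)
Lemma prob_good_lower m k l x : sorted_times l -> all (fun p => 0 <= p.1) l ->
  last (0, x0) l = (k%:R * d, x) ->
  ((fdd alpha beta muN x0 0 l * good_prob bad d m k x)%:E <= P (cyl l `&` good_ev k m))%E.
Proof.
elim: m k l x => [|m IH] k l x sl al ll.
  have -> : good_ev k 0 = setT.
    by apply/seteqP; split => w // _ j; rewrite addn0; case/andP=> h1 h2; move: (leq_trans h1 h2); rewrite ltnn.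
  by rewrite setIT /= mulr1; have [_ [_ [_ ->]]] := ch.
set t := k.+1%:R * d.
have F0 : 0 <= fdd alpha beta muN x0 0 l.
  by have [_ [_ [_ H]]] := ch; rewrite -lee_fin -H// measure_ge0.
have sl' y : sorted_times (rcons l (t, y)).
  move=> i; rewrite size_rcons ltnS !map_rcons !nth_rcons size_map => il.
  rewrite il; have [i1|i1] := ltnP i.+1 (size l); first exact: sl.
  have e : i.+1 = size l by apply/eqP; rewrite eqn_leq il i1.
  rewrite e eqxx /= -[i]/(i.+1.-1) e -(size_map fst) nth_last.
  have -> : last 0 [seq p.1 | p <- l] = (last (0, x0) l).1 by rewrite -[0 in LHS]/((0 : R, x0).1) last_map.
  by rewrite ll /= ler_wpM2r// ler_nat.
have al' y : all (fun p => 0 <= p.1) (rcons l (t, y)).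
  by rewrite all_rcons al andbT /t mulr_ge0.
have ll' y : last (0, x0) (rcons l (t, y)) = (k.+1%:R * d, y) by rewrite last_rcons.
have tE : t - k%:R * d = d by rewrite /t -natr1 mulrDl mul1r addrC addKr.
(* A negative value of [trans] would make the extended history have a nonpositive probability, hence
   0; this agrees with its replacement by 0 in [transp]. *)
have key y : fdd alpha beta muN x0 0 (rcons l (t, y)) = fdd alpha beta muN x0 0 l * transp d x y.
  have F1 : 0 <= fdd alpha beta muN x0 0 (rcons l (t, y)).
    by have [_ [_ [_ H]]] := ch; rewrite -lee_fin -H// measure_ge0.
  move: F1; rewrite fdd_rcons ll /= tE /transp => F1.
  have [tr0|tr0] := leP 0 (trans alpha beta muN d x y); first by [].
  rewrite mulr0; apply/le_anti; rewrite F1 andbT mulr_ge0_le0//; exact: ltW.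
pose A := cyl l `&` good_ev k m.+1.
have mA : measurable A by apply: measurableI; [exact: measurable_cyl|exact: measurable_good].
have us : uniq [seq y <- nbrs x | ~~ `[< bad t y >]] by apply: filter_uniq; exact: undup_uniq.
apply: le_trans (sum_measure_state t us mA).
rewrite /= big_filter mulr_sumr -sumEFin; apply: lee_sum => y; rewrite -/t => gy.
rewrite mulrA -key; apply: le_trans (IH k.+1 _ _ (sl' y) (al' y) (ll' y)) _.
apply: le_measure; rewrite ?inE.
- by apply: measurableI; [exact: measurable_cyl|exact: measurable_good].
- by apply: measurableI => //; case: ch.
move=> w [cw gw]; have Xt : X w t = y by apply: (cw (t, y)); rewrite mem_rcons inE eqxx.
split => //; split; first by move=> p pl; apply: cw; rewrite mem_rcons inE pl orbT.
by rewrite good_evS; split => //=; rewrite -/t Xt; apply/asboolPn.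
Qed.

End Bad.
End Chain.
End GridEstimate.

(* Supermartingale-type maximal inequality obtained from the finite-dimensional distributions alone, along
   dyadic grids. *)
Section MaximalInequality.
Variable R : realType.
Variables (N : nat) (alpha beta muN : R).
Hypotheses (al0 : 0 <= alpha) (be0 : 0 <= beta) (mu0 : 0 <= muN).
Local Notation G := (@gen R N alpha beta muN).
Variables (dd : measure_display) (Omega : measurableType dd) (P : probability Omega R).
Variables (x0 : config N) (X : Omega -> R -> config N).
Hypothesis ch : is_chain P alpha beta muN x0 X.
Variables (T M Ch : R) (h : R -> config N -> R) (bad : R -> config N -> Prop).
Hypotheses (T0 : 0 < T) (Ch0 : 0 <= Ch).
Hypothesis hM : forall s x, 0 <= s <= T -> 0 <= h s x <= M.
Hypothesis hstep : forall s d x, 0 <= s -> 0 <= d <= 1 -> s + d <= T ->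
  h (s + d) x + d * G (h (s + d)) x <= h s x + Ch * d ^+ 2.
Hypothesis hbad : forall s x, 0 <= s <= T -> bad s x -> 1 <= h s x.

Definition dyadic_bad (n : nat) : set Omega :=
  [set w | exists2 j, (0 < j <= 2 ^ n)%N & bad (j%:R * (T / (2 ^ n)%:R)) (X w (j%:R * (T / (2 ^ n)%:R)))].

Lemma dyadic_badE n : dyadic_bad n = ~` good_ev X bad (T / (2 ^ n)%:R) 0 (2 ^ n).
Proof.
apply/seteqP; split => w /=.
  by move=> [j jn bj] H; apply: (H j).
move=> H; apply: contrapT => K; apply: H => j jn bj; apply: K; exists j => //.
Qed.

Lemma measurable_dyadic_bad n : measurable (dyadic_bad n).
Proof. by rewrite dyadic_badE; apply: measurableC; exact: (measurable_good ch). Qed.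

Lemma dyadic_bad_mono n m : (n <= m)%N -> dyadic_bad n `<=` dyadic_bad m.
Proof.
move=> /subnKC <-; elim: (m - n)%N => [|k IH]; first by rewrite addn0.
move=> w /IH [j /andP[j0 jn] bj]; rewrite addnS; exists (j * 2)%N.
  by rewrite muln_gt0 j0 expnS mulnC leq_pmul2l.
have -> : (j * 2)%:R * (T / (2 ^ (n + k).+1)%:R) = j%:R * (T / (2 ^ (n + k))%:R) :> R; last by [].
by rewrite expnS !natrM; field; rewrite pnatr_eq0 expn_eq0.
Qed.

(** The grid of level [n] is contained in finer grids of level [m], where the accumulated error
    [E T d] is as small as desired. The bound does not depend on [n], which allows the union over
    all levels. *)
Lemma dyadic_bad_le n : (P (dyadic_bad n) <= (h 0 x0)%:E)%E.
Proof.
have [E E0 HE] := good_prob_lower al0 be0 mu0 Ch0 hM hstep hbad.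
pose d m : R := T / (2 ^ m)%:R.
have p2 m : 0 < (2 ^ m)%:R :> R by rewrite ltr0n expn_gt0.
have p2n m : (m%:R : R) <= (2 ^ m)%:R by rewrite ler_nat ltnW// ltn_expl.
have d0 m : 0 <= d m by rewrite /d divr_ge0// ltW.
have nd m : (2 ^ m)%:R * d m = T by rewrite /d mulrC divfK// gt_eqF.
have small (A e : R) : 0 <= A -> 0 < e -> exists m0, forall m, (m0 <= m)%N -> A * d m <= e.
  move=> A0 e0; exists (Num.truncn (A * T / e)).+1 => m m0m.
  rewrite /d [A * _]mulrA ler_pdivrMr// [e * _]mulrC -ler_pdivrMr//.
  by apply: le_trans (p2n m); apply: le_trans (ltW (truncnS_gt _)) _; rewrite ler_nat.
apply/lee_addgt0Pr => e e0.
have [m1 H1] := small 1 1 ler01 ltr01.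
have [m2 H2] := small _ 1 (Rtot_ge0 N al0 be0 mu0) ltr01.
have ET : 0 <= E * T by rewrite mulr_ge0// ltW.
have [m3 H3] := small _ 1 ET ltr01; have [m4 H4] := small _ e ET e0.
pose m := maxn n (maxn (maxn m1 m2) (maxn m3 m4)).
have nm : (n <= m)%N by rewrite leq_maxl.
have mm : [&& (m1 <= m)%N, (m2 <= m)%N, (m3 <= m)%N & (m4 <= m)%N].
  by rewrite /m; apply/and4P; split; rewrite !leq_max leqnn ?orbT.
case/and4P: mm => /H1; rewrite mul1r => d1 /H2 dL /H3 E1 /H4 Ee.
have EE : (2 ^ m)%:R * (E * d m ^+ 2) = E * T * d m by rewrite -[T in RHS](nd m); ring.
have d01 : 0 <= d m <= 1 by rewrite d0.
have ndT : (2 ^ m)%:R * d m <= T by rewrite nd.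
have nE : (2 ^ m)%:R * (E * d m ^+ 2) <= 1 by rewrite EE.
have dL' : d m * Rtot N alpha beta muN <= 1 by rewrite mulrC.
have low := HE (d m) (2 ^ m)%N d01 dL' ndT nE (2 ^ m)%N 0%N (leqnn _) x0.
have sl : sorted_times ([::] : seq (R * config N)) by [].
have ll : last (0, x0) [::] = (0%:R * d m, x0) by rewrite mul0r.
have := prob_good_lower ch bad (d0 m) (2 ^ m) sl isT ll.
rewrite /= mul1r => pl.
have mg := measurable_good ch bad (d m) 0 (2 ^ m).
have cylT : cyl X [::] = setT by apply/seteqP; split.
rewrite cylT setTI in pl.
apply: (@le_trans _ _ (P (dyadic_bad m))).
  by apply: le_measure; rewrite ?inE; [exact: measurable_dyadic_bad|exact: measurable_dyadic_bad|exact: dyadic_bad_mono].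
rewrite dyadic_badE -/(d m) probability_setC// leeBlDr ?fin_num_measure//.
rewrite mul0r EE in low.
apply: (@le_trans _ _ ((h 0 x0)%:E + e%:E + (1 - h 0 x0 - E * T * d m)%:E)%E).
  by rewrite -!EFinD lee_fin; lra.
rewrite leeD2l//; apply: le_trans pl; rewrite lee_fin; exact: low.
Qed.

Lemma dyadic_bad_union : measurable (\bigcup_n dyadic_bad n) /\
  (P (\bigcup_n dyadic_bad n) <= (h 0 x0)%:E)%E.
Proof.
have mU : measurable (\bigcup_n dyadic_bad n) by apply: bigcupT_measurable => n; exact: measurable_dyadic_bad.
split=> //.
have c : (P \o dyadic_bad) n @[n --> \oo] --> P (\bigcup_n dyadic_bad n).
  apply: nondecreasing_cvg_mu => //; first exact: measurable_dyadic_bad.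
  by move=> n m nm; apply/subsetPset; exact: dyadic_bad_mono.
rewrite -(cvg_lim _ c)//; apply: lime_le; first by apply/cvg_ex; eexists; exact: c.
by apply: nearW => n; exact: dyadic_bad_le.
Qed.

End MaximalInequality.

(** * Energy of the empirical profile *)

Section EmpiricalProfile.
Variable R : realType.
Variables (N : nat).
Hypothesis N0 : (0 < N)%N.
Implicit Types (x : config N) (y : R).

Let Ngt : 0 < N%:R :> R. Proof. by rewrite ltr0n. Qed.
Let Nne : N%:R != 0 :> R. Proof. by rewrite gt_eqF. Qed.

Lemma bool_le1 (b : bool) : b%:R <= 1 :> R. Proof. by case: b. Qed.

Lemma bool_dist_le1 (b b' : bool) : `|b%:R - b'%:R| <= 1 :> R.
Proof. by case: b; case: b'; rewrite ?subrr ?subr0 ?sub0r ?normrN ?normr0 ?normr1. Qed.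

Definition zeta x y : R := xi R (Num.floor (N%:R * y)) x.

Lemma xiE k x : xi R k x = N%:R^-1 * \sum_(i < N) (k <= x i)%R%:R.
Proof. by rewrite /xi mulrC -sum1_card natr_sum big_mkcond; congr (_ * _); apply: eq_bigr => i _; rewrite inE; case: ifP. Qed.

Lemma zeta_unitdec x : unitdec (zeta x).
Proof.
split=> [y z yz|y].
  rewrite /zeta !xiE ler_wpM2l ?invr_ge0//; apply: ler_sum => i _.
  rewrite ler_nat; have [h|//] := boolP (Num.floor (N%:R * z) <= x i)%R.
  by rewrite (le_trans _ h)// le_floor// ler_wpM2l// ltW.
rewrite /zeta xiE; apply/andP; split; first by rewrite mulr_ge0 ?invr_ge0// sumr_ge0.
rewrite mulrC ler_pdivrMr// mul1r; apply: (@le_trans _ _ (\sum_(i < N) 1)).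
  by apply: ler_sum => i _; exact: bool_le1.
by rewrite sumr_const card_ord.
Qed.

Lemma zeta_upd x i v y : zeta (upd x i v) y - zeta x y =
  N%:R^-1 * ((Num.floor (N%:R * y) <= v)%R%:R - (Num.floor (N%:R * y) <= x i)%R%:R).
Proof.
rewrite /zeta !xiE -mulrBr; congr (_ * _).
rewrite (bigD1 i)//= [X in _ - X](bigD1 i)//= /upd eqxx.
have -> : \sum_(j < N | j != i) ((Num.floor (N%:R * y) <= (if j == i then v else x j))%R%:R : R) =
   \sum_(j < N | j != i) (Num.floor (N%:R * y) <= x j)%R%:R.
  by apply: eq_bigr => j /negbTE ->.
by ring.
Qed.

Lemma floor_shift1 y (b : bool) : Num.floor (N%:R * (y + (if b then - N%:R^-1 else N%:R^-1))) =
  (Num.floor (N%:R * y) + (if b then -1 else 1))%R.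
Proof.
rewrite mulrDr; case: b.
  by rewrite mulrN mulfV// -[X in _ - X]/((1:int)%:~R) -intrN floorDrz ?intr_int// intrKfloor.
by rewrite mulfV// -[X in _ + X]/((1:int)%:~R) floorDrz ?intr_int// intrKfloor.
Qed.

Lemma zeta_shiftl x y : zeta x (y - N%:R^-1) = N%:R^-1 * \sum_(i < N) (Num.floor (N%:R * y) <= x i + 1)%R%:R.
Proof.
rewrite /zeta (floor_shift1 y true) xiE; congr (_ * _); apply: eq_bigr => i _.
by rewrite lerBlDr.
Qed.

Lemma zeta_shiftr x y : zeta x (y + N%:R^-1) = N%:R^-1 * \sum_(i < N) (Num.floor (N%:R * y) <= x i - 1)%R%:R.
Proof.
rewrite /zeta (floor_shift1 y false) xiE; congr (_ * _); apply: eq_bigr => i _.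
by rewrite lerBrDr.
Qed.

(** The equation closes on the profile without any factorization hypothesis: a move of [i] to the
    place of [j] lowers the profile at level [k] exactly when [x_j < k <= x_i], which already
    implies [x_j < x_i]. Summed over pairs, this product of indicators is [N^2 zeta (1 - zeta)]. *)
Lemma gen_zeta (alpha beta muN : R) x y :
  gen alpha beta muN (fun x => zeta x y) x =
  alpha * (zeta x (y - N%:R^-1) - zeta x y) + beta * (zeta x (y + N%:R^-1) - zeta x y)
  + muN * (zeta x y ^+ 2 - zeta x y).
Proof.
rewrite /gen; set k := Num.floor (N%:R * y).
have zE : zeta x y = N%:R^-1 * \sum_(i < N) (k <= x i)%R%:R by rewrite /zeta xiE.
congr (_ + _).
  under eq_bigr do rewrite !zeta_upd -/k.
  rewrite big_split /= -!mulr_sumr !sumrB zeta_shiftl zeta_shiftr zE -/k -!mulrBr.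
  by [].
(* The product of indicators vanishes for [i = j], so the diagonal can be added to the sum. *)
have H i j : (if (j != i) && (x j < x i)%R then (zeta (upd x i (x j)) y - zeta x y) * (muN / N%:R) else 0) =
   - (muN / N%:R / N%:R) * ((k <= x i)%R%:R * (1 - (k <= x j)%R%:R)).
  rewrite zeta_upd -/k; have [ji|ji] /= := eqVneq j i.
    by rewrite ji; case: (k <= x i)%R; rewrite ?subrr ?mulr0 ?mul0r ?mulr0.
  have [xji|xij] := ltP (x j) (x i).
    have [kj|kj] := leP k (x j); first by rewrite (le_trans kj (ltW xji)) !subrr !mulr0 mul0r.
    by move: ((k <= x i)%R%:R : R) => b; rewrite mulr0n; field.
  have [ki|ki] := leP k (x i); first by rewrite (le_trans ki xij) subrr !mulr0.
  by rewrite mul0r mulr0.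
under eq_bigr => i _.
  rewrite big_mkcond /=.
  under eq_bigr => j _ do rewrite -if_and H.
  over.
have -> : \sum_(i < N) \sum_(j < N) - (muN / N%:R / N%:R) * ((k <= x i)%R%:R * (1 - (k <= x j)%R%:R)) =
   - (muN / N%:R / N%:R) * ((\sum_(i < N) (k <= x i)%R%:R) * (N%:R - \sum_(j < N) (k <= x j)%R%:R)).
  rewrite mulr_suml mulr_sumr; apply: eq_bigr => i _; rewrite -mulr_sumr -mulr_sumr; congr (_ * (_ * _)).
  by rewrite sumrB sumr_const card_ord.
by rewrite zE; field.
Qed.

End EmpiricalProfile.

Section UnitInterval.
Variable R : realDomainType.

Lemma unit_dist_le1 (a b : R) : 0 <= a <= 1 -> 0 <= b <= 1 -> `|a - b| <= 1.
Proof. by move=> /andP[? ?] /andP[? ?]; rewrite ler_norml; apply/andP; split; lra. Qed.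

Lemma unit_add_le1 (a b : R) : 0 <= a <= 1 -> 0 <= b <= 1 -> `|a + b - 1| <= 1.
Proof. by move=> /andP[? ?] /andP[? ?]; rewrite ler_norml; apply/andP; split; lra. Qed.

End UnitInterval.

(** * Supermartingale estimate for the particle energy *)

Section ParticleEnergy.
Variable R : realType.
Local Notation leb := (@lebesgue_measure R).
Variables (sc : scaling R) (N : nat) (muN : R).
Hypotheses (N0 : (0 < N)%N) (hmu : sc_c sc N * muN = sc_mu sc) (muN0 : 0 <= muN).
Local Notation c := (sc_c sc N).
Local Notation al := (sc_al sc).
Local Notation be := (sc_be sc).
Local Notation mu := (sc_mu sc).
Local Notation G := (gen al be muN).
Local Notation zeta := (@zeta R N).
Implicit Types (x : config N).
Variable eps : R.
Hypothesis e0 : 0 < eps.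
Local Notation k := (moll eps).

Let Ngt : 0 < N%:R :> R. Proof. by rewrite ltr0n. Qed.
Let Nne : N%:R != 0 :> R. Proof. by rewrite gt_eqF. Qed.

Lemma gen_zeta_BN x y : c * G (fun x => zeta x y) x = BN sc N (zeta x) y.
Proof. by rewrite gen_zeta// /BN /Bop /Lop mulrDr mulrA hmu. Qed.

Variable M : R.
Hypothesis km : mollifier M eps k.

Definition zincr x e : R -> R := fun y => zeta (target x e) y - zeta x y.

Lemma zeta_bm x : bm (zeta x). Proof. exact: unitdec_bm (zeta_unitdec R N0 x). Qed.

Lemma zincr_bm x e : bm (zincr x e). Proof. by apply: bmB; exact: zeta_bm. Qed.

Lemma zincr_le x e y : `|zincr x e y| <= N%:R^-1.
Proof.
rewrite /zincr; case: e => [[i b]|[i j]] /=; rewrite zeta_upd// normrM ger0_norm ?invr_ge0// ler_piMr ?invr_ge0//; exact: bool_dist_le1.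
Qed.

Lemma S_zincr_le x e y : `|S k (zincr x e) y| <= N%:R^-1.
Proof. by apply: (normr_S_le e0 km (zincr_bm x e)) => z _; exact: zincr_le. Qed.

(** A unit jump changes the profile by at most 1/N and on a single cell of length 1/N, where the
    kernel is at most [M / eps]. The second factor 1/N is what the diffusive time change
    requires. *)
Lemma S_zincr_step x i b y : `|S k (zincr x (inl (i, b))) y| <= N%:R^-1 * (M / eps) * N%:R^-1.
Proof.
have [ck k0 ks _ kM] := km; have Me := moll_bound_ge0 km.
(* The cell affected: the new position for a jump up, the old one for a jump down. *)
pose k1 : int := if b then (x i + 1)%R else x i.
pose a : R := k1%:~R / N%:R.
have aN : a <= a + N%:R^-1 by rewrite lerDl invr_ge0.
have -> : N%:R^-1 * (M / eps) * N%:R^-1 = itg (fun z => N%:R^-1 * (M / eps) * ind a (a + N%:R^-1) z).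
  by rewrite itgZ ?itg_ind//; [congr (_ * _); ring|exact: dom_ind].
apply: normr_itg_le; [exact: (dom_Sint e0 km y (zincr_bm _ _))|by apply: domZ; exact: dom_ind|move=> z].
have Hk : 0 <= k (z - y) <= M / eps by rewrite k0 kM.
have [zz|zz] := boolP (Num.floor (N%:R * z) == k1).
  have -> : ind a (a + N%:R^-1) z = 1.
    rewrite indE /a -(eqP zz) ler_pdivrMr// [z * _]mulrC floor_le_tmp.
    set F := Num.floor _; have -> : F%:~R / N%:R + N%:R^-1 = (F + 1)%:~R / N%:R :> R by rewrite intrD mulrDl div1r.
    by rewrite ler_pdivlMr// [z * _]mulrC (ltW (floorD1_gt _)).
  rewrite mulr1 normrM; apply: ler_pM => //; first exact: zincr_le.
  by rewrite ger0_norm//; case/andP: Hk.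
have -> : zincr x (inl (i, b)) z = 0.
  rewrite /zincr /= zeta_upd//; move: zz; rewrite /k1; case: (b) => zz.
    suff -> : (Num.floor (N%:R * z) <= x i + 1)%R = (Num.floor (N%:R * z) <= x i)%R by rewrite subrr mulr0.
    by apply/idP/idP; lia.
  suff -> : (Num.floor (N%:R * z) <= x i - 1)%R = (Num.floor (N%:R * z) <= x i)%R by rewrite subrr mulr0.
  by apply/idP/idP; lia.
by rewrite mul0r normr0 mulr_ge0 ?ind_ge0// mulr_ge0// invr_ge0.
Qed.

Section FixedProfile.
Variable v : R -> R.
Hypothesis uv : unitdec v.
Let bv : bm v := unitdec_bm uv.

Definition dev x y : R := S k (zeta x) y - S k v y.
Definition Ven x : R := itg (fun y => wt y * dev x y ^+ 2).

Lemma dev_bm x : bm (dev x).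
Proof. by apply: bmB; apply: (bm_S e0 km) => //; exact: zeta_bm. Qed.

Lemma devE x y : dev x y = S k (fun z => zeta x z - v z) y.
Proof. by rewrite (SB e0 km y (zeta_bm x) bv). Qed.

Lemma dev_le x y : `|dev x y| <= 1.
Proof.
rewrite devE; apply: (normr_S_le e0 km); first by apply: bmB => //; exact: zeta_bm.
by move=> z _; apply: unit_dist_le1; [have [_ /(_ z)] := zeta_unitdec R N0 x|have [_ /(_ z)] := uv].
Qed.

Lemma dev_target x e y : dev (target x e) y = dev x y + S k (zincr x e) y.
Proof. by rewrite /dev /zincr (SB e0 km y (zeta_bm _) (zeta_bm x)); ring. Qed.

Lemma sum_rate_S x y : c * \sum_(e : move N) rate al be muN x e * S k (zincr x e) y = S k (BN sc N (zeta x)) y.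
Proof.
have -> : BN sc N (zeta x) = (fun z => c * \sum_(e : move N) rate al be muN x e * zincr x e z).
  by apply/funext => z; rewrite -gen_zeta_BN genE.
have dz e : dom (fun z => zincr x e z * k (z - y)) by exact: (dom_Sint e0 km y (zincr_bm x e)).
rewrite /S; have -> : (fun z => c * (\sum_(e : move N) rate al be muN x e * zincr x e z) * k (z - y)) =
  (fun z => c * \sum_(e : move N) rate al be muN x e * (zincr x e z * k (z - y))).
  apply/funext => z; rewrite -mulrA mulr_suml; congr (_ * _); apply: eq_bigr => e _; exact: esym (mulrA _ _ _).
rewrite itgZ; last by apply: dom_sum => e; exact: domZ.
rewrite itg_sum; last by move=> e; exact: domZ.
by congr (_ * _); apply: eq_bigr => e _; rewrite itgZ.
Qed.

Definition Cn : R := (2 * (al + be) * (M / eps) ^+ 2 + mu) * wtot R.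

(** Nearest-neighbour jumps: 2 N moves of squared size of order [N^-4], against [c <= N^2]. Moves to
    another particle: [N^2] pairs at rate [muN / N], of squared size at most [N^-2], with
    [c muN = mu]. Both contributions are O(1/N). *)
Lemma noise_le x : c * \sum_(e : move N) rate al be muN x e * itg (fun y => wt y * S k (zincr x e) y ^+ 2) <= Cn / N%:R.
Proof.
have c0 := sc_c0 sc N; have W0 := wtot_ge0 R; have al0 := sc_al0 sc; have be0 := sc_be0 sc.
have Me := moll_bound_ge0 km; have NV : 0 <= N%:R^-1 :> R by rewrite invr_ge0.
have bS e : bm (S k (zincr x e)) by apply: (bm_S e0 km); exact: zincr_bm.
have sq (f : R -> R) (B : R) : bm f -> (forall y, `|f y| <= B) -> itg (fun y => wt y * f y ^+ 2) <= B ^+ 2 * wtot R.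
  move=> bf fB; apply: itg_wtM_le => [|y]; first exact: bm_sqr.
  by rewrite -real_normK ?num_real// lerXn2r ?nnegrE// (le_trans _ (fB 0)).
rewrite (big_sumType _ predT) /=.
have h1 : \sum_(p : 'I_N * bool) rate al be muN x (inl p) * itg (fun y => wt y * S k (zincr x (inl p)) y ^+ 2) <=
    (N%:R * 2) * ((al + be) * ((N%:R^-1 * (M / eps) * N%:R^-1) ^+ 2 * wtot R)).
  have -> : N%:R * 2 = #|{: 'I_N * bool}|%:R :> R by rewrite card_prod card_ord card_bool natrM.
  rewrite mulr_natl -sumr_const; apply: ler_sum => -[i b] _; apply: ler_pM.
  - exact: rate_ge0.
  - by apply: itg_wtM_ge0 => y; rewrite sqr_ge0.
  - by rewrite /=; case: b; lra.
  - by apply: sq => // y; exact: S_zincr_step.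
have h2 : \sum_(p : 'I_N * 'I_N) rate al be muN x (inr p) * itg (fun y => wt y * S k (zincr x (inr p)) y ^+ 2) <=
    (N%:R * N%:R) * ((muN / N%:R) * (N%:R^-1 ^+ 2 * wtot R)).
  have -> : N%:R * N%:R = #|{: 'I_N * 'I_N}|%:R :> R by rewrite card_prod card_ord natrM.
  rewrite mulr_natl -sumr_const; apply: ler_sum => -[i j] _; apply: ler_pM.
  - exact: rate_ge0.
  - by apply: itg_wtM_ge0 => y; rewrite sqr_ge0.
  - by rewrite /=; case: ifP => // _; rewrite mulr_ge0.
  - by apply: sq => // y; exact: S_zincr_le.
apply: (@le_trans _ _ (c * ((N%:R * 2) * ((al + be) * ((N%:R^-1 * (M / eps) * N%:R^-1) ^+ 2 * wtot R)) +
   (N%:R * N%:R) * ((muN / N%:R) * (N%:R^-1 ^+ 2 * wtot R))))).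
  by rewrite ler_wpM2l// lerD.
set A := M / eps in Me *.
have -> : c * (N%:R * 2 * ((al + be) * ((N%:R^-1 * A * N%:R^-1) ^+ 2 * wtot R)) +
    N%:R * N%:R * (muN / N%:R * (N%:R^-1 ^+ 2 * wtot R))) =
   (c / N%:R ^+ 2) * (2 * (al + be) * A ^+ 2 * wtot R / N%:R) + c * muN * wtot R / N%:R by field.
have -> : Cn / N%:R = 2 * (al + be) * A ^+ 2 * wtot R / N%:R + mu * wtot R / N%:R by rewrite /Cn -/A; ring.
rewrite hmu lerD2r ler_piMl//.
  have ab : 0 <= al + be by exact: addr_ge0.
  by rewrite mulr_ge0// mulr_ge0// mulr_ge0 ?sqr_ge0// mulr_ge0.
by rewrite ler_pdivrMr ?exprn_gt0// mul1r; exact: sc_noise.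
Qed.

(** The square is expanded at each jump: the linear parts reassemble into the drift [BN] of the
    profile, and the quadratic parts are the noise. *)
Lemma gen_energy x : c * G Ven x <=
  itg (fun y => wt y * (2 * dev x y * S k (BN sc N (zeta x)) y)) + Cn / N%:R.
Proof.
have bS e : bm (S k (zincr x e)) by apply: (bm_S e0 km); exact: zincr_bm.
have bd := dev_bm x.
have bdS e : bm (fun y => 2 * dev x y * S k (zincr x e) y) by apply: bmM => //; exact: bmZ.
have H e : Ven (target x e) - Ven x = itg (fun y => wt y * (2 * dev x y * S k (zincr x e) y)) +
    itg (fun y => wt y * S k (zincr x e) y ^+ 2).
  rewrite -itg_wtMD//; last exact: bm_sqr.
  rewrite /Ven -itgB; [|by apply: dom_wtM; apply: bm_sqr; exact: dev_bm|by apply: dom_wtM; exact: bm_sqr].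
  by congr itg; apply/funext => y; rewrite dev_target; ring.
rewrite genE; under eq_bigr do rewrite H mulrDr.
rewrite big_split /= mulrDr; apply: lerD; last exact: noise_le.
rewrite le_eqVlt; apply/orP; left; apply/eqP.
transitivity (c * itg (fun y => \sum_(e : move N) rate al be muN x e * (wt y * (2 * dev x y * S k (zincr x e) y)))).
  rewrite itg_sum; last by move=> e; apply: domZ; exact: dom_wtM.
  by congr (_ * _); apply: eq_bigr => e _; rewrite itgZ//; exact: dom_wtM.
rewrite -itgZ; last by apply: dom_sum => e; apply: domZ; exact: dom_wtM.
congr itg; apply/funext => y; rewrite -sum_rate_S !mulr_sumr; apply: eq_bigr => e _; ring.
Qed.

End FixedProfile.

Section TimeStep.
Variables (psi : R -> R).
Hypothesis psi_u : unitdec psi.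
Local Notation vN := (vN sc psi_u N).

Definition Vt (t : R) x : R := Ven (vN t) x.

(** The pointwise form of the time step: primed quantities belong to the end of the step, where the
    generator acts, and are replaced by those at the beginning. The squared increment enters with a
    negative sign and is dropped. *)
Lemma square_step (F F' Sb Bv d r1 r2 L : R) : 0 <= d -> `|F'| <= 1 -> `|F - F' - d * Bv| <= r1 ->
  `|F - F'| <= r2 -> `|Bv| <= L -> `|Sb| <= L ->
  F' ^+ 2 + d * (2 * F' * Sb) <= F ^+ 2 + d * (2 * F * (Sb - Bv)) + (2 * r1 + 4 * d * r2 * L).
Proof.
move=> d0 F1 h1 h2 hB hS.
have -> : F' ^+ 2 + d * (2 * F' * Sb) = F ^+ 2 + d * (2 * F * (Sb - Bv)) +
   (- (F - F') ^+ 2 + (- (2 * (F' * (F - F' - d * Bv))) + 2 * d * ((F - F') * (Bv - Sb)))) by ring.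
rewrite lerD2l -[leRHS]add0r lerD ?oppr_le0 ?sqr_ge0//; apply: lerD.
  apply: le_trans (ler_norm _) _; rewrite normrN !normrM ger0_norm// ler_wpM2l//.
  by rewrite -[leRHS]mul1r; apply: ler_pM.
have -> : 4 * d * r2 * L = 2 * d * (r2 * (L + L)) by ring.
rewrite ler_wpM2l ?mulr_ge0//; apply: le_trans (ler_norm _) _; rewrite normrM; apply: ler_pM => //.
by apply: le_trans (ler_normB _ _) _; exact: lerD.
Qed.

(** [zeta] and [vN] obey the same lattice equation, so no consistency error appears. The sources are
    the oscillation of two monotone profiles and the noise. *)
Lemma energy_step : exists2 C2, 0 <= C2 & forall t d x, 0 <= t -> 0 <= d <= 1 ->
  Vt (t + d) x + d * (c * G (Vt (t + d)) x) <=
  (1 + (sc_K sc + 2 * mu) * d) * Vt t x + d * (16 * mu * eps * wtot R + Cn / N%:R) + C2 * d ^+ 2.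
Proof.
have L0 := Lam_gt0 sc N; set L := Lam sc N in L0.
have LL : 0 <= L + L ^+ 2 by rewrite addr_ge0 ?sqr_ge0// ltW.
have W0 := wtot_ge0 R.
pose Q := 2 * L ^+ 2 + 4 * (L + L ^+ 2) * L.
have Q0 : 0 <= Q by rewrite /Q addr_ge0// mulr_ge0 ?sqr_ge0// ?mulr_ge0// ltW.
exists (Q * wtot R) => [|t d x t0 /andP[d0 d1]]; first by rewrite mulr_ge0.
have td0 : 0 <= t + d by rewrite addr_ge0.
have uv := vN_unitdec sc psi_u N t0; have uv' := vN_unitdec sc psi_u N td0.
have ep y := vN_EP sc psi_u N y t0 d0; have lip y := vN_lip sc psi_u N y t0 d0 d1.
rewrite /Vt; move: ep lip uv uv'; rewrite -/L; set v := vN t; set v' := vN (t + d) => ep lip uv uv'.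
have bv := unitdec_bm uv; have bv' := unitdec_bm uv'; have bz := zeta_bm x; have uz := zeta_unitdec R N0 x.
have bBv := bm_BN sc N bv; have bBz := bm_BN sc N bz.
pose Sb := S k (BN sc N (zeta x)); pose SB_ := S k (BN sc N v).
have bSb : bm Sb by exact: (bm_S e0 km).
have bSB : bm SB_ by exact: (bm_S e0 km).
have bF := dev_bm uv x; have bF' := dev_bm uv' x.
have pt y : dev v' x y ^+ 2 + d * (2 * dev v' x y * Sb y) <=
    dev v x y ^+ 2 + d * (2 * dev v x y * (Sb y - SB_ y)) + Q * d ^+ 2.
  have dd : dev v x y - dev v' x y = S k (fun z => v' z - v z) y.
    by rewrite /dev (SB e0 km y bv' bv); ring.
  have r1 : `|dev v x y - dev v' x y - d * SB_ y| <= L ^+ 2 * d ^+ 2.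
    rewrite dd -(SZ e0 km d y bBv) -(SB e0 km y (bmB bv' bv) (bmZ d bBv)).
    apply: (normr_S_le e0 km); first by apply: bmB; [exact: bmB|exact: bmZ].
    by move=> z _; rewrite -exprMn; exact: ep.
  have r2 : `|dev v x y - dev v' x y| <= (L + L ^+ 2) * d.
    by rewrite dd; apply: (normr_S_le e0 km) => [|z _]; [exact: bmB|exact: lip].
  have hB : `|SB_ y| <= L by apply: (normr_S_le e0 km bBv) => z _; exact: BN_bound.
  have hS : `|Sb y| <= L by apply: (normr_S_le e0 km bBz) => z _; exact: BN_bound.
  have := square_step d0 (dev_le uv' x y) r1 r2 hB hS.
  have -> : 2 * (L ^+ 2 * d ^+ 2) + 4 * d * ((L + L ^+ 2) * d) * L = Q * d ^+ 2 by rewrite /Q; ring.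
  by [].
have b2F : bm (fun y => 2 * dev v x y) by exact: bmZ.
have b2F' : bm (fun y => 2 * dev v' x y) by exact: bmZ.
have bX : bm (fun y => 2 * dev v' x y * Sb y) by exact: bmM.
have bY : bm (fun y => 2 * dev v x y * (Sb y - SB_ y)) by apply: bmM => //; exact: bmB.
have I1 : Ven v' x + d * itg (fun y => wt y * (2 * dev v' x y * Sb y)) <=
   Ven v x + d * itg (fun y => wt y * (2 * dev v x y * (Sb y - SB_ y))) + Q * wtot R * d ^+ 2.
  have := le_itg_wtM (bmD (bm_sqr bF') (bmZ d bX)) (bmD (bmD (bm_sqr bF) (bmZ d bY)) (bm_cst (Q * d ^+ 2))) pt.
  rewrite (itg_wtMD (bm_sqr bF') (bmZ d bX)) (itg_wtMD (bmD (bm_sqr bF) (bmZ d bY)) (bm_cst (Q * d ^+ 2))).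
  rewrite (itg_wtMD (bm_sqr bF) (bmZ d bY)) (itg_wtMZ d bX) (itg_wtMZ d bY).
  have -> : itg (fun y => wt y * (Q * d ^+ 2)) = Q * wtot R * d ^+ 2.
    have -> : (fun y => wt y * (Q * d ^+ 2)) = (fun y => Q * d ^+ 2 * wt y) by apply/funext => y; rewrite mulrC.
    by rewrite itgZ; [rewrite /wtot; ring|exact: dom_wt].
  by [].
have I2 := gen_energy uv' x; rewrite -/Sb in I2.
have I3 : itg (fun y => wt y * (2 * dev v x y * (Sb y - SB_ y))) <=
   (sc_K sc + 2 * mu) * Ven v x + 16 * mu * eps * wtot R.
  pose D z := zeta x z - v z; pose R0 z := zeta x z + v z - 1.
  have bD : bm D by exact: bmB.
  have bR : bm R0 by apply: bmB; [exact: bmD|exact: bm_cst].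
  have DB z : `|D z| <= 1.
    by apply: unit_dist_le1; [have [_ /(_ z)] := uz|have [_ /(_ z)] := uv].
  have RB z : `|R0 z| <= 1.
    by apply: unit_add_le1; [have [_ /(_ z)] := uz|have [_ /(_ z)] := uv].
  have := energy e0 km (sc_c0 sc N) (sc_al0 sc) (sc_be0 sc) (ltW (sc_mu0 sc)) ler01 ler01
    (fun z : R => sc_wt sc N0 z) bD DB bR RB.
  have -> : itg (fun y => wt y * (2 * S k D y * (Lop c al be N%:R^-1 (S k D) y + mu * S k (fun z => D z * R0 z) y))) =
     itg (fun y => wt y * (2 * dev v x y * (Sb y - SB_ y))).
    congr itg; apply/funext => y; rewrite devE//; congr (_ * (_ * _)).
    by rewrite /Sb /SB_ (S_BN_diff sc N N y e0 km bz bv) subrr addr0.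
  have -> : itg (fun y => wt y * S k D y ^+ 2) = Ven v x.
    by congr itg; apply/funext => y; rewrite devE.
  move=> h; apply: (le_trans h); rewrite mulr1 lerD2l !mulr1.
  have := itg_wt_osc e0 km uz uv; rewrite -/D => ho.
  have -> : 16 * mu * eps * wtot R = 4 * mu * (4 * eps * wtot R) by ring.
  by rewrite ler_wpM2l// mulr_ge0// ltW// sc_mu0.
move: I1 I2 I3; set i1 := itg _; set i2 := itg _; set w1 := Ven v' x; set w2 := Ven v x; set g := c * _; set q := Q * wtot R * _; set kk := sc_K sc + 2 * mu; set ee := 16 * mu * eps * wtot R; set cn := Cn / _.
move=> I1 I2 I3.
have j2 : d * g <= d * (i1 + cn) by rewrite ler_wpM2l.
have j3 : d * i2 <= d * (kk * w2 + ee) by rewrite ler_wpM2l.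
have -> : (1 + kk * d) * w2 + d * (ee + cn) + q = w2 + d * (kk * w2 + ee) + q + d * cn by ring.
move: j2; rewrite mulrDr => j2; lra.
Qed.

Lemma Vt_lip t d x : 0 <= t -> 0 <= d -> d <= 1 ->
  `|Vt (t + d) x - Vt t x| <= 2 * (Lam sc N + Lam sc N ^+ 2) * wtot R * d.
Proof.
move=> t0 d0 d1; have td0 : 0 <= t + d by rewrite addr_ge0.
have uv := vN_unitdec sc psi_u N t0; have uv' := vN_unitdec sc psi_u N td0.
have bv := unitdec_bm uv; have bv' := unitdec_bm uv'.
have bF := dev_bm uv x; have bF' := dev_bm uv' x.
rewrite /Vt /Ven -itgB; [|by apply: dom_wtM; exact: bm_sqr|by apply: dom_wtM; exact: bm_sqr].
rewrite mulrAC; apply: normr_itg_wt => [|y].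
  by apply: mfB; apply: mfM; try exact: mf_wt; apply: mf_sqr; exact: bm_mf.
have -> : wt y * dev (vN (t + d)) x y ^+ 2 - wt y * dev (vN t) x y ^+ 2 =
   (dev (vN (t + d)) x y - dev (vN t) x y) * (dev (vN (t + d)) x y + dev (vN t) x y) * wt y by ring.
rewrite normrM (ger0_norm (wt_ge0 _)) ler_wpM2r ?wt_ge0// normrM.
rewrite -mulrA mulrC; apply: ler_pM => //.
  by apply: le_trans (ler_normD _ _) _; have := dev_le uv' x y; have := dev_le uv x y; lra.
have -> : dev (vN (t + d)) x y - dev (vN t) x y = - S k (fun z => vN (t + d) z - vN t z) y.
  by rewrite /dev (SB e0 km y bv' bv); ring.
by rewrite normrN; apply: (normr_S_le e0 km) => [|z _]; [exact: bmB|exact: vN_lip].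
Qed.

Lemma Vt_itv t x : 0 <= t -> 0 <= Vt t x <= wtot R.
Proof.
move=> t0; have uv := vN_unitdec sc psi_u N t0; have bF := dev_bm uv x.
apply/andP; split; first by apply: itg_wtM_ge0 => y; rewrite sqr_ge0.
rewrite -[leRHS]mul1r; apply: itg_wtM_le => [|y]; first exact: bm_sqr.
by rewrite -real_normK ?num_real// expr_le1// dev_le.
Qed.

Lemma zeta_dist t x eta : 0 <= t -> 0 < eta ->
  itg (fun y => wt y * `|zeta x y - vN t y|) <= eta * wtot R + Vt t x / eta + 4 * eps * wtot R.
Proof.
move=> t0 eta0; have uv := vN_unitdec sc psi_u N t0; have bv := unitdec_bm uv; have bz := zeta_bm x.
apply: le_trans (itg_wt_abs_le_sqr e0 km (bmB bz bv) eta0) _.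
have -> : itg (fun y => wt y * S k (fun z => zeta x z - vN t z) y ^+ 2) = Vt t x.
  by congr itg; apply/funext => y; rewrite devE.
by rewrite lerD2l; exact: (itg_wt_osc e0 km (zeta_unitdec R N0 x) uv).
Qed.

End TimeStep.
End ParticleEnergy.

(** * Convergence of the initial profile *)

Section InitialProfile.
Variable R : realType.
Local Notation leb := (@lebesgue_measure R).
Variables (f : R -> R) (y0 A L B : R).
Hypotheses (cf : continuous f) (fs : forall z, A <= `|z - y0| -> f z = 0) (A0 : 0 <= A) (L0 : 0 <= L).
Hypotheses (fL : forall a b, a <= b -> `|f b - f a| <= L * (b - a)) (fB : forall z, `|f z| <= B).
Variables (N : nat) (x : config N).
Hypothesis N0 : (0 < N)%N.

Let Ngt : 0 < N%:R :> R. Proof. by rewrite ltr0n. Qed.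
Let Nne : N%:R != 0 :> R. Proof. by rewrite gt_eqF. Qed.

Let a (k : int) : R := xi R k x * f (k%:~R / N%:R).
Let M0 : nat := (Num.truncn (N%:R * (`|y0| + A))).+1.

Let a_far (k : int) : (M0%:Z <= `|k|)%R -> a k = 0.
Proof.
move=> Mk; rewrite /a fs ?mulr0//.
have h1 : N%:R * (`|y0| + A) <= `|k%:~R : R|.
  apply: le_trans (ltW (truncnS_gt _)) _; rewrite -/M0.
  by rewrite -intr_norm -[M0%:R]/((M0%:Z)%:~R) ler_int.
have h2 : `|y0| + A <= `|k%:~R / N%:R|.
  by rewrite normrM normfV (ger0_norm (ltW Ngt)) ler_pdivlMr// mulrC.
by have := ler_distD 0 (k%:~R / N%:R) y0; have := lerB_dist (k%:~R / N%:R) y0; lra.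
Qed.

Let part (M : nat) : R := \sum_(i < (2 * M).+1) a (i%:Z - M%:Z)%R.

Let part_const M : (M0 <= M)%N -> part M.+1 = part M.
Proof.
move=> MM; rewrite /part mulnS add2n big_ord_recl big_ord_recr /=.
rewrite a_far ?add0r; last by lia.
rewrite [X in _ + X]a_far ?addr0; last by rewrite /bump; lia.
by apply: eq_bigr => i _; congr a; rewrite /bump /=; lia.
Qed.

Let zsumE M : (M0 <= M)%N -> zsum a = part M.
Proof.
have H m : part (M0 + m) = part M0.
  by elim: m => [|m IH]; [rewrite addn0|rewrite addnS part_const ?leq_addr].
have H' m : (M0 <= m)%N -> part m = part M0 by move=> /subnKC <-; exact: H.
move=> MM; rewrite H'// /zsum; apply: cvg_lim => //.
by apply: cvg_near_cst; exists M0 => // m /=; exact: H'.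
Qed.

Let cell (k : int) : R -> R := \1_(`[k%:~R / N%:R, (k + 1)%:~R / N%:R[%classic).

Let cellE k z : cell k z = (Num.floor (N%:R * z) == k)%:R.
Proof.
rewrite /cell indicE mem_setE in_itv/= ler_pdivrMr// ltr_pdivlMr// [z * _]mulrC.
by rewrite -floor_eq.
Qed.

Let cell_itg k : itg (cell k) = N%:R^-1.
Proof.
rewrite /itg integral_indic ?setIT//= lebesgue_measure_itv/= lte_fin.
have e : (k + 1)%:~R / N%:R - k%:~R / N%:R = N%:R^-1 :> R by rewrite intrD; field.
by rewrite ifT /= ?e// -subr_gt0 e invr_gt0.
Qed.

Let cell_dom k : dom (cell k).
Proof.
apply: dom_le (dom_ind (k%:~R / N%:R) ((k + 1)%:~R / N%:R)) _.
  by apply: measurable_indic; exact: measurable_itv.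
move=> z; rewrite /cell /ind !indicE !mem_setE !in_itv/=.
by case: (_ <= z); rewrite ?normr0//=; case: ltP => h; rewrite ?normr1 ?(ltW h)// normr0.
Qed.

Let flz (z : R) : R := (Num.floor (N%:R * z))%:~R / N%:R.

Let flz_le z : flz z <= z.
Proof. by rewrite /flz ler_pdivrMr// [z * _]mulrC floor_le_tmp. Qed.

Let flz_ge z : z - flz z <= N%:R^-1.
Proof.
have h := ltW (floorD1_gt (N%:R * z)); rewrite /flz.
rewrite -(ler_pM2r Ngt) mulrBl mulVf// divfK// [z * _]mulrC lerBlDl.
by rewrite -[1]/((1:int)%:~R) -intrD.
Qed.

Let step_sum M z : (M0 <= M)%N ->
  zeta x z * f (flz z) = \sum_(i < (2 * M).+1) a (i%:Z - M%:Z)%R * cell (i%:Z - M%:Z)%R z.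
Proof.
move=> MM; set k := Num.floor (N%:R * z).
have az : zeta x z * f (flz z) = a k by [].
have [kM|kM] := leP (`|k|)%R M%:Z.
  have ki : (absz (k + M%:Z)%R < (2 * M).+1)%N by lia.
  rewrite az (bigD1 (Ordinal ki))//= big1 ?addr0 => [|j jk].
    have -> : ((absz (k + M%:Z)%R)%:Z - M%:Z)%R = k by lia.
    by rewrite cellE -/k eqxx mulr1.
  rewrite cellE -/k; case: eqP => [e|_]; last by rewrite mulr0.
  by exfalso; move/eqP: jk; apply; apply/val_inj => /=; lia.
rewrite az a_far; last by lia.
rewrite big1// => i _; rewrite cellE -/k; case: eqP => [e|_]; last by rewrite mulr0.
by exfalso; have := ltn_ord i; lia.
Qed.

(** The lattice sum is exactly the integral of [zeta] against [f] sampled at the left end of each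
    cell, because [zeta] is constant on cells. What remains is the Lipschitz error [L / N] on an
    interval of length [2 A + 4], with a margin for cells that meet the boundary of the support. *)
Lemma riemann_dist : `|itg (fun z => zeta x z * f z) - N%:R^-1 * zsum a| <= L / N%:R * (2 * A + 4).
Proof.
have zM := zsumE (leqnn M0).
have dc (k : int) : dom (fun z => a k * cell k z) by apply: domZ.
have dg : dom (fun z => zeta x z * f (flz z)).
  have -> : (fun z => zeta x z * f (flz z)) = (fun z => \sum_(i < (2 * M0).+1) a (i%:Z - M0%:Z)%R * cell (i%:Z - M0%:Z)%R z).
    by apply/funext => z; rewrite -(step_sum z (leqnn M0)).
  by apply: dom_sum => i; exact: dc.
have ge : itg (fun z => zeta x z * f (flz z)) = N%:R^-1 * zsum a.
  have -> : (fun z => zeta x z * f (flz z)) = (fun z => \sum_(i < (2 * M0).+1) a (i%:Z - M0%:Z)%R * cell (i%:Z - M0%:Z)%R z).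
    by apply/funext => z; rewrite -(step_sum z (leqnn M0)).
  rewrite itg_sum; last by move=> i; exact: dc.
  rewrite zM /part mulr_sumr; apply: eq_bigr => i _; rewrite itgZ; last exact: cell_dom.
  by rewrite cell_itg mulrC.
have uz := zeta_unitdec R N0 x; have [mz [Bz zB]] := unitdec_bm uz.
have NV1 : N%:R^-1 <= 1 :> R by rewrite invf_le1 ?ler1n.
have NV0 : 0 <= N%:R^-1 :> R by rewrite invr_ge0.
have df : dom f.
  apply: (@dom_le _ (fun z => B * ind (y0 - A) (y0 + A) z)); first exact: mf_continuous.
    by apply: domZ; exact: dom_ind.
  move=> z; rewrite indE; have [h|h] := boolP (y0 - A <= z <= y0 + A); first by rewrite mulr1.
  rewrite mulr0 fs ?normr0//; move: h; rewrite negb_and -!ltNge => /orP[h|h].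
    by have A1 := A0; rewrite ler0_norm; lra.
  by have A1 := A0; rewrite ger0_norm; lra.
rewrite -ge -itgB//; last exact: (domM mz zB).
have -> : L / N%:R * (2 * A + 4) = itg (fun z => L / N%:R * ind (y0 - A - 2) (y0 + A + 2) z).
  have A1 := A0; rewrite itgZ ?itg_ind//; [congr (_ * _); ring|lra|exact: dom_ind].
apply: normr_itg_le; [by apply: domB => //; exact: (domM mz zB)|by apply: domZ; exact: dom_ind|move=> z].
have h1 := flz_le z; have h2 := flz_ge z; have A1 := A0.
rewrite -mulrBr normrM.
have zz : `|zeta x z| <= 1 by have [_ /(_ z)/andP[? ?]] := uz; rewrite ger0_norm.
apply: (@le_trans _ _ `|f z - f (flz z)|); first by rewrite ler_piMl.
rewrite indE; have [h|h] := boolP (y0 - A - 2 <= z <= y0 + A + 2).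
  rewrite mulr1; apply: le_trans (fL h1) _; by rewrite ler_wpM2l.
have zf : f z = 0.
  apply: fs; move: h; rewrite negb_and -!ltNge => /orP[h|h]; first by rewrite ler0_norm; lra.
  by rewrite ger0_norm; lra.
have zg : f (flz z) = 0.
  apply: fs; move: h; rewrite negb_and -!ltNge => /orP[h|h]; first by rewrite ler0_norm; lra.
  by rewrite ger0_norm; lra.
by rewrite zf zg subrr normr0 mulr0.
Qed.

End InitialProfile.

Section InitialEnergy.
Variable R : realType.
Variables (psi : R -> R) (x0 : forall N, config N).
Arguments x0 : clear implicits.
Hypothesis psi_u : unitdec psi.
Hypothesis hinit : forall f : R -> R, schwartz f ->
  (fun N : nat => (N%:R)^-1 * zsum (fun k : int => xi R k (x0 N) * f (k%:~R / N%:R)))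
       @ \oo --> distr_of psi f.
Variable eps : R.
Hypothesis e0 : 0 < eps.
Local Notation k := (moll eps).

(** For fixed [y] the translated mollifier is a Schwartz function, so the hypothesis on the initial
    configurations applies to it directly. This is where weak convergence becomes pointwise. *)
Lemma S_zeta_cvg y : S k (@zeta R n.+1 (x0 n.+1)) y @[n --> \oo] --> S k psi y.
Proof.
have [M M0 HM] := moll_mollifier R; have km := HM _ e0; have [ck k0 ks _ kM] := km.
have en0 : eps^-1 != 0 by rewrite invr_neq0// gt_eqF.
pose f z := k (z - y).
have sf : schwartz f by rewrite /f moll_translate; exact: schwartz_mkt.
have cf : continuous f by rewrite /f moll_translate; exact: continuous_mkt.
have [M1 M10 HM1] := moll_bounds eps y.
have fL a b : a <= b -> `|f b - f a| <= M1 * (b - a).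
  move=> ab; apply: mvt_bound => // t.
    by rewrite /f moll_translate; exact: derivable_mkt.
  exact: (HM1 1%N isT t).
have fB z : `|f z| <= M1 by exact: (HM1 0%N isT z).
have fs z : eps <= `|z - y| -> f z = 0 by exact: ks.
pose g0 N : R := N%:R^-1 * zsum (fun k : int => xi R k (x0 N) * f (k%:~R / N%:R)).
pose g n : R := g0 n.+1.
have hg : g0 @ \oo --> S k psi y := hinit sf.
have hi : g n @[n --> \oo] --> S k psi y by rewrite (cvg_shiftS g0).
have hd n : `|S k (@zeta R n.+1 (x0 n.+1)) y - g n| <= M1 * (2 * eps + 4) * n.+1%:R^-1.
  have := riemann_dist cf fs (ltW e0) M10 fL fB (x0 n.+1) (ltn0Sn n).
  by rewrite mulrAC.
have c0 : M1 * (2 * eps + 4) * n.+1%:R^-1 @[n --> \oo] --> (0 : R).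
  by rewrite -[X in _ --> X](mulr0 (M1 * (2 * eps + 4))); apply: cvgMl_tmp; exact: cvg_harmonic.
have d0 : S k (@zeta R n.+1 (x0 n.+1)) y - g n @[n --> \oo] --> (0 : R).
  by apply/norm_cvg0P; apply: (squeeze_cvgr _ (cvg_cst 0) c0); apply: nearW => n; rewrite normr_ge0 hd.
have -> : (fun n => S k (@zeta R n.+1 (x0 n.+1)) y) = (fun n => (S k (@zeta R n.+1 (x0 n.+1)) y - g n) + g n).
  by apply/funext => n; rewrite subrK.
by rewrite -[X in _ --> X]add0r; exact: cvgD d0 hi.
Qed.

Lemma init_energy e : 0 < e -> exists N1, forall N, (N1 <= N)%N -> (0 < N)%N ->
  itg (fun y => wt y * (S k (zeta (x0 N)) y - S k psi y) ^+ 2) <= e.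
Proof.
move=> e_gt0; have [M M0 HM] := moll_mollifier R; have km := HM _ e0.
pose F n y := wt y * (S k (@zeta R n.+1 (x0 n.+1)) y - S k psi y) ^+ 2.
have uz n := zeta_unitdec R (ltn0Sn n) (x0 n.+1).
have bd n : bm (fun y => S k (zeta (x0 n.+1)) y - S k psi y).
  by apply: bmB; apply: (bm_S e0 km); exact: unitdec_bm.
have c : itg (F n) @[n --> \oo] --> (0 : R).
  apply: (@itg_dominated R F 1).
  - by move=> n; apply: mfM; [exact: mf_wt|apply: mf_sqr; exact: bm_mf].
  - move=> n y; rewrite /F normrM mulrC (ger0_norm (wt_ge0 _)) ler_wpM2r ?wt_ge0// normrX.
    rewrite expr_le1// -(SB e0 km y (unitdec_bm (uz n)) (unitdec_bm psi_u)).
    apply: (normr_S_le e0 km); first by apply: bmB; exact: unitdec_bm.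
    by move=> z _; apply: unit_dist_le1; [have [_ /(_ z)] := uz n|have [_ /(_ z)] := psi_u].
  apply: aeW => y; rewrite -(mulr0 (wt y)); apply: cvgMl_tmp.
  have h := @S_zeta_cvg y; have h2 : S k (@zeta R n.+1 (x0 n.+1)) y - S k psi y @[n --> \oo] --> (0 : R).
    by rewrite -(subrr (S k psi y)); apply: cvgB => //; exact: cvg_cst.
  by rewrite -[X in _ --> X](mulr0 (0 : R)) -expr2; apply: cvgM.
have [N1 _ H] : \forall n \near \oo, itg (F n) <= e by apply: (cvgr_le _ c).
by exists N1.+1 => -[//|n] Nn _; exact: H.
Qed.

End InitialEnergy.

(** * Convergence in probability *)

Section ConvergenceInProbability.
Variable R : realType.
Variables (sc : scaling R) (psi : R -> R) (T : R) (x0 : forall N, config N) (muN : nat -> R).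
Arguments x0 : clear implicits.
Hypotheses (psi_u : unitdec psi) (T0 : 0 < T).
Hypothesis hinit : forall f : R -> R, schwartz f ->
  (fun N : nat => (N%:R)^-1 * zsum (fun k : int => xi R k (x0 N) * f (k%:~R / N%:R)))
       @ \oo --> distr_of psi f.
Hypothesis hmu : forall N, (2 <= N)%N -> sc_c sc N * muN N = sc_mu sc.
Hypothesis muN0 : forall N, (2 <= N)%N -> 0 <= muN N.
Hypothesis c1 : forall N, (2 <= N)%N -> 1 <= sc_c sc N.
Local Notation vN N := (vN sc psi_u N).
Local Notation mu := (sc_mu sc).

(** The integrating factor: [1 + K d <= e^(K d)] absorbs the growth of the energy, and the decrease
    of the remaining time by [d] pays for the source [r]. *)
Lemma exp_step (K E1 E2 tau V1 V2 g r d C : R) : 0 <= K -> 0 <= d -> 0 <= tau -> 0 <= V1 -> 0 <= r -> 0 <= C ->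
  0 <= E2 -> E1 = E2 * expR (K * d) ->
  V2 + d * g <= (1 + K * d) * V1 + d * r + C * d ^+ 2 ->
  E2 * (V2 + tau * r) + d * (E2 * g) <= E1 * (V1 + (tau + d) * r) + E2 * C * d ^+ 2.
Proof.
move=> K0 d0 t0 V0 r0 C0 E20 -> h.
have e1 := expR_ge1Dx (K * d).
have e2 : 1 <= expR (K * d) by rewrite -expR0 ler_expR mulr_ge0.
have -> : E2 * (V2 + tau * r) + d * (E2 * g) = E2 * ((V2 + d * g) + tau * r) by ring.
have -> : E2 * expR (K * d) * (V1 + (tau + d) * r) + E2 * C * d ^+ 2 =
  E2 * (expR (K * d) * V1 + expR (K * d) * ((tau + d) * r) + C * d ^+ 2) by ring.
rewrite ler_wpM2l//.
have a1 : (1 + K * d) * V1 <= expR (K * d) * V1 by rewrite ler_wpM2r.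
have a2 : (tau + d) * r <= expR (K * d) * ((tau + d) * r) by rewrite ler_peMl// mulr_ge0// addr_ge0.
move: a2; rewrite [in X in X <= _]mulrDl => a2; lra.
Qed.

Section FixedN.
Variables (N : nat) (eps M a : R).
Hypotheses (N2 : (2 <= N)%N) (e0 : 0 < eps) (km : mollifier M eps (moll eps)) (a0 : 0 < a).
Variables (d : measure_display) (Omega : measurableType d) (P : probability Omega R).
Variable X : Omega -> R -> config N.
Hypothesis ch : is_chain P (sc_al sc) (sc_be sc) (muN N) (x0 N) X.

Let N0 : (0 < N)%N. Proof. exact: ltn_trans N2. Qed.
Let c := sc_c sc N.
Let c_gt0 : 0 < c. Proof. exact: lt_le_trans (c1 N2). Qed.
Let V := @Vt R sc N eps psi psi_u.
Let K := sc_K sc + 2 * mu.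
Let err := 16 * mu * eps * wtot R + Cn sc eps M / N%:R.

Let K0 : 0 <= K. Proof. by rewrite /K addr_ge0 ?sc_K0// mulr_ge0// ltW// sc_mu0. Qed.
Let err0 : 0 <= err.
Proof.
have mu0 := sc_mu0 sc; have al0 := sc_al0 sc; have be0 := sc_be0 sc; have W0 := wtot_ge0 R.
rewrite /err addr_ge0//; first by rewrite mulr_ge0// mulr_ge0 ?(ltW e0)// mulr_ge0// ltW.
rewrite mulr_ge0// /Cn mulr_ge0// addr_ge0 ?(ltW mu0)// mulr_ge0 ?sqr_ge0// mulr_ge0//.
exact: addr_ge0.
Qed.

(** A space-time supersolution in the unaccelerated time [s] of the chain. With remaining time
    [T - s / c], the exponential compensates the growth of the energy and the additive term its
    sources; the division by [a] makes it at least 1 where the energy reaches [a]. *)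
Let h (s : R) (x : config N) : R := expR (K * (T - s / c)) / a * (V (s / c) x + (T - s / c) * err).
Let bad (s : R) (x : config N) : Prop := a <= V (s / c) x.

Let sT s : 0 <= s <= c * T -> 0 <= s / c <= T.
Proof. by move=> /andP[s0 sT]; rewrite divr_ge0 ?(ltW c_gt0)//= ler_pdivrMr// mulrC. Qed.

Let V01 t x : 0 <= t -> 0 <= V t x <= wtot R.
Proof. exact: (Vt_itv sc N0 e0 km psi_u). Qed.

Let hM s x : 0 <= s <= c * T -> 0 <= h s x <= expR (K * T) / a * (wtot R + T * err).
Proof.
move=> /sT /andP[t0 tT]; have /andP[V0 V1] := V01 x t0.
have Tt : 0 <= T - s / c by rewrite subr_ge0.
have TT : T - s / c <= T by rewrite lerBlDr lerDl.
have S0 : 0 <= V (s / c) x + (T - s / c) * err by rewrite addr_ge0// mulr_ge0.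
have Ea t : 0 <= expR t / a by rewrite mulr_ge0 ?expR_ge0// invr_ge0 ltW.
rewrite /h mulr_ge0//=; apply: ler_pM => //.
  by rewrite ler_pM2r ?invr_gt0// ler_expR ler_wpM2l.
by apply: lerD => //; rewrite ler_wpM2r.
Qed.

Let hbad s x : 0 <= s <= c * T -> bad s x -> 1 <= h s x.
Proof.
move=> /sT /andP[t0 tT] bx; have /andP[V0 V1] := V01 x t0.
have Tt : 0 <= T - s / c by rewrite subr_ge0.
have E1 : 1 <= expR (K * (T - s / c)) by rewrite -expR0 ler_expR mulr_ge0.
have Va : 1 <= (V (s / c) x + (T - s / c) * err) / a.
  by rewrite ler_pdivlMr// mul1r (le_trans bx)// lerDl mulr_ge0.
rewrite /h mulrAC -mulrA -[leLHS](mulr1 1); apply: ler_pM => //.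
Qed.

Let hstep_ex : exists2 Ch, 0 <= Ch & forall s dd x, 0 <= s -> 0 <= dd <= 1 -> s + dd <= c * T ->
  h (s + dd) x + dd * gen (sc_al sc) (sc_be sc) (muN N) (h (s + dd)) x <= h s x + Ch * dd ^+ 2.
Proof.
have [C2 C20 H2] := energy_step N0 (hmu N2) (muN0 N2) e0 km psi_u.
have Ea t : 0 <= expR t / a by rewrite mulr_ge0 ?expR_ge0// invr_ge0 ltW.
exists (expR (K * T) / a * C2) => [|s dd x s0 /andP[d0 d1] sdT]; first by rewrite mulr_ge0.
have t0 : 0 <= s / c by rewrite divr_ge0// ltW.
pose t := s / c; pose de := dd / c.
have de0 : 0 <= de by rewrite /de divr_ge0// ltW.
have ded : de <= dd by rewrite /de ler_pdivrMr// ler_peMr// c1.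
have tde : (s + dd) / c = t + de by rewrite mulrDl.
have tdT : t + de <= T by rewrite -tde ler_pdivrMr// mulrC.
pose E2 := expR (K * (T - (t + de))) / a; pose E1 := expR (K * (T - t)) / a.
have Eh : E1 = E2 * expR (K * de).
  by rewrite /E1 /E2 mulrAC -expRD; congr (expR _ / a); ring.
have := H2 t de x t0; rewrite de0 (le_trans ded d1) => /(_ isT).
rewrite -/V -/K -/err -/c => hV.
have /andP[V0 V1] := V01 x t0.
have tau0 : 0 <= T - (t + de) by rewrite subr_ge0.
have := exp_step K0 de0 tau0 V0 err0 C20 (Ea _) Eh hV.
have -> : T - (t + de) + de = T - t by ring.
have hg : dd * gen (sc_al sc) (sc_be sc) (muN N) (h (s + dd)) x =
   de * (E2 * (c * gen (sc_al sc) (sc_be sc) (muN N) (V (t + de)) x)).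
  have -> : h (s + dd) = (fun y => E2 * ((T - (t + de)) * err) + E2 * V (t + de) y).
    by apply/funext => y; rewrite /h tde -/E2; ring.
  rewrite gen_affine; set g1 := gen _ _ _ _ x.
  transitivity (de * c * (E2 * g1)); [by rewrite /de divfK ?gt_eqF|ring].
have hE : h (s + dd) x = E2 * (V (t + de) x + (T - (t + de)) * err) by rewrite /h tde.
rewrite hg hE => hh; apply: (le_trans hh); rewrite -/E1 /h -/t -/E1 lerD2l.
apply: ler_pM; [exact: mulr_ge0 (Ea _) C20|exact: exprn_ge0| |by rewrite lerXn2r ?nnegrE].
by rewrite ler_wpM2r// ler_pM2r ?invr_gt0// ler_expR ler_wpM2l// lerBlDr lerDl addr_ge0.
Qed.

Let bad_set : set Omega := \bigcup_n dyadic_bad X (c * T) bad n.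

Let V_cont t x : 0 <= t -> a < V t x -> exists2 sg, 0 < sg & forall t', t <= t' <= t + sg -> a <= V t' x.
Proof.
move=> t0 aV; pose L := 2 * (Lam sc N + Lam sc N ^+ 2) * wtot R.
have L0 : 0 <= L.
  by have := Lam_gt0 sc N => l0; rewrite /L mulr_ge0 ?wtot_ge0// mulr_ge0// addr_ge0 ?sqr_ge0// ltW.
have L1 : 0 < L + 1 by rewrite ltr_wpDl.
exists (Num.min 1 ((V t x - a) / (L + 1))); first by rewrite lt_min ltr01 divr_gt0// subr_gt0.
move=> t' /andP[tt']; rewrite -lerBlDl le_min => /andP[l1 l2].
have tt0 : 0 <= t' - t by rewrite subr_ge0.
have := Vt_lip sc N0 e0 km psi_u x t0 tt0 l1; rewrite -/V -/L.
have -> : t + (t' - t) = t' by ring.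
rewrite ler_norml => /andP[h1 _].
have h2 : (L + 1) * (t' - t) <= V t x - a by rewrite mulrC -ler_pdivlMr.
move: h1 h2; set z1 := V t' x; set z2 := V t x; set z3 := t' - t => h1 h2.
have : L * z3 <= (L + 1) * z3 by rewrite ler_wpM2r// lerDl.
lra.
Qed.

(** The maximal inequality concerns dyadic times. If the energy exceeded [a] at some [t < T], the
    chain would stay still for a while after [t] and the energy, continuous in time for a frozen
    configuration, would remain at least [a] until the next point of a fine dyadic grid. *)
Let not_bad w t : ~ bad_set w -> 0 <= t <= T -> V t (X w (t * c)) <= a.
Proof.
move=> nb /andP[t0 tT]; rewrite leNgt; apply/negP => aV; apply: nb.
have cne : c != 0 by rewrite gt_eqF.
have [tT'|Tt] := ltP t T; last first.
  (* The final time has no right neighbourhood to use, but it belongs to the coarsest grid. *)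
  have tE : t = T by apply/le_anti; rewrite tT.
  exists 0%N; first by []; exists 1%N; first by [].
  have -> : 1%:R * (c * T / (2 ^ 0)%:R) = t * c by rewrite expn0 divr1 mul1r mulrC tE.
  by rewrite /bad mulfK// ltW.
have [sg sg0 Hsg] := V_cont t0 aV.
have tc0 : 0 <= t * c by rewrite mulr_ge0// ltW.
have [_ [rc _]] := ch; have [e e_gt0 He] := rc w (t * c) tc0.
pose s := Num.min (T - t) (Num.min sg (e / c)).
have s0 : 0 < s by rewrite !lt_min subr_gt0 tT' sg0 divr_gt0.
pose n := (Num.truncn (T / s)).+1.
have p2 : 0 < (2 ^ n)%:R :> R by rewrite ltr0n expn_gt0.
have ns : T / (2 ^ n)%:R < s.
  rewrite ltr_pdivrMr// mulrC -ltr_pdivrMr//; apply: (lt_le_trans (truncnS_gt _)).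
  by rewrite ler_nat ltnW// ltn_expl.
pose q := T / (2 ^ n)%:R; have q0 : 0 < q by rewrite divr_gt0.
pose j := (Num.truncn (t / q)).+1.
have tq0 : 0 <= t / q by rewrite divr_ge0// ltW.
have jlo : t < j%:R * q by rewrite -ltr_pdivrMr//; exact: truncnS_gt.
have jhi : j%:R * q <= t + q.
  rewrite /j -natr1 mulrDl mul1r lerD2r -ler_pdivlMr//; by rewrite truncn_le.
have jT : j%:R * q <= T.
  by apply: (le_trans jhi); rewrite -lerBrDl; apply: (le_trans (ltW ns)); rewrite ge_min lexx.
have jn : (j <= 2 ^ n)%N.
  by rewrite -(ler_nat R) -(ler_pM2r q0) /q [leRHS]mulrC divfK ?gt_eqF.
exists n => //; exists j; first by rewrite jn.
have tm : j%:R * (c * T / (2 ^ n)%:R) = j%:R * q * c by rewrite /q; ring.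
rewrite tm /bad mulfK; last exact: cne.
have js : j%:R * q < t + s by apply: (le_lt_trans jhi); rewrite ltrD2l.
have jsg : j%:R * q <= t + sg.
  by apply: (le_trans (ltW js)); rewrite lerD2l !ge_min lexx orbT.
have Xe : X w (j%:R * q * c) = X w (t * c).
  apply: He; rewrite ler_pM2r// (ltW jlo)/=.
  have -> : t * c + e = (t + e / c) * c by rewrite mulrDl divfK.
  rewrite ltr_pM2r//; apply: (lt_le_trans js); by rewrite lerD2l !ge_min lexx !orbT.
by rewrite Xe; apply: Hsg; rewrite (ltW jlo).
Qed.

Lemma energy_maximal : exists2 BAD : set Omega, measurable BAD /\
    (P BAD <= (expR (K * T) / a * (V 0 (x0 N) + T * err))%:E)%E &
    forall w, ~ BAD w -> forall t, 0 <= t <= T -> V t (X w (t * c)) <= a.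
Proof.
have [Ch Ch0 hs] := hstep_ex; have cT : 0 < c * T by rewrite mulr_gt0.
have [mB PB] := dyadic_bad_union (sc_al0 sc) (sc_be0 sc) (muN0 N2) ch cT Ch0 hM hs hbad.
exists bad_set; last by move=> w nb t tT; exact: not_bad.
by split=> //; apply: (le_trans PB); rewrite /h mul0r subr0.
Qed.

End FixedN.

(** [eta] and the energy level [a] depend on [r] only; [eps] is taken small for both [r] and [p],
    and [N1] comes last. The distance is split into four parts and the probability into three:
    initial energy, oscillation, noise. [N1] is chosen before the probability space. *)
Lemma convergence_in_probability (u : R -> R -> R) : (forall t, bm (u t)) ->
  (forall e, 0 < e -> exists N0 : nat, forall N, (N0 <= N)%N -> (0 < N)%N /\
    forall t, 0 <= t <= T -> itg (fun y => wt y * `|vN N t y - u t y|) <= e) ->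
  forall r p, 0 < r -> 0 < p -> exists N1 : nat, forall N, (N1 <= N)%N -> (2 <= N)%N ->
  forall (d : measure_display) (Omega : measurableType d) (P : probability Omega R)
    (X : Omega -> R -> config N), is_chain P (sc_al sc) (sc_be sc) (muN N) (x0 N) X ->
  exists2 BAD : set Omega, measurable BAD /\ (P BAD <= p%:E)%E &
    forall w, ~ BAD w -> forall t, 0 <= t <= T ->
      itg (fun y => wt y * `|zeta (X w (t * sc_c sc N)) y - u t y|) <= r.
Proof.
move=> bu ul r p r0 p0; have [M M0 HM] := moll_mollifier R.
have W0 := wtot_ge0 R; pose W := wtot R + 1; have W1 : 0 < W by rewrite /W ltr_wpDl.
have WW : wtot R <= W by rewrite /W lerDl.
have mu0 := sc_mu0 sc.
pose eta := r / (4 * W); have eta0 : 0 < eta by rewrite divr_gt0// mulr_gt0.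
pose a := eta * (r / 4); have a0 : 0 < a by rewrite mulr_gt0// divr_gt0.
pose K := sc_K sc + 2 * mu.
pose Ke := expR (K * T) / a; have Ke0 : 0 < Ke by rewrite divr_gt0// expR_gt0.
pose q := 3 * Ke * T * 16 * mu * W; have q0 : 0 < q by rewrite /q mulr_gt0// mulr_gt0// mulr_gt0// mulr_gt0// mulr_gt0.
pose eps := Num.min (r / (16 * W)) (p / q).
have eps0 : 0 < eps by rewrite lt_min !divr_gt0// mulr_gt0.
have eps1 : eps <= r / (16 * W) by rewrite ge_min lexx.
have eps2 : eps <= p / q by rewrite ge_min lexx orbT.
have km := HM _ eps0.
have p3 : 0 < p / (3 * Ke) by rewrite divr_gt0// mulr_gt0.
have [Ni Hi] := init_energy psi_u hinit eps0 p3.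
have r4 : 0 < r / 4 by rewrite divr_gt0.
have [Nu Hu] := ul _ r4.
pose CC := Cn sc eps M.
have CC0 : 0 <= CC.
  have al0 := sc_al0 sc; have be0 := sc_be0 sc; have ab : 0 <= sc_al sc + sc_be sc by exact: addr_ge0.
  rewrite /CC /Cn mulr_ge0// addr_ge0 ?(ltW mu0)// mulr_ge0 ?sqr_ge0// mulr_ge0//.
pose Nc := (Num.truncn (3 * Ke * T * CC / p)).+1.
exists (maxn Ni (maxn Nu Nc)) => N Nbig N2 d Omega P X ch.
have [NiN NuN NcN] : [/\ (Ni <= N)%N, (Nu <= N)%N & (Nc <= N)%N].
  by move: Nbig; rewrite !geq_max => /andP[-> /andP[-> ->]].
have N0 : (0 < N)%N by exact: ltn_trans N2.
have Ngt : 0 < N%:R :> R by rewrite ltr0n.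
have [BAD [mB PB] HB] := energy_maximal N2 eps0 km a0 ch.
exists BAD => [|w nB t tT].
  split=> //; apply: (le_trans PB); rewrite lee_fin -/K -/Ke.
  have V0 : Vt sc eps psi_u 0 (x0 N) <= p / (3 * Ke).
    by rewrite /Vt vN0; exact: Hi.
  have h1 : Ke * Vt sc eps psi_u 0 (x0 N) <= p / 3.
    by have := ler_wpM2l (ltW Ke0) V0; rewrite (_ : Ke * (p / (3 * Ke)) = p / 3)//; field; rewrite gt_eqF.
  have h2 : Ke * (T * (16 * mu * eps * wtot R)) <= p / 3.
    apply: (@le_trans _ _ (Ke * (T * (16 * mu * (p / q) * W)))).
      rewrite ler_wpM2l ?(ltW Ke0)// ler_wpM2l ?(ltW T0)//; apply: ler_pM => //.
        by rewrite mulr_ge0 ?(ltW eps0)// mulr_ge0// ltW.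
      by rewrite ler_wpM2l// mulr_ge0// ltW.
    rewrite (_ : Ke * (T * (16 * mu * (p / q) * W)) = p / 3)// /q; field.
    by rewrite !gt_eqF.
  have h3 : Ke * (T * (CC / N%:R)) <= p / 3.
    have nb : 3 * Ke * T * CC / p <= N%:R.
      by apply: (le_trans (ltW (truncnS_gt _))); rewrite ler_nat.
    rewrite (_ : Ke * (T * (CC / N%:R)) = (3 * Ke * T * CC / p) * (p / 3) / N%:R); last first.
      by field; rewrite !gt_eqF.
    by rewrite ler_pdivrMr// mulrC ler_wpM2l// divr_ge0// ltW.
  rewrite -/CC mulrDr (mulrDr T) (mulrDr Ke); move: h1 h2 h3.
  set z1 := Ke * _; set z2 := Ke * _; set z3 := Ke * _; lra.
have /andP[t0 _] := tT.
have uz := zeta_unitdec R N0 (X w (t * sc_c sc N)).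
have bz := unitdec_bm uz; have bv := unitdec_bm (vN_unitdec sc psi_u N t0).
have h1 := zeta_dist sc N0 eps0 km psi_u (X w (t * sc_c sc N)) t0 eta0.
have [_ /(_ _ tT) h2] := Hu N NuN.
have h3 : Vt sc eps psi_u t (X w (t * sc_c sc N)) / eta <= r / 4.
  have -> : r / 4 = a / eta by rewrite /a mulrAC mulfV ?gt_eqF// mul1r.
  by apply: ler_wpM2r; [rewrite invr_ge0 ltW|exact: HB].
have h4 : eta * wtot R <= r / 4.
  apply: (@le_trans _ _ (eta * W)); first by rewrite ler_wpM2l// ltW.
  by rewrite (_ : eta * W = r / 4)// /eta; field; rewrite gt_eqF.
have h5 : 4 * eps * wtot R <= r / 4.
  apply: (@le_trans _ _ (4 * (r / (16 * W)) * W)).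
    by apply: ler_pM => //; [rewrite mulr_ge0// ltW|rewrite ler_wpM2l].
  by rewrite (_ : 4 * (r / (16 * W)) * W = r / 4)//; field; rewrite gt_eqF.
have h6 : itg (fun y => wt y * `|zeta (X w (t * sc_c sc N)) y - u t y|) <=
   itg (fun y => wt y * `|zeta (X w (t * sc_c sc N)) y - vN N t y|) + itg (fun y => wt y * `|vN N t y - u t y|).
  have b1 := bm_abs (bmB bz bv); have b2 := bm_abs (bmB bv (bu t)).
  rewrite -(itg_wtMD b1 b2); apply: le_itg_wtM; [exact: bm_abs (bmB bz (bu t))|exact: bmD|move=> y].
  exact: ler_distD.
apply: (le_trans h6); move: h1 h2 h3 h4 h5.
set i1 := itg _; set i2 := itg _; set i3 := _ / eta; set i4 := eta * _; set i5 := 4 * eps * _; lra.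
Qed.

End ConvergenceInProbability.

(** * The path space *)

Section TimeChanges.
Variable R : realType.
Variable T : R.
Hypothesis T0 : 0 < T.

(* [same_upto r p q]: [p] is exactly a time change of [q] with slopes in [e^-r, e^r]. *)
Definition slopes (r a b : R) (la : R -> R) := forall s t, a <= s -> s <= t -> t <= b ->
  expR (- r) * (t - s) <= la t - la s <= expR r * (t - s).

Definition same_upto (V : Type) (r : R) (p q : R -> V) := exists la : R -> R,
  [/\ la 0 = 0, la T = T, slopes r 0 T la & forall t, 0 <= t <= T -> p t = q (la t)].

Lemma slopes_itv r la t : la 0 = 0 -> la T = T -> slopes r 0 T la -> 0 <= t <= T -> 0 <= la t <= T.
Proof.
move=> l0 lT sl /andP[t0 tT].
have /andP[h1 _] := sl 0 t (lexx 0) t0 tT; have /andP[h2 _] := sl t T t0 tT (lexx T).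
rewrite l0 !subr0 in h1; rewrite lT in h2; apply/andP; split.
  by apply: le_trans h1; rewrite mulr_ge0 ?expR_ge0.
by rewrite -subr_ge0; apply: le_trans h2; rewrite mulr_ge0 ?expR_ge0// subr_ge0.
Qed.

Lemma same_upto_trans V r1 r2 (p q s : R -> V) :
  same_upto r1 p q -> same_upto r2 q s -> same_upto (r1 + r2) p s.
Proof.
move=> [l1 [l10 l1T s1 e1]] [l2 [l20 l2T s2 e2]]; exists (fun t => l2 (l1 t)); split.
- by rewrite l10.
- by rewrite l1T.
- move=> a b a0 ab bT.
  have /andP[b1 b2] := s1 a b a0 ab bT.
  have aT : 0 <= a <= T by rewrite a0 (le_trans ab).
  have b0T : 0 <= b <= T by rewrite bT (le_trans a0).
  have /andP[c1 c2] := slopes_itv l10 l1T s1 aT; have /andP[d1 d2] := slopes_itv l10 l1T s1 b0T.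
  have lab : l1 a <= l1 b.
    by rewrite -subr_ge0; apply: le_trans b1; rewrite mulr_ge0 ?expR_ge0// subr_ge0.
  have /andP[f1 f2] := s2 _ _ c1 lab d2.
  rewrite opprD addrC !expRD -!mulrA; apply/andP; split.
    by apply: le_trans f1; rewrite ler_wpM2l ?expR_ge0.
  by apply: (le_trans f2); rewrite mulrCA ler_wpM2l ?expR_ge0.
move=> t tT; rewrite e1// e2//; exact: slopes_itv l10 l1T s1 tT.
Qed.

Lemma same_upto_le V r1 r2 (p q : R -> V) : r1 <= r2 -> same_upto r1 p q -> same_upto r2 p q.
Proof.
move=> r12 [la [l0 lT sl e]]; exists la; split=> // s t s0 st tT.
have /andP[h1 h2] := sl s t s0 st tT; have st0 : 0 <= t - s by rewrite subr_ge0.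
apply/andP; split; first by apply: le_trans h1; rewrite ler_wpM2r// ler_expR lerN2.
by apply: (le_trans h2); rewrite ler_wpM2r// ler_expR.
Qed.

Lemma prefix_mono (tau : nat -> R) m i j : (forall k, (k < m)%N -> tau k < tau k.+1) ->
  (i <= j)%N -> (j <= m)%N -> tau i <= tau j.
Proof.
move=> tm; elim: j => [|j IH]; first by rewrite leqn0 => /eqP ->.
rewrite leq_eqVlt => /orP[/eqP ->//|]; rewrite ltnS => ij jm.
by apply: le_trans (IH ij (ltnW jm)) (ltW (tm j jm)).
Qed.

(** Piecewise linear interpolation between prescribed nodes; the slope bound on each piece adds up
    over any interval. *)
Lemma pl_exists (r : R) (tau sg : nat -> R) m :
  (forall j, (j < m)%N -> tau j < tau j.+1) ->
  (forall j, (j < m)%N -> expR (- r) * (tau j.+1 - tau j) <= sg j.+1 - sg j <= expR r * (tau j.+1 - tau j)) ->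
  exists la : R -> R, (forall j, (j <= m)%N -> la (tau j) = sg j) /\ slopes r (tau 0%N) (tau m) la.
Proof.
elim: m => [|m IH] tm sm.
  exists (fun _ => sg 0%N); split=> [j|s t s0 st tT]; first by rewrite leqn0 => /eqP ->.
  have -> : t = s by apply/le_anti; rewrite st andbT (le_trans tT).
  by rewrite !subrr !mulr0 lexx.
have [la [laE sl]] := IH (fun j jm => tm j (ltnW jm)) (fun j jm => sm j (ltnW jm)).
have tmm := tm m (ltnSn m); have gap : 0 < tau m.+1 - tau m by rewrite subr_gt0.
pose rho := (sg m.+1 - sg m) / (tau m.+1 - tau m).
have rhoE : rho * (tau m.+1 - tau m) = sg m.+1 - sg m by rewrite /rho divfK ?gt_eqF.
have /andP[r1 r2] : expR (- r) <= rho <= expR r.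
  by rewrite ler_pdivlMr// ler_pdivrMr//; exact: sm.
have mono j : (j <= m)%N -> tau j <= tau m.
  by move=> jm; apply: (prefix_mono (m := m)) => // k km; exact: tm (ltnW km).
exists (fun t => if t <= tau m then la t else sg m + (t - tau m) * rho); split.
  move=> j; rewrite leq_eqVlt => /orP[/eqP ->|]; last by rewrite ltnS => jm; rewrite mono//; exact: laE.
  by rewrite leNgt tmm /= mulrC rhoE addrC subrK.
move=> s t s0 st tT.
have lin a b : a <= b -> expR (- r) * (b - a) <= (b - a) * rho <= expR r * (b - a).
  by move=> ab; rewrite [_ * rho]mulrC !ler_wpM2r// subr_ge0.
have [tm'|tm'] := leP t (tau m); first by rewrite (le_trans st tm'); exact: sl.
have [sm'|sm'] := leP s (tau m).
  have /andP[a1 a2] := sl s (tau m) s0 sm' (lexx _); rewrite laE// in a1 a2.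
  have /andP[a3 a4] := lin _ _ (ltW tm').
  have e1 : t - s = (tau m - s) + (t - tau m) by ring.
  by rewrite e1 !mulrDr; apply/andP; split; lra.
have -> : sg m + (t - tau m) * rho - (sg m + (s - tau m) * rho) = (t - s) * rho by ring.
exact: lin.
Qed.

Section Paths.
Variable V : Type.
Implicit Types p q : R -> V.

Definition partition (S : R) p (m : nat) (tau : nat -> R) :=
  [/\ tau 0%N = 0, tau m = S, forall j, (j < m)%N -> tau j < tau j.+1 &
      forall j, (j < m)%N -> forall t, tau j <= t < tau j.+1 -> p t = p (tau j)].

Definition step S p := exists m tau, partition S p m tau.

Lemma step_extend a b p : step a p -> a < b -> (forall s, a <= s < b -> p s = p a) -> step b p.
Proof.
move=> [m [tau [t0 tm tinc tc]]] ab pc.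
exists m.+1, (fun j => if (j <= m)%N then tau j else b); split=> //.
- by rewrite ltnn.
- move=> j; rewrite ltnS => jm; rewrite jm; case: ltnP => [jm'|mj]; first exact: tinc.
  by have -> : j = m by [apply/eqP; rewrite eqn_leq jm mj]; rewrite tm.
move=> j; rewrite ltnS => jm t; rewrite jm; case: ltnP => [jm'|mj]; first exact: tc.
have -> : j = m by apply/eqP; rewrite eqn_leq jm mj.
by rewrite tm => /pc.
Qed.

(** A supremum argument on the times up to which the path is a step function: existence of left
    limits shows that the supremum is attained, and right continuity pushes it further unless it is
    [T]. *)
Lemma cadlag_step p :
  (forall t, 0 <= t < T -> exists2 e : R, 0 < e & forall s, t <= s < t + e -> p s = p t) ->
  (forall t, 0 < t <= T -> exists y, exists2 e : R, 0 < e & forall s, t - e < s < t -> p s = y) ->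
  step T p.
Proof.
move=> rc ll; pose E : set R := [set t | 0 <= t <= T /\ step t p].
have E0 : E 0.
  by split; [rewrite lexx ltW|exists 0%N, (fun _ => 0); split].
have ubE : ubound E T by move=> t [/andP[]].
have hs : has_sup E by split; [exists 0|exists T].
pose S := sup E.
have S0 : 0 <= S by exact: ub_le_sup hs.2 _ E0.
have ST : S <= T by apply: ge_sup ubE; exists 0.
have stepS : step S p.
  have [S_0|Spos] := eqVneq S 0; first by rewrite S_0; case: E0.
  have Sgt : 0 < S by rewrite lt_neqAle eq_sym Spos.
  have [y [e e0 He]] : exists y, exists2 e : R, 0 < e & forall s, S - e < s < S -> p s = y.
    by apply: ll; rewrite Sgt.
  have [t' Et' t'S] := sup_adherent e0 hs; rewrite -/S in t'S.
  have t'leS : t' <= S := ub_le_sup hs.2 Et'.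
  have [t'e|t'n] := eqVneq t' S; first by rewrite -t'e; case: Et'.
  have t'lt : t' < S by rewrite lt_neqAle t'n.
  apply: (step_extend Et'.2 t'lt) => s /andP[ts sS].
  by rewrite !He// ?t'S// ?t'lt// (lt_le_trans t'S).
have [SeT|SnT] := eqVneq S T; first by rewrite -SeT.
have SltT : S < T by rewrite lt_neqAle SnT.
have [e e0 He] : exists2 e : R, 0 < e & forall s, S <= s < S + e -> p s = p S by apply: rc; rewrite S0.
pose b := Num.min (S + e) T.
have Sb : S < b by rewrite lt_min SltT ltrDl e0.
have bT : b <= T by rewrite ge_min lexx orbT.
have Eb : E b.
  split; first by rewrite bT (le_trans S0 (ltW Sb)).
  apply: (step_extend stepS Sb) => s /andP[Ss sb]; apply: He; rewrite Ss (lt_le_trans sb)//.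
  by rewrite ge_min lexx.
by have := ub_le_sup hs.2 Eb; rewrite leNgt Sb.
Qed.

Lemma partition_find S p m tau t : partition S p m tau -> 0 <= t < S ->
  exists2 j, (j < m)%N & tau j <= t < tau j.+1.
Proof.
move=> [t0 <- _ _]; rewrite -t0; elim: m => [|m IH] /andP[h1 h2]; first by have := le_lt_trans h1 h2; rewrite ltxx.
have [tm|tm] := ltP t (tau m); first by have [|j jm jt] := IH _; [rewrite h1|exists j => //; exact: ltnW].
by exists m => //; rewrite tm.
Qed.

Lemma partition_gap S p m tau : partition S p m tau ->
  exists2 g, 0 < g & forall j, (j < m)%N -> g <= tau j.+1 - tau j.
Proof.
move=> [_ _ tinc _]; elim: m tinc => [|m IH] tinc; first by exists 1.
have [g g0 Hg] := IH (fun j jm => tinc j (ltnW jm)).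
exists (Num.min g (tau m.+1 - tau m)); first by rewrite lt_min g0 subr_gt0 tinc.
move=> j; rewrite ltnS leq_eqVlt => /orP[/eqP->|jm]; first by rewrite ge_min lexx orbT.
by rewrite ge_min Hg.
Qed.

Definition mesh (n : nat) : R := T / n.+1%:R.

Lemma mesh_gt0 n : 0 < mesh n. Proof. by rewrite divr_gt0. Qed.

Definition sample (n : nat) p : R -> V := fun t => p (mesh n * (Num.floor (t / mesh n))%:~R).

Lemma mesh_floorT n : mesh n * (Num.floor (T / mesh n))%:~R = T.
Proof.
have -> : T / mesh n = (n.+1%:Z)%:~R.
  rewrite /mesh invf_div mulrCA mulfV ?gt_eqF// mulr1 //.
by rewrite intrKfloor /mesh divfK// pnatr_eq0.
Qed.

(** Sampling replaces each jump time by a grid point within one mesh. Once the mesh is small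
    compared with the shortest gap between jumps, matching the jump times changes the gaps by ratios
    close to 1, in both directions. *)
Lemma sample_same p (r : R) : step T p -> 0 < r -> exists k, forall n, (k <= n)%N ->
  same_upto r p (sample n p) /\ same_upto r (sample n p) p.
Proof.
move=> [m [tau pt]] r0; have [g g0 Hg] := partition_gap pt.
have [t0 tm tinc tc] := pt.
have er : expR (- r) < 1 by rewrite -[1]expR0 ltr_expR oppr_lt0.
have er' : 1 < expR r by rewrite -[1]expR0 ltr_expR.
(* A gap changes by at most one mesh; this threshold keeps the ratio of the new gap to the old one
   between [e^(-r)] and [e^r]. *)
pose q := g * Num.min (1 - expR (- r)) (expR r - 1).
have q0 : 0 < q by rewrite mulr_gt0// lt_min !subr_gt0 er er'.
exists (Num.truncn (T / q)).+1 => n kn.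
have mq : mesh n <= q.
  rewrite /mesh ler_pdivrMr// mulrC -ler_pdivrMr//.
  by apply: (le_trans (ltW (truncnS_gt _))); rewrite ler_nat (leq_trans kn).
have m0 := mesh_gt0 n; set mu := mesh n in mq m0.
(* A sampled path shows a jump at the first grid point not before it, hence the ceiling. [T] is a
   grid point and stays fixed. *)
pose sg j := mu * (Num.ceil (tau j / mu))%:~R.
have sg_lo j : tau j <= sg j by rewrite /sg mulrC -ler_pdivrMr// ceil_ge.
have sg_hi j : sg j <= tau j + mu.
  rewrite /sg mulrC -ler_pdivlMr// mulrDl divff ?gt_eqF//.
  by have := ltW (ceilB1_lt (tau j / mu)); rewrite intrB lerBlDr.
have sg0 : sg 0%N = 0 by rewrite /sg t0 mul0r ceil0 mulr0.
have sgm : sg m = T.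
  have -> : sg m = mu * (n.+1%:Z)%:~R.
    rewrite /sg tm; have -> : T / mu = (n.+1%:Z)%:~R.
      by rewrite /mu /mesh invf_div mulrCA mulfV ?gt_eqF// mulr1.
    by rewrite intrKceil.
  by rewrite /mu /mesh divfK// pnatr_eq0.
have gapb j : (j < m)%N ->
  expR (- r) * (tau j.+1 - tau j) <= sg j.+1 - sg j <= expR r * (tau j.+1 - tau j).
  move=> jm; have := Hg j jm; set gp := tau j.+1 - tau j => hg.
  have q1 : q <= gp * (1 - expR (- r)).
    by rewrite /q; apply: ler_pM => //; rewrite ?(ltW g0) ?ge_min ?lexx// le_min !subr_ge0 !ltW.
  have q2 : q <= gp * (expR r - 1).
    by rewrite /q; apply: ler_pM => //; rewrite ?(ltW g0) ?ge_min ?lexx ?orbT// le_min !subr_ge0 !ltW.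
  have a1 := sg_lo j; have a2 := sg_hi j; have a3 := sg_lo j.+1; have a4 := sg_hi j.+1.
  rewrite mulrBr mulr1 [gp * _]mulrC in q1; rewrite mulrBr mulr1 [gp * _]mulrC in q2.
  move: q1 q2; rewrite /gp => q1 q2; apply/andP; split; lra.
have gapb' j : (j < m)%N ->
  expR (- r) * (sg j.+1 - sg j) <= tau j.+1 - tau j <= expR r * (sg j.+1 - sg j).
  move=> /gapb/andP[h1 h2]; have ee : expR (- r) * expR r = 1 by rewrite -expRD addNr expR0.
  apply/andP; split.
    by apply: le_trans (ler_wpM2l (expR_ge0 _) h2) _; rewrite mulrA ee mul1r.
  have ee' : expR r * expR (- r) = 1 by rewrite mulrC.
  by have := ler_wpM2l (expR_ge0 r) h1; rewrite mulrA ee' mul1r.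
have sinc j : (j < m)%N -> sg j < sg j.+1.
  move=> jm; have /andP[h _] := gapb j jm; rewrite -subr_gt0; apply: lt_le_trans h.
  by rewrite mulr_gt0 ?expR_gt0// subr_gt0 tinc.
have val j s : (j < m)%N -> sg j <= s < sg j.+1 -> sample n p s = p (tau j).
  move=> jm /andP[s1 s2]; apply: (tc j jm); rewrite -/mu; apply/andP; split.
    rewrite -ler_pdivrMl// mulrC; apply: le_trans (ceil_ge _) _; rewrite ler_int floor_ge_int.
    by rewrite ler_pdivlMr// [_ * mu]mulrC.
  rewrite -ltr_pdivlMl// [mu^-1 * tau _]mulrC -ceil_gt_int floor_lt_int//.
  by rewrite ltr_pdivrMr// [_ * mu]mulrC.
have lamono (la : R -> R) : slopes r 0 T la -> forall s t, 0 <= s -> s < t -> t <= T -> la s < la t.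
  move=> sl s t s0 st tT; have /andP[h _] := sl s t s0 (ltW st) tT.
  by rewrite -subr_gt0; apply: lt_le_trans h; rewrite mulr_gt0 ?expR_gt0// subr_gt0.
have lamono' (la : R -> R) : slopes r 0 T la -> forall s t, 0 <= s -> s <= t -> t <= T -> la s <= la t.
  move=> sl s t s0 st tT; have /andP[h _] := sl s t s0 st tT.
  by rewrite -subr_ge0; apply: le_trans h; rewrite mulr_ge0 ?expR_ge0// subr_ge0.
have tau_itv j : (j <= m)%N -> 0 <= tau j <= T.
  by move=> jm; rewrite -t0 -tm !(prefix_mono (m := m)).
have sg_itv j : (j <= m)%N -> 0 <= sg j <= T.
  by move=> jm; rewrite -sg0 -sgm !(prefix_mono (m := m)).
split.
  have [la [laE sl]] := pl_exists tinc gapb; rewrite t0 tm in sl.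
  exists la; split=> //; first by rewrite -[in LHS]t0 laE// sg0.
    by rewrite -[in LHS]tm laE// sgm.
  move=> t /andP[t_0 tT]; have [tlt|tge] := ltP t T; last first.
    have -> : t = T by apply/le_anti; rewrite tT.
    by rewrite -[in RHS]tm laE// sgm /sample mesh_floorT.
  have [j jm jt] := @partition_find T p m tau t pt (introT andP (conj t_0 tlt)).
  rewrite (tc j jm t jt) (val j)//; case/andP: jt => jt1 jt2.
  rewrite -!laE// ?(ltnW jm)//.
  have /andP[b1 b2] := tau_itv j (ltnW jm); have /andP[b3 b4] := tau_itv j.+1 jm.
  by rewrite (lamono' la sl) ?(lamono la sl).
have [la [laE sl]] := pl_exists sinc gapb'; rewrite sg0 sgm in sl.
exists la; split=> //; first by rewrite -[in LHS]sg0 laE// t0.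
  by rewrite -[in LHS]sgm laE// tm.
have pts : partition T (sample n p) m sg.
  split=> // j jm t jt; rewrite (val j)// (val j)//.
  by rewrite lexx sinc.
move=> t /andP[t_0 tT]; have [tlt|tge] := ltP t T; last first.
  have -> : t = T by apply/le_anti; rewrite tT.
  by rewrite -[in RHS]sgm laE// tm /sample mesh_floorT.
have [j jm jt] := @partition_find T _ m sg t pts (introT andP (conj t_0 tlt)).
rewrite (val j)//; case/andP: jt => jt1 jt2; apply: esym; apply: tc => //.
have /andP[b1 b2] := sg_itv j (ltnW jm); have /andP[b3 b4] := sg_itv j.+1 jm.
by rewrite -!laE// ?(ltnW jm)// (lamono' la sl) ?(lamono la sl).
Qed.

End Paths.
End TimeChanges.

(** * Seminorms and pseudometrics of the path space *)

Section PathSpace.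
Variable R : realType.
Local Notation leb := (@lebesgue_measure R).
Variable T : R.
Hypothesis T0 : 0 < T.
Implicit Types (A : set (R -> R)) (h : R -> R).

Lemma schwartz_dom (phi : R -> R) C0 C2 : schwartz phi -> (forall x, `|phi x| <= C0) ->
  (forall x, `|x ^+ 2 * phi x| <= C2) -> mf phi /\ forall x, `|phi x| <= (C0 + C2) * wt x.
Proof.
move=> [dphi _] h0 h2; split.
  by apply: mf_continuous => x; apply: differentiable_continuous; apply/derivable1_diffP; exact: (dphi 0%N x).
move=> x; rewrite -(ler_pM2r (wt_den_gt0 x)) -mulrA wtE mulr1 mulrDr mulr1 lerD//.
by rewrite -[x ^+ 2]ger0_norm ?sqr_ge0// -normrM mulrC.
Qed.

Lemma sbounded_wt A : sbounded A -> exists2 C, 0 <= C & forall phi, A phi ->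
  mf phi /\ forall x, `|phi x| <= C * wt x.
Proof.
move=> [As Ab]; have [C0 H0] := Ab 0%N 0%N; have [C2 H2] := Ab 2%N 0%N.
exists (`|C0| + `|C2|) => [|phi Aphi]; first exact: addr_ge0.
apply: schwartz_dom => [|x|x]; first exact: As.
  by have := H0 phi x Aphi; rewrite expr0 mul1r => /le_trans; apply; exact: ler_norm.
by have := H2 phi x Aphi; move=> /le_trans; apply; exact: ler_norm.
Qed.

Lemma distr_bound (phi : R -> R) C h : mf phi -> (forall x, `|phi x| <= C * wt x) -> bm h ->
  `|distr_of h phi| <= C * itg (fun y => wt y * `|h y|).
Proof.
move=> mphi phiC bh; have [mh [B hB]] := bh.
have dphi : dom phi by split=> //; exists C.
rewrite /distr_of -/(itg _) -itgZ; last by apply: dom_wtM; exact: bm_abs.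
apply: normr_itg_le; [exact: domM mh hB dphi|by apply: domZ; apply: dom_wtM; exact: bm_abs|move=> x].
by rewrite normrM mulrC mulrA ler_wpM2r.
Qed.

(** A bounded set of Schwartz functions is dominated by one multiple of the weight, so the weighted
    L^1 distance controls the seminorm of every such set. *)
Lemma rho_le A C h1 h2 : (forall phi, A phi -> mf phi /\ forall x, `|phi x| <= C * wt x) -> bm h1 -> bm h2 ->
  (rho A (dsub (distr_of h1) (distr_of h2)) <= (C * itg (fun y => wt y * `|h1 y - h2 y|))%:E)%E.
Proof.
move=> HA b1 b2; apply: ge_ereal_sup => _ [phi Aphi <-]; rewrite lee_fin.
have [mphi phiC] := HA _ Aphi; have dphi : dom phi by split=> //; exists C.
have [m1 [B1 H1]] := b1; have [m2 [B2 H2]] := b2.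
have -> : dsub (distr_of h1) (distr_of h2) phi = distr_of (fun y => h1 y - h2 y) phi.
  rewrite /dsub /distr_of -!/(itg _) -itgB; [|exact: domM H1 dphi|exact: domM H2 dphi].
  by congr itg; apply/funext => y; rewrite mulrBl.
by apply: distr_bound => //; exact: bmB.
Qed.

Lemma rho_same A (M : (R -> R) -> R) : (rho A (dsub M M) <= 0)%E.
Proof. by apply: ge_ereal_sup => _ [phi Aphi <-]; rewrite /dsub subrr normr0. Qed.

Lemma tempered_distr h : bm h -> tempered (distr_of h).
Proof.
move=> bh; have [mh [B hB]] := bh.
have sd (phi : R -> R) : schwartz phi -> dom phi.
  move=> sphi; have [_ Hs] := sphi; have [C0 H0] := Hs 0%N 0%N; have [C2 H2] := Hs 2%N 0%N.
  have [||mphi phiC] := @schwartz_dom phi C0 C2 sphi; [|exact: H2|by split=> //; exists (C0 + C2)].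
  by move=> x; have := H0 x; rewrite expr0 mul1r.
split=> [a b phi psi sphi spsi|].
  rewrite /distr_of -!/(itg _); have dp := domM mh hB (sd _ sphi); have dq := domM mh hB (sd _ spsi).
  rewrite -!itgZ// -itgD; [|exact: domZ|exact: domZ].
  by congr itg; apply/funext => x; ring.
exists (2 * itg (fun y => wt y * `|h y|)), 2%N, 0%N => phi K sphi HK.
have [||mphi phiC] := @schwartz_dom phi K K sphi.
- by move=> x; have := HK 0%N 0%N x isT isT; rewrite expr0 mul1r.
- by move=> x; exact: (HK 2%N 0%N x isT isT).
have -> : 2 * itg (fun y => wt y * `|h y|) * K = (K + K) * itg (fun y => wt y * `|h y|) by ring.
exact: distr_bound mphi phiC bh.
Qed.

(** The time change matches the two paths exactly, so only the logarithmic slope term remains, and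
    the slopes lie between [e^(-r)] and [e^r]. *)
Lemma dA_same A r (y z : path_sp R) : 0 <= r -> same_upto T r y z -> (dA T A y z <= r%:E)%E.
Proof.
move=> r0 [la [l0 lT sl e]].
have Lla : Lambda T la.
  split=> //; split=> //; split.
    move=> s t s0 st tT; have /andP[h _] := sl s t s0 (ltW st) tT.
    by rewrite -subr_gt0; apply: lt_le_trans h; rewrite mulr_gt0 ?expR_gt0// subr_gt0.
  apply/subspace_continuousP => t /= tT; apply/cvgrPdist_lt => eps eps0.
  have d0 : 0 < eps / expR r by rewrite divr_gt0// expR_gt0.
  have near1 : \forall s \near t, `|t - s| < eps / expR r by exact: (cvgr_dist_lt _ _ (@cvg_id _ (nbhs t)) _ d0).
  rewrite /within /=; apply: filterS near1 => s ts sT.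
  apply: (@le_lt_trans _ _ (expR r * `|t - s|)); last by rewrite mulrC -ltr_pdivlMr ?expR_gt0.
  move: tT sT; rewrite !in_itv/=; clear ts; wlog st : s t / s <= t.
    by move=> H tT sT; have [h|h] := leP s t; [exact: H|rewrite distrC [`|t - s|]distrC; apply: H => //; exact: ltW].
  move=> /andP[t0 tT] /andP[s0 sT]; have /andP[h1 h2] := sl s t s0 st tT.
  have st0 : 0 <= t - s by rewrite subr_ge0.
  rewrite (ger0_norm st0) ger0_norm//; apply: le_trans h1; rewrite mulr_ge0 ?expR_ge0//.
apply: le_trans (ereal_inf_lbound _) _; first by exists la.
rewrite -[leRHS]add0e; apply: leeD.
  apply: ge_ereal_sup => _ [t /= tT <-]; rewrite -(e t tT); exact: rho_same.
apply: ge_ereal_sup => _ [[s t] /= /andP[/andP[sT tT] st] <-]; rewrite lee_fin.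
wlog lst : s t sT tT st / s < t.
  move=> H; have [h|h] := ltP s t; first exact: H.
  have ts : t < s by rewrite lt_neqAle eq_sym st.
  have := H t s tT sT; rewrite eq_sym st => /(_ isT ts).
  by rewrite -(opprB (la s)) -(opprB s) invrN mulrNN.
case/andP: sT => s0 _; case/andP: tT => _ tT.
have /andP[h1 h2] := sl s t s0 (ltW lst) tT.
have gap : 0 < t - s by rewrite subr_gt0.
have -> : (la s - la t) / (s - t) = (la t - la s) / (t - s).
  by rewrite -(opprB (la t)) -(opprB t) invrN mulrNN.
have q1 : expR (- r) <= (la t - la s) / (t - s) by rewrite ler_pdivlMr.
have q2 : (la t - la s) / (t - s) <= expR r by rewrite ler_pdivrMr.
have q0 : 0 < (la t - la s) / (t - s) by apply: lt_le_trans q1; exact: expR_gt0.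
rewrite ler_norml; apply/andP; split.
  by rewrite -[- r](expRK) ler_ln ?posrE ?expR_gt0.
by rewrite -[r](expRK) ler_ln ?posrE ?expR_gt0.
Qed.

Lemma dA_unif A r (y z : path_sp R) : 0 <= r ->
  (forall t, 0 <= t <= T -> (rho A (dsub (y t) (z t)) <= r%:E)%E) -> (dA T A y z <= r%:E)%E.
Proof.
move=> r0 H; apply: le_trans (ereal_inf_lbound _) _.
  exists id => //; split=> //; split=> //; split=> //.
  by apply: continuous_subspaceT => x; exact: cvg_id.
rewrite -[leRHS]adde0; apply: leeD.
  by apply: ge_ereal_sup => _ [t /= tT <-]; exact: H.
apply: ge_ereal_sup => _ [[s t] /= /andP[_ st] <-]; rewrite lee_fin divff ?subr_eq0// ln1 normr0//.
Qed.

Lemma Dsp_L1 (H : R -> R -> R) : (forall t, bm (H t)) ->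
  (forall t, 0 <= t < T -> forall e, 0 < e -> exists2 del, 0 < del & forall s, t <= s < t + del -> s <= T ->
     itg (fun y => wt y * `|H s y - H t y|) < e) ->
  (forall t, 0 < t <= T -> exists2 h, bm h & forall e, 0 < e -> exists2 del, 0 < del &
     forall s, t - del < s < t -> 0 <= s -> itg (fun y => wt y * `|H s y - h y|) < e) ->
  Dsp T (fun t => distr_of (H t)).
Proof.
move=> bH rc ll; split=> [t _|]; first exact: tempered_distr.
have small A : sbounded A -> forall e : R, 0 < e -> exists2 e', 0 < e' &
    forall h1 h2, bm h1 -> bm h2 -> itg (fun y => wt y * `|h1 y - h2 y|) < e' ->
      (rho A (dsub (distr_of h1) (distr_of h2)) < e%:E)%E.
  move=> sA e e0; have [C C0 HC] := sbounded_wt sA; have C1 : 0 < C + 1 by rewrite ltr_wpDl.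
  exists (e / (C + 1)); first by rewrite divr_gt0.
  move=> h1 h2 b1 b2 hI; apply: le_lt_trans (rho_le HC b1 b2) _; rewrite lte_fin.
  apply: (@le_lt_trans _ _ ((C + 1) * itg (fun y => wt y * `|h1 y - h2 y|))).
    by rewrite ler_wpM2r ?lerDl//; apply: itg_wtM_ge0.
  by rewrite mulrC -ltr_pdivlMr.
split=> [t tT A sA e e0|t tT].
  have [e' e'0 He] := small A sA e e0; have [del del0 Hd] := rc t tT e' e'0.
  by exists del => // s st sT; apply: He => //; exact: Hd.
have [h bh Hh] := ll t tT; exists (distr_of h); first exact: tempered_distr.
move=> A sA e e0; have [e' e'0 He] := small A sA e e0; have [del del0 Hd] := Hh e' e'0.
by exists del => // s st sT; apply: He => //; exact: Hd.
Qed.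

Lemma partition_find_left (V : Type) S (p : R -> V) m tau t : partition S p m tau -> 0 < t <= S ->
  exists2 j, (j < m)%N & tau j < t <= tau j.+1.
Proof.
move=> [t0 <- _ _]; rewrite -t0; elim: m => [|m IH] /andP[h1 h2]; first by have := lt_le_trans h1 h2; rewrite ltxx.
have [tm|tm] := leP t (tau m); first by have [|j jm jt] := IH _; [rewrite h1|exists j => //; exact: ltnW].
by exists m => //; rewrite tm.
Qed.

Lemma step_Dsp (V : Type) (H : V -> R -> R) (p : R -> V) : (forall v, bm (H v)) -> step T p ->
  Dsp T (fun t => distr_of (H (p t))).
Proof.
move=> bH [m [tau pt]]; have [t0 tm tinc tc] := pt.
have z v : itg (fun y => wt y * `|H v y - H v y|) = 0.
  by rewrite -[RHS](itg0 R); congr itg; apply/funext => y; rewrite subrr normr0 mulr0.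
apply: Dsp_L1 => [t|t tT e e0|t tT]; first exact: bH.
  have [j jm /andP[j1 j2]] := partition_find pt tT.
  exists (tau j.+1 - t); first by rewrite subr_gt0.
  move=> s /andP[ts]; rewrite addrC subrK => sj _.
  by rewrite (tc j jm s) ?(le_trans j1)// (tc j jm t) ?j1// z.
have [j jm /andP[j1 j2]] := partition_find_left pt tT.
exists (H (p (tau j))) => // e e0; exists (t - tau j); first by rewrite subr_gt0.
move=> s; rewrite opprB addrC subrK => /andP[s1 s2] _.
by rewrite (tc j jm s) ?(ltW s1) ?(lt_le_trans s2)// z.
Qed.

(** A basic neighbourhood involves finitely many pseudometrics. Time changes are compared
    independently of the seminorm, so one [r] below all thresholds serves them all. *)
Lemma open_same_upto (U : set (path_sp R)) y : openD T U -> U y -> exists2 r, 0 < r &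
  forall z, Dsp T z -> same_upto T r y z -> U z.
Proof.
move=> [_ HU] Uy; have [s [Hs sub]] := HU y Uy.
have [r r0 Hr] : exists2 r : R, 0 < r & forall p, p \in s -> r < p.2.
  elim: s Hs {sub} => [|p s IH] Hs; first by exists 1.
  have [|r r0 Hr] := IH _; first by move=> q qs; apply: Hs; rewrite inE qs orbT.
  have [_ p0] := Hs p (mem_head _ _).
  exists (Num.min r (p.2 / 2)) => [|q]; first by rewrite lt_min r0 divr_gt0.
  rewrite inE => /orP[/eqP->|qs]; rewrite gt_min; last by rewrite Hr.
  by apply/orP; right; rewrite ltr_pdivrMr// ltr_pMr// ltr1n.
exists r => // z Dz yz; apply: sub; split=> // p ps.
by apply: le_lt_trans (dA_same p.1 (ltW r0) yz) _; rewrite lte_fin Hr.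
Qed.

End PathSpace.

(** * Measurability and weak convergence of the laws *)

Section WordMeasurability.
Variables (R : realType) (N : nat) (alpha beta muN : R).
Variables (dd : measure_display) (Omega : measurableType dd) (P : probability Omega R).
Variables (x0 : config N) (X : Omega -> R -> config N).
Hypothesis ch : is_chain P alpha beta muN x0 X.

(** An event determined by finitely many times is a countable union of cylinders because the state
    space is countable; [Q] can be arbitrary, and in particular may quantify over all step paths. *)
Lemma measurable_word m (tt : nat -> R) (Q : (nat -> config N) -> Prop) :
  (forall a b, (forall j, (j < m)%N -> a j = b j) -> Q a -> Q b) ->
  measurable [set w | Q (fun j => X w (tt j))].
Proof.
elim: m Q => [|m IH] Q HQ.
  have [q|q] := pselect (exists a, Q a).
    have -> : [set w | Q (fun j => X w (tt j))] = setT; last exact: measurableT.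
    by apply/seteqP; split=> w //= _; case: q => a; exact: HQ.
  have -> : [set w | Q (fun j => X w (tt j))] = set0; last exact: measurable0.
  by apply/seteqP; split=> w //= h; case: q; eexists; exact: h.
have -> : [set w | Q (fun j => X w (tt j))] = \bigcup_y ([set w | X w (tt m) = y] `&`
    [set w | Q (fun j => if j == m then y else X w (tt j))]).
  have aux w : (fun j => if j == m then X w (tt m) else X w (tt j)) = (fun j => X w (tt j)).
    by apply/funext => j; case: eqP => // ->.
  apply/seteqP; split=> [w /= q|w [y _ /= [<-]]]; last by rewrite aux.
  by exists (X w (tt m)) => //; split=> //=; rewrite aux.
apply: countable_bigcupT_measurable; first exact: config_countable.
move=> y; apply: measurableI; first by case: ch.
apply: (IH (fun a => Q (fun j => if j == m then y else a j))) => a b ab; apply: HQ => j.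
rewrite ltnS leq_eqVlt; case: eqP => //= _; exact: ab.
Qed.

Variables (T c : R) (hT : 0 < T) (c0 : 0 < c) (N0 : (0 < N)%N).
Local Notation path w := (fun t => X w (t * c)).
Local Notation F q := (fun t => distr_of (@zeta R N (q t))).

Let bz (x : config N) : bm (@zeta R N x). Proof. exact: unitdec_bm (zeta_unitdec R N0 x). Qed.

Lemma step_path w : step T (path w).
Proof.
have [_ [rc [ll _]]] := ch.
apply: cadlag_step => // [t /andP[t0 _]|t /andP[t0 _]].
  have [|e e0 He] := rc w (t * c); first by rewrite mulr_ge0// ltW.
  exists (e / c) => [|s /andP[ts st]]; first by rewrite divr_gt0.
  by apply: He; rewrite ler_pM2r// ts -ltr_pdivlMr// mulrDl mulfK// gt_eqF.
have [|y [e e0 He]] := ll w (t * c); first by rewrite mulr_gt0.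
exists y, (e / c) => [|s /andP[ts st]]; first by rewrite divr_gt0.
by apply: He; rewrite ltr_pM2r// st andbT -ltr_pdivrMr// mulrBl mulfK// gt_eqF.
Qed.

Lemma zeta_path_Dsp w : Dsp T (zeta_path X c w).
Proof. exact: (@step_Dsp R T _ (@zeta R N) (path w) bz (step_path w)). Qed.

Lemma measurable_sample n (Q : (R -> config N) -> Prop) :
  (forall p q, (forall t, 0 <= t <= T -> p t = q t) -> Q p -> Q q) ->
  measurable [set w | Q (sample T n (path w))].
Proof.
move=> HQ.
pose ext (a : nat -> config N) : R -> config N := fun t => a `|Num.floor (t / mesh T n)|%N.
have fl t : 0 <= t <= T -> exists2 j, (j < n.+2)%N & Num.floor (t / mesh T n) = j%:Z.
  move=> /andP[t0 tT]; have m0 := mesh_gt0 hT n.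
  have f0 : (0 <= Num.floor (t / mesh T n))%R by rewrite floor_ge_int divr_ge0// ltW.
  exists `|Num.floor (t / mesh T n)|%N; last by rewrite gez0_abs.
  rewrite -ltz_nat gez0_abs// floor_lt_int ltr_pdivrMr//; apply: (le_lt_trans tT).
  have e1 : n.+1%:R * mesh T n = T by rewrite /mesh mulrC divfK// pnatr_eq0.
  by rewrite -[ltLHS]e1 ltr_pM2r// ltr_nat.
have -> : [set w | Q (sample T n (path w))] =
    [set w | Q (ext (fun j => X w (mesh T n * j%:R * c)))].
  have E w t : 0 <= t <= T -> sample T n (path w) t = ext (fun j => X w (mesh T n * j%:R * c)) t.
    by move=> /fl[j _ jE]; rewrite /sample /ext jE.
  apply/seteqP; split=> w /=; apply: HQ => t tT; first exact: E.
  by rewrite E.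
apply: (@measurable_word n.+2 (fun j => mesh T n * j%:R * c) (fun a => Q (ext a))) => a b ab.
by apply: HQ => t /fl[j jn jE]; rewrite /ext jE; exact: ab.
Qed.

(* An open set is recognized from the sampled path: [zeta_path X c w] lies in [U] iff, for some tolerance [1/(m+1)]
   and all fine samplings, every step path that is a time change of the sampled path within this tolerance is in [U]. *)
Lemma measurable_open U : openD T U -> measurable (zeta_path X c @^-1` U).
Proof.
move=> oU.
pose S (m : nat) (p : R -> config N) := forall q, step T q -> same_upto T m.+1%:R^-1 p q -> U (F q).
have -> : zeta_path X c @^-1` U =
    \bigcup_m \bigcup_k \bigcap_(n in [set n | (k <= n)%N]) [set w | S m (sample T n (path w))].
  apply/seteqP; split=> [w /= Uw|w [m _ [k _ H]]].
    have [r r0 Hr] := open_same_upto oU Uw.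
    have r2 : 0 < r / 2 by rewrite divr_gt0.
    have [k Hk] := sample_same hT (step_path w) r2.
    exists (Num.truncn (r / 2)^-1) => //; exists k => // n kn q sq hq.
    have [h1 _] := Hk n kn; apply: Hr; first exact: step_Dsp sq.
    have := same_upto_le _ (same_upto_trans h1 hq) => /(_ r)[|la [l0 lT sl e]].
      rewrite -lerBrDl (_ : r - r / 2 = r / 2); last by field.
      rewrite -[leRHS]invrK lef_pV2 ?posrE ?invr_gt0 ?ltr0n//; exact: ltW (truncnS_gt _).
    by exists la; split=> // t tT; rewrite -e.
  (* Conversely, the path itself is one of the step paths [q] quantified over. *)
  have mr : 0 < m.+1%:R^-1 :> R by rewrite invr_gt0.
  have [k' Hk] := sample_same hT (step_path w) mr.
  have [_ h] := Hk (maxn k k') (leq_maxr _ _).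
  exact: H (maxn k k') (leq_maxl _ _) _ (step_path w) h.
apply: bigcupT_measurable => m; apply: bigcupT_measurable => k.
apply: bigcap_measurable => [|n _]; first by exists k => /=.
apply: measurable_sample => p q pq Sp r sr [la [l0 lT sl e]].
by apply: Sp => //; exists la; split=> // t tT; rewrite pq// e.
Qed.

Lemma measurable_zeta_path B : <<s Dsp T, openD T >> B -> measurable (zeta_path X c @^-1` B).
Proof.
apply: (@smallest_sub _ (sigma_algebra (Dsp T)) _ [set B | measurable (zeta_path X c @^-1` B)]).
  split=> [|A /= mA|A /= mA]; first by rewrite /= preimage_set0; exact: measurable0.
    rewrite (_ : _ @^-1` _ = ~` (zeta_path X c @^-1` A)); first exact: measurableC.
    by apply/seteqP; split=> w /= => [[]|nA] //; split=> //; exact: zeta_path_Dsp.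
  by rewrite preimage_bigcup; apply: bigcupT_measurable.
exact: measurable_open.
Qed.

Lemma measurable_bcont f : bcontD T f -> measurable_fun setT (fun w => f (zeta_path X c w)).
Proof.
move=> [_ Hf] mT; apply: (measurability _ (RGenOInfty.measurableE R)) => //.
move=> _ [_ [a ->] <-]; rewrite setTI.
rewrite (_ : _ @^-1` _ = zeta_path X c @^-1` [set y | Dsp T y /\ a < f y]); last first.
  apply/seteqP; split=> w /=; rewrite in_itv/= andbT; last by case.
  by move=> h; split=> //; exact: zeta_path_Dsp.
apply: measurable_open; split=> [y []//|y [Dy fy]].
have [|U [[_ HU] [Uy Hz]]] := Hf y Dy (f y - a); first by rewrite subr_gt0.
have [s [Hs sub]] := HU y Uy; exists s; split=> // z [Dz dz]; split=> //.
have := Hz z (sub z (conj Dz dz)); rewrite ltr_norml => /andP[h _].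
by move: h; rewrite opprB ltrBrDr subrK.
Qed.

End WordMeasurability.

(** * Weak convergence to a Dirac mass *)

Section WeakConvergence.
Variables (R : realType) (T : R).
Hypothesis hT : 0 < T.

Lemma traj_Dsp (u : R -> R -> R) : (forall t, bm (u t)) ->
  (forall e, 0 < e -> exists2 del, 0 < del & forall s t, 0 <= s <= T -> 0 <= t <= T ->
     `|s - t| < del -> itg (fun y => wt y * `|u s y - u t y|) < e) ->
  Dsp T (traj u).
Proof.
move=> bu H; apply: Dsp_L1 => // [t /andP[t0 tT] e /H[del del0 Hd]|t /andP[t0 tT]].
  exists del => // s /andP[ts st] sT; apply: Hd; rewrite ?sT ?(le_trans t0)// ?t0 ?ltW//.
  by rewrite ger0_norm ?subr_ge0// ltrBlDl.
exists (u t) => // e /H[del del0 Hd]; exists del => // s /andP[ts st] s0.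
apply: Hd; rewrite ?s0 ?tT ?(ltW t0) ?(le_trans (ltW st))//.
by rewrite distrC gtr0_norm ?subr_gt0// ltrBlDr addrC -ltrBlDr.
Qed.

Lemma open_ball_L1 (u : R -> R -> R) U : (forall t, bm (u t)) -> openD T U -> U (traj u) ->
  exists2 r, 0 < r & forall v, (forall t, bm (v t)) -> Dsp T (traj v) ->
    (forall t, 0 <= t <= T -> itg (fun y => wt y * `|v t y - u t y|) <= r) -> U (traj v).
Proof.
move=> bu [_ HU] Uu; have [s [Hs sub]] := HU _ Uu.
suff [r r0 Hr] : exists2 r : R, 0 < r & forall p, p \in s -> forall v, (forall t, bm (v t)) ->
    (forall t, 0 <= t <= T -> itg (fun y => wt y * `|v t y - u t y|) <= r) ->
    (dA T p.1 (traj u) (traj v) < p.2%:E)%E.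
  by exists r => // v bv Dv Hv; apply: sub; split=> // p ps; exact: Hr.
elim: s Hs {sub} => [|p s IH] Hs; first by exists 1.
have [|r r0 Hr] := IH _; first by move=> q qs; apply: Hs; rewrite inE qs orbT.
have [sA p0] := Hs p (mem_head _ _); have [C C0 HC] := sbounded_wt sA.
have C1 : 0 < C + 1 by rewrite ltr_wpDl.
pose r' := p.2 / 2 / (C + 1); have r'0 : 0 < r' by rewrite !divr_gt0.
exists (Num.min r r') => [|q]; first by rewrite lt_min r0.
rewrite inE => /orP[/eqP->|qs] v bv Hv; last first.
  by apply: Hr => // t tT; apply: le_trans (Hv t tT) _; rewrite ge_min lexx.
apply: (@le_lt_trans _ _ (p.2 / 2)%:E); last by rewrite lte_fin ltr_pdivrMr// ltr_pMr// ltr1n.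
apply: dA_unif => // [|t tT]; first by rewrite divr_ge0// ltW.
apply: le_trans (rho_le HC (bu t) (bv t)) _; rewrite lee_fin.
have -> : (fun y => wt y * `|u t y - v t y|) = (fun y => wt y * `|v t y - u t y|).
  by apply/funext => y; rewrite distrC.
have h : itg (fun y => wt y * `|v t y - u t y|) <= r'.
  by apply: le_trans (Hv t tT) _; rewrite ge_min lexx orbT.
apply: (@le_trans _ _ ((C + 1) * r')); last by rewrite mulrC /r' divfK// gt_eqF.
by apply: ler_pM => //; [apply: itg_wtM_ge0|rewrite lerDl].
Qed.

(** Outside [BAD] the deviation is at most [e]; inside it is at most [2 C], with probability at most
    [p]. *)
Lemma expectation_close (dd : measure_display) (Omega : measurableType dd) (P : probability Omega R)
    (g : Omega -> R) (C a e p : R) (BAD : set Omega) :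
  measurable_fun setT g -> (forall w, `|g w| <= C) -> `|a| <= C -> 0 <= e ->
  measurable BAD -> (P BAD <= p%:E)%E -> (forall w, ~ BAD w -> `|g w - a| <= e) ->
  (\int[P]_w (g w)%:E \is a fin_num)%E /\
  `|fine (\int[P]_w (g w)%:E) - a| <= e + 2 * C * p.
Proof.
move=> mg gC aC e0 mB PB Hg; have C0 : 0 <= C := le_trans (normr_ge0 a) aC.
have ig : P.-integrable setT (EFin \o g).
  apply: measurable_bounded_integrable => //; first exact: le_lt_trans (probability_le1 P measurableT) (ltry _).
  exists C; split; first exact: num_real.
  by move=> M CM w _; apply: le_trans (gC w) (ltW CM).
have fg : (\int[P]_w (g w)%:E \is a fin_num)%E by exact: integrable_fin_num ig.
split=> //.
have ia : P.-integrable setT (EFin \o cst a).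
  by apply: finite_measure_integrable_cst.
have E : (\int[P]_w ((g w)%:E - a%:E) = \int[P]_w (g w)%:E - a%:E)%E.
  have -> : (\int[P]_w ((g w)%:E - a%:E) = \int[P]_w ((g w)%:E - (cst a w)%:E))%E by [].
  rewrite integralB_EFin//; congr (_ - _)%E.
  by rewrite (integral_cst _ _ a%:E)//= probability_setT mule1.
have : (`|\int[P]_w (g w)%:E - a%:E| <= (e + 2 * C * p)%:E)%E.
  rewrite -E; have mga : measurable_fun setT (fun w => ((g w)%:E - a%:E)%E).
    by apply/measurable_EFinP; exact: measurable_funB.
  apply: le_trans (le_abse_integral _ _ mga) _ => //.
  have mI : measurable_fun setT (fun w => (e + 2 * C * \1_BAD w)%:E).
    apply/measurable_EFinP; apply: measurable_funD => //; apply: measurable_funM => //.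
  apply: (@le_trans _ _ (\int[P]_w (e + 2 * C * \1_BAD w)%:E)%E).
    apply: ge0_le_integral => //; first exact: measurableT_comp.
    move=> w _; rewrite -EFinB abse_EFin lee_fin indicE.
    have [wB|wB] := pselect (BAD w).
      rewrite mem_set// mulr1; apply: le_trans (ler_normB _ _) _.
      by rewrite mulr2n mulrDl mul1r; apply: ler_wpDl => //; exact: lerD.
    by rewrite memNset// mulr0 addr0; exact: Hg.
  have -> : (\int[P]_w (e + 2 * C * \1_BAD w)%:E = e%:E + (2 * C)%:E * P BAD)%E.
    under eq_integral do rewrite EFinD EFinM.
    have m2 : measurable_fun setT (fun w => ((2 * C)%:E * (\1_BAD w)%:E)%E).
      by apply/measurable_EFinP; apply: measurable_funM.
    rewrite ge0_integralD//; last by move=> w _; rewrite -EFinM lee_fin !mulr_ge0.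
    rewrite (integral_cst _ _ e%:E)//= probability_setT mule1 ge0_integralZl_EFin//; last first.
    - by rewrite mulr_ge0.
    - by apply/measurable_EFinP; exact: measurable_indic.
    by rewrite integral_indic// setIT.
  by rewrite EFinD (EFinM (2 * C) p); apply: leeD => //; apply: lee_wpmul2l => //; rewrite lee_fin mulr_ge0.
by rewrite -(fineK fg) -EFinB abse_EFin lee_fin.
Qed.

Variables (sc : scaling R) (psi : R -> R) (x0 : forall N, config N) (muN : nat -> R).
Arguments x0 : clear implicits.
Hypothesis psi_u : unitdec psi.
Hypothesis hinit : forall f : R -> R, schwartz f ->
  (fun N : nat => (N%:R)^-1 * zsum (fun k : int => xi R k (x0 N) * f (k%:~R / N%:R)))
       @ \oo --> distr_of psi f.
Hypothesis hmu : forall N, (2 <= N)%N -> sc_c sc N * muN N = sc_mu sc.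
Hypothesis muN0 : forall N, (2 <= N)%N -> 0 <= muN N.
Hypothesis c1 : forall N, (2 <= N)%N -> 1 <= sc_c sc N.
Local Notation vN N := (vN sc psi_u N).

Variable u : R -> R -> R.
Hypothesis bu : forall t, bm (u t).
Hypothesis ul : forall e, 0 < e -> exists N0 : nat, forall N, (N0 <= N)%N -> (0 < N)%N /\
    forall t, 0 <= t <= T -> itg (fun y => wt y * `|vN N t y - u t y|) <= e.

(** A three-term comparison with [vN N] for one sufficiently large [N], which is Lipschitz in time
    with a constant depending on that [N]. *)
Lemma limit_uniformly_continuous e : 0 < e -> exists2 del, 0 < del & forall s t, 0 <= s <= T -> 0 <= t <= T ->
  `|s - t| < del -> itg (fun y => wt y * `|u s y - u t y|) < e.
Proof.
move=> e0; have e4 : 0 < e / 4 by rewrite divr_gt0.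
have [N Hu] := ul e4; have [N0 HN] := Hu N (leqnn N).
pose K := Lam sc N + Lam sc N ^+ 2; have L0 := Lam_gt0 sc N.
have K0 : 0 < K by rewrite addr_gt0// exprn_gt0.
have W0 := wtot_ge0 R; pose W := wtot R + 1; have Wgt : 0 < W by rewrite ltr_wpDl.
pose del := Num.min 1 (e / 4 / (K * W)).
have del0 : 0 < del by rewrite lt_min ltr01 !divr_gt0// mulr_gt0.
have key s t : 0 <= s <= T -> 0 <= t <= T -> s <= t -> `|s - t| < del ->
    itg (fun y => wt y * `|u s y - u t y|) < e.
  move=> sT tT st sdt; have /andP[s0 _] := sT; have /andP[t0 _] := tT.
  have d0 : 0 <= t - s by rewrite subr_ge0.
  move: sdt; rewrite distrC ger0_norm// lt_min => /andP[d1 d2].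
  have bs := unitdec_bm (vN_unitdec sc psi_u N s0); have bt := unitdec_bm (vN_unitdec sc psi_u N t0).
  have h3 : itg (fun y => wt y * `|vN N s y - vN N t y|) <= e / 4.
    apply: (@le_trans _ _ (K * (t - s) * wtot R)).
      apply: itg_wtM_le => [|x]; first exact: bm_abs (bmB bs bt).
      by rewrite distrC -{1}(subrK s t) [t - s + s]addrC; apply: vN_lip => //; exact: ltW.
    apply: (@le_trans _ _ (K * (t - s) * W)); first by rewrite ler_wpM2l ?lerDl// mulr_ge0// ltW.
    by rewrite mulrAC -ler_pdivlMl ?mulr_gt0// mulrC ltW.
  have h1 := HN s sT; have h2 := HN t tT.
  have b1 := bm_abs (bmB bs (bu s)); have b2 := bm_abs (bmB bt (bu t)); have b3 := bm_abs (bmB bs bt).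
  apply: (@le_lt_trans _ _ (e / 4 + e / 4 + e / 4)); last by lra.
  apply: (@le_trans _ _ (itg (fun y => wt y * `|vN N s y - u s y|) +
     itg (fun y => wt y * `|vN N s y - vN N t y|) + itg (fun y => wt y * `|vN N t y - u t y|))).
    rewrite -(itg_wtMD b1 b3) -(itg_wtMD (bmD b1 b3) b2).
    apply: le_itg_wtM => [||y]; [exact: bm_abs (bmB (bu s) (bu t))|exact: bmD (bmD b1 b3) b2|].
    have -> : u s y - u t y = - (vN N s y - u s y) + (vN N s y - vN N t y) + (vN N t y - u t y) by ring.
    by apply: le_trans (ler_normD _ _) _; rewrite lerD2r; apply: le_trans (ler_normD _ _) _; rewrite normrN.
  by rewrite !lerD.
exists del => // s t sT tT std; have [st|ts] := leP s t; first exact: key.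
have -> : (fun y => wt y * `|u s y - u t y|) = (fun y => wt y * `|u t y - u s y|).
  by apply/funext => y; rewrite distrC.
by apply: key => //; [exact: ltW|rewrite distrC].
Qed.

(** Continuity of the functional is needed at the limit trajectory only: a neighbourhood of it
    contains a uniform L^1 ball, and the path leaves this ball with small probability. *)
Lemma law_convergence (d : nat -> measure_display) (Omega : forall N, measurableType (d N))
    (P : forall N, probability (Omega N) R) (X : forall N, Omega N -> R -> config N) :
  (forall N, (2 <= N)%N -> is_chain (P N) (sc_al sc) (sc_be sc) (muN N) (x0 N) (X N)) ->
  law_cvg_dirac T P (fun N => zeta_path (X N) (sc_c sc N)) (traj u).
Proof.
move=> ch; have cgt N : (2 <= N)%N -> 0 < sc_c sc N by move=> /c1; exact: lt_le_trans.
have Ngt N : (2 <= N)%N -> (0 < N)%N by exact: ltn_trans.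
have DZ N (N2 : (2 <= N)%N) w := zeta_path_Dsp (ch N N2) hT (cgt N N2) (Ngt N N2) w.
split; first by move=> N N2 w; exact: DZ.
split; first by move=> N N2 B; exact: (measurable_zeta_path (ch N N2) hT (cgt N N2) (Ngt N N2)).
move=> F bF; have [[C HC] Hc] := bF.
have Du : Dsp T (traj u) := traj_Dsp bu limit_uniformly_continuous.
have C0 : 0 <= C := le_trans (normr_ge0 _) (HC _ Du).
have C1 : 0 < 4 * (C + 1) by rewrite mulr_gt0// ltr_wpDl.
suff main e : 0 < e -> exists N1 : nat, forall N, (N1 <= N)%N ->
    (\int[P N]_w (F (zeta_path (X N) (sc_c sc N) w))%:E \is a fin_num)%E /\
    `|fine (\int[P N]_w (F (zeta_path (X N) (sc_c sc N) w))%:E) - F (traj u)| <= e.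
  apply/fine_cvgP; split.
    by have [N1 H] := main 1 ltr01; exists N1 => // N /= /H[].
  apply/cvgrPdist_le => e e0; have [N1 H] := main e e0.
  by exists N1 => // N /= /H[_]; rewrite distrC.
move=> e0; have e2 : 0 < e / 2 by rewrite divr_gt0.
have [U [oU [Uu HU]]] := Hc _ Du _ e2.
have [r r0 Hr] := open_ball_L1 bu oU Uu.
have p0 : 0 < e / (4 * (C + 1)) by rewrite divr_gt0.
have [N1 HN] := convergence_in_probability hT hinit hmu muN0 c1 bu ul r0 p0.
exists (maxn N1 2) => N; rewrite geq_max => /andP[N1N N2].
have [BAD [mB PB] HB] := HN N N1N N2 _ _ _ _ (ch N N2).
have [||||h1 h2] := @expectation_close _ _ (P N) _ C (F (traj u)) (e / 2) _ BAD
   (measurable_bcont (ch N N2) hT (cgt N N2) (Ngt N N2) bF) _ _ _ mB PB _.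
- by move=> w; apply: HC; exact: DZ.
- exact: HC.
- exact: ltW.
- move=> w nB; apply: ltW; apply: HU.
  apply: (Hr (fun t => @zeta R N (X N w (t * sc_c sc N)))) => [t||t tT]; last exact: HB.
    exact: unitdec_bm (zeta_unitdec R (Ngt N N2) _).
  exact: DZ.
split=> //; apply: (le_trans h2).
have : 2 * C * (e / (4 * (C + 1))) <= e / 2.
  have -> : e / 2 = 2 * (C + 1) * (e / (4 * (C + 1))) by field; rewrite gt_eqF// ltr_wpDl.
  by rewrite ler_wpM2r ?(ltW p0)// ler_wpM2l// lerDl.
lra.
Qed.

End WeakConvergence.

(** * The two scalings *)

Section Scalings.
Variable R : realType.

Lemma mvt_is_derive (g g' : R -> R) B d : (forall t : R, is_derive t (1:R) g (g' t)) ->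
  (forall t, `|t| <= `|d| -> `|g' t| <= B) -> `|g d - g 0| <= B * `|d|.
Proof.
move=> dg gB; have cg a b : {within `[a, b], continuous g}.
  by apply: derivable_within_continuous => t _; apply: ex_derive.
have [d0|d0] := leP 0 d.
  have [t + ->] := @MVT_segment R g g' 0 d d0 (fun t _ => dg t) (cg _ _).
  rewrite in_itv/= => /andP[t0 td]; rewrite subr0 normrM ler_wpM2r//.
  by apply: gB; rewrite !ger0_norm.
have [t + e] := @MVT_segment R g g' d 0 (ltW d0) (fun t _ => dg t) (cg _ _).
rewrite distrC e in_itv/= => /andP[t0 td]; rewrite sub0r normrM normrN ler_wpM2r//.
by apply: gB; rewrite (ltr0_norm d0) ler0_norm// lerN2.
Qed.

Lemma is_derive_shift (f f' : R -> R) x : (forall y : R, is_derive y (1:R) f (f' y)) ->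
  forall t : R, is_derive t (1:R) (fun s => f (x + s)) (f' (x + t)).
Proof.
move=> df t; have h : is_derive t (1:R) (fun s : R => x + s) 1.
  exact: is_derive_eq (is_deriveD (is_derive_cst x t 1) (is_derive_id t 1)) (add0r _).
have := @is_derive1_comp R f (fun s : R => x + s) t _ _ (df (x + t)) h.
by rewrite mulr1.
Qed.

Lemma taylor1 (f f1 f2 : R -> R) B x d :
  (forall y : R, is_derive y (1:R) f (f1 y)) -> (forall y : R, is_derive y (1:R) f1 (f2 y)) ->
  (forall y, `|f2 y| <= B) -> `|f (x + d) - f x - d * f1 x| <= B * `|d| ^+ 2.
Proof.
move=> df df1 fB; have B0 : 0 <= B := le_trans (normr_ge0 _) (fB 0).
have := @mvt_is_derive (fun t => f (x + t) - t * f1 x) (fun t => f1 (x + t) - f1 x) (B * `|d|) d.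
rewrite addr0 mul0r subr0 expr2 mulrA addrAC; apply=> [t|t td].
  have h1 := is_derive_shift x df t.
  apply: is_derive_eq; rewrite /GRing.scale/=; ring.
have := @mvt_is_derive (fun t => f1 (x + t)) (fun t => f2 (x + t)) B t (is_derive_shift x df1).
rewrite addr0 => /(_ (fun _ _ => fB _)) /le_trans; apply; exact: ler_wpM2l.
Qed.

Lemma taylor3 (f f1 f2 f3 : R -> R) B x d :
  (forall y : R, is_derive y (1:R) f (f1 y)) -> (forall y : R, is_derive y (1:R) f1 (f2 y)) ->
  (forall y : R, is_derive y (1:R) f2 (f3 y)) ->
  (forall y, `|f3 y| <= B) -> `|f (x + d) - f x - d * f1 x - d ^+ 2 / 2 * f2 x| <= B * `|d| ^+ 3.
Proof.
move=> df df1 df2 fB; have B0 : 0 <= B := le_trans (normr_ge0 _) (fB 0).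
have := @mvt_is_derive (fun t => f (x + t) - t * f1 x - t ^+ 2 / 2 * f2 x)
  (fun t => f1 (x + t) - f1 x - t * f2 x) (B * `|d| ^+ 2) d.
rewrite addr0 mul0r subr0 expr0n/= mul0r mul0r subr0 => H.
have -> : B * `|d| ^+ 3 = B * `|d| ^+ 2 * `|d| by ring.
have -> : f (x + d) - f x - d * f1 x - d ^+ 2 / 2 * f2 x =
          f (x + d) - d * f1 x - d ^+ 2 / 2 * f2 x - f x by ring.
apply: H => [t|t td].
  have h1 := is_derive_shift x df t.
  by apply: is_derive_eq; rewrite /GRing.scale/=; field.
apply: le_trans (taylor1 x t df1 df2 fB) _; rewrite ler_wpM2l// ler_pXn2r// nnegrE//.
Qed.

Section Step.
Variables (N : nat) (N0 : (0 < N)%N).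
Let h : R := N%:R^-1.
Let Ngt : 0 < N%:R :> R. Proof. by rewrite ltr0n. Qed.
Let h0 : 0 < h. Proof. by rewrite invr_gt0. Qed.
Let h1 : h <= 1. Proof. by rewrite invf_le1// ler1n. Qed.
Let Nh : N%:R * h = 1. Proof. by rewrite mulfV// gt_eqF. Qed.

Let expm1 : 0 <= expR h - 1 <= expR 1 * h.
Proof.
apply/andP; split; first by rewrite subr_ge0 -[1]expR0 ler_expR ltW.
have e : expR h * expR (- h) = 1 by rewrite -expRD subrr expR0.
have := expR_ge1Dx (- h) => g; have e1 : expR h <= expR 1 by rewrite ler_expR.
have e0 := expR_gt0 h.
have : expR h * (1 - expR (- h)) <= expR 1 * h by apply: ler_pM; [exact: ltW|by rewrite subr_ge0 -[leRHS]expR0 ler_expR oppr_le0 ltW|exact: e1|lra].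
by rewrite mulrBr mulr1 e.
Qed.

Let expNm1 : 0 <= 1 - expR (- h) <= h.
Proof.
apply/andP; split; first by rewrite subr_ge0 -[leRHS]expR0 ler_expR oppr_le0 ltW.
by have := expR_ge1Dx (- h); lra.
Qed.

Let wt_ratio (x d : R) : wt (x + d) - wt x = wt x * (wt (x + d) * (d ^+ 2 - 2 * d * (x + d))).
Proof. rewrite /wt; field; rewrite !gt_eqF//; exact: wt_den_gt0. Qed.

(** As [(N d)^2 = 1], the first-order term satisfies [- 2 (N d) y <= 1 + y^2], and the second-order
    one is [1/N <= 1]. *)
Let wt_step (x d : R) : `|d| = h -> N%:R * (wt (x + d) - wt x) <= 2 * wt x.
Proof.
move=> dh; rewrite wt_ratio mulrCA [leRHS]mulrC ler_wpM2l ?wt_ge0//.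
set y := x + d; rewrite mulrCA; apply: (@le_trans _ _ (wt y * (2 * (1 + y ^+ 2)))); last by rewrite mulrCA wtE mulr1.
rewrite ler_wpM2l ?wt_ge0//.
have d2 : d ^+ 2 = h * h by rewrite -real_normK ?num_real// dh.
rewrite mulrBr d2 mulrA Nh mul1r.
have h2 : - (N%:R * (2 * d * y)) <= 1 + y ^+ 2.
  have e : N%:R * (2 * d * y) = 2 * (N%:R * d) * y by ring.
  have n1 : (N%:R * d) ^+ 2 = 1 by rewrite exprMn d2 -expr2 -exprMn Nh expr1n.
  rewrite e; have := sqr_ge0 (N%:R * d + y); rewrite sqrrD n1 -mulr_natr; lra.
have y0 := sqr_ge0 y; have hh := h1.
by move: h2 y0 hh; set q := N%:R * (2 * d * y); set y2 := y ^+ 2; move: h q y2 => *; lra.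
Qed.

Lemma wt_drift al be x : 0 <= al -> 0 <= be -> Lop N%:R be al h (@wt R) x <= 2 * (al + be) * wt x.
Proof.
move=> al0 be0; rewrite /Lop.
have := wt_step x (d := - h); rewrite normrN gtr0_norm// => /(_ erefl) a1.
have := wt_step x (d := h); rewrite gtr0_norm// => /(_ erefl) a2.
have := ler_wpM2l be0 a1; have := ler_wpM2l al0 a2.
set w1 := wt (x - h); set w2 := wt (x + h); set w := wt x => b1 b2.
have -> : N%:R * (be * (w1 - w) + al * (w2 - w)) = be * (N%:R * (w1 - w)) + al * (N%:R * (w2 - w)) by ring.
apply: (le_trans (lerD b2 b1)); rewrite le_eqVlt; apply/orP; left; apply/eqP; ring.
Qed.

(** Each one-sided difference is of order 1/N and too large by itself against [N^2]. Added, the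
    first-order parts leave [wt z * z - wt y * y], which has a factor [h]. The constant 6 is 1 + 1 +
    4, since [wt <= 1] and [(z y - 1) wt z wt y <= 1]. *)
Lemma wt_diffusion ga x : 0 <= ga -> Lop (N%:R ^+ 2) ga ga h (@wt R) x <= 6 * ga * wt x.
Proof.
move=> ga0; rewrite /Lop; have a1 := wt_ratio x (- h); have a2 := wt_ratio x h.
rewrite a1 a2; set w := wt x; have w0 : 0 <= w := wt_ge0 x.
set y := x + h; set z := x - h.
have -> : N%:R ^+ 2 * (ga * (w * (wt z * ((- h) ^+ 2 - 2 * - h * z))) + ga * (w * (wt y * (h ^+ 2 - 2 * h * y)))) =
  ga * w * (N%:R ^+ 2 * (h ^+ 2 * (wt z + wt y) + 2 * h * (wt z * z - wt y * y))) by ring.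
rewrite (_ : 6 * ga * w = ga * w * 6); last by ring.
rewrite ler_wpM2l ?mulr_ge0//.
have -> : wt z * z - wt y * y = - (2 * h) * (1 - z * y) * (wt z * wt y).
  have -> : - (2 * h) = z - y by rewrite /z /y; ring.
  by rewrite /wt; field; rewrite !gt_eqF//; exact: wt_den_gt0.
have -> : N%:R ^+ 2 * (h ^+ 2 * (wt z + wt y) + 2 * h * (- (2 * h) * (1 - z * y) * (wt z * wt y))) =
  (N%:R * h) ^+ 2 * (wt z + wt y + 4 * (z * y - 1) * (wt z * wt y)) by ring.
rewrite Nh expr1n mul1r.
have le1 v : wt v <= 1 :> R by rewrite /wt invf_le1 ?wt_den_gt0// wt_den_ge1.
have : (z * y - 1) * (wt z * wt y) <= 1.
  apply: (@le_trans _ _ ((1 + z ^+ 2) * (1 + y ^+ 2) * (wt z * wt y))); last first.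
    by rewrite mulrACA ![_ * wt _]mulrC !wtE mulr1.
  rewrite ler_wpM2r ?mulr_ge0 ?wt_ge0//.
  have s1 := sqr_ge0 (z - y); have s2 := sqr_ge0 (z * y).
  rewrite sqrrB -mulr_natr in s1; rewrite exprMn in s2.
  have -> : (1 + z ^+ 2) * (1 + y ^+ 2) = 1 + z ^+ 2 + y ^+ 2 + z ^+ 2 * y ^+ 2 by ring.
  have s3 := sqr_ge0 z; have s4 := sqr_ge0 y; move: s1 s2 s3 s4.
  set p := z * y; set q := z ^+ 2; set r := y ^+ 2; lra.
have := le1 z; have := le1 y; rewrite -(mulrA 4 (z * y - 1)).
by set p := (z * y - 1) * _; move: (wt z) (wt y) p => *; lra.
Qed.

Lemma expN_drift al be x : 0 <= al -> 0 <= be ->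
  Lop N%:R al be h (fun x => expR (- x)) x <= (al + be) * expR 1 * expR (- x).
Proof.
move=> al0 be0; rewrite /Lop.
have -> : - (x - h) = - x + h by ring.
have -> : - (x + h) = - x - h by ring.
rewrite !expRD; have /andP[a1 a2] := expm1; have /andP[b1 b2] := expNm1.
set E := expR (- x); have E0 : 0 <= E := expR_ge0 _.
set s := expR h in a1 a2 *; set r := expR (- h) in b1 b2 *; set e := expR 1 in a2 *.
have e0 : 0 <= e := expR_ge0 _.
have -> : N%:R * (al * (E * s - E) + be * (E * r - E)) =
  E * (al * (N%:R * (s - 1)) - N%:R * (be * (1 - r))) by ring.
rewrite [leRHS]mulrC ler_wpM2l//.
have c1 : N%:R * (s - 1) <= e.
  by apply: (le_trans (ler_wpM2l (ltW Ngt) a2)); rewrite mulrCA Nh mulr1.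
have c2 : 0 <= N%:R * (be * (1 - r)) by rewrite mulr_ge0 ?(ltW Ngt)// mulr_ge0.
have := ler_wpM2l al0 c1; have : 0 <= be * e by rewrite mulr_ge0.
rewrite mulrDl; move: c2; set q1 := N%:R * (be * _); set q2 := al * (N%:R * _); lra.
Qed.

Lemma exp_drift al be x : 0 <= al -> 0 <= be ->
  Lop N%:R al be h (@expR R) x <= (al + be) * expR 1 * expR x.
Proof.
move=> al0 be0; have := @expN_drift be al (- x) be0 al0.
rewrite /Lop opprK (_ : - (- x - h) = x + h); last by ring.
rewrite (_ : - (- x + h) = x - h); last by ring.
by rewrite [be + al]addrC [be * _ + _]addrC.
Qed.

(** The second difference factors, [e^h + e^(-h) - 2 = (e^h - 1) (1 - e^(-h))], and each factor is
    O(h). *)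
Lemma exp_diffusion ga x : 0 <= ga ->
  Lop (N%:R ^+ 2) ga ga h (@expR R) x <= ga * expR 1 * expR x.
Proof.
move=> ga0; rewrite /Lop !expRD; have /andP[a1 a2] := expm1; have /andP[b1 b2] := expNm1.
set E := expR x; have E0 : 0 <= E := expR_ge0 _.
have e : expR h * expR (- h) = 1 by rewrite -expRD subrr expR0.
set s := expR h in a1 a2 e *; set r := expR (- h) in b1 b2 e *; set e1 := expR 1 in a2 *.
have -> : N%:R ^+ 2 * (ga * (E * r - E) + ga * (E * s - E)) = ga * E * (N%:R ^+ 2 * ((s - 1) * (1 - r))).
  have -> : (s - 1) * (1 - r) = s - 1 - s * r + r by ring.
  rewrite e; ring.
rewrite (_ : ga * e1 * E = ga * E * e1); last by ring.
rewrite ler_wpM2l ?mulr_ge0//.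
apply: (@le_trans _ _ (N%:R ^+ 2 * (e1 * h * h))).
  by rewrite ler_wpM2l ?sqr_ge0//; exact: ler_pM.
by rewrite (_ : N%:R ^+ 2 * (e1 * h * h) = e1 * (N%:R * h) ^+ 2); [rewrite Nh expr1n mulr1|ring].
Qed.

Lemma expN_diffusion ga x : 0 <= ga ->
  Lop (N%:R ^+ 2) ga ga h (fun x => expR (- x)) x <= ga * expR 1 * expR (- x).
Proof.
move=> ga0; have := @exp_diffusion ga (- x) ga0.
rewrite /Lop (_ : - (x - h) = - x + h); last by ring.
rewrite (_ : - (x + h) = - x - h); last by ring.
by rewrite [ga * _ + _]addrC.
Qed.

Section Consistency.
Variables (f f1 f2 f3 : R -> R) (B : R).
Hypothesis df : forall x : R, is_derive x (1:R) f (f1 x).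
Hypothesis df1 : forall x : R, is_derive x (1:R) f1 (f2 x).
Hypothesis df2 : forall x : R, is_derive x (1:R) f2 (f3 x).
Hypothesis fB : forall x, [/\ `|f1 x| <= B, `|f2 x| <= B & `|f3 x| <= B].

(** At this scale the second derivative belongs to the error; in the symmetric case the first-order
    terms cancel, [N^2] makes the second-order ones survive, and a third derivative is needed. *)
Lemma drift_consistent al be x : 0 <= al -> 0 <= be ->
  `|Lop N%:R be al h f x - ((al - be) * f1 x + 0 * f2 x)| <= (al + be) * B / N%:R.
Proof.
move=> al0 be0; have f2B y : `|f2 y| <= B by case: (fB y).
have a1 := taylor1 x (- h) df df1 f2B; have a2 := taylor1 x h df df1 f2B.
rewrite normrN (gtr0_norm h0) in a1; rewrite (gtr0_norm h0) in a2.
rewrite /Lop; set u := f (x - h) in a1 *; set v := f (x + h) in a2 *.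
have -> : N%:R * (be * (u - f x) + al * (v - f x)) - ((al - be) * f1 x + 0 * f2 x) =
  be * (N%:R * (u - f x - - h * f1 x)) + al * (N%:R * (v - f x - h * f1 x)) +
  (N%:R * h - 1) * ((al - be) * f1 x) by ring.
rewrite Nh subrr mul0r addr0; apply: le_trans (ler_normD _ _) _.
have st (b q : R) : 0 <= b -> `|q| <= B * h ^+ 2 -> `|b * (N%:R * q)| <= b * (B / N%:R).
  move=> b0 qB; rewrite normrM (ger0_norm b0) ler_wpM2l// normrM (gtr0_norm Ngt).
  apply: (le_trans (ler_wpM2l (ltW Ngt) qB)).
  by rewrite (_ : N%:R * (B * h ^+ 2) = (N%:R * h) * (B * h)); [rewrite Nh mul1r|ring].
apply: (le_trans (lerD (st _ _ be0 a1) (st _ _ al0 a2))).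
by rewrite -mulrDl [be + al]addrC mulrA.
Qed.

Lemma diffusion_consistent ga x : 0 <= ga ->
  `|Lop (N%:R ^+ 2) ga ga h f x - (0 * f1 x + ga * f2 x)| <= 2 * ga * B / N%:R.
Proof.
move=> ga0; have f3B y : `|f3 y| <= B by case: (fB y).
have a1 := taylor3 x (- h) df df1 df2 f3B; have a2 := taylor3 x h df df1 df2 f3B.
rewrite normrN (gtr0_norm h0) in a1; rewrite (gtr0_norm h0) in a2.
rewrite /Lop; set u := f (x - h) in a1 *; set v := f (x + h) in a2 *.
have -> : N%:R ^+ 2 * (ga * (u - f x) + ga * (v - f x)) - (0 * f1 x + ga * f2 x) =
  ga * (N%:R ^+ 2 * (u - f x - - h * f1 x - (- h) ^+ 2 / 2 * f2 x)) +
  ga * (N%:R ^+ 2 * (v - f x - h * f1 x - h ^+ 2 / 2 * f2 x)) +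
  ((N%:R * h) ^+ 2 - 1) * (ga * f2 x) by field.
rewrite Nh expr1n subrr mul0r addr0; apply: le_trans (ler_normD _ _) _.
have st (q : R) : `|q| <= B * h ^+ 3 -> `|ga * (N%:R ^+ 2 * q)| <= ga * (B / N%:R).
  move=> qB; rewrite normrM (ger0_norm ga0) ler_wpM2l// normrM (ger0_norm (sqr_ge0 _)).
  apply: (le_trans (ler_wpM2l (sqr_ge0 _) qB)).
  by rewrite (_ : N%:R ^+ 2 * (B * h ^+ 3) = (N%:R * h) ^+ 2 * (B * h)); [rewrite Nh expr1n mul1r|ring].
apply: (le_trans (lerD (st _ a1) (st _ a2))).
by rewrite le_eqVlt; apply/orP; left; apply/eqP; ring.
Qed.

End Consistency.
End Step.

Lemma hyperbolic_scaling (al be mu : R) : 0 <= al -> 0 <= be -> 0 < mu ->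
  exists sc : scaling R, [/\ sc_c sc = (fun N => N%:R), sc_al sc = al & sc_be sc = be] /\
    [/\ sc_mu sc = mu, sc_a1 sc = al - be & sc_a2 sc = 0].
Proof.
move=> al0 be0 mu0; have ab : 0 <= al + be by exact: addr_ge0.
unshelve eexists (@Scaling R (fun N => N%:R) al be mu (al - be) 0 (2 * (al + be)) (al + be)
  ((al + be) * expR 1) _ _ _ _ _ _ _ _ _ _ _ _) => //=.
- by rewrite mulr_ge0.
- by rewrite mulr_ge0// expR_ge0.
- by move=> N N0 x; exact: wt_drift.
- by move=> N N0 x; exact: expN_drift.
- by move=> N N0 x; exact: exp_drift.
- by move=> f f1 f2 f3 B df df1 df2 fB N N0 x; apply: drift_consistent fB _ _ _ _ _.
- by move=> N N0; rewrite expr2 ler_peMl// ler1n.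
Qed.

Lemma diffusive_scaling (ga mu : R) : 0 <= ga -> 0 < mu ->
  exists sc : scaling R, [/\ sc_c sc = (fun N => N%:R ^+ 2), sc_al sc = ga & sc_be sc = ga] /\
    [/\ sc_mu sc = mu, sc_a1 sc = 0 & sc_a2 sc = ga].
Proof.
move=> ga0 mu0.
unshelve eexists (@Scaling R (fun N => N%:R ^+ 2) ga ga mu 0 ga (6 * ga) (2 * ga)
  (ga * expR 1) _ _ _ _ _ _ _ _ _ _ _ _) => //=.
- by rewrite mulr_ge0.
- by rewrite mulr_ge0.
- by rewrite mulr_ge0// expR_ge0.
- by move=> N N0 x; exact: wt_diffusion.
- by move=> N N0 x; exact: expN_diffusion.
- by move=> N N0 x; exact: exp_diffusion.
- by move=> f f1 f2 f3 B df df1 df2 fB N N0 x; exact: diffusion_consistent df df1 df2 fB _ _ _.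
Qed.

End Scalings.

(** * The theorem for an abstract scaling *)

Section ScalingLimit.
Variables (R : realType) (T : R) (sc : scaling R) (psi : R -> R).
Variables (x0 : forall N : nat, config N) (muN : nat -> R).
Arguments x0 : clear implicits.
Hypotheses (hT : 0 < T) (hpsi : inH psi).
Hypothesis hinit : forall f : R -> R, schwartz f ->
  (fun N : nat => (N%:R)^-1 * zsum (fun k : int => xi R k (x0 N) * f (k%:~R / N%:R)))
       @ \oo --> distr_of psi f.
Hypothesis hmu : forall N, (2 <= N)%N -> sc_c sc N * muN N = sc_mu sc.
Hypothesis muN0 : forall N, (2 <= N)%N -> 0 <= muN N.
Hypothesis c1 : forall N, (2 <= N)%N -> 1 <= sc_c sc N.

(** [u] is chosen before the chains, as a limit of lattice solutions started from [psi] itself; the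
    discrepancy between [psi] and the initial configurations enters only through the energy at time
    0. *)
Lemma scaling_limit : exists u : R -> R -> R, unique_sol T (wsol sc psi T) u /\
  forall (d : nat -> measure_display) (Omega : forall N, measurableType (d N))
    (P : forall N, probability (Omega N) R) (X : forall N, Omega N -> R -> config N),
  (forall N, (2 <= N)%N -> is_chain (P N) (sc_al sc) (sc_be sc) (muN N) (x0 N) (X N)) ->
  law_cvg_dirac T P (fun N => zeta_path (X N) (sc_c sc N)) (traj u).
Proof.
have psi_u : unitdec psi by case: hpsi => h1 [_ [h2 _]].
have [u [mu uu ur ul uH]] := limit_profile sc psi_u hT.
have bu t : bm (u t) := unitdec_bm (uu t).
have u1 t x : `|u t x| <= 1 by have [_ /(_ x)/andP[h0 h1]] := uu t; rewrite ger0_norm.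
have wu : wsol sc psi T u by move=> f tf; exact (@weak_limit R sc psi T f psi_u hT tf u mu uu ul).
exists u; split.
  split; last split=> //; last split.
  - split; first exact: (measurable_funS measurableT (@subsetT _ _) mu).
    by exists 1 => t x _; exact: u1.
  - by move=> t _; exact: uH.
  by move=> v mv wv; exact: (wsol_unique (unitdec_bm psi_u) hT mu u1 wu mv wv).
move=> d Omega P X ch; exact: (law_convergence hT hinit hmu muN0 c1 bu ul ch).
Qed.

End ScalingLimit.

Lemma unique_sol_equiv (R : realType) (T : R) (s1 s2 : (R -> R -> R) -> Prop) u :
  (forall v, s1 v <-> s2 v) -> unique_sol T s1 u -> unique_sol T s2 u.
Proof.
move=> e [bu [su [hu uq]]]; split=> //; split; first exact/e.
by split=> // v bv /e; exact: uq.
Qed.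

Lemma wsol_transport (R : realType) (T : R) (sc : scaling R) (psi : R -> R) lambda mu v :
  sc_mu sc = mu -> sc_a1 sc = lambda -> sc_a2 sc = 0 ->
  wsol sc psi T v <-> weak_sol_transport T lambda mu psi v.
Proof.
move=> e0 e1 e2; rewrite /wsol /weak_sol_transport.
have E (f : R -> R -> R) : adj sc f = (fun t x => pdt f t x + lambda * pdx f t x).
  by apply/funext => t; apply/funext => x; rewrite /adj e1 e2 mul0r addr0.
by split=> H f /H; rewrite E e0.
Qed.

Lemma wsol_heat (R : realType) (T : R) (sc : scaling R) (psi : R -> R) gamma mu v :
  sc_mu sc = mu -> sc_a1 sc = 0 -> sc_a2 sc = gamma ->
  wsol sc psi T v <-> weak_sol_heat T gamma mu psi v.
Proof.
move=> e0 e1 e2; rewrite /wsol /weak_sol_heat.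
have E (f : R -> R -> R) : adj sc f = (fun t x => pdt f t x + gamma * pdx (pdx f) t x).
  by apply/funext => t; apply/funext => x; rewrite /adj e1 e2 mul0r add0r.
by split=> H f /H; rewrite E e0.
Qed.

Theorem theorem1 (R : realType) (T : R) (hT : 0 < T)
  (x0 : forall N : nat, config N) (psi : R -> R) (hpsi : inH psi)
  (hinit : forall f : R -> R, schwartz f ->
     (fun N : nat => (N%:R)^-1 * zsum (fun k : int => xi R k (x0 N) * f (k%:~R / N%:R)))
       @ \oo --> distr_of psi f) :
  (* (i) asymmetric case, hyperbolic scaling *)
  (forall alpha beta lambda mu : R,
     0 <= alpha -> 0 <= beta -> alpha - beta = lambda -> lambda != 0 -> 0 < mu ->
     exists u : R -> R -> R,
       unique_sol T (weak_sol_transport T lambda mu psi) u /\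
       forall (d : nat -> measure_display) (Omega : forall N, measurableType (d N))
              (P : forall N, probability (Omega N) R)
              (X : forall N, Omega N -> R -> config N),
         (forall N, (2 <= N)%N -> is_chain (P N) alpha beta (mu / N%:R) (x0 N) (X N)) ->
         law_cvg_dirac T P (fun N => zeta_path (X N) N%:R) (traj u)) /\
  (* (ii) symmetric case, diffusive scaling *)
  (forall gamma mu : R, 0 < gamma -> 0 < mu ->
     exists u : R -> R -> R,
       unique_sol T (weak_sol_heat T gamma mu psi) u /\
       forall (d : nat -> measure_display) (Omega : forall N, measurableType (d N))
              (P : forall N, probability (Omega N) R)
              (X : forall N, Omega N -> R -> config N),
         (forall N, (2 <= N)%N ->
            is_chain (P N) gamma gamma (mu / (N%:R ^+ 2)) (x0 N) (X N)) ->
         law_cvg_dirac T P (fun N => zeta_path (X N) (N%:R ^+ 2)) (traj u)).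
Proof.
split=> [alpha beta lambda mu al0 be0 lamE _ mu0|gamma mu ga0 mu0].
  have [sc [[cE alE beE] [muE a1E a2E]]] := hyperbolic_scaling al0 be0 mu0.
  have [|||u [uq H]] := @scaling_limit R T sc psi x0 (fun N => mu / N%:R) hT hpsi hinit.
  - by move=> N N2; rewrite cE muE mulrC divfK// pnatr_eq0 -lt0n (ltn_trans _ N2).
  - by move=> N _; rewrite divr_ge0// ltW.
  - by move=> N N2; rewrite cE ler1n (ltn_trans _ N2).
  exists u; split.
    apply: unique_sol_equiv uq => v; apply: wsol_transport => //.
    by rewrite a1E.
  by move=> d Omega P X ch; rewrite -alE -beE in ch; have := H d Omega P X ch; rewrite cE.
have [sc [[cE alE beE] [muE a1E a2E]]] := diffusive_scaling (ltW ga0) mu0.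
have [|||u [uq H]] := @scaling_limit R T sc psi x0 (fun N => mu / N%:R ^+ 2) hT hpsi hinit.
- by move=> N N2; rewrite cE muE mulrC divfK// expf_neq0// pnatr_eq0 -lt0n (ltn_trans _ N2).
- by move=> N _; rewrite divr_ge0 ?sqr_ge0// ltW.
- by move=> N N2; rewrite cE exprn_ege1// ler1n (ltn_trans _ N2).
exists u; split; first by apply: unique_sol_equiv uq => v; exact: wsol_heat.
move=> d Omega P X ch; have := H d Omega P X; rewrite alE beE cE; exact.
Qed.
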